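(* Let $n\ge 1$. Let $\sigma$ be a compactly supported Borel measure on $\mathbb{R}^n$, let $m=\widehat{\sigma}$ be its Fourier transform, and let $0\le\beta\le n$ and $\alpha>1/2$ be real numbers such that: 1) $\sigma$ is locally uniformly $\beta$-dimensional; 2) there is a constant $C$ such that $\left\{\int_{1}^{2}|m(t\xi)|^{2}\,dt\right\}^{1/2}\leq C(1+|\xi|)^{-\alpha}$ for all $\xi\in\mathbb{R}^n$; 3) there is a constant $C$ such that $\left\{\int_{1}^{2}|\nabla m(t\xi)|^{2}\,dt\right\}^{1/2}\leq C(1+|\xi|)^{-\alpha}$ for all $\xi\in\mathbb{R}^n$. If $p(\cdot)\in\mathcal{P}_{\log}$ and $$\frac{2n+2\alpha-2\beta-1}{n+2\alpha-\beta-1}<p_{-}\leq p_{+}<\frac{n+2\alpha-\beta-1}{n-\beta}\,p_{-}$$ (the right-hand side being $+\infty$ when $\beta=n$), then the maximal operator $\mathcal{M}_m$ maps $L^{p(\cdot)}(\mathbb{R}^n)$ to itself, i.e. there is a constant $C'$ such that $\|\mathcal{M}_m f\|_{p(\cdot)}\le C'\|f\|_{p(\cdot)}$ for all Schwartz functions $f$ on $\mathbb{R}^n$.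
   Context: Maximal multiplier operator: Borel measures are nonnegative and finite. For $m=\widehat\sigma$ with $\sigma$ a compactly supported Borel measure, and for $t>0$, define $M_t$ by $(M_tf)^{\wedge}(\xi)=\widehat f(\xi)m(t\xi)$; equivalently $M_tf(x)=\int f(x-ty)\,d\sigma(y)$. The maximal operator is $\mathcal{M}_mf(x)=\sup_{t>0}|M_tf(x)|$, defined a priori for Schwartz functions $f$. Here $\nabla m(t\xi)$ denotes the gradient of $m$ evaluated at the point $t\xi$. Locally uniformly $\beta$-dimensional: there is a constant $C_\beta$ such that $\sigma(B(x,R))\le C_\beta R^\beta$ for every $x\in\mathbb{R}^n$ and $0<R\le 1$, where $B(x,R)$ is the ball of radius $R$ centered at $x$. Variable Lebesgue spaces: for a measurable $p:\mathbb{R}^n\to[1,\infty]$ put $p_-=\operatorname{ess\,inf}_{x}p(x)$ and $p_+=\operatorname{ess\,sup}_{x}p(x)$. $L^{p(\cdot)}(\mathbb{R}^n)$ is the set of measurable $f$ with $\int_{\mathbb{R}^n}(|f(x)|/\lambda)^{p(x)}dx<\infty$ for some $\lambda>0$, with norm $\|f\|_{p(\cdot)}=\inf\{\lambda>0:\int_{\mathbb{R}^n}(|f(x)|/\lambda)^{p(x)}dx\le 1\}$. The class $\mathcal{P}_{\log}$ (globally log-Hölder continuous functions): the functions $p:\mathbb{R}^n\to(0,\infty)$ such that there exist $c_1,c_2>0$ and $p_\infty\in(0,\infty)$ with $|p(x)-p(y)|\le \frac{c_1}{\log(e+1/|x-y|)}$ for all $x,y\in\mathbb{R}^n$ with $0<|x-y|<1/2$,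 and $|p(x)-p_\infty|\le\frac{c_2}{\log(e+|x|)}$ for all $x\in\mathbb{R}^n$. *)

(* Defs.v *)
From HB Require Import structures.
From mathcomp Require Import all_boot all_order all_algebra.
From mathcomp Require Import all_classical all_reals all_analysis.
From mathcomp Require Import measurable_realfun ess_sup_inf complex.

Set Implicit Arguments.
Unset Strict Implicit.
Unset Printing Implicit Defensive.

Import Order.TTheory GRing.Theory Num.Theory.
Import numFieldNormedType.Exports.
Import Normc.

Local Open Scope classical_set_scope.
Local Open Scope ring_scope.
Local Open Scope complex_scope.

(* Every 'M[R]_(m, n), in particular 'rV[R]_n, carries its Borel sigma-algebra;
   the library's max norm on matrices induces the usual topology. *)
HB.instance Definition _ (R : realType) (m n : nat) :=
  @isMeasurable.Build (sigma_display (@open 'M[R]_(m, n))) 'M[R]_(m, n)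
    <<s @open 'M[R]_(m, n) >>
    (@sigma_algebra0 _ setT _) (@sigma_algebraC _ _)
    (@sigma_algebra_bigcup _ setT _).

Section lebesgue_rV.
Context {R : realType}.

Lemma open_measurable_mx m n (A : set 'M[R]_(m, n)) : open A -> measurable A.
Proof. exact: sub_sigma_algebra. Qed.

Lemma measurable_fun_Borel_mx d (T : measurableType d) m n
    (f : T -> 'M[R]_(m, n)) :
  (forall A, open A -> measurable (f @^-1` A)) -> measurable_fun setT f.
Proof.
move=> mf; apply: (@measurability _ _ _ _ _ _ (@open 'M[R]_(m, n))) => //.
by move=> _ [A oA <-]; rewrite setTI; exact: mf.
Qed.

Definition row_cons n (z : measurableTypeR R * 'rV[R]_n) : 'rV[R]_n.+1 :=
  row_mx (const_mx z.1 : 'rV[R]_1) z.2.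

Definition row_uncons n (x : 'rV[R]_n.+1) : measurableTypeR R * 'rV[R]_n :=
  (x ord0 ord0, \row_j x ord0 (lift ord0 j)).

Lemma row_cons0 n z : @row_cons n z ord0 ord0 = z.1.
Proof.
have -> : ord0 = lshift n (ord0 : 'I_1) by apply: val_inj.
by apply: etrans (row_mxEl _ _ _ _) _; rewrite mxE.
Qed.

Lemma row_consS n z j : @row_cons n z ord0 (lift ord0 j) = z.2 ord0 j.
Proof.
have -> : lift ord0 j = rshift 1 j by apply: val_inj.
exact: row_mxEr.
Qed.

Lemma row_consK n : cancel (@row_cons n) (@row_uncons n).
Proof.
move=> [a v]; rewrite /row_uncons row_cons0/=; congr pair.
by apply/rowP => j; rewrite mxE row_consS.
Qed.

Lemma row_cons_ball n (z w : measurableTypeR R * 'rV[R]_n) (e : R) : 0 < e ->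
  ball (z.1 : R) e (w.1 : R) ->
  (forall j, ball (z.2 ord0 j) e (w.2 ord0 j)) ->
  ball (row_cons z) e (row_cons w).
Proof.
move=> e0 zw1 zw2; split => // i j; rewrite (ord1 i).
have [->|j0] := eqVneq j ord0; first by rewrite !row_cons0.
have [k ->] : exists k, j = lift ord0 k.
  by move: j0; rewrite eq_sym => /unlift_some[k -> _]; exists k.
by rewrite !row_consS.
Qed.

Lemma measurable_row_cons n : measurable_fun setT (@row_cons n).
Proof.
apply: measurable_fun_Borel_mx => A oA.
pose c (q : rat * 'rV[rat]_n) : R * 'rV[R]_n :=
  (ratr q.1, map_mx ratr q.2).
pose B (q : rat * 'rV[rat]_n * nat) : set (measurableTypeR R * 'rV[R]_n) :=
  ball (c q.1).1 q.2.+1%:R^-1 `*` ball (c q.1).2 q.2.+1%:R^-1.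
have mB q : measurable (B q).
  apply: measurableX.
    by apply: open_measurable; apply: ball_open; rewrite invr_gt0.
  by apply: open_measurable_mx; apply: ball_open; rewrite invr_gt0.
pose F q := if `[< B q `<=` @row_cons n @^-1` A >] then B q else set0.
rewrite (_ : _ @^-1` _ = \bigcup_q F q); last first.
  apply/seteqP; split => [z Az|z [q _]]; last first.
    by rewrite /F; case: asboolP => // /(_ z).
  have /nbhs_ballP[e /= e0 eA] := open_nbhs_nbhs (conj oA Az).
  have e20 : 0 < e / 2 by rewrite divr_gt0.
  have [k _ /(_ _ (leqnn k)) /= ke] := near_infty_natSinv_lt (PosNum e20).
  have k0 : 0 < k.+1%:R^-1 :> R by rewrite invr_gt0.
  have ratP (a : R) : exists q : rat, ball (ratr q : R) k.+1%:R^-1 a.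
    have /rat_in_itvoo[q /itvP qa] : a - k.+1%:R^-1 < a + k.+1%:R^-1.
      by rewrite ltrD2l gtrN.
    by exists q; rewrite -ball_normE/= ltr_distl !qa.
  have [q1 zq1] := ratP z.1.
  have [q2 zq2] := choice (fun j => ratP (z.2 ord0 j)).
  pose q := (q1, \row_j q2 j, k).
  have Bz : B q z.
    split; first exact: zq1.
    by split => // i j; rewrite (ord1 i) /= !mxE.
  exists q => //; rewrite /F; case: asboolP => // -[] w [w1 [_ w2]].
  apply: eA; apply: row_cons_ball => //.
    apply: (@ball_split _ _ (ratr q1 : R)); apply: le_ball (ltW ke) _ _ => //.
    exact: ball_sym.
  move=> j; apply: (@ball_split _ _ (ratr (q2 j) : R)).
    by apply: le_ball (ltW ke) _ _; apply/ball_sym/zq2.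
  apply: le_ball (ltW ke) _ _.
  by have := w2 ord0 j; rewrite /= !mxE.
apply: countable_bigcupT_measurable; first exact: countableP.
by move=> q; rewrite /F; case: asboolP => _; [exact: mB|exact: measurable0].
Qed.

Lemma measurable_row_uncons n : measurable_fun setT (@row_uncons n).
Proof.
apply: measurable_fun_pair => /=.
  apply: (@measurability _ _ _ _ _ _ (@RGenOpens.G R)).
    exact: RGenOpens.measurableE.
  move=> _ [_ [a [b ->]] <-]; rewrite setTI; apply: open_measurable_mx.
  apply: open_comp; last exact: interval_open.
  by move=> x _; exact: coord_continuous.
apply: measurable_fun_Borel_mx => A oA; apply: open_measurable_mx.
apply: open_comp => // x _ B /nbhs_ballP[e /= e0 eB].
apply/nbhs_ballP; exists e => //= y [_ xy]; apply: eB; split => // i j.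
by rewrite !mxE; exact: xy.
Qed.

Section step.
Context n (mu : {sigma_finite_measure set 'rV[R]_n -> \bar R}).

Definition lebesgue_step : set 'rV[R]_n.+1 -> \bar R :=
  pushforward (@lebesgue_measure R \x mu)%E (@row_cons n).

HB.instance Definition _ := Measure.copy lebesgue_step
  (measure_function_pushforward__canonical__measure_function_Measure
     (@lebesgue_measure R \x mu)%E (@measurable_row_cons n)).

Let lebesgue_step_sigma_finite : sigma_finite setT lebesgue_step.
Proof.
have /sigma_finiteP[F [TF ndF Foo]] := sigma_finiteT (@lebesgue_measure R).
have /sigma_finiteP[G [TG ndG Goo]] := sigma_finiteT mu.
have FGE k : @row_cons n @^-1` (@row_uncons n @^-1` (F k `*` G k)) =
    F k `*` G k.
  rewrite -[LHS]/((@row_uncons n \o @row_cons n) @^-1` _).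
  by rewrite (_ : _ \o _ = id)//; apply/funext => z; exact: row_consK.
exists (fun k => @row_uncons n @^-1` (F k `*` G k)) => [|k].
  rewrite -preimage_bigcup; apply/esym/seteqP; split => // x _.
  have [i _ Fi] : (\bigcup_i F i) (row_uncons x).1 by rewrite -TF.
  have [j _ Gj] : (\bigcup_i G i) (row_uncons x).2 by rewrite -TG.
  exists (maxn i j) => //; split.
  - by move: Fi; exact/subsetPset/ndF/leq_maxl.
  - by move: Gj; exact/subsetPset/ndG/leq_maxr.
have [mF Fk] := Foo k; have [mG Gk] := Goo k; split.
  rewrite -[X in measurable X]setTI; apply: measurable_row_uncons => //.
  exact: measurableX.
rewrite /lebesgue_step/pushforward FGE product_measure1E//.
by rewrite lte_mul_pinfty// ge0_fin_numE.
Qed.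

HB.instance Definition _ := Measure_isSigmaFinite.Build _ _ _ lebesgue_step
  lebesgue_step_sigma_finite.

End step.

(* Lebesgue measure on R^n: the n-fold product of the Lebesgue measure on R,
   transported along R * R^n = R^n.+1. *)
Fixpoint lebesgue_rV n : {sigma_finite_measure set 'rV[R]_n -> \bar R} :=
  match n with
  | 0 => \d_(0 : 'rV[R]_0)
  | k.+1 => lebesgue_step (lebesgue_rV k)
  end.

Lemma lebesgue_rV_box n (A : 'I_n -> set (measurableTypeR R)) :
  (forall i, measurable (A i)) ->
  lebesgue_rV n [set x : 'rV[R]_n | forall i, A i (x ord0 i)] =
  (\prod_(i < n) lebesgue_measure (A i))%E.
Proof.
move=> mA; suff [] : measurable [set x : 'rV[R]_n | forall i, A i (x ord0 i)] /\
  lebesgue_rV n [set x : 'rV[R]_n | forall i, A i (x ord0 i)] =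
  (\prod_(i < n) lebesgue_measure (A i))%E by [].
elim: n A mA => [|n IHn] A mA.
  rewrite big_ord0 (_ : [set x | _] = setT); last first.
    by apply/seteqP; split => // x _ [].
  by split; [exact: measurableT|rewrite /= diracT].
have [mB BE] := IHn _ (fun i => mA (lift ord0 i)).
set B := [set x | _] in mB BE.
have AP (x : 'rV[R]_n.+1) : (forall i, A i (x ord0 i)) <->
    (A ord0 `*` B) (row_uncons x).
  split=> [Ax|[/= A0 AB] i]; first by split => //= i; rewrite mxE.
  have [<-//|/unlift_some[j -> _]] := eqVneq ord0 i.
  by have := AB j; rewrite mxE.
have -> : [set x : 'rV[R]_n.+1 | forall i, A i (x ord0 i)] =
    @row_uncons n @^-1` (A ord0 `*` B).
  by apply/seteqP; split => x /AP.
split.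
  rewrite -[X in measurable X]setTI; apply: measurable_row_uncons => //.
  exact: measurableX.
rewrite big_ord_recl -BE /= /lebesgue_step /pushforward.
rewrite (_ : _ @^-1` _ = A ord0 `*` B) ?product_measure1E//.
rewrite -[LHS]/((@row_uncons n \o @row_cons n) @^-1` _).
by rewrite (_ : _ \o _ = id)//; apply/funext => z; exact: row_consK.
Qed.

End lebesgue_rV.

Section euclidean.
Context {R : realType} {n : nat}.
Implicit Types x y : 'rV[R]_n.

Definition dotv x y : R := \sum_(i < n) x ord0 i * y ord0 i.

(* The library norm `|x| on 'rV[R]_n is the max norm; distances in the analytic
   conditions below are Euclidean. *)
Definition enorm x : R := Num.sqrt (dotv x x).

Definition eball x (r : R) : set 'rV[R]_n := [set y | enorm (y - x) < r].

End euclidean.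

Section complex_valued.
Context {R : realType}.

Definition cintegral d (T : measurableType d) (mu : {measure set T -> \bar R})
    (f : T -> R[i]) : R[i] :=
  (\int[mu]_x complex.Re (f x)) +i* (\int[mu]_x complex.Im (f x)).

Definition cis (theta : R) : R[i] := cos theta +i* sin theta.

Context {n : nat}.
Implicit Types (f : 'rV[R]_n -> R[i]) (sigma : {measure set 'rV[R]_n -> \bar R}).

Definition fourier_measure sigma (xi : 'rV[R]_n) : R[i] :=
  cintegral sigma (fun y => cis (- (2 * pi * dotv y xi))).

Definition partial (i : 'I_n) (u : 'rV[R]_n -> R) (x : 'rV[R]_n) : R :=
  'D_(delta_mx ord0 i) u x.

Definition gradient f (x : 'rV[R]_n) : 'rV[R[i]]_n :=
  \row_i (partial i (@complex.Re R \o f) x +i* partial i (@complex.Im R \o f) x).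

Definition cvnorm (v : 'rV[R[i]]_n) : R :=
  Num.sqrt (\sum_(i < n) normc (v ord0 i) ^+ 2).

Definition real_schwartz (u : 'rV[R]_n -> R) : Prop :=
  forall s : seq 'I_n, let Du := foldr partial u s in
    (forall x, differentiable Du x) /\
    (forall N : nat, exists C : R, forall x,
      (1 + enorm x) ^+ N * `|Du x| <= C).

Definition schwartz f : Prop :=
  real_schwartz (@complex.Re R \o f) /\ real_schwartz (@complex.Im R \o f).

(* M_t f; the multiplier of this operator is xi |-> fourier_measure sigma (t xi) *)
Definition dilated_average sigma (t : R) f (x : 'rV[R]_n) : R[i] :=
  cintegral sigma (fun y => f (x - t *: y)).

Definition maximal_multiplier sigma f (x : 'rV[R]_n) : \bar R :=
  ereal_sup [set (normc (dilated_average sigma t f x))%:E | t in [set t | 0 < t]].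

End complex_valued.

Section measures.
Context {R : realType} {n : nat}.
Implicit Types sigma : {measure set 'rV[R]_n -> \bar R}.

Definition compactly_supported sigma : Prop :=
  exists2 K : set 'rV[R]_n, compact K & sigma (~` K) = 0%E.

Definition locally_uniformly_dimensional (beta : R) sigma : Prop :=
  exists C : R, forall x (r : R), 0 < r -> r <= 1 ->
    (sigma (eball x r) <= (C * r `^ beta)%:E)%E.

Definition square_decay (alpha : R) (g : 'rV[R]_n -> R) : Prop :=
  exists C : R, forall xi : 'rV[R]_n,
    ((\int[@lebesgue_measure R]_(t in `[1%R, 2%R]) (g (t *: xi) ^+ 2)%:E) `^ 2^-1
      <= (C * (1 + enorm xi) `^ (- alpha))%:E)%E.

End measures.

Section variable_exponent.
Context {R : realType} {n : nat}.
Implicit Types p : 'rV[R]_n -> R.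

Definition exponent_inf p : \bar R := ess_inf (lebesgue_rV n) (EFin \o p).

Definition exponent_sup p : \bar R := ess_sup (lebesgue_rV n) (EFin \o p).

(* F is extended-real valued since a maximal function may take the value +oo;
   only exponents that are finite everywhere are considered. *)
Definition modular p (F : 'rV[R]_n -> \bar R) : \bar R :=
  (\int[lebesgue_rV n]_x (`|F x| `^ p x))%E.

Definition variable_norm p (F : 'rV[R]_n -> \bar R) : \bar R :=
  ereal_inf [set l%:E | l in
    [set l : R | 0 < l /\ (modular p (fun x => F x * l^-1%:E) <= 1)%E]].

Definition log_holder p : Prop :=
  (forall x, 0 < p x) /\
  exists c1 c2 pinf : R, [/\ 0 < c1, 0 < c2, 0 < pinf,
    (forall x y, 0 < enorm (x - y) -> enorm (x - y) < 2^-1 ->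
      `|p x - p y| <= c1 / ln (expR 1 + (enorm (x - y))^-1)) &
    (forall x, `|p x - pinf| <= c2 / ln (expR 1 + enorm x))].

End variable_exponent.

(* Main.v *)
(* The average A_t f is split into a Gaussian smoothing at scale t and
   Littlewood-Paley pieces T_j at frequency |t xi| ~ 2^j. Since sigma is
   beta-dimensional, sup_t |T_j f| <= C 2^{j(n-beta)} Mf pointwise, M being the
   Hardy-Littlewood maximal function; the decay of m and of its gradient gives
   ||sup_t |T_j f||_2 <= C 2^{-j(alpha-1/2)} ||f||_2 by Plancherel and the
   one-dimensional Sobolev inequality in t. For 1/p = th/2 + (1-th)/q the two bounds
   are interpolated by cutting f, at each point x and for each j, at a height that
   depends on the value of the maximal function at x; log-Hoelder continuity enters
   only through the boundedness of M on variable Lebesgue spaces. The condition on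
   p_- and p_+ leaves room for q > 1 and for convergence of the sum over j, once p is
   replaced by p/u through Jensen's inequality. *)

Require Import Defs.
From mathcomp Require Import all_boot all_order all_algebra.
From mathcomp Require Import all_classical all_reals all_analysis.
From mathcomp Require Import measurable_realfun ess_sup_inf complex.
From mathcomp Require Import ring lra.

Set Implicit Arguments.
Unset Strict Implicit.
Unset Printing Implicit Defensive.

Import Order.TTheory GRing.Theory Num.Theory.
Import numFieldNormedType.Exports.
Import Normc.

Local Open Scope classical_set_scope.
Local Open Scope ring_scope.

(** * Measure theory on row vectors *)

(** The truncation argument stands in for an interpolation theorem with variable exponents. The
    level 2^l is read off at x, where the supremum over t is taken, while f is cut at y through
    f(y)^{w(y)}; no regularity of w has to relate the two points. Summation over all l in Z removes
    the dependence on x: at fixed y the levels below f(y)^{w(y)}, up to a power of 2^j, form a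
    geometric series whose sum recovers f(y)^{P(y)}. With d = n - beta, a = alpha - 1/2 and s =
    th/2, the exponent q of the pointwise endpoint solves u/p = s + (1 - 2s)/q. It exceeds 1 if u <
    (1 - s) p, it is finite if s p < u, and the pieces are summable in j if d (1 - 2s) < 2 a s.
    Eliminating s and u >= 1 from these conditions leads to the hypotheses on p_- and p_+. Gaussian
    cutoffs are chosen because both sides of their Fourier transform are explicit. A difference of
    two Gaussians vanishes only to first order in r at low frequency; the binomial combination 1 -
    (1 - e^{-r})^{N+1} raises the order as far as alpha demands. Plancherel is needed only as an
    inequality, but in both directions: for f, and for functions of the frequency. *)

Section measure_rV.
Context {R : realType}.

Lemma measurable_coord n (i : 'I_n) :
  measurable_fun setT (fun x : 'rV[R]_n => x ord0 i : measurableTypeR R).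
Proof.
apply: (@measurability _ _ _ _ _ _ (@RGenOpens.G R)).
  exact: RGenOpens.measurableE.
move=> _ [_ [a [b ->]] <-]; rewrite setTI; apply: open_measurable_mx.
apply: open_comp; last exact: interval_open.
by move=> x _; exact: coord_continuous.
Qed.

Lemma measurable_coordT d (T : measurableType d) n (f : T -> 'rV[R]_n) i :
  measurable_fun setT f -> measurable_fun setT (fun t => f t ord0 i : measurableTypeR R).
Proof. move=> mf; exact: (measurableT_comp (measurable_coord i) mf). Qed.

Lemma measurable_fun_rV d (T : measurableType d) n (f : T -> 'rV[R]_n) :
  (forall i, measurable_fun setT (fun t => f t ord0 i : measurableTypeR R)) ->
  measurable_fun setT f.
Proof.
elim: n f => [|n IHn] f mf.
  rewrite (_ : f = cst 0); first exact: measurable_cst.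
  by apply/funext => t; apply/rowP => -[].
rewrite (_ : f = @row_cons R n \o
    (fun t => (f t ord0 ord0, \row_j f t ord0 (lift ord0 j)))); last first.
  apply/funext => t; apply/rowP => j /=.
  have [->|] := eqVneq j ord0; first by rewrite row_cons0.
  rewrite eq_sym => /unlift_some[k -> _].
  by rewrite row_consS mxE.
apply: measurableT_comp; first exact: measurable_row_cons.
have m1 := mf ord0.
have m2 : measurable_fun setT (fun t => \row_j f t ord0 (lift ord0 j)).
  by apply: IHn => i; under eq_fun do rewrite mxE; exact: mf.
exact: (measurable_fun_pair m1 m2).
Qed.

Lemma measurable_funD_rV d (T : measurableType d) n (f g : T -> 'rV[R]_n) :
  measurable_fun setT f -> measurable_fun setT g ->
  measurable_fun setT (fun t => f t + g t).
Proof.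
move=> mf mg; apply: measurable_fun_rV => i; under eq_fun do rewrite mxE.
by apply: measurable_funD; exact: measurable_coordT.
Qed.

Lemma measurable_funN_rV d (T : measurableType d) n (f : T -> 'rV[R]_n) :
  measurable_fun setT f -> measurable_fun setT (fun t => - f t).
Proof.
move=> mf; apply: measurable_fun_rV => i; under eq_fun do rewrite mxE.
by apply: measurableT_comp => //; exact: measurable_coordT.
Qed.

Lemma measurable_funB_rV d (T : measurableType d) n (f g : T -> 'rV[R]_n) :
  measurable_fun setT f -> measurable_fun setT g ->
  measurable_fun setT (fun t => f t - g t).
Proof.
by move=> mf mg; apply: measurable_funD_rV => //; exact: measurable_funN_rV.
Qed.

Lemma measurable_funZ_rV d (T : measurableType d) n (a : T -> R)
    (f : T -> 'rV[R]_n) :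
  measurable_fun setT a -> measurable_fun setT f ->
  measurable_fun setT (fun t => a t *: f t).
Proof.
move=> ma mf; apply: measurable_fun_rV => i; under eq_fun do rewrite mxE.
by apply: measurable_funM => //; exact: measurable_coordT.
Qed.

Lemma measurable_dotv d (T : measurableType d) n (f g : T -> 'rV[R]_n) :
  measurable_fun setT f -> measurable_fun setT g ->
  measurable_fun setT (fun t => dotv (f t) (g t)).
Proof.
move=> mf mg; rewrite /dotv; apply: measurable_sum => i.
by apply: measurable_funM; exact: measurable_coordT.
Qed.

Lemma continuous_measurable_rV n (f : 'rV[R]_n -> R) :
  continuous f -> measurable_fun setT f.
Proof.
move=> cf; apply: (@measurability _ _ _ _ _ _ (@RGenOpens.G R)).
  exact: RGenOpens.measurableE.
move=> _ [_ [a [b ->]] <-]; rewrite setTI; apply: open_measurable_mx.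
by apply: open_comp; [move=> x _; exact: cf|exact: interval_open].
Qed.

Lemma ge0_integral_rVS n (f : 'rV[R]_n.+1 -> \bar R) :
  measurable_fun setT f -> (forall x, 0 <= f x)%E ->
  (\int[lebesgue_rV n.+1]_x f x =
   \int[@lebesgue_measure R]_a \int[lebesgue_rV n]_v f (row_cons (a, v)))%E.
Proof.
move=> mf f0.
rewrite [LHS](_ : _ = \int[pushforward (@lebesgue_measure R \x lebesgue_rV n)%E
  (@row_cons R n)]_x f x)%E//.
rewrite ge0_integral_pushforward//; last exact: measurable_row_cons.
rewrite preimage_setT (fubini_tonelli1 (f \o @row_cons R n))//=.
by apply: measurableT_comp => //; exact: measurable_row_cons.
Qed.

Lemma ge0_integral_prod_rV n (g : 'I_n -> R -> R) :
  (forall i, measurable_fun setT (g i)) -> (forall i x, 0 <= g i x) ->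
  (\int[lebesgue_rV n]_x (\prod_(i < n) g i (x ord0 i))%:E =
   \prod_(i < n) \int[@lebesgue_measure R]_a (g i a)%:E)%E.
Proof.
elim: n g => [|n IHn] g mg g0.
  rewrite big_ord0; under eq_integral do rewrite big_ord0.
  by rewrite integral_cst//= mul1e; exact: diracT.
have mP : measurable_fun setT (fun x : 'rV[R]_n => \prod_(i < n) g (lift ord0 i) (x ord0 i)).
  apply: measurable_prod => i _.
  by apply: measurableT_comp => //; exact: measurable_coord.
rewrite ge0_integral_rVS; last 2 first.
- apply/measurable_EFinP; apply: measurable_prod => i _.
  by apply: measurableT_comp => //; exact: measurable_coord.
- by move=> x; rewrite lee_fin prodr_ge0.
transitivity (\int[@lebesgue_measure R]_a ((g ord0 a)%:E *
    \prod_(i < n) \int[@lebesgue_measure R]_a (g (lift ord0 i) a)%:E))%E.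
  apply: eq_integral => a _.
  rewrite -IHn// -ge0_integralZl_EFin//=; last 2 first.
  - by move=> x _; rewrite lee_fin prodr_ge0.
  - exact/measurable_EFinP.
  apply: eq_integral => v _; rewrite big_ord_recl row_cons0 EFinM.
  by congr (_ * _%:E)%E; apply: eq_bigr => i _; rewrite row_consS.
rewrite ge0_integralZr//.
- by rewrite big_ord_recl.
- by apply/measurable_EFinP; exact: (mg ord0).
- by move=> x _; rewrite lee_fin.
- by apply: prode_ge0 => i _; apply: integral_ge0 => x _; rewrite lee_fin.
Qed.

End measure_rV.

(** * Sums over the integers *)

Section zsum.
Context {R : realType}.
Implicit Types a b : int -> \bar R.

(** Since [Negz n] is -(n+1), every integer occurs exactly once. Sums over all of Z are needed
    because neither the dilations t nor the heights of f have a smallest dyadic scale. *)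
Definition zsum a : \bar R := (\sum_(n <oo) (a (Posz n) + a (Negz n)))%E.

Lemma zsum_ge0 a : (forall k, 0 <= a k)%E -> (0 <= zsum a)%E.
Proof. by move=> a0; apply: nneseries_ge0 => n _ _; apply: adde_ge0. Qed.

Lemma le_zsum a b : (forall k, 0 <= a k)%E -> (forall k, a k <= b k)%E ->
  (zsum a <= zsum b)%E.
Proof.
move=> a0 ab; apply: lee_nneseries => n _ *; first exact: adde_ge0.
exact: leeD.
Qed.

Lemma ge_zsum a k : (forall k, 0 <= a k)%E -> (a k <= zsum a)%E.
Proof.
move=> a0.
have aa n : (0 <= a (Posz n) + a (Negz n))%E by apply: adde_ge0.
suff h n : (a (Posz n) + a (Negz n) <= zsum a)%E.
  by case: k => n; apply: le_trans (h n); [rewrite leeDl|rewrite leeDr].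
rewrite /zsum (@nneseries_split_cond _ _ 0 n.+1)//.
apply: le_trans (leeDl _ _); last by apply: nneseries_ge0.
rewrite add0n big_nat_recr//= leeDr// sume_ge0// => i _; exact: aa.
Qed.

Lemma zsum_le a (B : \bar R) : (forall k, 0 <= a k)%E ->
  (forall N, \sum_(0 <= n < N) (a (Posz n) + a (Negz n)) <= B)%E -> (zsum a <= B)%E.
Proof.
move=> a0 aB; apply: lime_le.
  by apply: is_cvg_nneseries => n _ _; apply: adde_ge0.
by apply: nearW => N; exact: aB.
Qed.

(** The symmetric partial sums telescope to Phi N - Phi (-N), which is at most B. Both geometric
    series over Z below are summed through such a bounded potential. *)
Lemma zsum_telescope (u Phi : int -> R) B : (forall k, 0 <= u k) ->
  (forall k, u k <= Phi (k + 1) - Phi k) -> (forall k, 0 <= Phi k <= B) ->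
  (zsum (fun k => (u k)%:E) <= B%:E)%E.
Proof.
move=> u0 uP PB; apply: zsum_le => // N.
have : (\sum_(0 <= n < N) (u n + u (Negz n)) <= Phi N - Phi (- N%:Z)).
  elim: N => [|N IHN]; first by rewrite big_nil oppr0 subrr.
  rewrite big_nat_recr//=.
  have h1 := uP N; have h2 := uP (Negz N).
  have e1 : (N%:Z + 1 = N.+1%:Z)%R by rewrite -addn1 PoszD.
  have e2 : (Negz N + 1 = - N%:Z)%R by rewrite NegzE -addn1 PoszD opprD subrK.
  rewrite e1 in h1; rewrite e2 in h2.
  rewrite -NegzE; lra.
rewrite (eq_bigr (fun n => (u (Posz n) + u (Negz n))%:E)) ?sumEFin ?lee_fin// => /le_trans; apply.
have /andP[_ h1] := PB N; have /andP[h2 _] := PB (- N%:Z); lra.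
Qed.

Lemma integral_zsum d (T : measurableType d) (mu : {measure set T -> \bar R})
    (f : int -> T -> \bar R) :
  (forall k, measurable_fun setT (f k)) -> (forall k x, 0 <= f k x)%E ->
  (\int[mu]_x zsum (fun k => f k x) = zsum (fun k => \int[mu]_x f k x))%E.
Proof.
move=> mf f0; rewrite integral_nneseries//.
- by apply: eq_eseriesr => n _; rewrite ge0_integralD.
- by move=> n; exact: emeasurable_funD.
- by move=> n x _; exact: adde_ge0.
Qed.

Lemma measurable_zsum d (T : measurableType d) (f : int -> T -> \bar R) :
  (forall k, measurable_fun setT (f k)) -> (forall k x, 0 <= f k x)%E ->
  measurable_fun setT (fun x => zsum (fun k => f k x)).
Proof.
move=> mf f0; apply: ge0_emeasurable_sum => [k x _ _|k _].
  exact: adde_ge0.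
exact: emeasurable_funD.
Qed.

Lemma zsumZl a (c : R) : 0 <= c -> (forall k, 0 <= a k)%E ->
  (zsum (fun k => c%:E * a k) = c%:E * zsum a)%E.
Proof.
move=> c0 a0; rewrite /zsum -nneseriesZl//; last by move=> n _; apply: adde_ge0.
by apply: eq_eseriesr => n _; rewrite ge0_muleDr.
Qed.

Definition dy (k : int) : R := 2 `^ k%:~R.

Lemma dy_gt0 k : 0 < dy k. Proof. by rewrite powR_gt0. Qed.

Lemma dyS k : dy (k + 1) = 2 * dy k.
Proof. rewrite /dy intrD powRD; last by rewrite pnatr_eq0 implybT.
by rewrite powRr1// mulrC. Qed.

Lemma dy_powS k eta : dy (k + 1) `^ eta = 2 `^ eta * dy k `^ eta.
Proof. by rewrite dyS powRM// ltW// dy_gt0. Qed.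

Lemma ex_dy (y : R) : 0 < y -> exists k, dy k <= y < dy (k + 1).
Proof.
move=> y0; exists (Num.floor (ln y / ln 2)).
have l2 : 0 < ln 2 :> R by rewrite ln_gt0// ltr1n.
have E (c : R) : expR (ln 2 * c) = 2 `^ c by rewrite /powR pnatr_eq0/= mulrC.
have Ey : y = expR (ln 2 * (ln y / ln 2)).
  by rewrite mulrC divfK ?gt_eqF// lnK.
rewrite /dy; set z := ln y / ln 2 in Ey *.
rewrite -!E Ey ler_expR ltr_expR ler_pM2l// ltr_pM2l//.
by rewrite floor_le floorD1_gt.
Qed.

Lemma powR2_gt1 (eta : R) : 0 < eta -> 1 < 2 `^ eta.
Proof.
move=> e0; have <- : 1 `^ eta = 1 :> R by rewrite powR1.
by apply: gt0_ltr_powR; rewrite ?nnegrE ?powR1// ltr1n.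
Qed.

Lemma powR_le1 (x eta : R) : 0 <= eta -> 0 <= x -> x <= 1 -> x `^ eta <= 1.
Proof.
move=> e0 x0 x1; have <- : 1 `^ eta = 1 :> R by rewrite powR1.
by rewrite ge0_ler_powR ?nnegrE// powR1.
Qed.

Lemma powR_ge1 (x eta : R) : 0 <= eta -> 1 <= x -> 1 <= x `^ eta.
Proof.
move=> e0 x1; have <- : 1 `^ eta = 1 :> R by rewrite powR1.
by rewrite ge0_ler_powR ?nnegrE ?powR1// (le_trans ler01).
Qed.

(** A geometric series is dominated by its last term. With b = 2^eta, the potential b/(b-1)
    min(2^{k-1}, y)^eta grows by at least the k-th term as long as 2^k < y, and it never exceeds
    b/(b-1) y^eta. *)
Lemma zsum_dy_lt (eta : R) : 0 < eta -> exists2 C : R, 0 <= C & forall y : R, 0 <= y ->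
  (zsum (fun k => (dy k `^ eta * (dy k < y)%R%:R)%:E) <= (C * y `^ eta)%:E)%E.
Proof.
move=> eta0; pose b : R := 2 `^ eta.
have b1 : 1 < b by exact: powR2_gt1.
exists (b / (b - 1)) => [|y y0].
  by rewrite divr_ge0// ?subr_ge0// ltW// (lt_trans _ b1).
pose phi k := Num.min (dy (k - 1)) y `^ eta.
apply: (@zsum_telescope _ (fun k => b / (b - 1) * phi k)) => k.
- by rewrite mulr_ge0// powR_ge0.
- rewrite -mulrBr /phi addrK.
  have e : dy k = 2 * dy (k - 1) by rewrite -dyS subrK.
  have d0 := dy_gt0 (k - 1).
  have le1 : dy (k - 1) <= dy k by lra.
  have c0 : 0 <= b / (b - 1).
    by rewrite divr_ge0// ?subr_ge0// ltW// (lt_trans _ b1).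
  case: ltP => ky; last first.
    rewrite mulr0 mulr_ge0// subr_ge0 ge0_ler_powR ?nnegrE//.
    - exact: ltW.
    - by rewrite le_min y0 ltW.
    - by rewrite ge_min lexx orbT.
  rewrite min_l; last by rewrite (le_trans le1)// ltW.
  have -> : dy k `^ eta = b * dy (k - 1) `^ eta by rewrite -dy_powS subrK.
  rewrite mulr1 -[X in _ * (_ - X)]mul1r -mulrBl.
  by rewrite mulrA divfK// gt_eqF// subr_gt0.
- have d0 := dy_gt0 (k - 1).
  have c0 : 0 <= b / (b - 1).
    by rewrite divr_ge0// ?subr_ge0// ltW// (lt_trans _ b1).
  rewrite mulr_ge0 ?powR_ge0//=; apply: ler_wpM2l => //.
  apply: ge0_ler_powR; rewrite ?nnegrE ?ge_min ?lexx ?orbT//; first exact: ltW.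
  by rewrite le_min y0 ltW.
Qed.

(** The terms decay geometrically on both sides of the scale 2^k y = 1, so the sum is bounded
    uniformly in y. *)
Lemma zsum_dy_min (eta : R) : 0 < eta -> exists2 C : R, 0 <= C &
  forall y : R, 0 < y ->
  (zsum (fun k => (Num.min ((dy k * y) `^ eta) ((dy k * y) `^ (- eta)))%:E)
    <= C%:E)%E.
Proof.
move=> eta0; pose b : R := 2 `^ eta.
have b1 : 1 < b by exact: powR2_gt1.
have c0 : 0 < b / (b - 1) by rewrite divr_gt0// ?subr_gt0// (lt_trans _ b1).
exists (b / (b - 1) * 2) => [|y y0]; first by rewrite mulr_ge0// ltW.
pose z k := dy k * y.
have z0 k : 0 < z k by rewrite mulr_gt0// dy_gt0.
have zS k : z (k + 1) = 2 * z k by rewrite /z dyS mulrA.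
(* [f] absorbs the terms with 2^k y at most 1 and is constant afterwards, [g] absorbs the others and
   is constant before. The value of [f] is taken at k - 1 because its increment must end at k,
   whereas the increment of [g] starts at k. *)
pose f (x : R) := (Num.min x 1) `^ eta.
pose g (x : R) := - (Num.max x 1) `^ (- eta).
have f01 k : 0 <= f (z k) <= 1.
  rewrite /f powR_ge0/= powR_le1 ?(ltW eta0)//.
    by rewrite le_min ltW//= ler01.
  by rewrite ge_min lexx orbT.
have g01 k : 0 <= 1 + g (z k) <= 1.
  rewrite /g subr_ge0 gerBl powR_ge0 andbT.
  rewrite powRN invf_le1 ?powR_gt0 ?lt_max ?ltr01 ?orbT//.
  by rewrite powR_ge1 ?(ltW eta0)// le_max lexx orbT.
have fS k : f (z (k - 1)) <= f (z k).
  rewrite /f ge0_ler_powR ?nnegrE ?le_min ?ler01 ?(ltW (z0 _))//; first exact: ltW.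
  have := zS (k - 1); rewrite subrK => ->.
  rewrite !ge_min lexx orbT /= andbT; apply/orP; left.
  by have := z0 (k - 1); lra.
have gS k : g (z k) <= g (z (k + 1)).
  have M0 j : 0 < Num.max (z j) 1 by rewrite lt_max ltr01 orbT.
  have Mle : Num.max (z k) 1 <= Num.max (z (k + 1)) 1.
    rewrite zS; have := z0 k; case: (leP (z k) 1) => ? ?.
      by rewrite le_max lexx orbT.
    by rewrite le_max; apply/orP; left; lra.
  rewrite /g lerN2 2!powRN lef_pV2; last 2 first.
  - by rewrite posrE; apply/powR_gt0/M0.
  - by rewrite posrE; apply/powR_gt0/M0.
  by apply: ge0_ler_powR; rewrite ?nnegrE ?(ltW (M0 _))// ltW.
apply: (@zsum_telescope _
  (fun k => b / (b - 1) * (f (z (k - 1)) + (1 + g (z k))))) => k.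
- by rewrite le_min !powR_ge0.
- rewrite -mulrBr addrK -/(z k).
  have [zk|zk] := leP (z k) 1.
    apply: (@le_trans _ _ (b / (b - 1) * (f (z k) - f (z (k - 1))))).
      rewrite ge_min; apply/orP; left.
      have zz : z k = 2 * z (k - 1) by rewrite -zS subrK.
      have zk1 : z (k - 1) <= 1 by have := z0 (k - 1); lra.
      rewrite /f (min_l zk) (min_l zk1).
      have -> : z k `^ eta = b * z (k - 1) `^ eta.
        by rewrite zz powRM// ltW.
      rewrite -[X in _ * (_ - X)]mul1r -mulrBl.
      by rewrite mulrA divfK// gt_eqF// subr_gt0.
    apply: ler_wpM2l; first exact: ltW.
    move: (gS k) (f (z k)) (f (z (k - 1))); clear.
    by move: (g _) (g _) => ? ? ? ? ?; lra.
  apply: (@le_trans _ _ (b / (b - 1) * (g (z (k + 1)) - g (z k)))).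
    rewrite ge_min; apply/orP; right.
    have zk1 : 1 < z (k + 1) by rewrite zS; lra.
    rewrite /g (max_l (ltW zk)) (max_l (ltW zk1)) zS.
    have -> : (2 * z k) `^ (- eta) = b^-1 * z k `^ (- eta).
      by rewrite powRM ?(ltW (z0 _))// powRN.
    move: (z k `^ (- eta)) => Z.
    have b0 : b != 0 by rewrite gt_eqF// (lt_trans _ b1).
    have b10 : b - 1 != 0 by rewrite gt_eqF// subr_gt0.
    suff -> : b / (b - 1) * (- (b^-1 * Z) - - Z) = Z by [].
    by field; rewrite b0 b10.
  apply: ler_wpM2l; first exact: ltW.
  move: (fS k) (g (z (k + 1))) (g (z k)); clear.
  by move: (f _) (f _) => ? ? ? ? ?; lra.
- have /andP[f0 f1] := f01 (k - 1); have /andP[g0 g1] := g01 k.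
  apply/andP; split; first by apply: mulr_ge0; [exact: ltW|exact: addr_ge0].
  by apply: ler_wpM2l; [exact: ltW|exact: lerD].
Qed.

End zsum.

(** * The Hardy-Littlewood maximal function *)

Section maximal_function.
Context {R : realType} {n : nat}.
Local Notation V := 'rV[R]_n.
Local Notation mu := (lebesgue_rV n : {measure set V -> \bar R}).
Implicit Types (f g : V -> R) (c x : V) (r : R).

(** Means are taken over cubes rather than Euclidean balls because a cube is a product set with
    explicit measure. The number r is half of the side. *)
Definition cube c r : set V :=
  [set x | forall i, ball (c ord0 i : R) r (x ord0 i)].

Lemma cubeP c r x : cube c r x <-> forall i, `|c ord0 i - x ord0 i| < r.
Proof. by split => h i; have := h i; rewrite -ball_normE. Qed.

Lemma measurable_cube c r : measurable (cube c r).
Proof.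
rewrite (_ : cube c r = \bigcap_(i in [set: 'I_n])
    ((fun x : V => x ord0 i) @^-1` ball (c ord0 i : R) r)); last first.
  by apply/seteqP; split => [x h i _|x h i]; [exact: h|exact: (h i I)].
apply: fin_bigcap_measurable => // i _.
rewrite -[X in measurable X]setTI; apply: measurable_coord => //.
exact: measurable_ball.
Qed.

Lemma lebesgue_cube c r : 0 <= r -> mu (cube c r) = ((r * 2) ^+ n)%:E.
Proof.
move=> r0; rewrite [LHS](@lebesgue_rV_box _ _ (fun i => ball (c ord0 i : R) r)).
  rewrite (eq_bigr (fun=> (r * 2)%:E)) => [|i _].
    by rewrite prodEFin prodr_const card_ord.
  by rewrite lebesgue_measure_ball// mulr_natr.
by move=> i; exact: measurable_ball.
Qed.

Definition cube_mean f c r : \bar R :=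
  (((r * 2) ^+ n)^-1%:E * \int[mu]_(x in cube c r) (f x)%:E)%E.

Definition qcube (q : 'rV[rat]_n * rat) : set V :=
  cube (map_mx ratr q.1) (ratr q.2).

Definition qmean f (q : 'rV[rat]_n * rat) : \bar R :=
  cube_mean f (map_mx ratr q.1) (ratr q.2).

(* Only cubes with rational centre and half-side are used, so that the supremum
   is countable and measurable; an arbitrary cube is dominated by a rational one. *)
Definition HLmax f x : \bar R :=
  ereal_sup [set qmean f q | q in [set q | 0 < ratr q.2 :> R /\ qcube q x]].

Lemma cube_mean_ge0 f c r : 0 <= r -> (forall x, 0 <= f x) ->
  (0 <= cube_mean f c r)%E.
Proof.
move=> r0 f0; apply: mule_ge0.
  by rewrite lee_fin invr_ge0 exprn_ge0// mulr_ge0.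
by apply: integral_ge0 => x _; rewrite lee_fin.
Qed.

Lemma ratP (a e : R) : 0 < e -> exists q : rat, `|ratr q - a| < e.
Proof.
move=> e0; have /rat_in_itvoo[q /itvP qa] : a - e < a + e.
  by rewrite ltrD2l gtrN.
by exists q; rewrite ltr_distl !qa.
Qed.

(** A rational centre within r of x costs one r, so any half-side above 2 r covers the given cube; a
    rational half-side below 4 r keeps the volumes comparable. *)
Lemma qcube_above x r : 0 < r -> exists q : 'rV[rat]_n * rat,
  [/\ 0 < ratr q.2 :> R, ratr q.2 <= 4 * r, qcube q x & cube x r `<=` qcube q].
Proof.
move=> r0; have /choice[u uP] : forall i, exists q : rat, `|ratr q - x ord0 i| < r.
  by move=> i; exact: ratP.
have /rat_in_itvoo[s /itvP sr] : 2 * r < 4 * r by lra.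
have s2 : 2 * r < ratr s by rewrite sr.
have s4 : ratr s <= 4 * r by rewrite ltW// sr.
exists (\row_i u i, s) => /=; split => //; first lra.
  by apply/cubeP => i; rewrite !mxE; have := uP i; lra.
move=> y /cubeP xy; apply/cubeP => i; rewrite !mxE.
have := uP i; have := xy i; move: (ler_distD (x ord0 i) (ratr (u i)) (y ord0 i)).
lra.
Qed.

Lemma HLmax_ge0 f x : (forall x, 0 <= f x) -> (0 <= HLmax f x)%E.
Proof.
move=> f0; have [q [q0 _ qx _]] := qcube_above x (@ltr01 R).
apply: (@le_trans _ _ (qmean f q)); first by apply: cube_mean_ge0 => //; exact: ltW.
by apply: ereal_sup_ubound; exists q.
Qed.

(** The side 8 r is twice the half-side 4 r allowed by [qcube_above]. *)
Lemma integral_cube_le_HLmax f x r : 0 < r -> measurable_fun setT f ->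
  (forall x, 0 <= f x) ->
  (\int[mu]_(y in cube x r) (f y)%:E <= ((8 * r) ^+ n)%:E * HLmax f x)%E.
Proof.
move=> r0 mf f0; have [q [q0 q4 qx sub]] := qcube_above x r0.
have mf' A : measurable_fun A (EFin \o f).
  by apply/measurable_EFinP; exact: measurable_funTS.
apply: (@le_trans _ _ (\int[mu]_(y in qcube q) (f y)%:E)%E).
  apply: ge0_subset_integral => //; [exact: measurable_cube..|].
  by move=> y _; rewrite lee_fin.
set I := (\int[mu]_(y in qcube q) (f y)%:E)%E.
have I0 : (0 <= I)%E by apply: integral_ge0 => y _; rewrite lee_fin.
have d0 : 0 < (ratr q.2 * 2 : R) ^+ n by rewrite exprn_gt0// mulr_gt0.
have -> : I = (((ratr q.2 * 2) ^+ n)%:E * qmean f q)%E.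
  by rewrite /qmean /cube_mean muleA -EFinM mulfV ?gt_eqF// mul1e.
apply: lee_pmul.
- by rewrite lee_fin ltW.
- by apply: cube_mean_ge0 => //; exact: ltW.
- rewrite lee_fin; apply: lerXn2r; rewrite ?nnegrE; move: q0 q4 r0;
    by move: (ratr q.2 : R) => s; lra.
- by apply: ereal_sup_ubound; exists q.
Qed.

Lemma HLmax_gtE f (l : R) : [set x | (l%:E < HLmax f x)%E] =
  \bigcup_(q in [set q | 0 < ratr q.2 :> R /\ (l%:E < qmean f q)%E]) qcube q.
Proof.
apply/seteqP; split => [x /= /ereal_sup_gt|x [q [q0 lq] qx]] /=.
  by move=> [_ [q [q0 qx] <-] lq]; exists q.
by apply: (lt_le_trans lq); apply: ereal_sup_ubound; exists q.
Qed.

Lemma measurable_HLmax_gt f (l : R) : measurable [set x | (l%:E < HLmax f x)%E].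
Proof.
rewrite HLmax_gtE bigcup_mkcond.
apply: countable_bigcupT_measurable; first exact: countableP.
by move=> q; case: ifP => _ //; exact: measurable_cube.
Qed.

Lemma measurable_HLmax f : measurable_fun setT (HLmax f).
Proof.
apply: (measurability _ (ErealGenOInfty.measurableE R)) => //.
move=> _ [_ [l ->] <-]; rewrite setTI.
rewrite (_ : _ @^-1` _ = [set x | (l%:E < HLmax f x)%E]); last first.
  by apply/seteqP; split => x /=; rewrite in_itv/= andbT.
exact: measurable_HLmax_gt.
Qed.

Lemma seq_maxP (s : seq ('rV[rat]_n * rat)) : (0 < size s)%N ->
  exists2 q, q \in s & forall p, p \in s -> p.2 <= q.2.
Proof.
elim: s => // a [|b s] IHs _.
  by exists a; rewrite ?mem_head// => p; rewrite inE => /eqP ->.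
have [q qs qmax] := IHs isT.
have [aq|qa] := leP a.2 q.2.
  exists q; first by rewrite inE qs orbT.
  by move=> p; rewrite inE => /predU1P[->//|]; exact: qmax.
exists a; first by rewrite mem_head.
move=> p; rewrite inE => /predU1P[->//|/qmax pq].
by rewrite (le_trans pq)// ltW.
Qed.

Lemma measurable_qcubes (s : seq ('rV[rat]_n * rat)) :
  measurable (\bigcup_(q in [set` s]) qcube q).
Proof.
apply: fin_bigcup_measurable; first exact: finite_seq.
by move=> q _; exact: measurable_cube.
Qed.

(* Greedy Vitali selection: the largest cube absorbs, after tripling, all the
   cubes that meet it, and the remaining ones are disjoint from it. *)
Lemma weak_type_finite f (l : R) : 0 < l -> measurable_fun setT f ->
  (forall x, 0 <= f x) -> forall s : seq ('rV[rat]_n * rat),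
  (forall q, q \in s -> 0 < ratr q.2 :> R /\ (l%:E < qmean f q)%E) ->
  (l%:E * mu (\bigcup_(q in [set` s]) qcube q) <=
   (3 ^+ n)%:E * \int[mu]_(x in \bigcup_(q in [set` s]) qcube q) (f x)%:E)%E.
Proof.
move=> l0 mf f0 s; have [N] := ubnP (size s).
elim: N s => // N IHN s; rewrite ltnS => sN good.
have mf' A : measurable_fun A (EFin \o f).
  by apply/measurable_EFinP; exact: measurable_funTS.
have [/size0nil ->|s0] := posnP (size s).
  by rewrite set_nil bigcup_set0 measure0 mule0 integral_set0 mule0.
have [q qs qmax] := seq_maxP s0.
have [q0 lq] := good q qs.
pose a (p : 'rV[rat]_n * rat) := `[< qcube p `&` qcube q = set0 :> set V >].
pose s' := seq.filter a s.
have qq : qcube q (map_mx ratr q.1) by apply/cubeP => i; rewrite subrr normr0.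
(* The selected cube meets itself, hence it is discarded with the cubes it absorbs and the remaining
   list is strictly shorter. *)
have naq : ~~ a q by apply/asboolP => /seteqP[/(_ _ (conj qq qq))].
have s's : (size s' < N)%N.
  apply: leq_trans sN; rewrite size_filter ltn_neqAle count_size andbT.
  by apply/negP; rewrite -all_count => /allP /(_ q qs); exact/negP.
have := IHN s' s's; set U' := \bigcup_(p in [set` s']) _.
set U := \bigcup_(p in [set` s]) _.
have /[swap] /[apply] IH' : forall p, p \in s' ->
    0 < ratr p.2 :> R /\ (l%:E < qmean f p)%E.
  by move=> p; rewrite mem_filter => /andP[_]; exact: good.
pose Q3 : set V := cube (map_mx ratr q.1) (3 * ratr q.2).
(* A cube meeting the selected one has no larger half-side, so each of its points is at distance
   less than r + 2 r from the selected centre. *)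
have UQ : U `<=` Q3 `|` U'.
  move=> x [p ps px].
  have [ap|/negP nap] := boolP (a p).
    by right; exists p => //=; rewrite mem_filter ap.
  left; have /set0P[y [yp yq]] : qcube p `&` qcube q != set0 :> set V.
    by apply/negP => /eqP /asboolP.
  apply/cubeP => i; move/cubeP : px => /(_ i); move/cubeP : yp => /(_ i).
  move/cubeP : yq => /(_ i).
  have : ratr p.2 <= ratr q.2 :> R by rewrite ler_rat; exact: qmax.
  move: (ler_distD (y ord0 i) (map_mx ratr q.1 ord0 i) (x ord0 i)).
  move: (ler_distD (map_mx ratr p.1 ord0 i) (y ord0 i) (x ord0 i)).
  rewrite (distrC (y ord0 i) (map_mx ratr p.1 ord0 i)).
  by move: (ratr p.2 : R) (ratr q.2 : R) => ? ?; lra.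
have mQ3 : measurable Q3 by exact: measurable_cube.
have mU' : measurable U' by exact: measurable_qcubes.
have mU : measurable U by exact: measurable_qcubes.
have mQ : measurable (qcube q : set V) by exact: measurable_cube.
have lQ : (l%:E * ((ratr q.2 * 2) ^+ n)%:E <= \int[mu]_(x in qcube q) (f x)%:E)%E.
  have d0 : 0 < (ratr q.2 * 2 : R) ^+ n by rewrite exprn_gt0// mulr_gt0.
  rewrite muleC; apply: (@le_trans _ _ (((ratr q.2 * 2) ^+ n)%:E * qmean f q)%E).
    by apply: lee_wpmul2l; [rewrite lee_fin ltW|exact: ltW].
  by rewrite /qmean /cube_mean muleA -EFinM mulfV ?gt_eqF// mul1e.
apply: (@le_trans _ _ (l%:E * (mu Q3 + mu U'))%E).
  apply: lee_wpmul2l; first by rewrite lee_fin ltW.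
  apply: le_trans (measureU2 _ mQ3 mU').
  by apply: le_measure; rewrite ?inE//; exact: measurableU.
rewrite ge0_muleDr//; apply: (@le_trans _ _ ((3 ^+ n)%:E *
  (\int[mu]_(x in qcube q) (f x)%:E + \int[mu]_(x in U') (f x)%:E))%E).
  rewrite ge0_muleDr ?integral_ge0//; last 2 first.
    by move=> x _; rewrite lee_fin.
    by move=> x _; rewrite lee_fin.
  have r3 : 0 <= 3 * ratr q.2 :> R by apply: mulr_ge0 => //; exact: ltW.
  apply: leeD => //; rewrite [mu Q3](lebesgue_cube _ r3).
  rewrite -mulrA exprMn EFinM muleCA; apply: lee_wpmul2l => //.
apply: lee_wpmul2l; first by rewrite lee_fin exprn_ge0.
rewrite -ge0_integral_setU//.
- apply: ge0_subset_integral => //.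
  + exact: measurableU.
  + by move=> x _; rewrite lee_fin.
  + move=> x [qx|[p /=]]; first by exists q.
    by rewrite mem_filter => /andP[_ ps] px; exists p.
- by move=> x _; rewrite lee_fin.
- apply/disj_setPS => x [qx [p /=]]; rewrite mem_filter => /andP[/asboolP pq _] px.
  by have /seteqP[/(_ x (conj px qx))] := pq.
Qed.

(** The level set is the increasing union of the finite unions obtained by enumerating rational
    cubes through [pickle]. The finite estimate is uniform in the number of cubes and passes to the
    limit by continuity of the measure from below. *)
Lemma weak_type f (l : R) : 0 < l -> measurable_fun setT f ->
  (forall x, 0 <= f x) ->
  (mu [set x | (l%:E < HLmax f x)%E] <= (3 ^+ n / l)%:E * \int[mu]_x (f x)%:E)%E.
Proof.
move=> l0 mf f0; rewrite HLmax_gtE; set good := [set q | _].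
have mf' A : measurable_fun A (EFin \o f).
  by apply/measurable_EFinP; exact: measurable_funTS.
pose s (N : nat) := [seq q <- pmap (@unpickle ('rV[rat]_n * rat)%type) (iota 0 N) | q \in good].
pose A N := \bigcup_(q in [set` s N]) (qcube q : set V).
have AE : \bigcup_(q in good) qcube q = \bigcup_N A N.
  apply/seteqP; split => [x [q gq qx]|x [N _ [q /=]]]; last first.
    by rewrite mem_filter => /andP[/set_mem gq _] qx; exists q.
  exists (pickle q).+1 => //; exists q => //.
  have : Some q \in [seq unpickle i | i <- iota 0 (pickle q).+1].
    by apply/mapP; exists (pickle q); rewrite ?pickleK// mem_iota leq0n ltnSn.
  rewrite -mem_pmap => h; suff : q \in s (pickle q).+1 by [].
  by rewrite /s mem_filter h andbT; exact/mem_set.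
have mA N : measurable (A N) by exact: measurable_qcubes.
have ndA : nondecreasing_seq A.
  move=> N M NM; apply/subsetPset => x [q /=]; rewrite mem_filter => /andP[gq qN] qx.
  exists q => //=; rewrite mem_filter gq/=.
  move: qN; rewrite !mem_pmap => /mapP[k]; rewrite mem_iota => /andP[_ kN] e.
  by apply/mapP; exists k => //; rewrite mem_iota/= (leq_trans kN).
have mbA : measurable (\bigcup_N A N) by exact: bigcupT_measurable.
rewrite AE; have cv := nondecreasing_cvg_mu (mu := mu) mA mbA ndA.
rewrite -(cvg_lim _ cv)//; apply: lime_le.
  by apply/cvg_ex; eexists; exact: cv.
apply: nearW => N /=.
have /(weak_type_finite l0 mf f0) : forall q, q \in s N ->
    0 < ratr q.2 :> R /\ (l%:E < qmean f q)%E.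
  by move=> q; rewrite mem_filter => /andP[/set_mem].
rewrite -/(A N) => h.
have {}h : (l%:E * mu (A N) <= (3 ^+ n)%:E * \int[mu]_x (f x)%:E)%E.
  apply: (le_trans h); apply: lee_wpmul2l; first by rewrite lee_fin exprn_ge0.
  by apply: ge0_subset_integral => // x _; rewrite lee_fin.
rewrite (mulrC _ l^-1) EFinM -muleA -[leLHS]mul1e.
have -> : (1 = l^-1%:E * l%:E :> \bar R)%E by rewrite -EFinM mulVf// gt_eqF.
by rewrite -muleA; apply: lee_wpmul2l => //; rewrite lee_fin invr_ge0 ltW.
Qed.

Definition above f (l : R) : V -> R := fun y => f y * \1_[set z | l < f z] y.

Lemma aboveE f (l : R) y : above f l y = f y * (l < f y)%R%:R.
Proof.
rewrite /above indicE; congr (_ * (nat_of_bool _)%:R).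
by apply/idP/idP => ?; [exact: (set_mem (A := [set z | l < f z]))|exact: mem_set].
Qed.

Lemma above_ge0 f (l : R) y : (forall x, 0 <= f x) -> 0 <= above f l y.
Proof. by move=> f0; rewrite mulr_ge0. Qed.

Lemma measurable_gt f (l : R) : measurable_fun setT f ->
  measurable [set y | l < f y].
Proof.
move=> mf; rewrite -[X in measurable X]setTI.
rewrite (_ : [set y | l < f y] = f @^-1` `]l, +oo[%classic); last first.
  by apply/seteqP; split => y /=; rewrite in_itv/= andbT.
exact: mf.
Qed.

Lemma measurable_above f (l : R) : measurable_fun setT f ->
  measurable_fun setT (above f l).
Proof.
move=> mf; apply: measurable_funM => //.
by apply: measurable_indic; exact: measurable_gt.
Qed.

Lemma HLmax_above f (l : R) x : 0 < l -> measurable_fun setT f ->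
  (forall x, 0 <= f x) -> (HLmax f x <= l%:E + HLmax (above f l) x)%E.
Proof.
move=> l0 mf f0; apply: ge_ereal_sup => _ [q [q0 qx] <-].
have mQ : measurable (qcube q : set V) by exact: measurable_cube.
have d0 : 0 < (ratr q.2 * 2 : R) ^+ n by rewrite exprn_gt0// mulr_gt0.
have mg' A : measurable_fun A (EFin \o above f l).
  by apply/measurable_EFinP; apply: measurable_funTS; exact: measurable_above.
apply: (@le_trans _ _ (l%:E + qmean (above f l) q)%E); last first.
  by apply: leeD => //; apply: ereal_sup_ubound; exists q.
rewrite /qmean /cube_mean; set D := (_ ^+ n)^-1.
have D0 : 0 <= D by rewrite invr_ge0 ltW.
have -> : l%:E = (D%:E * (l%:E * mu (qcube q)))%E.
  by rewrite [mu _](lebesgue_cube _ (ltW q0)) -!EFinM mulrCA mulVf ?mulr1// gt_eqF.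
rewrite -integral_cst// -ge0_muleDr; last 2 first.
- by apply: integral_ge0 => y _; rewrite lee_fin ltW.
- by apply: integral_ge0 => y _; rewrite lee_fin above_ge0.
rewrite -ge0_integralD//; last 2 first.
- by move=> y _; rewrite lee_fin ltW.
- by move=> y _; rewrite lee_fin above_ge0.
apply: lee_wpmul2l => //; apply: ge0_le_integral => //.
- by move=> y _; rewrite lee_fin.
- by apply/measurable_EFinP; exact: measurable_funTS.
- by apply: emeasurable_funD.
move=> y _; rewrite lee_fin aboveE; case: (ltP l (f y)) => ly.
  by rewrite mulr1 lerDr ltW.
by rewrite mulr0 addr0.
Qed.

(** Values of f below l contribute at most l to any mean, so only the part of f above l can lift the
    maximal function beyond 2 l. This localization makes the sum over levels converge for every
    exponent s > 1. *)
Lemma HLmax_gt2 f (l : R) : 0 < l -> measurable_fun setT f ->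
  (forall x, 0 <= f x) ->
  (mu [set x | ((2 * l)%:E < HLmax f x)%E] <=
   (3 ^+ n / l)%:E * \int[mu]_x (above f l x)%:E)%E.
Proof.
move=> l0 mf f0.
have mg := measurable_above l mf.
apply: le_trans (weak_type l0 mg (fun x => above_ge0 l x f0)).
apply: le_measure; rewrite ?inE; [exact: measurable_HLmax_gt..|].
move=> x /= lx; have := lt_le_trans lx (HLmax_above x l0 mf f0).
by rewrite mulr_natl mulr2n EFinD lteD2lE.
Qed.

(** A dyadic layer-cake formula that also covers y = +oo, a value which the maximal function may
    take. *)
Lemma poweR_le_zsum (y : \bar R) (s : R) : 0 < s -> (0 <= y)%E ->
  (y `^ s <= zsum (fun k => ((8 * dy k) `^ s)%:E * ((2 * dy k : R)%:E < y)%E%:R%:E))%E.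
Proof.
move=> s0 y0; set a := fun k => _.
have a0 k : (0 <= a k)%E by rewrite mule_ge0// lee_fin ?powR_ge0.
move: y => [y| |] in y0 a a0 *; last by rewrite leeNy_eq in y0.
- rewrite lee_fin in y0; have [<-|/eqP yn0] := eqVneq 0 y.
    by rewrite poweR_EFin powR0 ?gt_eqF// zsum_ge0.
  have yp : 0 < y by rewrite lt_neqAle y0 andbT; apply/eqP.
  have [k /andP[k1 k2]] := ex_dy yp.
  (* For 2^k <= y < 2^{k+1} the term of index k - 2 suffices: its threshold 2 * 2^{k-2} lies
     strictly below y, and its size 8 * 2^{k-2} = 2^{k+1} lies above y. *)
  apply: le_trans (ge_zsum (k - 2) a0); rewrite /a.
  have e : dy k = 4 * dy (k - 2) :> R.
    have {1}-> : k = k - 2 + 1 + 1 by rewrite -addrA subrK.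
    by rewrite !dyS mulrA -natrM.
  have d0 := @dy_gt0 R (k - 2).
  rewrite lte_fin; have -> : 2 * dy (k - 2) < y by lra.
  rewrite mule1 poweR_EFin lee_fin ge0_ler_powR ?nnegrE ?(ltW s0)//.
    by lra.
  by rewrite dyS in k2; lra.
(* At y = +oo all terms are present and they are unbounded: one with s M > N and 2^N > r exceeds the
   given r. *)
- rewrite poweRyr ?gt_eqF// leye_eq; apply/eqP/eq_infty => r.
  have [N rN] : exists N : nat, r < N%:R.
    have := archi_boundP (normr_ge0 r); move=> h; exists (Num.bound `|r|).
    by rewrite (le_lt_trans _ h)// ler_norm.
  pose M := (Num.trunc (N%:R / s : R)).+1.
  have NM : N%:R < s * M%:R.
    by rewrite mulrC -ltr_pdivrMr// truncnS_gt.
  apply: le_trans (ge_zsum (Posz M) a0); rewrite /a ltry mule1 lee_fin.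
  apply: (@le_trans _ _ (dy M `^ s)).
    rewrite /dy -powRrM mulrC (@le_trans _ _ (2 `^ N%:R))//.
      by rewrite powR_mulrn// ltW// (lt_trans rN)// -natrX ltr_nat ltn_expl.
    by rewrite ler_powR ?ler1n// ltW.
  rewrite ge0_ler_powR ?nnegrE ?(ltW s0)//; have := @dy_gt0 R M; lra.
Qed.

(** Marcinkiewicz interpolation with the trivial bound at infinity. After [HLmax_gt2], level 2^k
    contributes a multiple of 2^{k(s-1)} f(x) at the points where 2^k < f(x), and s > 1 makes the
    sum over k a multiple of f(x)^s. *)
Lemma strong_type (s : R) : 1 < s -> exists2 C : R, 0 <= C & forall f,
  measurable_fun setT f -> (forall x, 0 <= f x) ->
  (\int[mu]_x (HLmax f x `^ s) <= C%:E * \int[mu]_x (f x `^ s)%:E)%E.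
Proof.
move=> s1; have s0 : 0 < s by rewrite (lt_trans _ s1).
have e0 : 0 < s - 1 by rewrite subr_gt0.
have [C C0 CP] := zsum_dy_lt e0.
pose K : R := 8 `^ s * 3 ^+ n.
have K0 : 0 <= K by rewrite mulr_ge0 ?powR_ge0 ?exprn_ge0.
exists (K * C) => [|f mf f0]; first by rewrite mulr_ge0.
pose E k := [set x | ((2 * dy k : R)%:E < HLmax f x)%E].
have mE k : measurable (E k) by exact: measurable_HLmax_gt.
have d0 k := @dy_gt0 R k.
have mM : measurable_fun setT (fun x => HLmax f x `^ s)%E.
  by apply: (measurableT_comp (measurable_poweR s)); exact: measurable_HLmax.
pose a k x : \bar R := (((8 * dy k) `^ s)%:E * (\1_(E k) x)%:E)%E.
have a0 k x : (0 <= a k x)%E by rewrite mule_ge0// lee_fin ?powR_ge0.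
have ma k : measurable_fun setT (a k).
  by apply: measurable_funeM; exact/measurable_EFinP/measurable_indic.
pose b k x := K * (dy k `^ (s - 1) * (dy k < f x)%R%:R) * f x.
have b0 k x : 0 <= b k x.
  by rewrite !mulr_ge0// powR_ge0.
have mb k : measurable_fun setT (b k).
  rewrite (_ : b k = fun x => (K * dy k `^ (s - 1)) * above f (dy k) x).
    by apply: measurable_funM => //; exact: measurable_above.
  by apply/funext => x; rewrite aboveE /b -!mulrA (mulrC (f x)).
apply: (@le_trans _ _ (\int[mu]_x zsum (fun k => a k x))%E).
  apply: ge0_le_integral => //.
  - by move=> x _; exact: poweR_ge0.
  - exact: measurable_zsum.
  - move=> x _; have := poweR_le_zsum s0 (HLmax_ge0 x f0).
    congr (_ <= zsum _)%E; apply/funext => k; rewrite /a; congr (_ * ((nat_of_bool _)%:R)%:E)%E.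
    by apply/idP/idP => h;
      [exact: mem_set|exact: (set_mem (A := E k))].
rewrite integral_zsum//.
apply: (@le_trans _ _ (zsum (fun k => \int[mu]_x (b k x)%:E))%E).
  apply: le_zsum => k; first exact: integral_ge0.
  rewrite ge0_integralZl_EFin ?powR_ge0//; last first.
    exact/measurable_EFinP/measurable_indic.
  rewrite integral_indic// setIT.
  apply: (@le_trans _ _ (((8 * dy k) `^ s)%:E *
      ((3 ^+ n / dy k)%:E * \int[mu]_x (above f (dy k) x)%:E))%E).
    by apply: lee_wpmul2l; [rewrite lee_fin powR_ge0|exact: HLmax_gt2].
  rewrite muleA -EFinM -ge0_integralZl_EFin; first last.
  - by rewrite mulr_ge0 ?powR_ge0// divr_ge0 ?exprn_ge0// ltW.
  - by apply/measurable_EFinP; exact: measurable_above.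
  - by move=> x _; rewrite lee_fin above_ge0.
  - exact: measurableT.
  rewrite le_eqVlt; apply/orP; left; apply/eqP; apply: eq_integral => x _.
  rewrite -EFinM aboveE /b powRM ?(ltW (d0 _))//; congr EFin.
  have -> : dy k `^ (s - 1) = dy k `^ s / dy k :> R.
    by rewrite powRB ?powRr1 ?(ltW (d0 _))// (gt_eqF (d0 _)) implybT.
  by rewrite /K; ring.
rewrite -integral_zsum; first last.
- by move=> k x; rewrite lee_fin.
- by move=> k; exact/measurable_EFinP.
rewrite -ge0_integralZl_EFin; first last.
- by rewrite mulr_ge0.
- by apply/measurable_EFinP; exact: (measurableT_comp (measurable_powR s)).
- by move=> x _; rewrite lee_fin powR_ge0.
- exact: measurableT.
apply: ge0_le_integral => //.
- by move=> x _; apply: zsum_ge0 => k; rewrite lee_fin.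
- by apply: measurable_zsum => [k|k x]; [exact/measurable_EFinP|rewrite lee_fin].
- apply/measurable_EFinP; apply: measurable_funM => //.
  exact: (measurableT_comp (measurable_powR s)).
move=> x _; rewrite (_ : (fun k => _) = fun k =>
    ((K * f x)%:E * (dy k `^ (s - 1) * (dy k < f x)%R%:R)%:E)%E); last first.
  by apply/funext => k; rewrite -EFinM /b; congr EFin; ring.
rewrite zsumZl ?mulr_ge0//; last by move=> k; rewrite lee_fin mulr_ge0 ?powR_ge0.
apply: (@le_trans _ _ ((K * f x)%:E * (C * f x `^ (s - 1))%:E)%E).
  by apply: lee_wpmul2l; [rewrite lee_fin mulr_ge0|exact: CP].
rewrite -!EFinM lee_fin -[in leRHS](@mulr_powRB1 _ (f x) s)//.
by rewrite le_eqVlt; apply/orP; left; apply/eqP; ring.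
Qed.

End maximal_function.

(** * Jensen's inequality and an integrable weight *)

Section jensen.
Context {R : realType} d (T : measurableType d).
Variable mu : {measure set T -> \bar R}.

(** M is only an upper bound for the measure of D. Young's inequality f c^{s-1} <= f^s / s + (1 -
    1/s) c^s is integrated over D, and the free constant c is chosen afterwards. *)
Lemma jensen_powR (D : set T) (f : T -> R) (M s : R) :
  measurable D -> (mu D <= M%:E)%E -> 0 < M -> 1 <= s ->
  measurable_fun D f -> (forall x, 0 <= f x) ->
  ((\int[mu]_(x in D) (f x)%:E) `^ s <=
   (M `^ (s - 1))%:E * \int[mu]_(x in D) (f x `^ s)%:E)%E.
Proof.
move=> mD DM M0; rewrite le_eqVlt => /predU1P[<- mf f0|s1 mf f0].
  rewrite subrr powRr0 mul1e poweRe1.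
    rewrite le_eqVlt; apply/orP; left; apply/eqP; apply: eq_integral => x _.
    by rewrite powRr1.
  by apply: integral_ge0 => x _; rewrite lee_fin.
have s0 : 0 < s by rewrite (lt_trans _ s1).
set I := (\int[mu]_(x in D) (f x)%:E)%E.
set J := (\int[mu]_(x in D) (f x `^ s)%:E)%E.
have I0 : (0 <= I)%E by apply: integral_ge0 => x _; rewrite lee_fin.
have J0 : (0 <= J)%E by apply: integral_ge0 => x _; rewrite lee_fin powR_ge0.
have mfs : measurable_fun D (fun x => f x `^ s).
  exact: (measurableT_comp (measurable_powR s)).
have young (c : R) : 0 <= c ->
    ((c `^ (s - 1))%:E * I <= s^-1%:E * J + ((1 - s^-1) * c `^ s * M)%:E)%E.
  move=> c0; have k0 : 0 <= (1 - s^-1) * c `^ s.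
    by rewrite mulr_ge0 ?powR_ge0// subr_ge0 invf_le1// ltW.
  apply: (@le_trans _ _ (s^-1%:E * J + ((1 - s^-1) * c `^ s)%:E * mu D)%E); last first.
    by apply: leeD => //; rewrite [leRHS]EFinM; apply: lee_wpmul2l.
  rewrite -integral_cst// -!ge0_integralZl_EFin ?powR_ge0 ?invr_ge0 ?(ltW s0)//; first last.
  - exact/measurable_EFinP.
  - by move=> x _; rewrite lee_fin.
  - exact/measurable_EFinP.
  - by move=> x _; rewrite lee_fin powR_ge0.
  rewrite -ge0_integralD//; first last.
  - by apply: measurable_funeM; exact/measurable_EFinP.
  - by move=> x _; rewrite -EFinM lee_fin mulr_ge0 ?powR_ge0// invr_ge0 ltW.
  apply: ge0_le_integral => //.
  - by move=> x _; rewrite -EFinM lee_fin mulr_ge0 ?powR_ge0.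
  - by apply: measurable_funeM; exact/measurable_EFinP.
  - by apply: emeasurable_funD => //; apply: measurable_funeM; exact/measurable_EFinP.
  move=> x _; rewrite -!EFinM -EFinD lee_fin.
  pose q := s / (s - 1).
  have s10 : 0 < s - 1 by rewrite subr_gt0.
  have q0 : 0 < q by rewrite divr_gt0.
  have sq : s^-1 + q^-1 = 1.
    by rewrite /q invf_div mulrBl mulfV ?gt_eqF// mul1r addrCA subrr addr0.
  have := @conjugate_powR _ (f x) (c `^ (s - 1)) s q (f0 x) (powR_ge0 _ _) s0 q0 sq.
  rewrite -powRrM (_ : (s - 1) * q = s); last by rewrite /q mulrCA mulfV ?mulr1// gt_eqF.
  have -> : q^-1 = 1 - s^-1 by rewrite -sq addrC addKr.
  by rewrite mulrC (mulrC _ (s^-1)) (mulrC (c `^ s)).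
have [Joo|Jfin] := eqVneq J +oo%E.
  by rewrite Joo gt0_muley ?leey// lte_fin powR_gt0.
have {}Jfin : J \is a fin_num by rewrite ge0_fin_numE// lt_neqAle Jfin leey.
have Ifin : I \is a fin_num.
  have := young 1 ler01; rewrite !powR1 mul1e => h.
  rewrite ge0_fin_numE// (le_lt_trans h)// -(fineK Jfin) -EFinM -EFinD.
  exact: ltry.
move: young J0 I0; rewrite -(fineK Jfin) -(fineK Ifin).
move: (fine I) (fine J) => i j young j0 i0; rewrite !lee_fin in j0 i0.
(* The optimal c is the mean value i / M. Before that, c = 1 has shown that the integral of f is
   finite, so that this mean exists. *)
have := young (i / M) (divr_ge0 i0 (ltW M0)).
rewrite poweR_EFin -!EFinM -EFinD !lee_fin.
have c0 : 0 <= i / M by rewrite divr_ge0// ltW.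
have : i = i / M * M by rewrite divfK// gt_eqF.
move: (i / M) c0 => c c0 -> h.
rewrite powRM ?(ltW M0)//.
have e (z : R) : 0 <= z -> z `^ s = z * z `^ (s - 1) by move=> z0; rewrite mulr_powRB1.
rewrite (e M (ltW M0)); rewrite mulrA in h.
suff : c `^ s * M <= j.
  move=> /(ler_wpM2l (powR_ge0 M (s - 1))); apply: le_trans.
  by rewrite le_eqVlt; apply/orP; left; apply/eqP; ring.
have : s^-1 * (c `^ s * M) <= s^-1 * j.
  rewrite (mulrC _ c) -e// in h.
  by move: h; rewrite mulrBl mul1r mulrBl mulrA; lra.
by rewrite ler_pM2l// invr_gt0.
Qed.

End jensen.

Section integrable_weight.
Context {R : realType}.

Lemma integral_oneDsqrV_lty :
  (\int[@lebesgue_measure R]_x ((1 + x ^+ 2)^-1)%:E < +oo)%E.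
Proof.
rewrite ge0_symfun_integralT//=.
- rewrite (_ : [set x | _] = `[0, +oo[%classic); last first.
    by apply/seteqP; split => x/=; rewrite in_itv/= andbT.
  rewrite (@ge0_continuous_FTC2y _ _ (@atan R) _ (pi / 2)).
  + by rewrite -EFinB -EFinM ltry.
  + by move=> x _; rewrite invr_ge0 addr_ge0 ?sqr_ge0.
  + apply: continuous_subspaceT => x.
    exact: (@continuous_oneDsqrV R x).
  + exact: cvgy_atan.
  + by move=> x _; exact: derivable_atan.
  + by apply: cvg_at_right_filter; exact: continuous_atan.
  + by move=> x _; rewrite derive1_atan.
- by move=> x; rewrite invr_ge0 addr_ge0 ?sqr_ge0.
- exact: (@continuous_oneDsqrV R).
- by move=> x/=; rewrite sqrrN.
Qed.

(** An integrable function bounded by 1 and below by a negative power of 1 + |y|. The product form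
    reduces its integral to the one-dimensional arctangent integral. *)
Definition weight n (y : 'rV[R]_n) : R := \prod_(i < n) (1 + y ord0 i ^+ 2)^-1.

Lemma weight_gt0 n (y : 'rV[R]_n) : 0 < weight y.
Proof. by apply: prodr_gt0 => i _; rewrite invr_gt0 ltr_wpDr// sqr_ge0. Qed.

Lemma weight_le1 n (y : 'rV[R]_n) : weight y <= 1.
Proof.
apply: prodr_ile1 => i _.
have h : 0 < 1 + y ord0 i ^+ 2 by rewrite ltr_wpDr// sqr_ge0.
by rewrite invr_ge0 ltW//= invf_le1// lerDl sqr_ge0.
Qed.

Lemma measurable_weight n : measurable_fun setT (@weight n).
Proof.
apply: measurable_prod => i _.
apply: (measurableT_comp (f := fun t : R => (1 + t ^+ 2)^-1)); last exact: measurable_coord.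
by apply: continuous_measurable_fun; exact: (@continuous_oneDsqrV R).
Qed.

Lemma integral_weight_lty n : (\int[lebesgue_rV n]_y (weight y)%:E < +oo)%E.
Proof.
rewrite /weight (@ge0_integral_prod_rV _ _ (fun _ t => (1 + t ^+ 2)^-1)).
- suff : (0 <= \prod_(i < n) \int[@lebesgue_measure R]_a ((1 + a ^+ 2)^-1)%:E < +oo)%E.
    by case/andP.
  elim/big_ind: _ => [|a b /andP[a0 ha] /andP[b0 hb]|i _].
  + by rewrite ltry lee_fin ler01.
  + by rewrite mule_ge0//= lte_mul_pinfty// ge0_fin_numE.
  + rewrite integral_oneDsqrV_lty andbT.
    by apply: integral_ge0 => x _; rewrite lee_fin invr_ge0 addr_ge0 ?sqr_ge0.
- by move=> _; apply: continuous_measurable_fun; exact: (@continuous_oneDsqrV R).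
- by move=> _ x; rewrite invr_ge0 addr_ge0 ?sqr_ge0.
Qed.

End integrable_weight.

(** * The maximal function in variable Lebesgue spaces *)

Section enorm_theory.
Context {R : realType} {n : nat}.
Implicit Types x y v : 'rV[R]_n.

Lemma dotvv_ge0 v : 0 <= dotv v v.
Proof. by apply: sumr_ge0 => i _; rewrite -expr2 sqr_ge0. Qed.

Lemma sqr_enorm v : enorm v ^+ 2 = dotv v v.
Proof. by rewrite sqr_sqrtr// dotvv_ge0. Qed.

Lemma enorm_ge0 v : 0 <= enorm v. Proof. exact: sqrtr_ge0. Qed.

Lemma coord_le_enorm v i : `|v ord0 i| <= enorm v.
Proof.
rewrite -sqrtr_sqr ler_wsqrtr// /dotv (bigD1 i)//= -expr2 lerDl.
by apply: sumr_ge0 => j _; rewrite -expr2 sqr_ge0.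
Qed.

Lemma enorm_le v a : 0 <= a -> (forall i, `|v ord0 i| <= a) ->
  enorm v <= Num.sqrt n%:R * a.
Proof.
move=> a0 va; rewrite -[X in _ * X](ger0_norm a0) -sqrtr_sqr -sqrtrM//.
rewrite ler_wsqrtr// /dotv mulr_natl -[in leRHS](card_ord n) -sumr_const.
apply: ler_sum => i _; rewrite -expr2 -real_normK ?num_real//.
by rewrite lerXn2r ?nnegrE.
Qed.

Lemma enorm_eq0 v : enorm v = 0 -> v = 0.
Proof.
move=> v0; apply/rowP => i; rewrite mxE; apply/eqP; rewrite -normr_le0 -v0.
exact: coord_le_enorm.
Qed.

Lemma ln_expR1D_ge1 (a : R) : 0 <= a -> 1 <= ln (expR 1 + a).
Proof.
move=> a0; rewrite -[leLHS](expRK 1) ler_ln ?posrE ?expR_gt0//.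
  by rewrite lerDl.
by rewrite ltr_wpDr// expR_gt0.
Qed.

Lemma expR1_ge1 : 1 <= expR 1 :> R.
Proof. by rewrite -expR0 ler_expR. Qed.

End enorm_theory.

Section integral_monotone.
Context {R : realType} d (T : measurableType d) (mu : {measure set T -> \bar R}).

(* unlike [ge0_le_integral], no measurability is required *)
Lemma le_nnintegral (f g : T -> \bar R) : (forall x, 0 <= f x)%E ->
  (forall x, f x <= g x)%E -> (\int[mu]_x f x <= \int[mu]_x g x)%E.
Proof.
move=> f0 fg; have g0 x : (0 <= g x)%E by exact: le_trans (fg x).
rewrite !ge0_integralTE//; apply: ge_ereal_sup => _ [h hf <-].
by apply: ereal_sup_ubound; exists h => // x; exact: le_trans (fg x).
Qed.

End integral_monotone.

(** * Powers of means over cubes for log-Hoelder exponents *)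

Section key_estimate.
Context {R : realType} {n : nat}.
Hypothesis n0 : (0 < n)%N.
Local Notation V := 'rV[R]_n.
Local Notation mu := (lebesgue_rV n : {measure set V -> \bar R}).
Implicit Types (f g r : V -> R) (x y c : V).

Definition log_local r (c1 : R) := forall x y, 0 < enorm (x - y) ->
  enorm (x - y) < 2^-1 ->
  `|r x - r y| <= c1 / ln (expR 1 + (enorm (x - y))^-1).

Definition log_decay r (c2 rinf : R) :=
  forall x, `|r x - rinf| <= c2 / ln (expR 1 + enorm x).

(** The classical consequence of local log-Hoelder continuity: |Q|^{-(r(x) - inf_Q r)} is bounded
    over all cubes Q containing x. The number [rm] replaces the infimum over Q, and the maximum with
    1 makes the quantity monotone in the exponent. *)
Lemma log_local_cube r (c1 rM : R) : 0 <= c1 -> log_local r c1 ->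
  (forall x, 1 <= r x <= rM) ->
  exists2 C : R, 1 <= C & forall c rho x, 0 < rho -> cube c rho x ->
    exists rm, [/\ 1 <= rm, rm <= r x, forall y, cube c rho y -> rm <= r y &
      Num.max 1 ((rho * 2) ^+ n)^-1 `^ (r x - rm) <= C].
Proof.
move=> c10 rl rb; pose sn : R := Num.sqrt n%:R.
have sn0 : 0 < sn by rewrite sqrtr_gt0 ltr0n.
pose L1 : R := n%:R * c1 * (ln (1 + sn) + 1).
pose L2 : R := n%:R * (rM - 1) * ln (1 + 2 * sn).
have rM1 : 0 <= rM - 1.
  by have /andP[h1 h2] := rb 0; rewrite subr_ge0 (le_trans h1).
have ls1 : 0 <= ln (1 + sn) by rewrite ln_ge0// lerDl ltW.
have ls2 : 0 <= ln (1 + 2 * sn) by rewrite ln_ge0// lerDl mulr_ge0// ltW.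
have L10 : 0 <= L1 by rewrite !mulr_ge0// addr_ge0.
have L20 : 0 <= L2 by rewrite !mulr_ge0.
exists (expR (L1 + L2)) => [|c rho x rho0 cx].
  by rewrite -expR0 ler_expR addr_ge0.
have rho2 : 0 < rho * 2 by rewrite mulr_gt0.
set X := (_ ^+ n)^-1.
have X0 : 0 < X by rewrite invr_gt0 exprn_gt0.
have XE (b : R) : 1 <= b -> (rho * 2)^-1 <= b -> ln (Num.max 1 X) <= n%:R * ln b.
  move=> b1 hb; have b0 : 0 < b by exact: lt_le_trans b1.
  rewrite mulr_natl -lnXn// ler_ln ?posrE ?lt_max ?ltr01 ?exprn_gt0//.
  rewrite ge_max exprn_ege1//= /X -exprVn lerXn2r// nnegrE ?(ltW b0)// invr_ge0.
  exact: ltW.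
have powE (z : R) : Num.max 1 X `^ z = expR (z * ln (Num.max 1 X)).
  by rewrite /powR gt_eqF// lt_max ltr01.
have lnX0 : 0 <= ln (Num.max 1 X) by rewrite ln_ge0// le_max lexx.
pose D := sn * (rho * 2).
have D0 : 0 < D by rewrite mulr_gt0.
have diam y : cube c rho y -> enorm (x - y) <= D.
  move=> cy; apply: enorm_le; first exact: ltW.
  move=> i; rewrite !mxE; move/cubeP : cx => /(_ i); move/cubeP : cy => /(_ i).
  move: (ler_distD (c ord0 i) (x ord0 i) (y ord0 i)).
  by rewrite (distrC (x ord0 i) (c ord0 i)); lra.
(* Local continuity only speaks of distances below 1/2. On a larger cube |Q|^{-1} is bounded, so
   [rm] = 1 is good enough. *)
have [Dlt|Dge] := ltP D 2^-1; last first.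
  exists 1; split => //; first by have /andP[] := rb x.
    by move=> y _; have /andP[] := rb y.
  rewrite powE ler_expR; apply: (@le_trans _ _ L2); last by rewrite lerDr.
  have h : ln (Num.max 1 X) <= n%:R * ln (1 + 2 * sn).
    apply: XE; first by rewrite lerDl mulr_ge0// ltW.
    rewrite invf_ple ?posrE//; last by rewrite ltr_wpDr// mulr_ge0// ltW.
    rewrite -(ler_pM2l sn0) -/D; apply: le_trans Dge.
    rewrite ler_pdivrMr; last by rewrite ltr_wpDr// mulr_ge0// ltW.
    by lra.
  apply: (@le_trans _ _ ((rM - 1) * ln (Num.max 1 X))).
    by apply: ler_wpM2r => //; have /andP[_ h2] := rb x; lra.
  rewrite /L2 (mulrC n%:R) -mulrA; exact: ler_wpM2l.
(* The oscillation of r on a cube of diameter at most D. Its product with log(1/|Q|), which is about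
   n log(1/D), stays bounded by [L1]. *)
pose delta := c1 / ln (expR 1 + D^-1).
have lD : 1 <= ln (expR 1 + D^-1) by rewrite ln_expR1D_ge1// invr_ge0 ltW.
have lD0 : 0 < ln (expR 1 + D^-1) by exact: lt_le_trans lD.
have del0 : 0 <= delta by rewrite divr_ge0// ltW.
have rxy y : cube c rho y -> `|r x - r y| <= delta.
  move=> cy; have [xy|xy] := eqVneq (enorm (x - y)) 0.
    have /eqP : x - y = 0 by exact: enorm_eq0.
    by rewrite subr_eq0 => /eqP ->; rewrite subrr normr0.
  have xy0 : 0 < enorm (x - y) by rewrite lt_neqAle eq_sym xy enorm_ge0.
  have dy := diam y cy.
  apply: (le_trans (rl x y xy0 (le_lt_trans dy Dlt))).
  apply: ler_wpM2l => //; rewrite lef_pV2 ?posrE//; last first.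
    by apply: (lt_le_trans ltr01); rewrite ln_expR1D_ge1// invr_ge0 ltW.
  rewrite ler_ln ?posrE ?ltr_wpDr ?expR_gt0 ?invr_ge0 ?(ltW D0) ?(ltW xy0)//.
  by rewrite lerD2l lef_pV2.
exists (Num.max 1 (r x - delta)); split.
- by rewrite le_max lexx.
- by rewrite ge_max; have /andP[-> _] := rb x; rewrite lerBlDr lerDl.
- move=> y cy; rewrite ge_max; have /andP[-> _] := rb y.
  by have := rxy y cy; rewrite ler_norml => /andP[]; lra.
rewrite powE ler_expR; apply: (@le_trans _ _ L1); last by rewrite lerDl.
apply: (@le_trans _ _ (delta * ln (Num.max 1 X))).
  apply: ler_wpM2r => //; have : r x - delta <= Num.max 1 (r x - delta).
    by rewrite le_max lexx orbT.
  lra.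
have h : ln (Num.max 1 X) <= n%:R * (ln (1 + sn) + ln (expR 1 + D^-1)).
  have p1 : 0 < 1 + sn by rewrite addr_gt0.
  have p2 : 0 < expR 1 + D^-1 by rewrite addr_gt0 ?expR_gt0// invr_gt0.
  rewrite -lnM ?posrE//; apply: XE.
    rewrite -[leLHS]mul1r ler_pM// ?lerDl ?(ltW sn0)//.
    by apply: (le_trans expR1_ge1); rewrite lerDl invr_ge0 ltW.
  have -> : (rho * 2)^-1 = sn * D^-1.
    by rewrite /D; field; rewrite (gt_eqF sn0) (gt_eqF rho0).
  by apply: ler_pM; rewrite ?(ltW sn0) ?invr_ge0 ?(ltW D0)// ?lerDr// expR_ge0.
apply: (le_trans (ler_wpM2l del0 h)).
rewrite mulrCA /L1 -mulrA ler_wpM2l//.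
rewrite mulrDr {2}/delta divfK ?gt_eqF// mulrDr mulr1 lerD2r ler_wpM2r//.
by rewrite ler_pdivrMr// ler_peMr.
Qed.

(** The logarithm here is the one of [log_decay]: powers of the weight with exponent -c / log(e +
    |y|) are therefore bounded. *)
Lemma weight_decay (y : V) : - ln (weight y) <= n%:R * 2 * ln (expR 1 + enorm y).
Proof.
have e0 : 0 < expR 1 + enorm y by rewrite ltr_wpDr ?enorm_ge0 ?expR_gt0.
rewrite -lnV ?posrE ?weight_gt0// -natrM mulr_natl -lnXn//.
rewrite ler_ln ?posrE ?invr_gt0 ?weight_gt0 ?exprn_gt0//.
rewrite /weight -prodfV exprM exprAC.
set E := expR 1 + enorm y in e0 *; rewrite -[X in _ <= _ ^+ X](card_ord n) -prodr_const.
apply: ler_prod => i _; rewrite invrK addr_ge0 ?sqr_ge0//=.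
rewrite /E in e0 *; have h := coord_le_enorm y i; rewrite -(real_normK (num_real (y ord0 i))).
have e1 := @expR1_ge1 R; have nn := normr_ge0 (y ord0 i).
move: (expR 1) e1 e0 h nn => e; move: `|y ord0 i| (enorm y) => a b e1 _ ab a0.
by rewrite !expr2; nra.
Qed.

(** If t is below the weight, then t^a <= t is already small enough. Otherwise t^{a-b} is at most
    the weight to the power -|a-b|, which [weight_decay] bounds by K. As r >= 1, replacing rinf by
    its maximum with 1 does not move it away from r, and it keeps the exponent in the range of
    Jensen's inequality. *)
Lemma decay_compare r (c2 rinf rM : R) : 0 <= c2 -> log_decay r c2 rinf ->
  (forall x, 1 <= r x <= rM) ->
  exists2 K : R, 1 <= K & forall z (t : R), 0 <= t <= 1 ->
    t `^ r z <= K * t `^ (Num.max rinf 1) + weight z /\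
    t `^ (Num.max rinf 1) <= K * t `^ r z + weight z.
Proof.
move=> c20 rd rb; exists (expR (n%:R * 2 * c2)) => [|z t /andP[t0 t1]].
  by rewrite -expR0 ler_expR !mulr_ge0.
set K := expR _; set ro := Num.max rinf 1.
have lz : 1 <= ln (expR 1 + enorm z) by rewrite ln_expR1D_ge1 ?enorm_ge0.
have lz0 : 0 < ln (expR 1 + enorm z) by exact: lt_le_trans lz.
pose de := c2 / ln (expR 1 + enorm z).
have de0 : 0 <= de by rewrite divr_ge0// ltW.
have hde : `|r z - ro| <= de.
  have := rd z; rewrite -/de !ler_norml /ro; have /andP[r1 _] := rb z.
  by case: (leP rinf 1) => ? /andP[? ?]; apply/andP; split; lra.
have w0 := weight_gt0 z; have w1 := weight_le1 z.
have gen a b : 1 <= a -> `|a - b| <= de -> t `^ a <= K * t `^ b + weight z.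
  move=> a1 ab; have [<-|tn0] := eqVneq 0 t.
    rewrite powR0; last by rewrite gt_eqF// (lt_le_trans ltr01).
    by rewrite addr_ge0 ?(ltW w0)// mulr_ge0 ?expR_ge0// powR_ge0.
  have tp : 0 < t by rewrite lt_neqAle tn0.
  have [tw|wt] := ltP t (weight z).
    apply: (@le_trans _ _ (weight z)); last by rewrite lerDr mulr_ge0 ?expR_ge0 ?powR_ge0.
    apply: le_trans (ltW tw); rewrite -[leRHS]powRr1// ger_powR ?tp//.
  apply: (@le_trans _ _ (K * t `^ b)); last by rewrite lerDl ltW.
  have -> : a = (a - b) + b by rewrite subrK.
  rewrite powRD; last by rewrite (gt_eqF tp) implybT.
  apply: ler_wpM2r; first exact: powR_ge0.
  apply: (@le_trans _ _ (t `^ (- de))).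
    by rewrite ger_powR ?tp//; move: ab; rewrite ler_norml => /andP[].
  rewrite /powR (gt_eqF tp) ler_expR mulNr -mulrN.
  have lt1 : - ln t <= - ln (weight z) by rewrite lerN2 ler_ln ?posrE.
  apply: (le_trans (ler_wpM2l de0 lt1)).
  apply: (le_trans (ler_wpM2l de0 (weight_decay z))).
  by rewrite mulrCA /de divfK ?gt_eqF.
split; first by apply: gen => //; have /andP[] := rb z.
by apply: gen; [rewrite le_max lexx orbT|rewrite distrC].
Qed.

Lemma cube_meanD f g c (rho : R) : 0 < rho ->
  measurable_fun setT f -> measurable_fun setT g ->
  (forall x, 0 <= f x) -> (forall x, 0 <= g x) ->
  cube_mean (fun x => f x + g x)%R c rho = (cube_mean f c rho + cube_mean g c rho)%E.
Proof.
move=> rho0 mf mg f0 g0; rewrite /cube_mean -ge0_muleDr; first last.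
- by apply: integral_ge0 => x _; rewrite lee_fin.
- by apply: integral_ge0 => x _; rewrite lee_fin.
congr (_ * _)%E; rewrite -ge0_integralD//.
- exact: measurable_cube.
- by move=> x _; rewrite lee_fin.
- by apply/measurable_EFinP; exact: measurable_funTS.
- by move=> x _; rewrite lee_fin.
- by apply/measurable_EFinP; exact: measurable_funTS.
Qed.

Lemma cube_meanZl f c (k rho : R) : 0 <= k -> 0 < rho ->
  measurable_fun setT f -> (forall x, 0 <= f x) ->
  cube_mean (fun x => k * f x)%R c rho = (k%:E * cube_mean f c rho)%E.
Proof.
move=> k0 rho0 mf f0; rewrite /cube_mean muleCA; congr (_ * _)%E.
rewrite -ge0_integralZl_EFin//.
- exact: measurable_cube.
- by move=> x _; rewrite lee_fin.
- by apply/measurable_EFinP; exact: measurable_funTS.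
Qed.

Lemma le_cube_mean f g c (rho : R) : 0 < rho ->
  measurable_fun setT f -> measurable_fun setT g -> (forall x, 0 <= f x) ->
  (forall x, cube c rho x -> f x <= g x) ->
  (cube_mean f c rho <= cube_mean g c rho)%E.
Proof.
move=> rho0 mf mg f0 fg; apply: lee_wpmul2l.
  by rewrite lee_fin invr_ge0 exprn_ge0// mulr_ge0// ltW.
apply: ge0_le_integral => //.
- exact: measurable_cube.
- by move=> x _; rewrite lee_fin.
- by apply/measurable_EFinP; exact: measurable_funTS.
- by apply/measurable_EFinP; exact: measurable_funTS.
Qed.

Lemma cube_mean1 c (rho : R) : 0 < rho -> cube_mean (fun=> 1) c rho = 1%E.
Proof.
move=> rho0; rewrite /cube_mean integral_cst; last exact: measurable_cube.
rewrite [X in (_ * (_ * X))%E](lebesgue_cube _ (ltW rho0)) mul1e -EFinM.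
by rewrite mulVf// gt_eqF// exprn_gt0// mulr_gt0.
Qed.

Lemma cube_mean_powR f c (rho s : R) : 0 < rho -> 1 <= s ->
  measurable_fun setT f -> (forall x, 0 <= f x) ->
  (cube_mean f c rho `^ s <= cube_mean (fun x => f x `^ s)%R c rho)%E.
Proof.
move=> rho0 s1 mf f0; rewrite /cube_mean.
have v0 : 0 < (rho * 2) ^+ n by rewrite exprn_gt0// mulr_gt0.
rewrite poweRM; last 2 first.
- by rewrite lee_fin invr_ge0 ltW.
- by apply: integral_ge0 => x _; rewrite lee_fin.
set v := (rho * 2) ^+ n in v0 *.
have h : (mu (cube c rho) <= v%:E)%E by rewrite [leLHS](lebesgue_cube _ (ltW rho0)).
have mf' : measurable_fun (cube c rho) f by exact: measurable_funTS.
have := jensen_powR (measurable_cube c rho) h v0 s1 mf' f0.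
have e : v^-1 = v^-1 `^ s * v `^ (s - 1).
  rewrite powRB ?powRr1 ?(ltW v0)//; last by rewrite (gt_eqF v0) implybT.
  rewrite mulrA -powRM ?invr_ge0 ?(ltW v0)// mulVf ?gt_eqF// powR1 mul1r.
  by [].
move=> J; rewrite [X in (_ <= X%:E * _)%E]e EFinM -muleA.
by rewrite poweR_EFin; apply: lee_wpmul2l => //; rewrite lee_fin powR_ge0.
Qed.

Definition powf f r : V -> R := fun y => f y `^ r y.

Lemma powf_ge0 f r y : 0 <= powf f r y. Proof. exact: powR_ge0. Qed.

Lemma measurable_powf f r : measurable_fun setT f -> measurable_fun setT r ->
  measurable_fun setT (powf f r).
Proof.
move=> mf mr; rewrite /powf.
rewrite (_ : (fun x => _) = (fun x => if f x == 0 then (r x == 0)%:R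
    else expR (r x * ln (f x)))); last by apply/funext => x; rewrite /powR.
have m0 : measurable_fun setT (fun x => f x == 0).
  by apply: measurable_fun_eqr => //; exact: measurable_cst.
have m1 : measurable_fun setT (fun x => r x == 0).
  by apply: measurable_fun_eqr => //; exact: measurable_cst.
apply: measurable_fun_ifT => //.
  rewrite (_ : (fun x => _) = (fun x => if r x == 0 then 1 else 0 : R)).
    by apply: measurable_fun_ifT => //; exact: measurable_cst.
  by apply/funext => x; case: (r x == 0).
apply: measurableT_comp => //; apply: measurable_funM => //.
by apply: measurableT_comp => //; exact: measurable_ln.
Qed.

(** The truncated function is 0 or larger than 1, so lowering the exponent to [rm] decreases its
    powers, and Jensen's inequality gives a^rm <= b for the two means. Then a^{r(x)} <= b
    b^{(r(x)-rm)/rm}; the normalization gives b <= |Q|^{-1}, and [log_local_cube] bounds the second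
    factor. *)
Lemma mean_above r (c1 rM : R) : 0 <= c1 -> log_local r c1 ->
  (forall x, 1 <= r x <= rM) -> measurable_fun setT r ->
  exists2 C : R, 1 <= C & forall f, measurable_fun setT f -> (forall x, 0 <= f x) ->
    (\int[mu]_x (powf (above f 1) r x)%:E <= 1)%E ->
    forall c (rho : R) x, 0 < rho -> cube c rho x ->
    (cube_mean (above f 1) c rho `^ r x <=
     C%:E * cube_mean (powf (above f 1) r) c rho)%E.
Proof.
move=> c10 rl rb mr; have [C C1 CP] := log_local_cube c10 rl rb.
exists C => // f mf f0 If c rho x rho0 cx.
have [rm [rm1 rmx rmQ Crm]] := CP _ _ _ rho0 cx.
set g := above f 1; have mg : measurable_fun setT g by exact: measurable_above.
have g0 y : 0 <= g y by exact: above_ge0.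
have v0 : 0 < (rho * 2) ^+ n by rewrite exprn_gt0// mulr_gt0.
have mgr : measurable_fun setT (powf g r) by exact: measurable_powf.
have A1 : (cube_mean g c rho `^ rm <= cube_mean (powf g r) c rho)%E.
  apply: (le_trans (cube_mean_powR c rho0 rm1 mg g0)).
  apply: le_cube_mean => //.
  - exact: (measurableT_comp (measurable_powR rm)).
  - by move=> y; exact: powR_ge0.
  - move=> y cy; rewrite /powf /g aboveE; case: ltP => fy.
      by rewrite mulr1 ler_powR ?(ltW fy)// rmQ.
    by rewrite mulr0 !powR0// gt_eqF// (lt_le_trans ltr01)//; have /andP[] := rb y.
have B1 : (cube_mean (powf g r) c rho <= ((rho * 2) ^+ n)^-1%:E)%E.
  rewrite -[leRHS]mule1; apply: lee_wpmul2l; first by rewrite lee_fin invr_ge0 ltW.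
  apply: le_trans If; apply: ge0_subset_integral => //.
  - exact: measurable_cube.
  - exact/measurable_EFinP.
  - by move=> y _; rewrite lee_fin powR_ge0.
have B0 : (0 <= cube_mean (powf g r) c rho)%E.
  by apply: cube_mean_ge0 => [|y]; [exact: ltW|exact: powR_ge0].
have A0 : (0 <= cube_mean g c rho)%E by apply: cube_mean_ge0 => //; exact: ltW.
have Bf : cube_mean (powf g r) c rho \is a fin_num.
  by rewrite ge0_fin_numE// (le_lt_trans B1)// ltry.
have rm0 : 0 < rm by exact: lt_le_trans rm1.
have Af : cube_mean g c rho \is a fin_num.
  rewrite ge0_fin_numE//; apply: (@lty_poweRy _ _ rm); first by rewrite gt_eqF.
  by rewrite (le_lt_trans A1)// (le_lt_trans B1)// ltry.
move: A1 B1 A0 B0; rewrite -(fineK Af) -(fineK Bf) !poweR_EFin -EFinM !lee_fin.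
move: (fine (cube_mean g c rho)) (fine (cube_mean (powf g r) c rho)) => a b ab bX a0 b0.
have [b00|bn0] := eqVneq b 0.
  have : a `^ rm = 0 by apply/eqP; rewrite eq_le powR_ge0 andbT -b00.
  move=> /powR_eq0_eq0 ->; rewrite powR0 ?mulr_ge0 ?(le_trans ler01 C1)//.
  by rewrite gt_eqF// (lt_le_trans rm0).
have bp : 0 < b by rewrite lt_neqAle eq_sym bn0.
apply: (@le_trans _ _ (b `^ (r x / rm))).
  apply: (@le_trans _ _ ((a `^ rm) `^ (r x / rm))).
    by rewrite -powRrM mulrCA mulfV ?mulr1// gt_eqF.
  apply: ge0_ler_powR; rewrite ?nnegrE ?powR_ge0//.
  by rewrite divr_ge0 ?(ltW rm0)// (le_trans (ltW rm0)).
have -> : r x / rm = 1 + (r x - rm) / rm by rewrite mulrBl mulfV ?gt_eqF// addrC subrK.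
rewrite powRD; last by rewrite bn0 implybT.
rewrite powRr1// mulrC; apply: ler_wpM2r => //.
apply: le_trans Crm.
set X := ((rho * 2) ^+ n)^-1 in bX *.
apply: (@le_trans _ _ (Num.max 1 X `^ ((r x - rm) / rm))).
  apply: ge0_ler_powR; rewrite ?nnegrE ?le_max ?ler01 ?bX ?orbT//.
  by rewrite divr_ge0 ?(ltW rm0)// subr_ge0.
rewrite ler_powR ?le_max ?lexx// ler_pdivrMr//.
by rewrite ler_peMr// subr_ge0.
Qed.

Definition below f : V -> R := fun y => f y - above f 1 y.

Lemma belowE f y : below f y = f y * (f y <= 1)%R%:R.
Proof. by rewrite /below aboveE; case: ltP => _; rewrite ?mulr1 ?mulr0 ?subrr ?subr0. Qed.

Lemma below_itv f y : (forall x, 0 <= f x) -> 0 <= below f y <= 1.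
Proof.
move=> f0; rewrite belowE; case: (leP (f y) 1) => h.
  by rewrite mulr1 f0.
by rewrite mulr0 lexx ler01.
Qed.

Lemma measurable_below f : measurable_fun setT f -> measurable_fun setT (below f).
Proof. by move=> mf; apply: measurable_funB => //; exact: measurable_above. Qed.

(* The weight absorbs the error made when [r] is replaced by its limit at infinity. *)
Definition reg f r : V -> R := fun y => powf f r y + weight y.

Lemma reg_ge0 f r y : 0 <= reg f r y.
Proof. by rewrite addr_ge0 ?powf_ge0// ltW// weight_gt0. Qed.

Lemma measurable_reg f r : measurable_fun setT f -> measurable_fun setT r ->
  measurable_fun setT (reg f r).
Proof.
move=> mf mr; apply: measurable_funD; first exact: measurable_powf.
exact: measurable_weight.
Qed.

(** For values in [0, 1] every exponent may be exchanged for the limit exponent at the price of the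
    weight. This is done once at y under the mean and, after Jensen's inequality with a constant
    exponent, once more at x. *)
Lemma mean_below r (c2 rinf rM : R) : 0 <= c2 -> log_decay r c2 rinf ->
  (forall x, 1 <= r x <= rM) -> measurable_fun setT r ->
  exists2 C : R, 1 <= C & forall f, measurable_fun setT f -> (forall x, 0 <= f x) ->
    forall c (rho : R) x, 0 < rho -> cube c rho x ->
    (cube_mean (below f) c rho `^ r x <=
     C%:E * (cube_mean (reg f r) c rho + (weight x)%:E))%E.
Proof.
move=> c20 rd rb mr; have [K K1 KP] := decay_compare c20 rd rb.
set ro := Num.max rinf 1 in KP.
have ro1 : 1 <= ro by rewrite le_max lexx orbT.
have K0 : 0 <= K by exact: le_trans K1.
exists (K * K + 1) => [|f mf f0 c rho x rho0 cx].
  by rewrite lerDr mulr_ge0.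
have mb := measurable_below mf.
have b0 y : 0 <= below f y by have /andP[] := below_itv y f0.
have mg := measurable_reg mf mr.
have g0 y := reg_ge0 f r y.
have A0 : (0 <= cube_mean (below f) c rho)%E by apply: cube_mean_ge0 => //; exact: ltW.
have A1 : (cube_mean (below f) c rho <= 1)%E.
  rewrite -(cube_mean1 c rho0); apply: le_cube_mean => //.
  by move=> y _; have /andP[] := below_itv y f0.
have Af : cube_mean (below f) c rho \is a fin_num.
  by rewrite ge0_fin_numE// (le_lt_trans A1)// ltry.
have : (cube_mean (below f) c rho `^ ro <= K%:E * cube_mean (reg f r) c rho)%E.
  apply: (le_trans (cube_mean_powR c rho0 ro1 mb b0)).
  rewrite -cube_meanZl//; apply: le_cube_mean => //.
  - exact: (measurableT_comp (measurable_powR ro)).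
  - exact: measurable_funM.
  - by move=> y; exact: powR_ge0.
  - move=> y _; have [_ h] := KP y _ (below_itv y f0).
    apply: (le_trans h); rewrite /reg mulrDr; apply: lerD; last first.
      by rewrite ler_peMl// ltW// weight_gt0.
    apply: ler_wpM2l => //; apply: ge0_ler_powR; rewrite ?nnegrE//.
      by have /andP[h1 _] := rb y; rewrite (le_trans ler01).
    by rewrite /below gerBl above_ge0.
have G0 : (0 <= cube_mean (reg f r) c rho)%E by apply: cube_mean_ge0 => //; exact: ltW.
move: A0 A1; rewrite -(fineK Af) !poweR_EFin !lee_fin.
move: (fine (cube_mean (below f) c rho)) => a a0 a1.
have a01 : 0 <= a <= 1 by rewrite a0.
have [h _] := KP x a a01.
move=> aro; have w0 := ltW (weight_gt0 x).
apply: (@le_trans _ _ (K * a `^ ro + weight x)%:E); first by rewrite lee_fin.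
rewrite ge0_muleDr ?lee_fin// EFinD; apply: leeD; last first.
  by rewrite -EFinM lee_fin ler_peMl// lerDr mulr_ge0.
rewrite EFinM; apply: (@le_trans _ _ ((K * K)%:E * cube_mean (reg f r) c rho)%E).
  by rewrite [in leRHS]EFinM -muleA; apply: lee_wpmul2l.
by apply: lee_wpmul2r => //; rewrite lee_fin lerDl.
Qed.

Lemma powRD_le (a b e eM : R) : 0 <= a -> 0 <= b -> 0 <= e <= eM ->
  (a + b) `^ e <= 2 `^ eM * (a `^ e + b `^ e).
Proof.
move=> a0 b0 /andP[e0 eeM].
apply: (@le_trans _ _ ((2 * Num.max a b) `^ e)).
  apply: ge0_ler_powR; rewrite ?nnegrE ?addr_ge0 ?mulr_ge0 ?le_max ?a0//.
  have : a <= Num.max a b by rewrite le_max lexx.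
  have : b <= Num.max a b by rewrite le_max lexx orbT.
  lra.
rewrite powRM ?le_max ?a0//; apply: ler_pM; rewrite ?powR_ge0//.
  by rewrite ler_powR// ler1n.
by case: (leP a b) => _; rewrite ?lerDr ?lerDl powR_ge0.
Qed.

Lemma mean_powf r (c1 c2 rinf rM : R) : 0 <= c1 -> 0 <= c2 ->
  log_local r c1 -> log_decay r c2 rinf ->
  (forall x, 1 <= r x <= rM) -> measurable_fun setT r ->
  exists2 C : R, 0 <= C & forall f, measurable_fun setT f -> (forall x, 0 <= f x) ->
    (\int[mu]_x (powf (above f 1) r x)%:E <= 1)%E ->
    forall c (rho : R) x, 0 < rho -> cube c rho x ->
    (cube_mean f c rho `^ r x <=
     C%:E * (cube_mean (reg f r) c rho + (weight x)%:E))%E.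
Proof.
move=> c10 c20 rl rd rb mr.
have [C1 C11 C1P] := mean_above c10 rl rb mr.
have [C2 C21 C2P] := mean_below c20 rd rb mr.
have C10 : 0 <= C1 by exact: le_trans C11.
have C20 : 0 <= C2 by exact: le_trans C21.
exists (2 `^ rM * (C1 + C2)) => [|f mf f0 If c rho x rho0 cx].
  by rewrite mulr_ge0 ?powR_ge0// addr_ge0.
have h1 := C1P f mf f0 If c rho x rho0 cx.
have h2 := C2P f mf f0 c rho x rho0 cx.
have mg := measurable_reg mf mr.
have g0 y := reg_ge0 f r y.
have w0 := ltW (weight_gt0 x).
have G0 : (0 <= cube_mean (reg f r) c rho)%E by apply: cube_mean_ge0 => //; exact: ltW.
have {}h1 : (cube_mean (above f 1) c rho `^ r x <=
     C1%:E * (cube_mean (reg f r) c rho + (weight x)%:E))%E.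
  apply: (le_trans h1); apply: lee_wpmul2l; first by rewrite lee_fin.
  apply: (@le_trans _ _ (cube_mean (reg f r) c rho)); last by rewrite leeDl// lee_fin.
  apply: le_cube_mean => //.
  - by apply: measurable_powf => //; exact: measurable_above.
  - by move=> y; exact: powf_ge0.
  - move=> y _; apply: (@le_trans _ _ (powf f r y)).
      apply: ge0_ler_powR; rewrite ?nnegrE ?above_ge0//.
        by have /andP[h _] := rb y; rewrite (le_trans ler01).
      by rewrite aboveE; case: ltP; rewrite ?mulr1 ?mulr0.
    by rewrite lerDl ltW// weight_gt0.
have -> : cube_mean f c rho = (cube_mean (above f 1) c rho + cube_mean (below f) c rho)%E.
  rewrite -cube_meanD//.
  - by congr cube_mean; apply/funext => y; rewrite /below addrC subrK.
  - exact: measurable_above.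
  - exact: measurable_below.
  - by move=> y; exact: above_ge0.
  - by move=> y; have /andP[] := below_itv y f0.
have A0 : (0 <= cube_mean (above f 1) c rho)%E.
  by apply: cube_mean_ge0 => [|y]; [exact: ltW|exact: above_ge0].
have B0 : (0 <= cube_mean (below f) c rho)%E.
  apply: cube_mean_ge0 => [|y]; first exact: ltW.
  by have /andP[] := below_itv y f0.
set G := (cube_mean (reg f r) c rho + _)%E in h1 h2 *.
have GG0 : (0 <= G)%E by rewrite adde_ge0.
have /andP[r1 rM1] := rb x; have r0 : 0 < r x by exact: lt_le_trans r1.
have K0 : 0 < 2 `^ rM * (C1 + C2).
  rewrite mulr_gt0 ?powR_gt0//; lra.
have [Goo|Gn] := eqVneq G +oo%E; first by rewrite Goo gt0_muley ?leey// lte_fin.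
have Gf : G \is a fin_num by rewrite ge0_fin_numE// lt_neqAle Gn leey.
have fin (z : \bar R) (k : R) : (0 <= z)%E -> (z `^ r x <= k%:E * G)%E -> z \is a fin_num.
  move=> z0 zk; rewrite ge0_fin_numE//; apply: (@lty_poweRy _ _ (r x)); first by rewrite gt_eqF.
  by rewrite (le_lt_trans zk)// -(fineK Gf) -EFinM ltry.
have Af := fin _ _ A0 h1; have Bf := fin _ _ B0 h2.
move: h1 h2 A0 B0; rewrite -(fineK Gf) -(fineK Af) -(fineK Bf).
move: (fine (cube_mean (above f 1) c rho)) (fine (cube_mean (below f) c rho)) => a b.
move: (fine G) => g; rewrite -EFinD !poweR_EFin -!EFinM !lee_fin => h1 h2 A0 B0.
have rr : 0 <= r x <= rM by rewrite ltW.
apply: (le_trans (powRD_le A0 B0 rr)).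
rewrite -mulrA; apply: ler_wpM2l; first exact: powR_ge0.
by rewrite mulrDl lerD.
Qed.

(* The exponent [q] is split as [qm * r] with [r >= 1]: the key estimate bounds
   [(HLmax f) `^ r] by a maximal function, to which the constant-exponent
   theorem in [L^qm] applies. *)
Lemma HLmax_variable (q : V -> R) (c1 c2 qinf qm qM : R) :
  0 <= c1 -> 0 <= c2 -> log_local q c1 -> log_decay q c2 qinf ->
  1 < qm -> (forall x, qm <= q x <= qM) -> measurable_fun setT q ->
  exists2 C : R, 0 <= C & forall f, measurable_fun setT f -> (forall x, 0 <= f x) ->
    (\int[mu]_x (powf f q x)%:E <= 1)%E ->
    (\int[mu]_x (HLmax f x `^ q x) <= C%:E)%E.
Proof.
move=> c10 c20 ql qd qm1 qb mq; have qm0 : 0 < qm by exact: lt_trans qm1.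
pose r x := q x / qm.
have rl : log_local r (c1 / qm).
  move=> x y xy0 xy1; rewrite /r -mulrBl normrM (ger0_norm (x := qm^-1)) ?invr_ge0 ?(ltW qm0)//.
  by rewrite mulrAC; apply: ler_wpM2r; [rewrite invr_ge0 ltW|exact: ql].
have rd : log_decay r (c2 / qm) (qinf / qm).
  move=> x; rewrite /r -mulrBl normrM (ger0_norm (x := qm^-1)) ?invr_ge0 ?(ltW qm0)//.
  by rewrite mulrAC; apply: ler_wpM2r; [rewrite invr_ge0 ltW|exact: qd].
have rb x : 1 <= r x <= qM / qm.
  by have /andP[h1 h2] := qb x; rewrite /r ler_pdivlMr// mul1r h1 ler_pM2r ?invr_gt0.
have mr : measurable_fun setT r by exact: measurable_funM.
have [C1 C10 C1P] := mean_powf (divr_ge0 c10 (ltW qm0)) (divr_ge0 c20 (ltW qm0)) rl rd rb mr.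
have [C2 C20 C2P] := @strong_type R n qm qm1.
have W := @integral_weight_lty R n.
set w := (\int[mu]_y (weight y)%:E)%E in W.
have w0 : (0 <= w)%E by apply: integral_ge0 => y _; rewrite lee_fin ltW// weight_gt0.
have wf : w \is a fin_num by rewrite ge0_fin_numE.
pose P : R := 2 `^ qm.
have P0 : 0 <= P by exact: powR_ge0.
have fw0 : 0 <= fine w by exact: fine_ge0.
exists (C1 `^ qm * P * (C2 * P * (1 + fine w) + fine w)) => [|f mf f0 If].
  by rewrite !mulr_ge0 ?powR_ge0// addr_ge0// !mulr_ge0// addr_ge0.
have mg := measurable_reg mf mr.
have g0 y := reg_ge0 f r y.
(* The function is 0 or larger than 1 and r = q / qm <= q, so the normalization for q implies the
   one for r. *)
have If1 : (\int[mu]_x (powf (above f 1) r x)%:E <= 1)%E.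
  apply: le_trans If; apply: le_nnintegral => x.
    by rewrite lee_fin powf_ge0.
  rewrite lee_fin /powf aboveE; have /andP[r1 _] := rb x.
  case: ltP => fx; last by rewrite mulr0 powR0 ?powR_ge0// gt_eqF// (lt_le_trans ltr01).
  rewrite mulr1 ler_powR ?(ltW fx)// /r ler_pdivrMr// ler_peMr ?(ltW qm1)//.
  by have /andP[h _] := qb x; rewrite (le_trans _ h)// ltW.
have pt x : (HLmax f x `^ q x <= (C1 `^ qm * P)%:E * (HLmax (reg f r) x `^ qm + (weight x)%:E))%E.
  have M0 : (0 <= HLmax (reg f r) x)%E by exact: HLmax_ge0.
  have wx0 := ltW (weight_gt0 x).
  have r0 : 0 < r x by have /andP[h _] := rb x; exact: lt_le_trans h.
  have B0 : (0 <= C1%:E * (HLmax (reg f r) x + (weight x)%:E))%E by rewrite mule_ge0 ?adde_ge0.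
  have h1 : (HLmax f x `^ r x <= C1%:E * (HLmax (reg f r) x + (weight x)%:E))%E.
    set B := (C1%:E * _)%E in B0 *.
    have : (HLmax f x <= B `^ (r x)^-1)%E.
      apply: ge_ereal_sup => _ [k [k0 kx] <-].
      have := C1P f mf f0 If1 _ _ _ k0 kx; rewrite -/(qmean f k) => h.
      have qk0 : (0 <= qmean f k)%E by apply: cube_mean_ge0 => //; exact: ltW.
      have -> : qmean f k = ((qmean f k `^ r x) `^ (r x)^-1)%E.
        by rewrite -poweRrM mulfV ?gt_eqF// poweRe1.
      apply: gt0_ler_poweR; rewrite ?invr_ge0 ?(ltW r0) ?in_itv/= ?poweR_ge0 ?leey ?B0//.
      apply: (le_trans h); apply: lee_wpmul2l; first by rewrite lee_fin.
      by apply: leeD => //; apply: ereal_sup_ubound; exists k.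
    move=> /(gt0_ler_poweR (ltW r0)) h.
    have -> : B = ((B `^ (r x)^-1) `^ r x)%E.
      by rewrite -poweRrM mulVf ?gt_eqF// poweRe1.
    by apply: h; rewrite in_itv/= leey ?HLmax_ge0 ?poweR_ge0.
  have -> : q x = r x * qm by rewrite /r divfK// gt_eqF.
  rewrite poweRrM; apply: (@le_trans _ _ ((C1%:E * (HLmax (reg f r) x + (weight x)%:E)) `^ qm)%E).
    by apply: gt0_ler_poweR; rewrite ?(ltW qm0) ?in_itv/= ?poweR_ge0 ?leey ?B0.
  rewrite poweRM ?adde_ge0// poweR_EFin EFinM -muleA.
  apply: lee_wpmul2l; first by rewrite lee_fin powR_ge0.
  have [->|Mn] := eqVneq (HLmax (reg f r) x) +oo%E.
    rewrite !addye// poweRyr ?gt_eqF// addye// gt0_muley// lte_fin.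
    by rewrite powR_gt0.
  have Mf : HLmax (reg f r) x \is a fin_num by rewrite ge0_fin_numE// lt_neqAle Mn leey.
  move: M0; rewrite -(fineK Mf) -EFinD !poweR_EFin -EFinD -EFinM !lee_fin => M0.
  have qq : 0 <= qm <= qm by rewrite lexx ltW.
  apply: (le_trans (powRD_le M0 wx0 qq)); apply: ler_wpM2l => //; rewrite lerD2l.
  rewrite -[leRHS]powRr1// ger_powR ?weight_gt0 ?weight_le1//; exact: ltW.
have mM : measurable_fun setT (fun x => HLmax (reg f r) x `^ qm)%E.
  by apply: (measurableT_comp (measurable_poweR qm)); exact: measurable_HLmax.
have mw : measurable_fun setT (fun x : V => (weight x)%:E).
  by apply/measurable_EFinP; exact: measurable_weight.
apply: (@le_trans _ _ (\int[mu]_x ((C1 `^ qm * P)%:E * (HLmax (reg f r) x `^ qm + (weight x)%:E)))%E).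
  by apply: le_nnintegral => // x; exact: poweR_ge0.
rewrite ge0_integralZl_EFin//; first last.
- by rewrite mulr_ge0 ?powR_ge0.
- exact: emeasurable_funD.
- by move=> x _; rewrite adde_ge0 ?poweR_ge0// lee_fin ltW// weight_gt0.
rewrite [in leRHS]EFinM; apply: lee_wpmul2l; first by rewrite lee_fin mulr_ge0 ?powR_ge0.
rewrite ge0_integralD//; first last.
- by move=> x _; rewrite lee_fin ltW// weight_gt0.
- by move=> x _; exact: poweR_ge0.
rewrite EFinD fineK//; apply: leeD => //.
apply: (le_trans (C2P _ mg g0)).
rewrite -mulrA EFinM; apply: lee_wpmul2l => //.
apply: (@le_trans _ _ (\int[mu]_x (P%:E * ((powf f q x)%:E + (weight x)%:E)))%E).
  apply: le_nnintegral => x; first by rewrite lee_fin powR_ge0.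
  rewrite -EFinD -EFinM lee_fin /reg.
  have qq : 0 <= qm <= qm by rewrite lexx ltW.
  have wx0 := ltW (weight_gt0 x).
  apply: (le_trans (powRD_le (powf_ge0 f r x) wx0 qq)); apply: ler_wpM2l => //.
  apply: lerD; first by rewrite /powf -powRrM /r divfK ?gt_eqF.
  rewrite -[leRHS]powRr1// ger_powR ?weight_gt0 ?weight_le1//; exact: ltW.
have mfq : measurable_fun setT (fun x => (powf f q x)%:E).
  by apply/measurable_EFinP; exact: measurable_powf.
rewrite ge0_integralZl_EFin//; first last.
- exact: emeasurable_funD.
- by move=> x _; rewrite -EFinD lee_fin addr_ge0 ?powf_ge0// ltW// weight_gt0.
rewrite EFinM; apply: lee_wpmul2l => //.
rewrite ge0_integralD//; first last.
- by move=> x _; rewrite lee_fin ltW// weight_gt0.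
- by move=> x _; rewrite lee_fin powf_ge0.
by rewrite EFinD (fineK wf) leeD2r.
Qed.

End key_estimate.

(** * Gaussians and parameter-dependent integrals *)

Section calculus.
Context {R : realType}.
Local Notation leb := (@lebesgue_measure R).

Lemma is_derive_integral d (Y : measurableType d) (mu : {measure set Y -> \bar R})
    (f f' : R -> Y -> R) (G : Y -> R) (u v a : R) : u < a < v ->
  (forall x, u < x < v -> mu.-integrable setT (EFin \o f x)) ->
  (forall x y, u < x < v -> is_derive x 1 (f ^~ y) (f' x y)) ->
  mu.-integrable setT (EFin \o G) ->
  (forall x y, u < x < v -> `|f' x y| <= G y) ->
  is_derive a 1 (fun x => \int[mu]_y f x y) (\int[mu]_y f' a y).
Proof.
move=> auv fi fd Gi fG.
have Ia : `]u, v[%classic a by rewrite /= in_itv.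
have Iuv x : `]u, v[%classic x -> u < x < v by rewrite /= in_itv.
have fd' x y : `]u, v[%classic x -> setT y -> derivable (f ^~ y) x 1.
  by move=> /Iuv xuv _; have := fd x y xuv => -[].
have d1 x y : `]u, v[%classic x -> partial1of2 f x y = f' x y.
  by move=> /Iuv xuv; rewrite partial1of2E; have := fd x y xuv => -[].
have G0 y : 0 <= G y by rewrite (le_trans _ (fG a y auv)).
have fG' x y : `]u, v[%classic x -> setT y -> `|partial1of2 f x y| <= G y.
  by move=> xuv _; rewrite d1//; exact/fG/Iuv.
have fi' x : `]u, v[%classic x -> mu.-integrable setT (EFin \o f x).
  by move=> /Iuv; exact: fi.
have D := derivable_under_integral measurableT Ia fi' fd' G0 Gi fG'.
apply: DeriveDef => //.
rewrite -derive1E (differentiation_under_integral measurableT Ia fi' fd' G0 Gi fG').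
by apply: eq_Rintegral => y _; rewrite d1.
Qed.

Lemma dominated_Rintegral d (T : measurableType d) (mu : {measure set T -> \bar R})
    (fn : nat -> T -> R) (f g : T -> R) :
  (forall k, measurable_fun setT (fn k)) -> measurable_fun setT f ->
  (forall x, fn k x @[k --> \oo] --> f x) ->
  mu.-integrable setT (EFin \o g) -> (forall k x, `|fn k x| <= g x) ->
  \int[mu]_x fn k x @[k --> \oo] --> \int[mu]_x f x.
Proof.
move=> mfn mf cv gi fg.
have mfn' k : measurable_fun setT (EFin \o fn k) by exact/measurable_EFinP.
have mf' : measurable_fun setT (EFin \o f) by exact/measurable_EFinP.
have cv' x : setT x -> (EFin \o fn k) x @[k --> \oo] --> (EFin \o f) x.
  by move=> _; apply: cvg_EFin; [exact: nearW|exact: cv].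
have fg' x k : setT x -> (`|(EFin \o fn k) x| <= (EFin \o g) x)%E.
  by move=> _; rewrite /= lee_fin.
have [fi _ h] := dominated_convergence measurableT mfn' mf' (aeW mu cv') gi
  (aeW mu fg').
by apply: fine_cvg; rewrite /Rintegral fineK//; exact: integrable_fin_num.
Qed.

(** The integrals over [-n, n] are F n - F (-n) and converge by domination, so it is enough to know
    the limits of F along the integers. *)
Lemma integral_derive_eq0 (F f : R -> R) :
  (forall x : R, is_derive x 1 F (f x)) -> continuous f ->
  leb.-integrable setT (EFin \o f) ->
  F n%:R @[n --> \oo] --> (0 : R) -> F (- n%:R) @[n --> \oo] --> (0 : R) ->
  \int[leb]_x f x = 0.
Proof.
move=> dF cf fi F0 FN0.
pose fn (n : nat) x := f x * \1_`[- n%:R, n%:R] x.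
have mf : measurable_fun setT f by exact: continuous_measurable_fun.
have mfn n : measurable_fun setT (fn n) by exact: measurable_funM.
have cv x : fn n x @[n --> \oo] --> f x.
  apply: cvg_near_cst; near=> n.
  rewrite /fn indicE mem_set ?mulr1//=.
  have h : `|x| <= n%:R by near: n; exact: nbhs_infty_ger.
  by rewrite in_itv/= -ler_norml.
have ia : leb.-integrable setT (EFin \o (fun x => `|f x|)).
  by have := integrable_abse fi; apply: eq_integrable => // x _.
have fnle n x : `|fn n x| <= `|f x|.
  rewrite /fn normrM ler_piMr// indicE.
  by case: (_ \in _); rewrite ?normr1 ?normr0.
have h : \int[leb]_x fn k x @[k --> \oo] --> \int[leb]_x f x.
  apply: (@dominated_Rintegral _ _ leb fn f (fun x => `|f x|)).
  - exact: mfn.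
  - exact: mf.
  - exact: cv.
  - exact: ia.
  - exact: fnle.
have h0 : F n%:R - F (- n%:R) @[n --> \oo] --> (0 - 0 : R) by exact: cvgB.
have e : (fun n => \int[leb]_x fn n x) = (fun n : nat => F n%:R - F (- n%:R)).
  apply/funext => n; have -> : \int[leb]_x fn n x =
      \int[leb]_(x in `[(- n%:R)%R, n%:R]) f x.
    rewrite [RHS]Rintegral_mkcond; apply: eq_Rintegral => x _.
    by rewrite /fn patchE indicE; case: ifP => _; rewrite ?mulr1 ?mulr0.
  case: n => [|n].
    by rewrite oppr0 subrr set_itv1 Rintegral_set1.
  rewrite /Rintegral (@continuous_FTC2 _ f F)//.
  - by rewrite gtrN// ltr0n.
  - exact: continuous_subspaceT.
  - split.
    + by move=> x _; exact: ex_derive.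
    + apply: cvg_at_right_filter; apply: differentiable_continuous.
      by apply/derivable1_diffP; exact: ex_derive.
    + apply: cvg_at_left_filter; apply: differentiable_continuous.
      by apply/derivable1_diffP; exact: ex_derive.
  - by move=> x _; rewrite derive1E derive_val.
rewrite e in h; rewrite -(cvg_lim _ h)//.
by rewrite (cvg_lim _ h0)// subrr.
Unshelve. all: end_near. Qed.

End calculus.

(** * The Gaussian on the line and its Fourier transform *)

Section gaussian1.
Context {R : realType}.
Local Notation leb := (@lebesgue_measure R).
Variable c : R.
Hypothesis c0 : 0 < c.

Definition gs (c x : R) : R := expR (- (c * x ^+ 2)).

Lemma gs_ge0 x : 0 <= gs c x. Proof. exact: expR_ge0. Qed.

Lemma measurable_gs (b : R) : measurable_fun setT (gs b).
Proof.
apply: measurableT_comp => //; apply: measurableT_comp => //.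
by apply: measurable_funM => //; exact: measurable_funX.
Qed.

Lemma integral_gsB m : (\int[leb]_x (gs c (x - m))%:E = (Num.sqrt (pi / c))%:E)%E.
Proof.
(* The Gaussian of parameter c is, up to its peak value, the normal density of variance 1 / (2
   c). *)
pose s : R := (Num.sqrt (c * 2))^-1.
have c2 : 0 < c * 2 by rewrite mulr_gt0.
have s0 : 0 < s by rewrite invr_gt0 sqrtr_gt0.
have s2 : s ^+ 2 = (c * 2)^-1 by rewrite exprVn sqr_sqrtr// ltW.
have := integral_normal_pdf m s.
have pk0 := normal_peak_gt0 (lt0r_neq0 s0).
under eq_integral => x _.
  rewrite (normal_pdfE m (lt0r_neq0 s0)) /normal_fun -[_ *+ 2]mulr_natr s2.
  have -> : ((c * 2)^-1 * 2)^-1 = c by rewrite invfM invrK mulfK ?pnatr_eq0.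
  rewrite mulNr (mulrC _ c) -/(gs c (x - m)) EFinM.
  over.
rewrite /= ge0_integralZl_EFin//; first last.
- exact: ltW.
- apply/measurable_EFinP; apply: measurableT_comp; first exact: measurable_gs.
  exact: measurable_funB.
- by move=> x _; rewrite lee_fin gs_ge0.
set I := (\int[leb]_x _)%E => H.
have -> : I = ((normal_peak s)^-1%:E * ((normal_peak s)%:E * I))%E.
  by rewrite muleA -EFinM mulVf ?mul1e// gt_eqF.
rewrite H mule1 /normal_peak invrK s2 -mulr_natr invfM.
by congr (Num.sqrt _)%:E; rewrite mulrAC divfK// mulrC.
Qed.

Lemma integral_gs : (\int[leb]_x (gs c x)%:E = (Num.sqrt (pi / c))%:E)%E.
Proof. by rewrite -(integral_gsB 0); under [RHS]eq_integral do rewrite subr0. Qed.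

Lemma integrable_gs : leb.-integrable setT (EFin \o gs c).
Proof.
apply/integrableP; split; first by apply/measurable_EFinP; exact: measurable_gs.
under eq_integral do rewrite /= ger0_norm ?gs_ge0//.
by rewrite integral_gs ltry.
Qed.

End gaussian1.

Section gaussian1_fourier.
Context {R : realType}.
Local Notation leb := (@lebesgue_measure R).
Variable c : R.
Hypothesis c0 : 0 < c.

(** Half of the exponent absorbs the factor |x|, the other half is an integrable Gaussian. This is
    the majorant for differentiating the transform under the integral. *)
Lemma integrable_norm_gs : leb.-integrable setT (EFin \o (fun x => `|x| * gs c x)).
Proof.
have ch : 0 < c / 2 by rewrite divr_gt0.
pose K : R := 1 + 2 / c.
have K0 : 0 <= K by rewrite addr_ge0// divr_ge0// ltW.
have : leb.-integrable setT (EFin \o (fun x => K * gs (c / 2) x)).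
  have := integrableZl measurableT K (integrable_gs ch).
  by apply: eq_integrable => // x _; rewrite /= EFinM.
apply: le_integrable => //.
  apply/measurable_EFinP; apply: measurable_funM; last exact: measurable_gs.
  exact: normr_measurable.
move=> x _; rewrite /= lee_fin [leLHS]ger0_norm ?mulr_ge0 ?gs_ge0//.
rewrite [leRHS]ger0_norm ?mulr_ge0 ?expR_ge0//.
have -> : gs c x = gs (c / 2) x * gs (c / 2) x.
  by rewrite /gs -expRD -opprD -mulrDl -splitr.
rewrite mulrA ler_wpM2r ?expR_ge0//.
rewrite /gs expRN ler_pdivrMr ?expR_gt0//.
apply: (@le_trans _ _ (K * (1 + c / 2 * x ^+ 2))); last first.
  by rewrite ler_wpM2l// expR_ge1Dx.
have [x1|x1] := leP `|x| 1.
  apply: (le_trans x1); rewrite -[leLHS]mulr1 ler_pM//.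
    by rewrite lerDl divr_ge0// ltW.
  by rewrite lerDl mulr_ge0 ?sqr_ge0// ltW.
apply: (@le_trans _ _ (2 / c * (c / 2 * x ^+ 2))).
  have -> : 2 / c * (c / 2 * x ^+ 2) = x ^+ 2 by field; rewrite gt_eqF.
  rewrite -real_normK ?num_real// expr2 ler_peMl// ltW//.
have h : 0 <= c / 2 * x ^+ 2 by rewrite mulr_ge0 ?sqr_ge0// ltW.
have h2 : 0 <= 2 / c by rewrite divr_ge0// ltW.
by rewrite /K; nra.
Qed.

Lemma continuous_gs : continuous (gs c).
Proof.
move=> x; apply: continuous_comp; last exact: continuous_expR.
by apply: cvgN; apply: cvgM; [exact: cvg_cst|exact: exprn_continuous].
Qed.

Lemma measurable_cosM (z : R) : measurable_fun setT (fun x : R => cos (z * x)).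
Proof.
apply: continuous_measurable_fun => x; apply: continuous_comp.
  by apply: cvgM; [exact: cvg_cst|exact: cvg_id].
exact: continuous_cos.
Qed.

Lemma measurable_sinM (z : R) : measurable_fun setT (fun x : R => sin (z * x)).
Proof.
apply: continuous_measurable_fun => x; apply: continuous_comp.
  by apply: cvgM; [exact: cvg_cst|exact: cvg_id].
exact: continuous_sin.
Qed.

Lemma integrable_bounded (f g : R -> R) : leb.-integrable setT (EFin \o f) ->
  measurable_fun setT g -> (forall x, `|g x| <= 1) ->
  leb.-integrable setT (EFin \o (fun x => f x * g x)).
Proof.
move=> fi mg g1; have mf := measurable_int _ fi.
apply: (le_integrable measurableT _ _ fi).
  by apply/measurable_EFinP; apply: measurable_funM => //; exact/measurable_EFinP.
by move=> x _; rewrite /= lee_fin normrM ler_piMr.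
Qed.

Lemma norm_cos_le1 (x : R) : `|cos x| <= 1.
Proof. by rewrite ler_norml cos_geN1 cos_le1. Qed.

Lemma norm_sin_le1 (x : R) : `|sin x| <= 1.
Proof. by rewrite ler_norml sin_geN1 sin_le1. Qed.

Definition gsF (z : R) := \int[leb]_x (gs c x * cos (z * x)).

Lemma integrable_gs_cos z : leb.-integrable setT (EFin \o (fun x => gs c x * cos (z * x))).
Proof.
apply: integrable_bounded; first exact: integrable_gs.
  exact: measurable_cosM.
by move=> x; exact: norm_cos_le1.
Qed.

Lemma integrable_xgs_sin z :
  leb.-integrable setT (EFin \o (fun x => x * gs c x * sin (z * x))).
Proof.
apply: integrable_bounded; last 2 first.
- exact: measurable_sinM.
- by move=> x; exact: norm_sin_le1.
apply: (le_integrable measurableT _ _ integrable_norm_gs).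
  by apply/measurable_EFinP; apply: measurable_funM => //; exact: measurable_gs.
by move=> x _; rewrite /= lee_fin !normrM normr_id.
Qed.

Lemma is_derive_gsF (z : R) :
  is_derive z 1 gsF (- \int[leb]_x (x * gs c x * sin (z * x))).
Proof.
have : is_derive z 1 gsF (\int[leb]_x (- (x * gs c x * sin (z * x)))).
  apply: (@is_derive_integral _ _ _ leb
    (fun z x => gs c x * cos (z * x)) (fun z x => - (x * gs c x * sin (z * x)))
    (fun x => `|x| * gs c x) (z - 1) (z + 1)).
  - by rewrite ltrDl ltr01 andbT ltrBlDr ltrDl ltr01.
  - by move=> y _; exact: integrable_gs_cos.
  - move=> y x _.
    rewrite (_ : (fun w => _) = gs c x \*: (cos \o (fun w => w * x)))//.
    by apply: is_derive_eq; rewrite scaler0 add0r /GRing.scale/= mulr1; ring.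
  - exact: integrable_norm_gs.
  - move=> y x _; rewrite normrN !normrM (ger0_norm (gs_ge0 c x)).
    by rewrite ler_piMr ?norm_sin_le1// mulr_ge0// gs_ge0.
under [X in is_derive _ _ _ X -> _]eq_Rintegral do rewrite -mulN1r.
by rewrite RintegralZl// ?mulN1r//; exact: integrable_xgs_sin.
Qed.

(** Integration by parts: the derivative of [gs] times the sine has integral zero. *)
Lemma gs_sin_parts (z : R) :
  2 * c * \int[leb]_x (x * gs c x * sin (z * x)) = z * gsF z.
Proof.
pose f x := z * (gs c x * cos (z * x)) - 2 * c * (x * gs c x * sin (z * x)).
have i1 := integrable_gs_cos z; have i2 := integrable_xgs_sin z.
have j1 : leb.-integrable setT (EFin \o (fun x => z * (gs c x * cos (z * x)))).
  by have := integrableZl measurableT z i1; apply: eq_integrable.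
have j2 : leb.-integrable setT (EFin \o (fun x => 2 * c * (x * gs c x * sin (z * x)))).
  by have := integrableZl measurableT (2 * c) i2; apply: eq_integrable.
suff : \int[leb]_x f x = 0.
  rewrite /f RintegralB// RintegralZl// RintegralZl// => /eqP.
  by rewrite subr_eq0 => /eqP.
have bd (e x : R) : 1 <= e -> `|gs c (e * x)| <= 1 -> True by [].
have lim (F : nat -> R) : (forall k, `|F k| <= gs c k%:R) -> F k @[k --> \oo] --> (0 : R).
  move=> Fg; pose K : R := 2 + 2 / c.
  have K0 : 0 <= K by rewrite addr_ge0// divr_ge0// ltW.
  have bnd k : `|F k| <= K * k.+1%:R^-1.
    apply: (le_trans (Fg k)); rewrite /gs expRN ler_pdivlMr ?ltr0n//.
    rewrite ler_pdivrMl ?expR_gt0//.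
    apply: (@le_trans _ _ (K * (1 + c * k%:R ^+ 2))); last first.
      by rewrite mulrC ler_wpM2r// expR_ge1Dx.
    have kk : k%:R <= 1 + k%:R ^+ 2 :> R by have := sqr_ge0 (k%:R - 1 / 2 : R); nra.
    have e : 2 / c * (c * k%:R ^+ 2) = 2 * k%:R ^+ 2 by field; rewrite gt_eqF.
    have h2 : 0 <= 2 / c by rewrite divr_ge0// ltW.
    have h3 : 0 <= c * k%:R ^+ 2 by rewrite mulr_ge0 ?sqr_ge0// ltW.
    rewrite -natr1 /K; nra.
  apply/norm_cvg0P; apply: (@squeeze_cvgr _ _ _ _ (cst 0) (fun k => K * k.+1%:R^-1)).
  - by apply: nearW => k; rewrite normr_ge0/=.
  - exact: cvg_cst.
  - rewrite -[X in _ --> X](mulr0 K); apply: cvgM; first exact: cvg_cst.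
    exact: cvg_harmonic.
apply: (@integral_derive_eq0 _ (fun x => gs c x * sin (z * x))).
- move=> x; rewrite /gs /f /gs.
  rewrite (_ : (fun w => _) = (expR \o (fun w => - (c * w ^+ 2))) \* (sin \o (fun w => z * w)))//.
  by apply: is_derive_eq; rewrite /GRing.scale/=; ring.
- move=> x; apply: cvgB; apply: cvgM; try exact: cvg_cst.
    apply: cvgM; first exact: continuous_gs.
    apply: continuous_comp; last exact: continuous_cos.
    by apply: cvgM; [exact: cvg_cst|exact: cvg_id].
  apply: cvgM; first by apply: cvgM; [exact: cvg_id|exact: continuous_gs].
  apply: continuous_comp; last exact: continuous_sin.
  by apply: cvgM; [exact: cvg_cst|exact: cvg_id].
- have := integrableB measurableT j1 j2; exact: eq_integrable.
- by apply: lim => k; rewrite normrM ger0_norm ?gs_ge0// ler_piMr ?gs_ge0 ?norm_sin_le1.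
- apply: lim => k; rewrite normrM ger0_norm ?gs_ge0// /gs sqrrN.
  by rewrite ler_piMr ?expR_ge0 ?norm_sin_le1.
Qed.

(** By [is_derive_gsF] and [gs_sin_parts] the transform solves y' = - z y / (2 c), so its product
    with exp(z^2 / (4 c)) is constant and equals its value at 0. *)
Lemma gsFE (z : R) : gsF z = Num.sqrt (pi / c) * expR (- (z ^+ 2 / (4 * c))).
Proof.
pose h z := gsF z * expR (z ^+ 2 / (4 * c)).
have dh (w : R) : is_derive w 1 h 0.
  have dg := is_derive_gsF w.
  have de : is_derive w 1 (expR \o (fun w => w ^+ 2 / (4 * c)))
      (expR (w ^+ 2 / (4 * c)) * (w / (2 * c))).
    apply: is_derive_eq; rewrite /GRing.scale/=; congr (_ * _).
    by field; rewrite gt_eqF.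
  have := is_deriveM dg de.
  congr is_derive; rewrite /GRing.scale/=.
  have := gs_sin_parts w; set I := \int[leb]_x _ => e.
  have -> : gsF w * (expR (w ^+ 2 / (4 * c)) * (w / (2 * c))) =
     expR (w ^+ 2 / (4 * c)) * ((w * gsF w) / (2 * c)) by ring.
  by rewrite -e; field; rewrite gt_eqF.
have : h z = h 0 by exact: is_derive_0_is_cst.
rewrite /h expr0n/= mul0r expR0 mulr1.
have -> : gsF 0 = Num.sqrt (pi / c).
  rewrite /gsF; under eq_Rintegral do rewrite mul0r cos0 mulr1.
  by rewrite /Rintegral integral_gs.
by move=> <-; rewrite -mulrA expRN mulfV ?mulr1// gt_eqF// expR_gt0.
Qed.

End gaussian1_fourier.

(** * Fubini's theorem for real integrals with a product majorant *)

Section Rfubini.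
Context {R : realType} d1 d2 (T1 : measurableType d1) (T2 : measurableType d2).
Variables (m1 : {sigma_finite_measure set T1 -> \bar R}).
Variables (m2 : {sigma_finite_measure set T2 -> \bar R}).
Variables (f : T1 * T2 -> R) (g : T1 -> R) (h : T2 -> R).
Hypotheses (mf : measurable_fun setT f) (g0 : forall x, 0 <= g x).
Hypotheses (h0 : forall y, 0 <= h y) (fgh : forall x y, `|f (x, y)| <= g x * h y).
Hypotheses (gi : m1.-integrable setT (EFin \o g)).
Hypotheses (hi : m2.-integrable setT (EFin \o h)).

(** The majorant g x * h y holds at every point, so every slice is integrable and not just almost
    every one. Inner integrals are then finite everywhere, and [fine] can be moved through them. *)
Lemma Rfubini_slice1 x : m2.-integrable setT (EFin \o (fun y => f (x, y))).
Proof.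
have := integrableZl measurableT (g x) hi.
apply: le_integrable => //.
  by apply/measurable_EFinP; exact: measurableT_comp.
by move=> y _; rewrite /= lee_fin (le_trans (fgh x y))// ler_norm.
Qed.

Lemma Rfubini_slice2 y : m1.-integrable setT (EFin \o (fun x => f (x, y))).
Proof.
have := integrableZl measurableT (h y) gi.
apply: le_integrable => //.
  by apply/measurable_EFinP; exact: measurableT_comp.
by move=> x _; rewrite /= lee_fin (le_trans (fgh x y))// mulrC ler_norm.
Qed.

Lemma Rfubini_integrable : (m1 \x m2)%E.-integrable setT (EFin \o f).
Proof.
have mg : measurable_fun setT g by apply/measurable_EFinP; exact: measurable_int gi.
have mh : measurable_fun setT h by apply/measurable_EFinP; exact: measurable_int hi.
apply/integrable12ltyP; first exact/measurable_EFinP.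
apply: (@le_lt_trans _ _ (\int[m1]_x \int[m2]_y ((g x)%:E * (h y)%:E))%E).
  apply: le_nnintegral => x; first by apply: integral_ge0 => y _; exact: abse_ge0.
  by apply: le_nnintegral => y //; rewrite /= lee_fin.
under eq_integral => x _.
  rewrite ge0_integralZl_EFin//; [|by move=> y _; rewrite lee_fin|exact/measurable_EFinP].
  over.
rewrite ge0_integralZr//.
- apply: lte_mul_pinfty.
  + by apply: integral_ge0 => x _; rewrite lee_fin.
  + by have := integrable_fin_num measurableT gi.
  + by have := integrable_fin_num measurableT hi; move=> /fin_numPlt/andP[].
- exact/measurable_EFinP.
- by move=> x _; rewrite lee_fin.
- by apply: integral_ge0 => y _; rewrite lee_fin.
Qed.

Lemma Rfubini_F_integrable :
  m1.-integrable setT (EFin \o (fun x => \int[m2]_y f (x, y))).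
Proof.
have := integrable_fubini_F Rfubini_integrable; apply: eq_integrable => // x _.
by rewrite /= /Rintegral fineK//; exact: integrable_fin_num (Rfubini_slice1 x).
Qed.

Lemma Rfubini12 :
  \int[m1]_x \int[m2]_y f (x, y) = fine (\int[(m1 \x m2)%E]_z (f z)%:E)%E.
Proof.
rewrite -(integral12_prod_meas1 Rfubini_integrable) {1}/Rintegral; congr fine.
apply: eq_integral => x _; rewrite /Rintegral fineK//.
exact: integrable_fin_num (Rfubini_slice1 x).
Qed.

Lemma Rfubini :
  \int[m1]_x \int[m2]_y f (x, y) = \int[m2]_y \int[m1]_x f (x, y).
Proof.
rewrite Rfubini12 -(integral21_prod_meas1 Rfubini_integrable) [RHS]/Rintegral.
congr fine; apply: eq_integral => y _; rewrite [RHS]/= /Rintegral fineK//.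
exact: integrable_fin_num (Rfubini_slice2 y).
Qed.

End Rfubini.

(** * The Gaussian on R^n *)

Section gaussian_rV.
Context {R : realType}.
Local Notation leb := (@lebesgue_measure R).

Lemma Rintegral_oddR (f : R -> R) : leb.-integrable setT (EFin \o f) ->
  (forall x, f (- x) = - f x) -> \int[leb]_x f x = 0.
Proof.
move=> fi fN.
have mN : measurable_fun setT (-%R : measurableTypeR R -> measurableTypeR R) by [].
have e : (\int[leb]_x (f x)%:E = \int[leb]_x (f (- x))%:E)%E.
  rewrite -[RHS](@integral_pushforward _ _ _ _ R _ mN leb setT (EFin \o f))//.
  - apply: eq_measure_integral => A mA _.
    exact: (esym (lebesgue_measureN mA)).
  - by apply: measurable_int fi.
  - by have := integrableN fi; apply: eq_integrable => // x _ /=; rewrite fN.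
have : \int[leb]_x f x = - \int[leb]_x f x.
  rewrite {1}/Rintegral e -[RHS]mulN1r -RintegralZl// /Rintegral; congr fine.
  by apply: eq_integral => x _; rewrite fN mulN1r.
by lra.
Qed.

Lemma integral_rVS n (f : 'rV[R]_n.+1 -> R) (g : R -> R) (h : 'rV[R]_n -> R) :
  measurable_fun setT f -> (forall a, 0 <= g a) -> (forall v, 0 <= h v) ->
  (forall a v, `|f (row_cons (a, v))| <= g a * h v) ->
  leb.-integrable setT (EFin \o g) ->
  (lebesgue_rV n).-integrable setT (EFin \o h) ->
  \int[lebesgue_rV n.+1]_x f x =
  \int[leb]_a \int[lebesgue_rV n]_v f (row_cons (a, v)).
Proof.
move=> mf g0 h0 fgh gi hi.
have mr := @measurable_row_cons R n.
have mc : measurable_fun setT (f \o @row_cons R n) by exact: (measurableT_comp mf mr).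
have fi := Rfubini_integrable mc g0 h0 fgh gi hi.
rewrite [RHS](Rfubini12 mc g0 h0 fgh gi hi) [LHS]/Rintegral; congr fine.
have mf' : measurable_fun setT (EFin \o f) by exact/measurable_EFinP.
exact: (@integral_pushforward _ _ _ _ R _ mr (leb \x lebesgue_rV n)%E setT _ mf' fi measurableT).
Qed.

Definition wt (c : R) n (x : 'rV[R]_n) := \prod_(i < n) gs c (x ord0 i).

Lemma wt_ge0 c n (x : 'rV[R]_n) : 0 <= wt c x.
Proof. by apply: prodr_ge0 => i _; exact: gs_ge0. Qed.

Lemma wtE c n (x : 'rV[R]_n) : wt c x = expR (- (c * dotv x x)).
Proof.
rewrite /wt /gs -expR_sum /dotv mulr_sumr -sumrN.
by under eq_bigr do rewrite expr2.
Qed.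

Lemma measurable_wt c n : measurable_fun setT (@wt c n).
Proof.
apply: measurable_prod => i _.
by apply: (measurableT_comp (measurable_gs c)); exact: measurable_coord.
Qed.

Lemma integral_wtB c n (z : 'rV[R]_n) : 0 < c ->
  (\int[lebesgue_rV n]_x (wt c (z - x))%:E = ((Num.sqrt (pi / c)) ^+ n)%:E)%E.
Proof.
move=> c0.
have -> : (fun x => (wt c (z - x))%:E) =
    (fun x : 'rV[R]_n => (\prod_(i < n) gs c (x ord0 i - z ord0 i))%:E).
  apply/funext => x; congr EFin; apply: eq_bigr => i _.
  by rewrite /gs !mxE -sqrrN opprB.
rewrite (@ge0_integral_prod_rV _ _ (fun i t => gs c (t - z ord0 i))).
- rewrite (eq_bigr (fun=> (Num.sqrt (pi / c))%:E)) => [|i _].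
    by rewrite prodEFin prodr_const card_ord.
  exact: integral_gsB.
- move=> i; apply: (measurableT_comp (measurable_gs c)).
  exact: measurable_funB.
- by move=> i x; exact: gs_ge0.
Qed.

Lemma integrable_wt c n : 0 < c ->
  (lebesgue_rV n).-integrable setT (EFin \o @wt c n).
Proof.
move=> c0; apply/integrableP; split.
  by apply/measurable_EFinP; exact: measurable_wt.
have := @integral_wtB c n 0 c0.
have e (x : 'rV[R]_n) : wt c (0 - x) = wt c x.
  by apply: eq_bigr => i _; rewrite /gs !mxE add0r sqrrN.
under eq_integral do rewrite e.
move=> h; under eq_integral do rewrite /= ger0_norm ?wt_ge0//.
by rewrite h ltry.
Qed.

Lemma wt_row_cons c n a (v : 'rV[R]_n) : wt c (row_cons (a, v)) = gs c a * wt c v.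
Proof.
rewrite /wt big_ord_recl row_cons0; congr (_ * _).
by apply: eq_bigr => i _; rewrite row_consS.
Qed.

Lemma dotv_row_cons n (z : 'rV[R]_n.+1) a (v : 'rV[R]_n) :
  dotv z (row_cons (a, v)) = z ord0 ord0 * a + dotv (row_uncons z).2 v.
Proof.
rewrite /dotv big_ord_recl row_cons0; congr (_ + _).
by apply: eq_bigr => i _; rewrite row_consS !mxE.
Qed.

Lemma integrable_bounded_mul d (T : measurableType d) (mu : {measure set T -> \bar R})
    (f g : T -> R) (M : R) : mu.-integrable setT (EFin \o f) ->
  measurable_fun setT g -> (forall x, `|g x| <= M) ->
  mu.-integrable setT (EFin \o (fun x => f x * g x)).
Proof.
move=> fi mg gM; have mf : measurable_fun setT f.
  by apply/measurable_EFinP; exact: measurable_int fi.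
apply: (@le_integrable _ _ _ _ _ _ _ (fun x => (M%:E * (f x)%:E)%E)) => //.
- by apply/measurable_EFinP; exact: measurable_funM.
- move=> x _; rewrite /= lee_fin !normrM mulrC ler_wpM2r//.
  by rewrite (le_trans (gM x))// ler_norm.
- exact: integrableZl.
Qed.

Lemma measurable_cos_dotv d (T : measurableType d) n (f g : T -> 'rV[R]_n) :
  measurable_fun setT f -> measurable_fun setT g ->
  measurable_fun setT (fun t => cos (dotv (f t) (g t))).
Proof.
move=> mf mg; apply: (measurableT_comp (f := @cos R)); last exact: measurable_dotv.
by apply: continuous_measurable_fun; exact: continuous_cos.
Qed.

Lemma measurable_sin_dotv d (T : measurableType d) n (f g : T -> 'rV[R]_n) :
  measurable_fun setT f -> measurable_fun setT g ->
  measurable_fun setT (fun t => sin (dotv (f t) (g t))).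
Proof.
move=> mf mg; apply: (measurableT_comp (f := @sin R)); last exact: measurable_dotv.
by apply: continuous_measurable_fun; exact: continuous_sin.
Qed.

Lemma integrable_wt_cos c n (z : 'rV[R]_n) : 0 < c ->
  (lebesgue_rV n).-integrable setT (EFin \o (fun x => wt c x * cos (dotv z x))).
Proof.
move=> c0; apply: (integrable_bounded_mul (M := 1)).
- exact: integrable_wt.
- by apply: measurable_cos_dotv => //; exact: measurable_cst.
- by move=> x; exact: norm_cos_le1.
Qed.

Lemma integrable_wt_sin c n (z : 'rV[R]_n) : 0 < c ->
  (lebesgue_rV n).-integrable setT (EFin \o (fun x => wt c x * sin (dotv z x))).
Proof.
move=> c0; apply: (integrable_bounded_mul (M := 1)).
- exact: integrable_wt.
- by apply: measurable_sin_dotv => //; exact: measurable_cst.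
- by move=> x; exact: norm_sin_le1.
Qed.

(** The cosine and sine integrals are treated together because the addition formulas mix them in the
    induction on n. The sine part vanishes by oddness in the first coordinate and by the induction
    hypothesis in the others. *)
Lemma wt_fourier c n (z : 'rV[R]_n) : 0 < c ->
  \int[lebesgue_rV n]_x (wt c x * cos (dotv z x)) = \prod_(i < n) gsF c (z ord0 i) /\
  \int[lebesgue_rV n]_x (wt c x * sin (dotv z x)) = 0.
Proof.
move=> c0; elim: n z => [|n IHn] z.
  have e (x : 'rV[R]_0) : wt c x = 1 by rewrite /wt big_ord0.
  have e' (x : 'rV[R]_0) : dotv z x = 0 by rewrite /dotv big_ord0.
  under eq_Rintegral do rewrite e e' cos0 mulr1.
  under [X in _ /\ X = _]eq_Rintegral do rewrite e e' sin0 mulr0.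
  rewrite big_ord0 !Rintegral_cst// mul0r mul1r; split => //.
  by rewrite [X in fine X](_ : _ = 1%E)//=; exact: diracT.
have [IHc IHs] := IHn (row_uncons z).2.
have ic := integrable_wt_cos (row_uncons z).2 c0.
have js := integrable_wt_sin (row_uncons z).2 c0.
split.
- rewrite (integral_rVS (g := gs c) (h := @wt c n)) ?gs_ge0 ?wt_ge0//; first last.
  + exact: integrable_wt.
  + exact: integrable_gs.
  + move=> a v; rewrite wt_row_cons normrM ger0_norm ?mulr_ge0 ?gs_ge0 ?wt_ge0//.
    by rewrite ler_piMr ?norm_cos_le1// mulr_ge0 ?gs_ge0 ?wt_ge0.
  + by move=> v; exact: wt_ge0.
  + by move=> a; exact: gs_ge0.
  + apply: measurable_funM; first exact: measurable_wt.
    by apply: measurable_cos_dotv => //; exact: measurable_cst.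
  transitivity (\int[leb]_a (gs c a * cos (z ord0 ord0 * a) *
      \prod_(i < n) gsF c ((row_uncons z).2 ord0 i))).
    apply: eq_Rintegral => a _; rewrite -IHc.
    pose A := gs c a * cos (z ord0 ord0 * a); pose B := gs c a * sin (z ord0 ord0 * a).
    transitivity (\int[lebesgue_rV n]_v (A * (wt c v * cos (dotv (row_uncons z).2 v)) -
        B * (wt c v * sin (dotv (row_uncons z).2 v)))).
      apply: eq_Rintegral => v _; rewrite wt_row_cons dotv_row_cons cosD /A /B.
      by ring.
    rewrite RintegralB//; last 2 first.
    + by have := integrableZl measurableT A ic; apply: eq_integrable.
    + by have := integrableZl measurableT B js; apply: eq_integrable.
    by rewrite RintegralZl// RintegralZl// IHs mulr0 subr0.
  rewrite RintegralZr//; last exact: integrable_gs_cos.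
  rewrite big_ord_recl -/(gsF c (z ord0 ord0)); congr (_ * _).
  by apply: eq_bigr => i _; rewrite !mxE.
- rewrite (integral_rVS (g := gs c) (h := @wt c n)) ?gs_ge0 ?wt_ge0//; first last.
  + exact: integrable_wt.
  + exact: integrable_gs.
  + move=> a v; rewrite wt_row_cons normrM ger0_norm ?mulr_ge0 ?gs_ge0 ?wt_ge0//.
    by rewrite ler_piMr ?norm_sin_le1// mulr_ge0 ?gs_ge0 ?wt_ge0.
  + by move=> v; exact: wt_ge0.
  + by move=> a; exact: gs_ge0.
  + apply: measurable_funM; first exact: measurable_wt.
    by apply: measurable_sin_dotv => //; exact: measurable_cst.
  transitivity (\int[leb]_a (gs c a * sin (z ord0 ord0 * a) *
      \prod_(i < n) gsF c ((row_uncons z).2 ord0 i))).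
    apply: eq_Rintegral => a _; rewrite -IHc.
    pose A := gs c a * cos (z ord0 ord0 * a); pose B := gs c a * sin (z ord0 ord0 * a).
    transitivity (\int[lebesgue_rV n]_v (B * (wt c v * cos (dotv (row_uncons z).2 v)) +
        A * (wt c v * sin (dotv (row_uncons z).2 v)))).
      apply: eq_Rintegral => v _; rewrite wt_row_cons dotv_row_cons sinD /A /B.
      by ring.
    rewrite RintegralD//; last 2 first.
    + by have := integrableZl measurableT B ic; apply: eq_integrable.
    + by have := integrableZl measurableT A js; apply: eq_integrable.
    by rewrite RintegralZl// RintegralZl// IHs mulr0 addr0.
  have is1 : leb.-integrable setT (EFin \o (fun x => gs c x * sin (z ord0 ord0 * x))).
    apply: integrable_bounded; first exact: integrable_gs.
    - exact: measurable_sinM.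
    - by move=> x; exact: norm_sin_le1.
  rewrite RintegralZr// Rintegral_oddR ?mul0r// => a.
  by rewrite /gs sqrrN mulrN sinN mulrN.
Qed.

End gaussian_rV.

(** * Real Fourier analysis *)

Section Rintegral_abs.
Context {R : realType} d (T : measurableType d) (mu : {measure set T -> \bar R}).

(** This holds for every r, integrable or not: if the positive or the negative part has infinite
    integral, [fine] returns 0 on the left. *)
Lemma le_abse_Rintegral (r : T -> R) :
  (`|\int[mu]_x r x|%:E <= \int[mu]_x `|r x|%:E)%E.
Proof.
rewrite /Rintegral integralE; set a := (\int[mu]_x _^\+ x)%E.
set b := (\int[mu]_x _^\- x)%E; set I := (\int[mu]_x _)%E.
have a0 : (0 <= a)%E by exact: integral_ge0.
have b0 : (0 <= b)%E by exact: integral_ge0.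
have aI : (a <= I)%E.
  by apply: le_nnintegral => // x; rewrite funeposE ge_max !lee_fin ler_norm normr_ge0.
have bI : (b <= I)%E.
  by apply: le_nnintegral => // x; rewrite funenegE ge_max -EFinN !lee_fin -normrN ler_norm normr_ge0.
clearbody a b I.
case: a a0 aI => [a| |]//= a0 aI; last first.
  by case: b b0 bI => [b| |]//= _ _; rewrite ?normr0 (le_trans _ aI).
case: b b0 bI => [b| |]//= b0 bI; last by rewrite normr0 (le_trans _ aI).
rewrite !lee_fin in a0 b0.
have [ab|ab] := leP b a.
  by rewrite ger0_norm ?subr_ge0//; apply: le_trans aI; rewrite lee_fin gerBl.
rewrite ltr0_norm ?subr_lt0// opprB; apply: le_trans bI.
by rewrite lee_fin gerBl.
Qed.

End Rintegral_abs.

Section fourier.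
Context {R : realType} {n : nat}.
Local Notation V := 'rV[R]_n.
Local Notation mu := (lebesgue_rV n).
Implicit Types (f : V -> R) (x z w xi : V).

Definition ph x xi : R := 2 * pi * dotv x xi.

(* exp (- pi de^2 |xi|^2) and its inverse Fourier transform. *)
Definition gE (de : R) xi : R := wt (pi * de ^+ 2) xi.

Definition gG (de : R) x : R := de^-1 ^+ n * wt (pi / de ^+ 2) x.

(* The Fourier transform of a real function is kept as the pair of its cosine and
   sine transforms, [ct f - i st f]. *)
Definition ct f xi : R := \int[mu]_w (f w * cos (ph w xi)).
Definition st f xi : R := \int[mu]_w (f w * sin (ph w xi)).

Lemma phE x xi : ph x xi = dotv ((2 * pi) *: x) xi.
Proof.
by rewrite /ph /dotv mulr_sumr; apply: eq_bigr => i _; rewrite mxE mulrA.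
Qed.

Lemma phB x z xi : ph (x - z) xi = ph x xi - ph z xi.
Proof.
rewrite /ph -mulrBr; congr (_ * _); rewrite /dotv -sumrB.
by apply: eq_bigr => i _; rewrite !mxE mulrBl.
Qed.

Lemma measurable_ph d (T : measurableType d) (a b : T -> V) :
  measurable_fun setT a -> measurable_fun setT b ->
  measurable_fun setT (fun t => ph (a t) (b t)).
Proof. by move=> ma mb; apply: measurable_funM => //; exact: measurable_dotv. Qed.

Lemma measurable_cos_ph d (T : measurableType d) (a b : T -> V) :
  measurable_fun setT a -> measurable_fun setT b ->
  measurable_fun setT (fun t => cos (ph (a t) (b t))).
Proof.
move=> ma mb; apply: (measurableT_comp (f := @cos R)); last exact: measurable_ph.
by apply: continuous_measurable_fun; exact: continuous_cos.
Qed.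

Lemma measurable_sin_ph d (T : measurableType d) (a b : T -> V) :
  measurable_fun setT a -> measurable_fun setT b ->
  measurable_fun setT (fun t => sin (ph (a t) (b t))).
Proof.
move=> ma mb; apply: (measurableT_comp (f := @sin R)); last exact: measurable_ph.
by apply: continuous_measurable_fun; exact: continuous_sin.
Qed.

Lemma gE_gt0 de xi : 0 < gE de xi.
Proof. by rewrite /gE wtE expR_gt0. Qed.

Lemma gG_ge0 de x : 0 < de -> 0 <= gG de x.
Proof. by move=> d0; rewrite mulr_ge0 ?wt_ge0// exprn_ge0// invr_ge0 ltW. Qed.

Lemma measurable_gE de : measurable_fun setT (gE de).
Proof. exact: measurable_wt. Qed.

Lemma measurable_gG de : measurable_fun setT (gG de).
Proof. by apply: measurable_funM => //; exact: measurable_wt. Qed.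

Let pd0 (de : R) : 0 < de -> 0 < pi * de ^+ 2.
Proof. by move=> d0; rewrite mulr_gt0 ?pi_gt0// exprn_gt0. Qed.

Let pv0 (de : R) : 0 < de -> 0 < pi / de ^+ 2.
Proof. by move=> d0; rewrite divr_gt0 ?pi_gt0// exprn_gt0. Qed.

Lemma integrable_gE (de : R) : 0 < de -> mu.-integrable setT (EFin \o gE de).
Proof. by move=> d0; apply: integrable_wt; exact: pd0. Qed.

Lemma integral_gGB (de : R) z : 0 < de -> (\int[mu]_w (gG de (z - w))%:E = 1)%E.
Proof.
move=> d0; rewrite /gG; under eq_integral do rewrite EFinM.
rewrite ge0_integralZl_EFin//; first last.
- by rewrite exprn_ge0// invr_ge0 ltW.
- have m : measurable_fun setT (fun w => wt (pi / de ^+ 2) (z - w)).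
    rewrite -[X in measurable_fun _ X]/(@wt R (pi / de ^+ 2) n \o (fun w => z - w)).
    apply: measurableT_comp; first exact: measurable_wt.
    by apply: measurable_funB_rV => //; exact: measurable_cst.
  exact/measurable_EFinP.
- by move=> w _; rewrite lee_fin wt_ge0.
rewrite (integral_wtB _ (pv0 d0)) -EFinM -exprMn.
have -> : pi / (pi / de ^+ 2) = de ^+ 2.
  by rewrite invf_div mulrCA mulfV ?mulr1// gt_eqF// pi_gt0.
by rewrite sqrtr_sqr gtr0_norm// mulVf ?gt_eqF// expr1n.
Qed.

Lemma gGC de x z : gG de (x - z) = gG de (z - x).
Proof.
rewrite /gG; congr (_ * _); apply: eq_bigr => i _.
have -> : (x - z) ord0 i = - ((z - x) ord0 i) by rewrite !mxE opprB.
by rewrite /gs sqrrN.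
Qed.

Lemma integrable_gGB (de : R) z : 0 < de ->
  mu.-integrable setT (EFin \o (fun w => gG de (z - w))).
Proof.
move=> d0; apply/integrableP; split.
  apply/measurable_EFinP; apply: (measurableT_comp (measurable_gG _)).
  by apply: measurable_funB_rV => //; exact: measurable_cst.
under eq_integral do rewrite /= ger0_norm ?gG_ge0//.
by rewrite integral_gGB// ltry.
Qed.

Lemma gE_fourier (de : R) z : 0 < de ->
  \int[mu]_xi (gE de xi * cos (ph z xi)) = gG de z.
Proof.
move=> d0; under eq_Rintegral do rewrite phE.
have [-> _] := wt_fourier ((2 * pi) *: z) (pd0 d0).
rewrite /gG /wt; have -> : de^-1 ^+ n = \prod_(i < n) de^-1 by rewrite prodr_const card_ord.
rewrite -big_split/=.
apply: eq_bigr => i _; rewrite (gsFE (pd0 d0)) mxE /gs.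
have p0 : pi != 0 :> R by rewrite gt_eqF// pi_gt0.
have dn0 : de != 0 by rewrite gt_eqF.
congr (_ * expR (- _)); last first.
  by move: (@pi R) p0 => P p0; field; rewrite dn0 p0.
have -> : pi / (pi * de ^+ 2) = (de^-1) ^+ 2 :> R.
  by move: (@pi R) p0 => P p0; field; rewrite dn0 p0.
by rewrite sqrtr_sqr gtr0_norm// invr_gt0.
Qed.

Section L1.
Variable f : V -> R.
Hypothesis fi : mu.-integrable setT (EFin \o f).

Let mf : measurable_fun setT f.
Proof. by apply/measurable_EFinP; exact: measurable_int fi. Qed.

Let fai : mu.-integrable setT (EFin \o (fun x => `|f x|)).
Proof. by have := integrable_abse fi; apply: eq_integrable. Qed.

Lemma integrable_cosM xi : mu.-integrable setT (EFin \o (fun w => f w * cos (ph w xi))).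
Proof.
apply: (integrable_bounded_mul (M := 1)) => //.
- by apply: measurable_cos_ph => //; exact: measurable_cst.
- by move=> x; exact: norm_cos_le1.
Qed.

Lemma integrable_sinM xi : mu.-integrable setT (EFin \o (fun w => f w * sin (ph w xi))).
Proof.
apply: (integrable_bounded_mul (M := 1)) => //.
- by apply: measurable_sin_ph => //; exact: measurable_cst.
- by move=> x; exact: norm_sin_le1.
Qed.

Lemma norm_ct_le xi : `|ct f xi| <= \int[mu]_w `|f w|.
Proof.
apply: (le_trans (le_normr_Rintegral measurableT (integrable_cosM xi))).
apply: le_Rintegral => //.
  by have := integrable_abse (integrable_cosM xi); apply: eq_integrable.
by move=> x _; rewrite normrM ler_piMr// norm_cos_le1.
Qed.

Lemma norm_st_le xi : `|st f xi| <= \int[mu]_w `|f w|.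
Proof.
apply: (le_trans (le_normr_Rintegral measurableT (integrable_sinM xi))).
apply: le_Rintegral => //.
  by have := integrable_abse (integrable_sinM xi); apply: eq_integrable.
by move=> x _; rewrite normrM ler_piMr// norm_sin_le1.
Qed.

Lemma gE_ct_integrable (de : R) : 0 < de ->
  mu.-integrable setT (EFin \o (fun xi => gE de xi * ct f xi)).
Proof.
move=> d0.
have := @Rfubini_F_integrable R _ _ _ _ mu mu
  (fun p => gE de p.1 * (f p.2 * cos (ph p.2 p.1))) (gE de) (fun x => `|f x|).
have mF : measurable_fun setT (fun p : V * V => gE de p.1 * (f p.2 * cos (ph p.2 p.1))).
  apply: measurable_funM.
    by apply: (measurableT_comp (measurable_gE de)); exact: measurable_fst.
  apply: measurable_funM; last by apply: measurable_cos_ph.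
  by apply: (measurableT_comp mf); exact: measurable_snd.
move=> /(_ mF (fun x => ltW (gE_gt0 de x)) (fun x => normr_ge0 _)).
have B x y : `|gE de x * (f y * cos (ph y x))| <= gE de x * `|f y|.
  rewrite normrM (gtr0_norm (gE_gt0 _ _)) ler_wpM2l ?(ltW (gE_gt0 _ _))//.
  by rewrite normrM ler_piMr// norm_cos_le1.
move=> /(_ B (integrable_gE d0) fai); apply: eq_integrable => // xi _ /=.
by rewrite RintegralZl//; exact: integrable_cosM.
Qed.

Lemma gE_st_integrable (de : R) : 0 < de ->
  mu.-integrable setT (EFin \o (fun xi => gE de xi * st f xi)).
Proof.
move=> d0.
have := @Rfubini_F_integrable R _ _ _ _ mu mu
  (fun p => gE de p.1 * (f p.2 * sin (ph p.2 p.1))) (gE de) (fun x => `|f x|).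
have mF : measurable_fun setT (fun p : V * V => gE de p.1 * (f p.2 * sin (ph p.2 p.1))).
  apply: measurable_funM.
    by apply: (measurableT_comp (measurable_gE de)); exact: measurable_fst.
  apply: measurable_funM; last by apply: measurable_sin_ph.
  by apply: (measurableT_comp mf); exact: measurable_snd.
move=> /(_ mF (fun x => ltW (gE_gt0 de x)) (fun x => normr_ge0 _)).
have B x y : `|gE de x * (f y * sin (ph y x))| <= gE de x * `|f y|.
  rewrite normrM (gtr0_norm (gE_gt0 _ _)) ler_wpM2l ?(ltW (gE_gt0 _ _))//.
  by rewrite normrM ler_piMr// norm_sin_le1.
move=> /(_ B (integrable_gE d0) fai); apply: eq_integrable => // xi _ /=.
by rewrite RintegralZl//; exact: integrable_sinM.
Qed.

(** Fubini applies only after multiplication by a Gaussian in xi; dividing by this Gaussian, which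
    has no zero, recovers the transform. *)
Lemma measurable_ct : measurable_fun setT (ct f).
Proof.
have h : measurable_fun setT (fun xi => gE 1 xi * ct f xi).
  by apply/measurable_EFinP; exact: measurable_int (gE_ct_integrable ltr01).
rewrite (_ : ct f = fun xi => expR (pi * dotv xi xi) * (gE 1 xi * ct f xi)).
  apply: measurable_funM => //; apply: (measurableT_comp (f := @expR R)) => //.
  by apply: measurable_funM => //; exact: measurable_dotv.
apply/funext => xi; rewrite mulrA /gE wtE expr1n mulr1 -expRD subrr.
by rewrite expR0 mul1r.
Qed.

Lemma measurable_st : measurable_fun setT (st f).
Proof.
have h : measurable_fun setT (fun xi => gE 1 xi * st f xi).
  by apply/measurable_EFinP; exact: measurable_int (gE_st_integrable ltr01).
rewrite (_ : st f = fun xi => expR (pi * dotv xi xi) * (gE 1 xi * st f xi)).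
  apply: measurable_funM => //; apply: (measurableT_comp (f := @expR R)) => //.
  by apply: measurable_funM => //; exact: measurable_dotv.
apply/funext => xi; rewrite mulrA /gE wtE expr1n mulr1 -expRD subrr.
by rewrite expR0 mul1r.
Qed.

(** Inversion for the smoothed function only: the Gaussian factor makes the double integral over w
    and xi absolutely convergent for any integrable f, while the transform of f need not be
    integrable. *)
Lemma gG_inversion (de : R) z : 0 < de ->
  \int[mu]_w (f w * gG de (z - w)) =
  \int[mu]_xi (gE de xi * (ct f xi * cos (ph z xi) + st f xi * sin (ph z xi))).
Proof.
move=> d0.
transitivity (\int[mu]_w \int[mu]_xi (f w * (gE de xi * cos (ph (z - w) xi)))).
  apply: eq_Rintegral => w _; rewrite RintegralZl//; first by rewrite gE_fourier.
  apply: (integrable_bounded_mul (M := 1)); first exact: integrable_gE.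
  - by apply: measurable_cos_ph => //; exact: measurable_cst.
  - by move=> x; exact: norm_cos_le1.
have mF : measurable_fun setT (fun p : V * V => f p.1 * (gE de p.2 * cos (ph (z - p.1) p.2))).
  apply: measurable_funM; first by apply: (measurableT_comp mf); exact: measurable_fst.
  apply: measurable_funM.
    by apply: (measurableT_comp (measurable_gE de)); exact: measurable_snd.
  apply: measurable_cos_ph => //.
  by apply: measurable_funB_rV => //; exact: measurable_cst.
have B x y : `|f x * (gE de y * cos (ph (z - x) y))| <= `|f x| * gE de y.
  rewrite normrM ler_wpM2l// normrM (gtr0_norm (gE_gt0 _ _)).
  by rewrite ler_piMr ?norm_cos_le1// ltW// gE_gt0.
rewrite (Rfubini mF (fun x => normr_ge0 _) (fun x => ltW (gE_gt0 de x)) B fai (integrable_gE d0)).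
apply: eq_Rintegral => xi _.
have i1 := integrable_cosM xi; have i2 := integrable_sinM xi.
transitivity (\int[mu]_w (gE de xi * cos (ph z xi) * (f w * cos (ph w xi)) +
    gE de xi * sin (ph z xi) * (f w * sin (ph w xi)))).
  by apply: eq_Rintegral => w _; rewrite phB cosB; ring.
rewrite RintegralD//.
- by rewrite RintegralZl// RintegralZl// -/(ct f xi) -/(st f xi); ring.
- have := integrableZl measurableT (gE de xi * cos (ph z xi)) i1; exact: eq_integrable.
- have := integrableZl measurableT (gE de xi * sin (ph z xi)) i2; exact: eq_integrable.
Qed.

Lemma integrable_gE_inner (de : R) : 0 < de -> mu.-integrable setT
  (EFin \o (fun xi => gE de xi * (ct f xi ^+ 2 + st f xi ^+ 2))).
Proof.
move=> d0; pose M : R := (\int[mu]_w `|f w|) ^+ 2 + (\int[mu]_w `|f w|) ^+ 2.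
apply: (integrable_bounded_mul (M := M)); first exact: integrable_gE.
  by apply: measurable_funD; apply: measurable_funX; [exact: measurable_ct|exact: measurable_st].
move=> xi; rewrite ger0_norm ?addr_ge0 ?sqr_ge0//.
by apply: lerD; rewrite -[leLHS]real_normK ?num_real//;
  rewrite lerXn2r ?nnegrE ?Rintegral_ge0// ?norm_ct_le ?norm_st_le.
Qed.

Lemma gE_bessel (de : R) : 0 < de ->
  \int[mu]_xi (gE de xi * (ct f xi ^+ 2 + st f xi ^+ 2)) =
  \int[mu]_x (f x * \int[mu]_w (f w * gG de (x - w))).
Proof.
move=> d0; pose M : R := \int[mu]_w `|f w| + \int[mu]_w `|f w|.
have M0 : 0 <= M by rewrite addr_ge0// Rintegral_ge0.
have cM (x : V) xi : `|ct f xi * cos (ph x xi) + st f xi * sin (ph x xi)| <= M.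
  apply: (le_trans (ler_normD _ _)); apply: lerD; rewrite normrM.
    by rewrite (le_trans (ler_piMr _ (norm_cos_le1 _))) ?norm_ct_le.
  by rewrite (le_trans (ler_piMr _ (norm_sin_le1 _))) ?norm_st_le.
transitivity (\int[mu]_x \int[mu]_xi (f x * (gE de xi *
    (ct f xi * cos (ph x xi) + st f xi * sin (ph x xi))))); last first.
  apply: eq_Rintegral => x _; rewrite gG_inversion// RintegralZl//.
  apply: (integrable_bounded_mul (M := M)); first exact: integrable_gE.
  - apply: measurable_funD; apply: measurable_funM.
    + exact: measurable_ct.
    + by apply: measurable_cos_ph => //; exact: measurable_cst.
    + exact: measurable_st.
    + by apply: measurable_sin_ph => //; exact: measurable_cst.
  - by move=> xi; exact: cM.
have mF : measurable_fun setT (fun p : V * V => f p.1 * (gE de p.2 *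
    (ct f p.2 * cos (ph p.1 p.2) + st f p.2 * sin (ph p.1 p.2)))).
  apply: measurable_funM; first by apply: (measurableT_comp mf); exact: measurable_fst.
  apply: measurable_funM.
    by apply: (measurableT_comp (measurable_gE de)); exact: measurable_snd.
  apply: measurable_funD; apply: measurable_funM.
  - by apply: (measurableT_comp measurable_ct); exact: measurable_snd.
  - exact: measurable_cos_ph.
  - by apply: (measurableT_comp measurable_st); exact: measurable_snd.
  - exact: measurable_sin_ph.
have B x y : `|f x * (gE de y * (ct f y * cos (ph x y) + st f y * sin (ph x y)))| <=
    `|f x| * (gE de y * M).
  rewrite normrM ler_wpM2l// normrM (gtr0_norm (gE_gt0 _ _)).
  by rewrite ler_wpM2l ?cM// ltW// gE_gt0.
have hi : mu.-integrable setT (EFin \o (fun y => gE de y * M)).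
  by apply: (integrable_bounded_mul (M := `|M|)) => //; exact: integrable_gE.
have h0 y : 0 <= gE de y * M by rewrite mulr_ge0// ltW// gE_gt0.
rewrite (Rfubini mF (fun x => normr_ge0 _) h0 B fai hi).
apply: eq_Rintegral => xi _.
have i1 := integrable_cosM xi; have i2 := integrable_sinM xi.
transitivity (\int[mu]_w (gE de xi * ct f xi * (f w * cos (ph w xi)) +
    gE de xi * st f xi * (f w * sin (ph w xi)))); last first.
  by apply: eq_Rintegral => w _; ring.
rewrite RintegralD//.
- by rewrite RintegralZl// RintegralZl// -/(ct f xi) -/(st f xi); ring.
- have := integrableZl measurableT (gE de xi * ct f xi) i1; exact: eq_integrable.
- have := integrableZl measurableT (gE de xi * st f xi) i2; exact: eq_integrable.
Qed.

(** A Schur test: f(x) f(w) <= (f(x)^2 + f(w)^2) / 2, and the kernel gG(x - w) has integral 1 in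
    each variable. The right-hand side may be infinite. *)
Lemma gE_bessel_le (de : R) : 0 < de ->
  (\int[mu]_xi (gE de xi * (ct f xi ^+ 2 + st f xi ^+ 2))%:E <=
   \int[mu]_x (f x ^+ 2)%:E)%E.
Proof.
move=> d0.
have iF := integrable_gE_inner d0.
rewrite -[leLHS]fineK; last exact: integrable_fin_num iF.
rewrite -[fine _]/(\int[mu]_xi (gE de xi * (ct f xi ^+ 2 + st f xi ^+ 2))) gE_bessel//.
have mG : measurable_fun setT (fun p : V * V => gG de (p.1 - p.2)).
  by apply: (measurableT_comp (measurable_gG de)); apply: measurable_funB_rV.
have mf1 : measurable_fun setT (fun p : V * V => f p.1).
  by apply: (measurableT_comp mf); exact: measurable_fst.
have mf2 : measurable_fun setT (fun p : V * V => f p.2).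
  by apply: (measurableT_comp mf); exact: measurable_snd.
have mf2' : measurable_fun setT (fun x => f x ^+ 2) by exact: measurable_funX.
have G0 x w : 0 <= gG de (x - w) by exact: gG_ge0.
have s0 x : (0 <= (f x ^+ 2)%:E)%E by rewrite lee_fin sqr_ge0.
have mGx x : measurable_fun setT (fun w => gG de (x - w)).
  by apply: (measurableT_comp (measurable_gG de)); apply: measurable_funB_rV.
pose H (x w : V) : \bar R := ((f x ^+ 2)%:E * (gG de (x - w))%:E)%E.
pose K (x w : V) : \bar R := ((f w ^+ 2)%:E * (gG de (x - w))%:E)%E.
have H0 x w : (0 <= H x w)%E by rewrite mule_ge0 ?lee_fin ?sqr_ge0.
have K0 x w : (0 <= K x w)%E by rewrite mule_ge0 ?lee_fin ?sqr_ge0.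
have mH : measurable_fun setT (fun p : V * V => H p.1 p.2).
  by apply: emeasurable_funM; apply/measurable_EFinP => //; exact: measurable_funX.
have mK : measurable_fun setT (fun p : V * V => K p.1 p.2).
  by apply: emeasurable_funM; apply/measurable_EFinP => //; exact: measurable_funX.
have mHx x : measurable_fun setT (H x) by apply: emeasurable_funM; [exact: measurable_cst|apply/measurable_EFinP; exact: mGx].
have mKx x : measurable_fun setT (K x) by apply: emeasurable_funM; apply/measurable_EFinP; [exact: mf2'|exact: mGx].
have IH : (\int[mu]_x \int[mu]_w H x w = \int[mu]_x (f x ^+ 2)%:E)%E.
  apply: eq_integral => x _; rewrite /H ge0_integralZl_EFin ?sqr_ge0//.
  - by rewrite integral_gGB// mule1.
  - by move=> w _; rewrite lee_fin.
  - exact/measurable_EFinP.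
have IK : (\int[mu]_x \int[mu]_w K x w = \int[mu]_x (f x ^+ 2)%:E)%E.
  transitivity (\int[mu]_w \int[mu]_x K x w)%E.
    exact: (@fubini_tonelli _ _ _ _ _ mu mu (fun p : V * V => K p.1 p.2) mK (fun p => K0 _ _)).
  apply: eq_integral => w _; rewrite /K ge0_integralZl_EFin ?sqr_ge0//.
  - by under eq_integral do rewrite gGC; rewrite integral_gGB// mule1.
  - by move=> x _; rewrite lee_fin.
  - by apply/measurable_EFinP; under eq_fun do rewrite gGC; exact: mGx.
have S : (\int[mu]_x \int[mu]_w (H x w + K x w) =
    \int[mu]_x (f x ^+ 2)%:E + \int[mu]_x (f x ^+ 2)%:E)%E.
  rewrite -{1}IH -{1}IK -ge0_integralD//.
  - by apply: eq_integral => x _; rewrite ge0_integralD.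
  - by move=> x _; apply: integral_ge0.
  - exact: (measurable_fun_fubini_tonelli_F (fun p : V * V => H p.1 p.2)).
  - by move=> x _; apply: integral_ge0.
  - exact: (measurable_fun_fubini_tonelli_F (fun p : V * V => K p.1 p.2)).
apply: (@le_trans _ _ (\int[mu]_x (2^-1%:E * \int[mu]_w (H x w + K x w)))%E); last first.
  rewrite ge0_integralZl_EFin//; first last.
  - apply: (measurable_fun_fubini_tonelli_F (fun p : V * V => H p.1 p.2 + K p.1 p.2)%E).
      exact: emeasurable_funD.
    by move=> p; exact: adde_ge0.
  - by move=> x _; apply: integral_ge0 => w _; exact: adde_ge0.
  rewrite S; have A0 : (0 <= \int[mu]_x (f x ^+ 2)%:E)%E by exact: integral_ge0.
  rewrite ge0_muleDr// -ge0_muleDl ?lee_fin ?invr_ge0//.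
  by rewrite -EFinD (_ : 2^-1 + 2^-1 = 1) ?mul1e//; field.
apply: (le_trans _ (le_trans (le_abse_Rintegral mu (fun x => f x * \int[mu]_w (f w * gG de (x - w)))) _)).
  by rewrite lee_fin ler_norm.
apply: le_nnintegral => x; first by rewrite lee_fin.
rewrite normrM EFinM.
apply: (@le_trans _ _ (`|f x|%:E * \int[mu]_w `|f w * gG de (x - w)|%:E)%E).
  by apply: lee_wpmul2l; [rewrite lee_fin|exact: le_abse_Rintegral].
rewrite -ge0_integralZl_EFin//; first last.
- by apply/measurable_EFinP; apply: measurableT_comp => //; exact: measurable_funM.
rewrite -ge0_integralZl_EFin//; first last.
- exact: emeasurable_funD.
- by move=> w _; exact: adde_ge0.
apply: le_nnintegral => w; first by rewrite -EFinM lee_fin mulr_ge0.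
have -> : (H x w + K x w = (f x ^+ 2 * gG de (x - w) + f w ^+ 2 * gG de (x - w))%:E)%E by [].
rewrite -!EFinM lee_fin normrM (ger0_norm (G0 _ _)).
move: (gG de (x - w)) (G0 x w) => g g0; rewrite mulrA -mulrDl mulrA.
apply: ler_wpM2r => //.
rewrite -(real_normK (num_real (f x))) -(real_normK (num_real (f w))).
by have := sqr_ge0 (`|f x| - `|f w|); move: `|f x| `|f w| => a b; rewrite sqrrB; lra.
Qed.

(** The Gaussian factor tends to 1 as the smoothing scale tends to 0, and Fatou's lemma preserves
    the bound. *)
Lemma bessel :
  (\int[mu]_xi (ct f xi ^+ 2 + st f xi ^+ 2)%:E <= \int[mu]_x (f x ^+ 2)%:E)%E.
Proof.
pose de (k : nat) : R := k.+1%:R^-1.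
have de0 k : 0 < de k by rewrite invr_gt0.
pose F (k : nat) xi : \bar R := (gE (de k) xi * (ct f xi ^+ 2 + st f xi ^+ 2))%:E.
have F0 k xi : (0 <= F k xi)%E.
  by rewrite lee_fin mulr_ge0 ?(ltW (gE_gt0 _ _))// addr_ge0 ?sqr_ge0.
have mF k : measurable_fun setT (F k).
  exact: measurable_int (integrable_gE_inner (de0 k)).
have Fcv xi : (F^~ xi) k @[k --> \oo] --> (ct f xi ^+ 2 + st f xi ^+ 2)%:E.
  apply: cvg_EFin; first exact: nearW.
  rewrite -[X in _ --> X]mul1r; apply: cvgM; last exact: cvg_cst.
  rewrite /gE; under eq_fun do rewrite wtE.
  have -> : 1 = expR (- (pi * 0 ^+ 2 * dotv xi xi)) :> R.
    by rewrite expr0n/= mulr0 mul0r oppr0 expR0.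
  apply: continuous_cvg; first exact: continuous_expR.
  apply: cvgN; apply: cvgM; last exact: cvg_cst.
  apply: cvgM; first exact: cvg_cst.
  by rewrite expr2; under eq_fun do rewrite expr2; apply: cvgM; exact: cvg_harmonic.
have -> : (\int[mu]_xi (ct f xi ^+ 2 + st f xi ^+ 2)%:E =
    \int[mu]_xi limn_einf (F^~ xi))%E.
  apply: eq_integral => xi _; have h := Fcv xi.
  rewrite -[LHS](cvg_lim _ h)//; apply/esym/is_cvg_limn_einfE.
  by apply/cvg_ex; eexists; exact: h.
apply: (le_trans (fatou mu measurableT mF (fun k x _ => F0 k x))).
rewrite limn_einf_lim; apply: lime_le; first exact: is_cvg_einfs.
apply: nearW => k; apply: le_trans (gE_bessel_le (de0 k)).
by apply: ereal_inf_lbound; exists k => /=.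
Qed.

End L1.

End fourier.

(** * Pointwise bounds by the maximal function *)

Section kernel.
Context {R : realType} {n : nat}.
Local Notation V := 'rV[R]_n.
Local Notation mu := (lebesgue_rV n).
Implicit Types (f : V -> R) (x y w : V).

Lemma expRN_le_exprV (m : nat) : exists2 C : R, 1 <= C &
  forall z : R, 1 <= z -> expR (- (pi * (z / 2) ^+ 2)) <= C / z ^+ m.+1.
Proof.
exists (m.+1`!%:R * 2 ^+ m.+1) => [|z z1].
  rewrite -[leLHS]mul1r ler_pM ?ler1n ?fact_gt0//.
  by rewrite exprn_ege1// ler1n.
have z0 : 0 < z by exact: lt_le_trans z1.
have h2 : 0 < z / 2 by rewrite divr_gt0.
have hpi : 2 <= pi :> R by exact: pi_ge2.
apply: (@le_trans _ _ (expR (- (z / 2)))).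
  rewrite ler_expR lerN2 expr2 mulrA -[leLHS]mul1r ler_pM2r//.
  apply: (@le_trans _ _ (2 * (z / 2))); first by rewrite mulrC divfK.
  by rewrite ler_pM2r.
rewrite expRN; have f0 : 0 < m.+1`!%:R :> R by rewrite ltr0n fact_gt0.
have h := expR_ge1Dxn m (ltW h2).
have hz : (z / 2) ^+ m.+1 / m.+1`!%:R <= expR (z / 2).
  by apply: le_trans h; rewrite lerDr.
have p : 0 < (z / 2) ^+ m.+1 / m.+1`!%:R by rewrite divr_gt0// exprn_gt0.
apply: (@le_trans _ _ (((z / 2) ^+ m.+1 / m.+1`!%:R)^-1)).
  by rewrite lef_pV2 ?posrE ?expR_gt0.
by rewrite invf_div expr_div_n invf_div mulrA.
Qed.

(** For the least such i > 0, the cube of half-side 2^{i-1} misses x, so one coordinate is at least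
    2^{i-1} in absolute value. *)
Lemma ex_cube0 x : exists i : nat, cube 0 (2 ^+ i) x /\
  (i = 0%N \/ (2 ^+ i / 2) ^+ 2 <= dotv x x).
Proof.
have cubeb i : cube 0 (2 ^+ i) x <-> [forall l, `|x ord0 l| < 2 ^+ i].
  rewrite cubeP; split => [h|/forallP h l].
    by apply/forallP => l; have := h l; rewrite !mxE sub0r normrN.
  by rewrite !mxE sub0r normrN.
have ex : exists i : nat, [forall l, `|x ord0 l| < 2 ^+ i].
  exists (Num.bound (\sum_l `|x ord0 l|)); apply/forallP => l.
  apply: le_lt_trans (upper_nthrootP (leqnn _)).
  by rewrite (bigD1 l)//= lerDl sumr_ge0.
case: (ex_minnP ex) => -[|i] hi mi; [exists 0%N|exists i.+1]; split; try exact/cubeb.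
  by left.
right; have : ~~ [forall l, `|x ord0 l| < 2 ^+ i].
  by apply/negP => /mi; rewrite ltnn.
rewrite negb_forall => /existsP[l]; rewrite -leNgt => hl.
rewrite [2 ^+ i.+1]exprS mulrAC divff// mul1r; apply: (@le_trans _ _ (x ord0 l ^+ 2)).
  by rewrite -[leRHS]real_normK ?num_real// lerXn2r ?nnegrE ?exprn_ge0.
rewrite /dotv (bigD1 l)//= -expr2 lerDl sumr_ge0// => k _.
by rewrite -expr2 sqr_ge0.
Qed.

(** The Gaussian is spread over dyadic cubes. The decay 2^{-i(2n+1)} pays for a factor 2^{i beta} <=
    2^{in} from the dimension of sigma, for 2^{in} from the volume of the cube, and leaves 2^{-i}
    for summation. *)
Lemma gG_le : exists2 C : R, 0 <= C & forall (D : R) x, 0 < D ->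
  ((gG D x)%:E <= \sum_(i <oo) ((C * D^-1 ^+ n * (2 ^+ i)^-1 ^+ (2 * n).+1) *
    \1_(cube 0 (D * 2 ^+ i)) x)%:E)%E.
Proof.
have [C C1 CP] := expRN_le_exprV (2 * n); have C0 : 0 <= C by exact: le_trans C1.
exists C => // D x D0; have [i [xi hi]] := ex_cube0 (D^-1 *: x).
have t0 k : 0 <= (C * D^-1 ^+ n * (2 ^+ k)^-1 ^+ (2 * n).+1) *
    \1_(cube 0 (D * 2 ^+ k)) x.
  by rewrite !mulr_ge0// ?exprn_ge0// ?invr_ge0 ?exprn_ge0// ltW.
apply: le_trans (nneseries_lim_ge i.+1 _); last first.
  by move=> k _ _; rewrite lee_fin t0.
rewrite big_nat_recr//= -[leLHS]add0e leeD ?sume_ge0// => [k _|]; first by rewrite lee_fin t0.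
rewrite lee_fin; have -> : \1_(cube 0 (D * 2 ^+ i)) x = 1 :> R.
  rewrite indicE mem_set//; apply/cubeP => l; move/cubeP: xi => /(_ l).
  rewrite !mxE !sub0r !normrN normrM gtr0_norm ?invr_gt0//.
  by rewrite mulrC ltr_pdivrMr// mulrC.
rewrite mulr1 (mulrC C) -[leRHS]mulrA /gG wtE ler_wpM2l ?exprn_ge0 ?invr_ge0 ?(ltW D0)//.
have -> : pi / D ^+ 2 * dotv x x = pi * dotv (D^-1 *: x) (D^-1 *: x).
  rewrite -mulrA; congr (_ * _); rewrite /dotv mulr_sumr; apply: eq_bigr => l _.
  by rewrite !mxE; field; rewrite gt_eqF.
have p2 : 1 <= 2 ^+ i :> R by rewrite exprn_ege1// ler1n.
case: hi => [->|hi].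
  rewrite expr0 invr1 expr1n mulr1 (le_trans _ C1)// -expR0 ler_expR oppr_le0.
  by rewrite mulr_ge0 ?pi_ge0 ?dotvv_ge0.
rewrite exprVn; apply: le_trans (CP _ p2).
by rewrite ler_expR lerN2 ler_wpM2l ?pi_ge0.
Qed.

Context (sigma : {finite_measure set V -> \bar R}) (R0 Cs beta : R).
Hypotheses (R00 : 0 < R0) (supp : sigma (~` cube 0 R0) = 0%E).
Hypotheses (Cs0 : 0 <= Cs).
Hypothesis dim : forall y r, 0 < r -> (sigma (cube y r) <= (Cs * r `^ beta)%:E)%E.

Lemma measurable_cube_shift d (T : measurableType d) (a : T -> V) r :
  measurable_fun setT a ->
  measurable_fun setT (fun t => \1_(cube 0 r) (a t) : R).
Proof.
move=> ma; rewrite -[X in measurable_fun _ X]/((\1_(cube 0 r) : V -> R) \o a).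
by apply: measurableT_comp => //; apply: measurable_indic; exact: measurable_cube.
Qed.

(** Tonelli with w outside. For fixed w the admissible y lie in a cube of half-side r / t, whose
    sigma-measure is controlled by the dimension; they carry mass only if w is within t R0 + r of x,
    because of the support. *)
Lemma cube_average f (t r : R) x : measurable_fun setT f -> (forall x, 0 <= f x) ->
  0 < t -> 0 < r ->
  (\int[sigma]_y \int[mu]_w (f w * \1_(cube 0 r) (x - t *: y - w))%:E <=
   (Cs * (r / t) `^ beta * (8 * (t * R0 + r)) ^+ n)%:E * HLmax f x)%E.
Proof.
move=> mf f0 t0 r0.
pose F (p : V * V) := (f p.2 * \1_(cube 0 r) (x - t *: p.1 - p.2))%:E.
have mF : measurable_fun setT F.
  apply/measurable_EFinP; apply: measurable_funM.
    by apply: (measurableT_comp mf); exact: measurable_snd.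
  apply: measurable_cube_shift; apply: measurable_funB_rV => //.
  apply: measurable_funB_rV; first exact: measurable_cst.
  by apply: measurable_funZ_rV => //; exact: measurable_cst.
have F0 p : (0 <= F p)%E by rewrite lee_fin mulr_ge0.
rewrite (_ : (\int[sigma]_y _)%E = \int[mu]_w \int[sigma]_y F (y, w))%E; last first.
  exact: (@fubini_tonelli _ _ _ _ _ sigma mu F mF F0).
have tR : 0 < t * R0 + r by rewrite addr_gt0// mulr_gt0.
pose K := Cs * (r / t) `^ beta.
have K0 : 0 <= K by rewrite mulr_ge0// powR_ge0.
apply: (@le_trans _ _ (\int[mu]_w (K * f w * \1_(cube x (t * R0 + r)) w)%:E)%E).
  apply: le_nnintegral => w; first by apply: integral_ge0.
  pose A : set V := [set y | cube 0 r (x - t *: y - w)].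
  have mA : measurable A.
    have mh : measurable_fun setT (fun y : V => x - t *: y - w).
      apply: measurable_funB_rV; last exact: measurable_cst.
      apply: measurable_funB_rV; first exact: measurable_cst.
      by apply: measurable_funZ_rV => //; exact: measurable_cst.
    rewrite -[X in measurable X]setTI; apply: mh => //; exact: measurable_cube.
  have -> : (\int[sigma]_y F (y, w) = (f w)%:E * sigma A)%E.
    rewrite -(setIT A) -integral_indic// -ge0_integralZl_EFin//.
    by apply/measurable_EFinP; exact: measurable_indic.
  have [wx|wx] := boolP (w \in cube x (t * R0 + r)); last first.
    rewrite indicE (negbTE wx) mulr0.
    rewrite (_ : sigma _ = 0)%E ?mule0//; apply/eqP; rewrite -measure_le0 -supp.
    apply: le_measure; rewrite ?inE.
    - exact: mA.
    - by apply: measurableC; exact: measurable_cube.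
    - move=> y /= /cubeP hy /cubeP hy'; move/negP: wx; apply; apply/mem_set/cubeP => l.
      have := hy l; have := hy' l; rewrite !mxE !sub0r !normrN => h1 h2.
      have -> : x ord0 l - w ord0 l = t * y ord0 l + (x ord0 l - t * y ord0 l - w ord0 l) by ring.
      apply: (le_lt_trans (ler_normD _ _)); apply: ltrD => //.
      by rewrite normrM gtr0_norm// ltr_pM2l.
  rewrite indicE wx mulr1 EFinM muleC lee_wpmul2r ?lee_fin//.
  apply: le_trans (dim (t^-1 *: (x - w)) (divr_gt0 r0 t0)).
  apply: le_measure; rewrite ?inE.
  - exact: mA.
  - exact: measurable_cube.
  - move=> y /= /cubeP hy; apply/cubeP => l; have := hy l; rewrite !mxE sub0r normrN => h.
    have -> : t^-1 * (x ord0 l - w ord0 l) - y ord0 l = (x ord0 l - t * y ord0 l - w ord0 l) / t.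
      by field; rewrite gt_eqF.
    by rewrite normrM (gtr0_norm (_ : 0 < t^-1)) ?invr_gt0// ltr_pM2r ?invr_gt0.
rewrite [in leRHS]EFinM -muleA.
apply: le_trans (lee_wpmul2l _ (integral_cube_le_HLmax x tR mf f0)); last by rewrite lee_fin.
rewrite [in leRHS]integral_mkcond -ge0_integralZl_EFin//.
- apply: le_nnintegral => w.
    by rewrite lee_fin; apply: mulr_ge0 => //; apply: mulr_ge0.
  by rewrite patchE indicE; case: ifPn => _; rewrite ?mulr1 ?mulr0 ?mule0.
- by move=> w _; rewrite patchE; case: ifPn => _ //; rewrite lee_fin.
- apply/(measurable_restrictT _ (measurable_cube _ _)); apply/measurable_EFinP.
  exact: measurable_funTS.
Qed.

Hypothesis beta_n : 0 <= beta <= n%:R.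

(** Up to summable powers of 2^i, normalization gives (t de)^{-n}, the dimension de^beta and the
    volume t^n, so t cancels and de^{beta-n} remains. The bound de <= de1 keeps the enlarged cube
    comparable to t R0. *)
Lemma kernel_HLmax (de1 : R) : exists2 K : R, 0 <= K & forall f (de t : R) x,
  measurable_fun setT f -> (forall x, 0 <= f x) -> 0 < de -> de <= de1 -> 0 < t ->
  (\int[sigma]_y \int[mu]_w (f w * gG (t * de) (x - t *: y - w))%:E <=
   (K * de `^ (beta - n%:R))%:E * HLmax f x)%E.
Proof.
have [C C0 CP] := gG_le; case/andP: beta_n => b0 bn.
(* The factor 2 is the sum of 2^{-i}. The summand 1 makes the constant positive, so that the
   right-hand side is +oo wherever the maximal function is. *)
exists (C * Cs * (8 * (R0 + `|de1|)) ^+ n * 2 + 1) => [|f de t x mf f0 d0 dd1 t0].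
  by rewrite addr_ge0// !mulr_ge0// exprn_ge0// mulr_ge0// addr_ge0// ltW.
have td0 : 0 < t * de by rewrite mulr_gt0.
pose a (i : nat) : R := C * (t * de)^-1 ^+ n * (2 ^+ i)^-1 ^+ (2 * n).+1.
have a0 i : 0 <= a i by rewrite !mulr_ge0// exprn_ge0// invr_ge0 ?exprn_ge0// ltW.
pose r (i : nat) : R := t * de * 2 ^+ i.
have r0 i : 0 < r i by rewrite mulr_gt0// exprn_gt0.
pose I i (p : V * V) := (f p.2 * \1_(cube 0 (r i)) (x - t *: p.1 - p.2))%:E.
have mI i : measurable_fun setT (I i).
  apply/measurable_EFinP; apply: measurable_funM.
    by apply: (measurableT_comp mf); exact: measurable_snd.
  apply: measurable_cube_shift; apply: measurable_funB_rV => //.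
  apply: measurable_funB_rV; first exact: measurable_cst.
  by apply: measurable_funZ_rV => //; exact: measurable_cst.
have I0 i p : (0 <= I i p)%E by rewrite lee_fin mulr_ge0.
have mI2 i y : measurable_fun setT (fun w => I i (y, w)).
  by apply: (measurableT_comp (mI i)); exact: measurable_pair1.
have mI1 i : measurable_fun setT (fun y => \int[mu]_w I i (y, w))%E.
  exact: (measurable_fun_fubini_tonelli_F (I i)).
have aI i y w : (0 <= (a i)%:E * I i (y, w))%E by rewrite mule_ge0// lee_fin.
apply: (@le_trans _ _ (\sum_(i <oo) ((a i)%:E * \int[sigma]_y \int[mu]_w I i (y, w)))%E).
  apply: (@le_trans _ _ (\int[sigma]_y \int[mu]_w \sum_(i <oo) ((a i)%:E * I i (y, w)))%E).
    apply: le_nnintegral => y.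
      by apply: integral_ge0 => w _; rewrite lee_fin mulr_ge0// gG_ge0.
    apply: le_nnintegral => w; first by rewrite lee_fin mulr_ge0// gG_ge0.
    rewrite EFinM; apply: (le_trans (lee_wpmul2l _ (CP _ (x - t *: y - w) td0))).
      by rewrite lee_fin.
    rewrite -nneseriesZl; last by move=> i _; rewrite lee_fin; apply: mulr_ge0 => //; exact: (a0 i).
    apply: lee_nneseries => [i _ _|i _]; rewrite -EFinM.
      by rewrite lee_fin; apply: mulr_ge0 => //; apply: mulr_ge0 => //; exact: (a0 i).
    by rewrite -EFinM lee_fin -/(a i) -/(r i) mulrCA.
  under eq_integral => y _.
    rewrite integral_nneseries//; last first.
      by move=> i; apply: emeasurable_funM => //; exact: measurable_cst.
    under eq_eseriesr => i _ do rewrite ge0_integralZl_EFin//.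
    over.
  rewrite integral_nneseries//.
  - apply: lee_nneseries => [i _ _|i _].
      by apply: integral_ge0 => y _; rewrite mule_ge0 ?lee_fin ?integral_ge0.
    by rewrite ge0_integralZl_EFin// => y _; exact: integral_ge0.
  - by move=> i; apply: emeasurable_funM => //; exact: measurable_cst.
  - by move=> i y _; rewrite mule_ge0 ?lee_fin ?integral_ge0.
pose G := C * Cs * de `^ (beta - n%:R) * (8 * (R0 + `|de1|)) ^+ n.
have G0 : 0 <= G.
  by rewrite !mulr_ge0 ?powR_ge0// exprn_ge0// mulr_ge0// addr_ge0// ltW.
apply: (@le_trans _ _ (\sum_(i <oo) ((2 * G) / (2 ^ i.+1)%:R)%:E * HLmax f x)%E); last first.
  have H0 := HLmax_ge0 x f0; case: (HLmax f x) H0 => [h| |]// h0; last first.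
    rewrite gt0_muley ?leey// lte_fin mulr_gt0 ?powR_gt0//.
    rewrite ltr_wpDl// !mulr_ge0// exprn_ge0// mulr_ge0// addr_ge0//; exact: ltW.
  under eq_eseriesr => i _ do rewrite muleC.
  rewrite nneseriesZl; last by move=> i _; rewrite lee_fin divr_ge0// mulr_ge0.
  rewrite muleC; apply: lee_wpmul2r => //.
  apply: (le_trans (epsilon_trick0 _ _)); first by rewrite mulr_ge0.
  rewrite lee_fin /G; apply: (@le_trans _ _ (C * Cs * (8 * (R0 + `|de1|)) ^+ n * 2 * de `^ (beta - n%:R))).
    by rewrite le_eqVlt; apply/orP; left; apply/eqP; ring.
  by rewrite ler_wpM2r ?powR_ge0// lerDl.
apply: lee_nneseries => [i _ _|i _].
  by rewrite mule_ge0 ?lee_fin ?integral_ge0// => y _; rewrite integral_ge0.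
apply: (le_trans (lee_wpmul2l _ (cube_average x mf f0 t0 (r0 i)))); first by rewrite lee_fin.
rewrite muleA -EFinM; apply: lee_wpmul2r; first exact: HLmax_ge0.
rewrite lee_fin /G /a.
have z1 : 1 <= 2 ^+ i :> R by rewrite exprn_ege1// ler1n.
have -> : (2 ^ i.+1)%:R = 2 * 2 ^+ i :> R by rewrite expnS natrM natrX.
rewrite /r {I mI I0 mI2 mI1 aI r0 a a0 r G G0}; move: (2 ^+ i : R) z1 => z z1.
have z0 : 0 < z by exact: lt_le_trans z1.
have B0 : 0 <= 8 * (R0 + `|de1|) by rewrite mulr_ge0// addr_ge0// ltW.
have e1 : (8 * (t * R0 + t * de * z)) ^+ n <= (t * z) ^+ n * (8 * (R0 + `|de1|)) ^+ n.
  rewrite -exprMn lerXn2r ?nnegrE ?mulr_ge0 ?addr_ge0 ?mulr_ge0// ?(ltW t0) ?(ltW R00) ?(ltW z0) ?(ltW d0)//.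
  rewrite mulrCA ler_wpM2l// mulrDr lerD//.
    by rewrite -mulrA ler_wpM2l ?(ltW t0)// ler_peMl// ltW.
  rewrite -!mulrA ler_wpM2l ?(ltW t0)// mulrC ler_wpM2l ?(ltW z0)//.
  by rewrite (le_trans dd1)// ler_norm.
have e2 : (t * de * z / t) `^ beta <= de `^ beta * z ^+ n.
  have -> : t * de * z / t = de * z by field; rewrite gt_eqF.
  rewrite powRM ?(ltW d0) ?(ltW z0)// ler_wpM2l ?powR_ge0//.
  by rewrite -powR_mulrn ?(ltW z0)// ler_powR.
have -> : de `^ (beta - n%:R) = de `^ beta / de ^+ n.
  rewrite powRD; last by rewrite (gt_eqF d0) implybT.
  by rewrite powRN powR_mulrn ?(ltW d0).
set B := (8 * (R0 + _)) ^+ n in e1 *.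
apply: (@le_trans _ _ (C * (t * de)^-1 ^+ n * z^-1 ^+ (2 * n).+1 *
    (Cs * (de `^ beta * z ^+ n) * ((t * z) ^+ n * B)))).
  apply: ler_wpM2l.
    by rewrite !mulr_ge0// exprn_ge0// invr_ge0 ?(ltW td0) ?(ltW z0).
  apply: ler_pM => //.
  - by rewrite mulr_ge0// powR_ge0.
  - by rewrite exprn_ge0// mulr_ge0// addr_ge0// !mulr_ge0// ltW.
  - by rewrite ler_wpM2l.
have -> : (t * de)^-1 ^+ n = (t ^+ n * de ^+ n)^-1 by rewrite exprVn exprMn.
have -> : z^-1 ^+ (2 * n).+1 = (z * (z ^+ n * z ^+ n))^-1.
  by rewrite exprVn exprS mul2n -addnn exprD.
rewrite (exprMn n t z).
have := exprn_gt0 n z0; have := exprn_gt0 n t0; have := exprn_gt0 n d0.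
move: (z ^+ n) (t ^+ n) (de ^+ n) => Z T D D0 T0 Z0.
rewrite le_eqVlt; apply/orP; left; apply/eqP; field.
by rewrite !gt_eqF.
Qed.

End kernel.

Section Rintegral_param.
Context {R : realType}.

(** No integrability is assumed: Tonelli gives measurability for the positive and negative parts,
    and both the difference of extended reals and [fine] preserve it. *)
Lemma measurable_Rintegral2 d1 d2 (T1 : measurableType d1) (T2 : measurableType d2)
    (m2 : {sigma_finite_measure set T2 -> \bar R}) (f : T1 * T2 -> R) :
  measurable_fun setT f -> measurable_fun setT (fun x => \int[m2]_y f (x, y)).
Proof.
move=> mf; have mEf : measurable_fun setT (EFin \o f) by exact/measurable_EFinP.
have h1 : measurable_fun setT (fun x => \int[m2]_y ((EFin \o f)^\+ (x, y)))%E.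
  apply: (measurable_fun_fubini_tonelli_F (EFin \o f)^\+%E).
  - exact: measurable_funepos.
  - by move=> p; exact: funepos_ge0.
have h2 : measurable_fun setT (fun x => \int[m2]_y ((EFin \o f)^\- (x, y)))%E.
  apply: (measurable_fun_fubini_tonelli_F (EFin \o f)^\-%E).
  - exact: measurable_funeneg.
  - by move=> p; exact: funeneg_ge0.
rewrite (_ : (fun x => _) = fine \o (fun x => \int[m2]_y ((EFin \o f)^\+ (x, y)) -
    \int[m2]_y ((EFin \o f)^\- (x, y)))%E).
  by apply: (measurableT_comp (f := fine)) => //; exact: emeasurable_funB.
apply/funext => x; rewrite /Rintegral integralE /=; congr (fine (_ - _)%E).
  by apply: eq_integral => y _; rewrite !funeposE.
by apply: eq_integral => y _; rewrite !funenegE.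
Qed.

Lemma continuous_Rintegral d (Y : measurableType d) (mu : {measure set Y -> \bar R})
    (f : R -> Y -> R) (G : Y -> R) (u v a : R) : u < a < v ->
  (forall x, u < x < v -> mu.-integrable setT (EFin \o f x)) ->
  (forall x y, u < x < v -> {for x, continuous (f ^~ y)}) ->
  mu.-integrable setT (EFin \o G) ->
  (forall x y, u < x < v -> `|f x y| <= G y) ->
  {for a, continuous (fun x => \int[mu]_y f x y)}.
Proof.
move=> auv fi fc Gi fG.
have Iuv x : `]u, v[%classic x -> u < x < v by rewrite /= in_itv.
apply: (@continuity_under_integral R _ Y mu f setT measurableT u v) => //.
- by apply: aeW => y _ x /set_mem/Iuv; exact: fc.
- exact: Gi.
- by move=> x /Iuv xuv; apply: aeW => y _; exact: fG.
- by apply/mem_set; rewrite /= in_itv.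
Qed.

End Rintegral_param.

(** * The frequency cutoff and its majorants *)

Section psi.
Context {R : realType}.
Variable N : nat.
Implicit Types (k t r : R).

(* With r = pi de^2 |t xi|^2, [psi1 r] is the frequency cutoff of [Top] below; it
   vanishes to order N + 1 at r = 0 and decays exponentially. *)
Definition psi1 r : R := (1 - expR (- (4 * r))) ^+ N.+1 - (1 - expR (- r)) ^+ N.+1.

(** This is r times the derivative of [psi1], not the derivative itself. In this form d/dt psi1(k
    t^2) = 2 psi1'(k t^2) / t, and the function obeys the same bound by [gbump] as [psi1]. *)
Definition psi1' r : R := N.+1%:R *
  ((1 - expR (- (4 * r))) ^+ N * (4 * r * expR (- (4 * r))) -
   (1 - expR (- r)) ^+ N * (r * expR (- r))).

Definition gbump r : R := r ^+ N.+1 * expR (- r).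

Definition Kpsi : R := N.+1%:R * (2 * 4 ^+ N.+1).

Lemma Kpsi_ge0 : 0 <= Kpsi. Proof. by rewrite !mulr_ge0// exprn_ge0. Qed.

Lemma subrXX_le (a b : R) m : 0 <= b -> b <= a ->
  a ^+ m.+1 - b ^+ m.+1 <= m.+1%:R * a ^+ m * (a - b).
Proof.
move=> b0 ba; have a0 : 0 <= a by exact: le_trans ba.
elim: m => [|m IH]; first by rewrite expr0 !expr1 !mul1r.
have -> : a ^+ m.+2 - b ^+ m.+2 = a * (a ^+ m.+1 - b ^+ m.+1) + b ^+ m.+1 * (a - b).
  by rewrite !(exprS _ m.+1); ring.
have h1 : a * (a ^+ m.+1 - b ^+ m.+1) <= a * (m.+1%:R * a ^+ m * (a - b)).
  exact: ler_wpM2l.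
have h2 : b ^+ m.+1 * (a - b) <= a ^+ m.+1 * (a - b).
  by rewrite ler_wpM2r ?subr_ge0// lerXn2r.
apply: (le_trans (lerD h1 h2)).
rewrite -(natr1 m.+1) le_eqVlt; apply/orP; left; apply/eqP.
by rewrite (exprS a m); ring.
Qed.

Lemma oneBexpRN (x : R) : 0 <= x -> 0 <= 1 - expR (- x) <= 1 /\ 1 - expR (- x) <= x.
Proof.
move=> x0; have h := expR_ge1Dx (- x); have e0 := expR_ge0 (- x).
have e1 : expR (- x) <= 1 by rewrite -expR0 ler_expR oppr_le0.
by split; [apply/andP; split|]; lra.
Qed.

Lemma psi1_le r : 0 <= r -> `|psi1 r| <= Kpsi * gbump r.
Proof.
move=> r0; have r40 : 0 <= 4 * r by rewrite mulr_ge0.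
have [/andP[a0 a1] a4] := oneBexpRN r40; have [/andP[b0 b1] br] := oneBexpRN r0.
have ba : 1 - expR (- r) <= 1 - expR (- (4 * r)).
  by rewrite lerD2l lerN2 ler_expR lerN2 ler_peMl// ler1n.
rewrite /psi1 ger0_norm ?subr_ge0; last by rewrite lerXn2r.
apply: (le_trans (subrXX_le N b0 ba)).
have ab : 1 - expR (- (4 * r)) - (1 - expR (- r)) <= 4 * r * expR (- r).
  have -> : - (4 * r) = - r + - (3 * r) by ring.
  rewrite expRD; have := expR_ge1Dx (- (3 * r)); have := expR_ge0 (- r).
  move: (expR (- r)) (expR (- (3 * r))) => E F E0 F1.
  have : E * (1 - F) <= E * (3 * r) by rewrite ler_wpM2l//; lra.
  by have := mulr_ge0 r0 E0; lra.
apply: (@le_trans _ _ (N.+1%:R * (4 * r) ^+ N * (4 * r * expR (- r)))).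
  apply: ler_pM => //.
  - by rewrite mulr_ge0// exprn_ge0.
  - by rewrite subr_ge0.
  - by rewrite ler_wpM2l// lerXn2r ?nnegrE.
have -> : Kpsi * gbump r = 2 * (N.+1%:R * (4 * r) ^+ N * (4 * r * expR (- r))).
  by rewrite /Kpsi /gbump exprMn !exprS; ring.
by rewrite ler_peMl ?ler1n// !mulr_ge0 ?expR_ge0 ?exprn_ge0.
Qed.

Lemma psi1'_le r : 0 <= r -> `|psi1' r| <= Kpsi * gbump r.
Proof.
move=> r0; have r40 : 0 <= 4 * r by rewrite mulr_ge0.
have [/andP[a0 a1] a4] := oneBexpRN r40; have [/andP[b0 b1] br] := oneBexpRN r0.
have e41 : expR (- (4 * r)) <= expR (- r) by rewrite ler_expR lerN2 ler_peMl// ler1n.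
have r4r : r <= 4 * r by rewrite ler_peMl// ler1n.
have B : 4 ^+ N.+1 * gbump r = (4 * r) ^+ N * (4 * r * expR (- r)).
  by rewrite /gbump exprMn !exprS; ring.
have h1 : 0 <= (1 - expR (- (4 * r))) ^+ N * (4 * r * expR (- (4 * r))) <=
    4 ^+ N.+1 * gbump r.
  rewrite !mulr_ge0 ?expR_ge0 ?exprn_ge0//= B.
  apply: ler_pM; rewrite ?exprn_ge0 ?mulr_ge0 ?expR_ge0//.
    by rewrite lerXn2r ?nnegrE.
  by rewrite ler_wpM2l.
have h2 : 0 <= (1 - expR (- r)) ^+ N * (r * expR (- r)) <= 4 ^+ N.+1 * gbump r.
  rewrite !mulr_ge0 ?expR_ge0 ?exprn_ge0//= B.
  apply: ler_pM; rewrite ?exprn_ge0 ?mulr_ge0 ?expR_ge0//.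
    by rewrite lerXn2r ?nnegrE// (le_trans br).
  by rewrite ler_wpM2r ?expR_ge0.
rewrite /psi1' normrM ger0_norm// /Kpsi -(mulrA N.+1%:R) ler_wpM2l// -mulrA.
rewrite ler_norml; move: h1 h2 => /andP[? ?] /andP[? ?].
by apply/andP; split; lra.
Qed.

Lemma is_derive_psi1 k t : t != 0 ->
  is_derive t 1 (fun t => psi1 (k * t ^+ 2)) (2 * psi1' (k * t ^+ 2) / t).
Proof.
move=> t0; rewrite /psi1 /psi1'.
have d (c : R) : is_derive t 1 (fun t => (1 - expR (- (c * (k * t ^+ 2)))) ^+ N.+1)
    (N.+1%:R * (1 - expR (- (c * (k * t ^+ 2)))) ^+ N *
     (2 * c * k * t * expR (- (c * (k * t ^+ 2))))).
  have h : is_derive t 1 (fun t => 1 - expR (- (c * (k * t ^+ 2))))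
      (2 * c * k * t * expR (- (c * (k * t ^+ 2)))).
    rewrite (_ : (fun _ => _) = cst 1 - (expR \o (fun z => - (c * (k * z ^+ 2)))))//.
    by apply: is_derive_eq; rewrite /GRing.scale/= ?expr1; ring.
  rewrite (_ : (fun _ => _) = (fun t => 1 - expR (- (c * (k * t ^+ 2)))) ^+ N.+1); last first.
    by apply/funext => z; rewrite exprfctE.
  exact: is_deriveX.
have d4 := d 4; have d1 := d 1.
have e1 : (fun t => (1 - expR (- (1 * (k * t ^+ 2)))) ^+ N.+1) =
  (fun t => (1 - expR (- (k * t ^+ 2))) ^+ N.+1).
  by apply/funext => z; rewrite mul1r.
rewrite e1 mul1r mulr1 in d1.
apply: (@is_derive_eq _ _ _ _ _ _ _ _ (is_deriveB d4 d1)).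
move: (expR (- (4 * (k * t ^+ 2)))) (expR (- (k * t ^+ 2))) => a b.
move: ((1 - a) ^+ N) ((1 - b) ^+ N) => A B; move: (N.+1%:R : R) => c.
by field.
Qed.

Lemma continuous_psi1' k : continuous (fun t => psi1' (k * t ^+ 2)).
Proof.
move=> t; rewrite /psi1'.
have c2 : {for t, continuous (fun t : R => k * t ^+ 2)}.
  by apply: cvgM; [exact: cvg_cst|exact: exprn_continuous].
have cr : {for t, continuous (fun t : R => 4 * (k * t ^+ 2))}.
  by apply: cvgM; [exact: cvg_cst|exact: c2].
have e (h : R -> R) : {for t, continuous h} -> {for t, continuous (fun t => expR (- h t))}.
  by move=> ch; apply: continuous_comp; [exact: cvgN|exact: continuous_expR].
have p (h : R -> R) : {for t, continuous h} ->
    {for t, continuous (fun t => (1 - expR (- h t)) ^+ N)}.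
  move=> ch; apply: (@continuous_comp _ _ _ (fun t => 1 - expR (- h t)) (fun z => z ^+ N)).
    by apply: cvgB; [exact: cvg_cst|exact: e].
  exact: exprn_continuous.
apply: cvgM; first exact: cvg_cst.
apply: cvgB; apply: cvgM.
- exact: p cr.
- by apply: cvgM; [exact: cr|exact: e cr].
- exact: p c2.
- by apply: cvgM; [exact: c2|exact: e c2].
Qed.

End psi.

(** * The Fourier transform of sigma along rays *)

Section sigma_transform.
Context {R : realType} {n : nat}.
Local Notation V := 'rV[R]_n.
Variables (sigma : {finite_measure set V -> \bar R}) (R0 : R).
Hypotheses (R00 : 0 < R0) (supp : sigma (~` cube 0 R0) = 0%E).
Implicit Types (y xi : V) (t : R) (g : V -> R).

Definition mass : R := fine (sigma setT).

Lemma mass_ge0 : 0 <= mass. Proof. exact: fine_ge0. Qed.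

Lemma massE : sigma setT = mass%:E.
Proof. by rewrite fineK// fin_num_measure. Qed.

Lemma supp_integral_le g (M : R) : measurable_fun setT g ->
  (forall y, cube 0 R0 y -> `|g y| <= M) -> 0 <= M ->
  (\int[sigma]_y `|g y|%:E <= (M * mass)%:E)%E.
Proof.
move=> mg gM M0; have mC := measurable_cube (0 : V) R0.
rewrite (@ge0_negligible_integral _ _ _ sigma _ (~` cube 0 R0))//.
- rewrite setTD setCK; apply: (@le_trans _ _ (\int[sigma]_(y in cube 0 R0) M%:E)%E).
    apply: ge0_le_integral => //.
    by apply/measurable_EFinP; apply: measurable_funTS; exact: measurableT_comp.
  rewrite integral_cst// EFinM lee_wpmul2l ?lee_fin// -massE.
  by apply: le_measure; rewrite ?inE.
- exact: measurableC.
- by apply/measurable_EFinP; exact: measurableT_comp.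
Qed.

Lemma supp_integrable g (M : R) : measurable_fun setT g ->
  (forall y, cube 0 R0 y -> `|g y| <= M) -> sigma.-integrable setT (EFin \o g).
Proof.
move=> mg gM; apply/integrableP; split; first exact/measurable_EFinP.
apply: le_lt_trans (supp_integral_le (M := `|M|) mg _ (normr_ge0 _)) (ltry _).
by move=> y /gM h; rewrite (le_trans h)// ler_norm.
Qed.

Lemma supp_Rintegral_le g (M : R) : measurable_fun setT g ->
  (forall y, cube 0 R0 y -> `|g y| <= M) -> 0 <= M ->
  `|\int[sigma]_y g y| <= M * mass.
Proof.
move=> mg gM M0; rewrite -lee_fin; apply: le_trans (supp_integral_le mg gM M0).
exact: le_abse_Rintegral.
Qed.

(** The Fourier transform of sigma is [cS] - i [sS]. *)
Definition cS xi : R := \int[sigma]_y cos (ph y xi).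
Definition sS xi : R := \int[sigma]_y sin (ph y xi).
(* Derivatives in [t] of the cosine and sine transforms of sigma at [t *: xi]. *)
Definition cS' xi t : R := \int[sigma]_y (- ph y xi * sin (ph y (t *: xi))).
Definition sS' xi t : R := \int[sigma]_y (ph y xi * cos (ph y (t *: xi))).

Lemma phZr y t xi : ph y (t *: xi) = t * ph y xi.
Proof.
rewrite /ph mulrCA; congr (_ * _); rewrite /dotv mulr_sumr.
by apply: eq_bigr => i _; rewrite mxE mulrCA.
Qed.

Definition Lph : R := 2 * pi * n%:R * R0.

Lemma Lph_ge0 : 0 <= Lph.
Proof. by rewrite !mulr_ge0 ?pi_ge0// ltW. Qed.

Lemma norm_ph_le y xi : cube 0 R0 y -> `|ph y xi| <= Lph * enorm xi.
Proof.
move=> /cubeP yc; rewrite /ph /Lph normrM ger0_norm ?mulr_ge0 ?pi_ge0//.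
rewrite -!mulrA !ler_wpM2l ?pi_ge0//; apply: (le_trans (ler_norm_sum _ _ _)).
have -> : n%:R * (R0 * enorm xi) = \sum_(i < n) R0 * enorm xi.
  by rewrite sumr_const card_ord mulr_natl.
apply: ler_sum => i _; rewrite normrM ler_pM ?coord_le_enorm//.
by have := yc i; rewrite mxE sub0r normrN => /ltW.
Qed.

Let mph xi : measurable_fun setT (fun y => ph y xi).
Proof. by apply: measurable_ph => //; exact: measurable_cst. Qed.

Let mcos xi : measurable_fun setT (fun y => cos (ph y xi)).
Proof. by apply: measurable_cos_ph => //; exact: measurable_cst. Qed.

Let msin xi : measurable_fun setT (fun y => sin (ph y xi)).
Proof. by apply: measurable_sin_ph => //; exact: measurable_cst. Qed.

Lemma norm_cS'_le xi t : `|cS' xi t| <= Lph * enorm xi * mass.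
Proof.
apply: supp_Rintegral_le => [|y yc|].
- by apply: measurable_funM => //; exact: measurableT_comp.
- by rewrite normrM normrN (le_trans _ (norm_ph_le xi yc))// ler_piMr// norm_sin_le1.
- by rewrite mulr_ge0 ?Lph_ge0 ?enorm_ge0.
Qed.

Lemma norm_sS'_le xi t : `|sS' xi t| <= Lph * enorm xi * mass.
Proof.
apply: supp_Rintegral_le => [|y yc|].
- exact: measurable_funM.
- by rewrite normrM (le_trans _ (norm_ph_le xi yc))// ler_piMr// norm_cos_le1.
- by rewrite mulr_ge0 ?Lph_ge0 ?enorm_ge0.
Qed.

Let iph xi : sigma.-integrable setT (EFin \o (fun y => `|ph y xi|)).
Proof.
apply: (supp_integrable (M := Lph * enorm xi)); first exact: measurableT_comp.
by move=> y /norm_ph_le h; rewrite normr_id.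
Qed.

Let around t : t - 1 < t < t + 1.
Proof. by rewrite ltrBlDr ltrDl ltr01. Qed.

Lemma is_derive_cS xi t : is_derive t 1 (fun t => cS (t *: xi)) (cS' xi t).
Proof.
apply: (@is_derive_integral R _ _ sigma (fun t y => cos (ph y (t *: xi)))
  (fun t y => - ph y xi * sin (ph y (t *: xi))) (fun y => `|ph y xi|) _ _ _ (around t)).
- move=> x _; apply: (supp_integrable (M := 1)) => // y _; exact: norm_cos_le1.
- move=> x y _; rewrite (_ : (fun z => _) = cos \o (fun z : R => z * ph y xi)); last first.
    by apply/funext => z; rewrite phZr.
  by apply: is_derive_eq; rewrite /GRing.scale/= phZr; ring.
- exact: iph.
- by move=> x y _; rewrite normrM normrN ler_piMr// norm_sin_le1.
Qed.

Lemma is_derive_sS xi t : is_derive t 1 (fun t => sS (t *: xi)) (sS' xi t).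
Proof.
apply: (@is_derive_integral R _ _ sigma (fun t y => sin (ph y (t *: xi)))
  (fun t y => ph y xi * cos (ph y (t *: xi))) (fun y => `|ph y xi|) _ _ _ (around t)).
- move=> x _; apply: (supp_integrable (M := 1)) => // y _; exact: norm_sin_le1.
- move=> x y _; rewrite (_ : (fun z => _) = sin \o (fun z : R => z * ph y xi)); last first.
    by apply/funext => z; rewrite phZr.
  by apply: is_derive_eq; rewrite /GRing.scale/= phZr; ring.
- exact: iph.
- by move=> x y _; rewrite normrM ler_piMr// norm_cos_le1.
Qed.

Lemma continuous_cS' xi : continuous (cS' xi).
Proof.
move=> t; apply: (continuous_Rintegral (G := fun y => `|ph y xi|) (around t)).
- move=> x _; apply: (supp_integrable (M := Lph * enorm xi)).
    by apply: measurable_funM => //; exact: measurableT_comp.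
  by move=> y yc; rewrite normrM normrN (le_trans _ (norm_ph_le xi yc))// ler_piMr// norm_sin_le1.
- move=> x y _; have h : {for x, continuous (fun z : R => sin (ph y (z *: xi)))}.
    rewrite (_ : (fun z => _) = sin \o (fun z : R => z * ph y xi)); last first.
      by apply/funext => z; rewrite phZr.
    apply: continuous_comp; last exact: continuous_sin.
    by apply: cvgM; [exact: cvg_id|exact: cvg_cst].
  by apply: cvgM; [exact: cvg_cst|exact: h].
- exact: iph.
- by move=> x y _; rewrite normrM normrN ler_piMr// norm_sin_le1.
Qed.

Lemma continuous_sS' xi : continuous (sS' xi).
Proof.
move=> t; apply: (continuous_Rintegral (G := fun y => `|ph y xi|) (around t)).
- move=> x _; apply: (supp_integrable (M := Lph * enorm xi)); first exact: measurable_funM.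
  by move=> y yc; rewrite normrM (le_trans _ (norm_ph_le xi yc))// ler_piMr// norm_cos_le1.
- move=> x y _; have h : {for x, continuous (fun z : R => cos (ph y (z *: xi)))}.
    rewrite (_ : (fun z => _) = cos \o (fun z : R => z * ph y xi)); last first.
      by apply/funext => z; rewrite phZr.
    apply: continuous_comp; last exact: continuous_cos.
    by apply: cvgM; [exact: cvg_id|exact: cvg_cst].
  by apply: cvgM; [exact: cvg_cst|exact: h].
- exact: iph.
- by move=> x y _; rewrite normrM ler_piMr// norm_cos_le1.
Qed.

Section measurability.
Context d (T : measurableType d) (a : T -> V) (t : T -> R).
Hypotheses (ma : measurable_fun setT a) (mt : measurable_fun setT t).

Let ma1 : measurable_fun setT (fun p : T * V => a p.1).
Proof. by apply: (measurableT_comp ma); exact: measurable_fst. Qed.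

Let mta1 : measurable_fun setT (fun p : T * V => t p.1 *: a p.1).
Proof.
by apply: measurable_funZ_rV => //; apply: (measurableT_comp mt); exact: measurable_fst.
Qed.

Let m2 : measurable_fun setT (fun p : T * V => p.2).
Proof. exact: measurable_snd. Qed.

Lemma measurable_cS : measurable_fun setT (fun x => cS (a x)).
Proof.
by apply: (measurable_Rintegral2 sigma (f := fun p : T * V => cos (ph p.2 (a p.1))));
  exact: measurable_cos_ph.
Qed.

Lemma measurable_sS : measurable_fun setT (fun x => sS (a x)).
Proof.
by apply: (measurable_Rintegral2 sigma (f := fun p : T * V => sin (ph p.2 (a p.1))));
  exact: measurable_sin_ph.
Qed.

Lemma measurable_cS' : measurable_fun setT (fun x => cS' (a x) (t x)).
Proof.
apply: (measurable_Rintegral2 sigma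
  (f := fun p : T * V => - ph p.2 (a p.1) * sin (ph p.2 (t p.1 *: a p.1)))).
apply: measurable_funM; last exact: measurable_sin_ph.
by apply: measurableT_comp => //; exact: measurable_ph.
Qed.

Lemma measurable_sS' : measurable_fun setT (fun x => sS' (a x) (t x)).
Proof.
apply: (measurable_Rintegral2 sigma
  (f := fun p : T * V => ph p.2 (a p.1) * cos (ph p.2 (t p.1 *: a p.1)))).
by apply: measurable_funM; [exact: measurable_ph|exact: measurable_cos_ph].
Qed.

End measurability.

End sigma_transform.

(** * Littlewood-Paley pieces of the averages *)

Lemma Rintegral_sum {R : realType} d (T : measurableType d)
    (m : {measure set T -> \bar R}) (I : Type) (s : seq I) (h : I -> T -> R) :
  (forall i, m.-integrable setT (EFin \o h i)) ->
  m.-integrable setT (EFin \o (fun x => \sum_(i <- s) h i x)) /\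
  \int[m]_x (\sum_(i <- s) h i x) = \sum_(i <- s) \int[m]_x h i x.
Proof.
move=> hi; elim: s => [|i s [IHi IH]].
  split; last by rewrite big_nil; under eq_Rintegral do rewrite big_nil; by rewrite /Rintegral integral0.
  have := integrable0 m (setT : set T).
  by apply: eq_integrable => // x _; rewrite /= big_nil.
split; last first.
  by under eq_Rintegral do rewrite big_cons; rewrite RintegralD// big_cons IH.
have := integrableD measurableT (hi i) IHi.
by apply: eq_integrable => // x _; rewrite /= big_cons.
Qed.

Section operators.
Context {R : realType} {n : nat}.
Local Notation V := 'rV[R]_n.
Local Notation mu := (lebesgue_rV n).
Variables (sigma : {finite_measure set V -> \bar R}) (N : nat).
Implicit Types (f g : V -> R) (x y z w xi : V) (de t D : R).

Definition gavg f D z : R := \int[mu]_w (f w * gG D (z - w)).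

(* [Fop f de t] is A_t applied to f smoothed at scale t * de: its multiplier is
   m (t xi) exp (- pi de^2 |t xi|^2). *)
Definition Fop f de t x : R := \int[sigma]_y gavg f (t * de) (x - t *: y).

(** Uf + i Wf is the transform ct - i st of f times exp(i ph x xi), and [Phi] is the real part of
    its product with m(t xi) = cS - i sS. For real f, integration over xi sees only this real
    part. *)
Definition Uf f x xi : R := ct f xi * cos (ph x xi) + st f xi * sin (ph x xi).
Definition Wf f x xi : R := ct f xi * sin (ph x xi) - st f xi * cos (ph x xi).
Definition Phi f t x xi : R :=
  cS sigma (t *: xi) * Uf f x xi + sS sigma (t *: xi) * Wf f x xi.

Definition normL1 f : R := \int[mu]_w `|f w|.

Lemma normL1_ge0 f : 0 <= normL1 f. Proof. exact: Rintegral_ge0. Qed.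

(** The coefficient of e^{k+1} in the polynomial 1 - (1 - e)^{N+1}. *)
Definition bcoef (k : 'I_N.+1) : R := (-1) ^+ k * 'C(N.+1, k.+1)%:R.

(** Enlarging the smoothing scale by this factor raises the Gaussian multiplier to the power k + 1,
    so powers of e^{-r} are again Gaussian smoothings. *)
Definition sqk (k : 'I_N.+1) : R := Num.sqrt k.+1%:R.

Lemma sqk_ge1 k : 1 <= sqk k.
Proof. by rewrite /sqk -[leLHS]sqrtr1 ler_wsqrtr// ler1n. Qed.

Lemma sqk_gt0 k : 0 < sqk k. Proof. exact: lt_le_trans (sqk_ge1 k). Qed.

Lemma sqk_le k : sqk k <= Num.sqrt N.+1%:R.
Proof. by rewrite ler_wsqrtr// ler_nat. Qed.

Lemma bcoef_sum (e : R) : \sum_(k < N.+1) bcoef k * e ^+ k.+1 = 1 - (1 - e) ^+ N.+1.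
Proof.
rewrite exprBn [in RHS]big_ord_recl/= expr0 expr1n mul1r bin0 mulr1n mul1r.
rewrite opprD addrA subrr add0r -sumrN; apply: eq_bigr => k _.
rewrite /bcoef /bump/= add1n expr1n mulr1 -[in RHS]mulr_natr (exprS (-1)); ring.
Qed.

Lemma bcoef_sum1 : \sum_(k < N.+1) bcoef k = 1.
Proof.
have := bcoef_sum 1; rewrite subrr expr0n/= subr0 => <-.
by apply: eq_bigr => k _; rewrite expr1n mulr1.
Qed.

(* The combination of Gaussian smoothings with multiplier
   m (t xi) (1 - (1 - e^{-r})^{N+1}), r = pi de^2 |t xi|^2; as de -> 0 it tends
   to A_t, and [Top f de] is the difference of two consecutive dyadic scales. *)
Definition Pop f de t x : R := \sum_(k < N.+1) bcoef k * Fop f (sqk k * de) t x.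

Definition Top f de t x : R := Pop f de t x - Pop f (2 * de) t x.

Definition kap de xi : R := pi * de ^+ 2 * dotv xi xi.

Lemma kap_ge0 de xi : 0 <= kap de xi.
Proof. by rewrite /kap mulr_ge0 ?dotvv_ge0// mulr_ge0 ?pi_ge0 ?sqr_ge0. Qed.

Lemma gE_kap t de xi : gE (t * de) xi = expR (- (kap de xi * t ^+ 2)).
Proof. by rewrite /gE wtE /kap; congr (expR (- _)); ring. Qed.

Lemma gE_sqk t de xi k : gE (t * (sqk k * de)) xi = gE (t * de) xi ^+ k.+1.
Proof.
rewrite !gE_kap -expRM_natl; congr expR.
have -> : kap (sqk k * de) xi = k.+1%:R * kap de xi.
  by rewrite /kap exprMn sqr_sqrtr//; ring.
by rewrite mulrN -mulrA.
Qed.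

Section L1.
Variable f : V -> R.
Hypothesis fi : mu.-integrable setT (EFin \o f).

Let mf : measurable_fun setT f.
Proof. by apply/measurable_EFinP; exact: measurable_int fi. Qed.

Lemma norm_Uf_le x xi : `|Uf f x xi| <= normL1 f + normL1 f.
Proof.
apply: (le_trans (ler_normD _ _)); apply: lerD; rewrite normrM.
  by rewrite (le_trans (ler_piMr _ (norm_cos_le1 _))) ?norm_ct_le.
by rewrite (le_trans (ler_piMr _ (norm_sin_le1 _))) ?norm_st_le.
Qed.

Lemma norm_Wf_le x xi : `|Wf f x xi| <= normL1 f + normL1 f.
Proof.
apply: (le_trans (ler_normB _ _)); apply: lerD; rewrite normrM.
  by rewrite (le_trans (ler_piMr _ (norm_sin_le1 _))) ?norm_ct_le.
by rewrite (le_trans (ler_piMr _ (norm_cos_le1 _))) ?norm_st_le.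
Qed.

Lemma measurable_Uf d (T : measurableType d) (a b : T -> V) :
  measurable_fun setT a -> measurable_fun setT b ->
  measurable_fun setT (fun p => Uf f (a p) (b p)).
Proof.
move=> ma mb; apply: measurable_funD; apply: measurable_funM.
- exact: (measurableT_comp (measurable_ct fi)).
- exact: measurable_cos_ph.
- exact: (measurableT_comp (measurable_st fi)).
- exact: measurable_sin_ph.
Qed.

Lemma measurable_Wf d (T : measurableType d) (a b : T -> V) :
  measurable_fun setT a -> measurable_fun setT b ->
  measurable_fun setT (fun p => Wf f (a p) (b p)).
Proof.
move=> ma mb; apply: measurable_funB; apply: measurable_funM.
- exact: (measurableT_comp (measurable_ct fi)).
- exact: measurable_sin_ph.
- exact: (measurableT_comp (measurable_st fi)).
- exact: measurable_cos_ph.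
Qed.

Lemma measurable_Phi t x : measurable_fun setT (Phi f t x).
Proof.
have mt : measurable_fun setT (fun xi : V => t *: xi).
  by apply: measurable_funZ_rV; [exact: measurable_cst|exact: measurable_id].
have mx : measurable_fun setT (fun _ : V => x) by exact: measurable_cst.
apply: measurable_funD; apply: measurable_funM.
- exact: measurable_cS.
- exact: measurable_Uf.
- exact: measurable_sS.
- exact: measurable_Wf.
Qed.

Let M := normL1 f + normL1 f.

Lemma norm_cSsS_le (a b : R) x xi : `|a * Uf f x xi + b * Wf f x xi| <= (`|a| + `|b|) * M.
Proof.
apply: (le_trans (ler_normD _ _)); rewrite mulrDl.
by apply: lerD; rewrite normrM ler_wpM2l ?norm_Uf_le ?norm_Wf_le.
Qed.

Lemma norm_cSE xi : `|cS sigma xi| <= mass sigma /\ `|sS sigma xi| <= mass sigma.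
Proof.
have h (g : V -> R) : measurable_fun setT g -> (forall y, `|g y| <= 1) ->
    `|\int[sigma]_y g y| <= mass sigma.
  move=> mg g1; rewrite -lee_fin -massE; apply: (le_trans (le_abse_Rintegral _ _)).
  rewrite -[leRHS]mul1e -integral_cst//; apply: le_nnintegral => y //.
  by rewrite lee_fin.
split; apply: h => [|y].
- by apply: measurable_cos_ph => //; exact: measurable_cst.
- exact: norm_cos_le1.
- by apply: measurable_sin_ph => //; exact: measurable_cst.
- exact: norm_sin_le1.
Qed.

Lemma norm_Phi_le t x xi : `|Phi f t x xi| <= (mass sigma + mass sigma) * M.
Proof.
apply: (le_trans (norm_cSsS_le _ _ _ _)); have [h1 h2] := norm_cSE (t *: xi).
by apply: ler_wpM2r; [rewrite addr_ge0 ?normL1_ge0|exact: lerD].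
Qed.

Lemma integrable_gE_Phi D t x : 0 < D ->
  mu.-integrable setT (EFin \o (fun xi => gE D xi * Phi f t x xi)).
Proof.
move=> D0; apply: (integrable_bounded_mul (M := (mass sigma + mass sigma) * M)).
- exact: integrable_gE.
- exact: measurable_Phi.
- by move=> xi; exact: norm_Phi_le.
Qed.

(** Inversion at each point x - t y, then Fubini between sigma and the frequency. The phase of t y
    at xi is that of y at t xi, so the addition formulas produce the transforms of sigma at t xi. *)
Lemma FopE de t x : 0 < de -> 0 < t ->
  Fop f de t x = \int[mu]_xi (gE (t * de) xi * Phi f t x xi).
Proof.
move=> d0 t0; have td0 : 0 < t * de by rewrite mulr_gt0.
transitivity (\int[sigma]_y \int[mu]_xi (gE (t * de) xi * Uf f (x - t *: y) xi)).
  by apply: eq_Rintegral => y _; rewrite /gavg gG_inversion.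
have mx : measurable_fun setT (fun p : V * V => x - t *: p.1).
  apply: measurable_funB_rV; first exact: measurable_cst.
  by apply: measurable_funZ_rV => //; exact: measurable_cst.
have mF : measurable_fun setT (fun p : V * V => gE (t * de) p.2 * Uf f (x - t *: p.1) p.2).
  apply: measurable_funM; last exact: measurable_Uf.
  by apply: (measurableT_comp (measurable_gE _)); exact: measurable_snd.
have M0 : 0 <= M by rewrite addr_ge0 ?normL1_ge0.
have B (y xi : V) : `|gE (t * de) xi * Uf f (x - t *: y) xi| <=
    cst 1 y * (gE (t * de) xi * M).
  rewrite mul1r normrM (gtr0_norm (gE_gt0 _ _)).
  by rewrite ler_wpM2l ?norm_Uf_le// ltW// gE_gt0.
have hi : mu.-integrable setT (EFin \o (fun y => gE (t * de) y * M)).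
  by apply: (integrable_bounded_mul (M := `|M|)) => //; exact: integrable_gE.
have gi : sigma.-integrable setT (EFin \o cst 1).
  by apply: finite_measure_integrable_cst.
have g0 (y : V) : 0 <= cst 1 y :> R by [].
have h0 y : 0 <= gE (t * de) y * M by rewrite mulr_ge0// ltW// gE_gt0.
rewrite (Rfubini mF g0 h0 B gi hi); apply: eq_Rintegral => xi _.
have mc : measurable_fun setT (fun y : V => cos (ph y (t *: xi))).
  by apply: measurable_cos_ph => //; exact: measurable_cst.
have ms : measurable_fun setT (fun y : V => sin (ph y (t *: xi))).
  by apply: measurable_sin_ph => //; exact: measurable_cst.
have ic : sigma.-integrable setT (EFin \o (fun y => cos (ph y (t *: xi)))).
  have := integrable_bounded_mul gi mc (fun y => norm_cos_le1 _).
  by apply: eq_integrable => // y _ /=; rewrite mul1r.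
have iS : sigma.-integrable setT (EFin \o (fun y => sin (ph y (t *: xi)))).
  have := integrable_bounded_mul gi ms (fun y => norm_sin_le1 _).
  by apply: eq_integrable => // y _ /=; rewrite mul1r.
transitivity (\int[sigma]_y (gE (t * de) xi * Uf f x xi * cos (ph y (t *: xi)) +
    gE (t * de) xi * Wf f x xi * sin (ph y (t *: xi)))).
  apply: eq_Rintegral => y _; rewrite /Uf /Wf phB.
  have -> : ph (t *: y) xi = ph y (t *: xi).
    rewrite /ph; congr (_ * _); rewrite /dotv; apply: eq_bigr => i _.
    by rewrite !mxE mulrCA mulrA.
  by rewrite cosB sinB; ring.
rewrite RintegralD//.
- by rewrite RintegralZl// RintegralZl// /Phi -/(cS sigma (t *: xi)) -/(sS sigma (t *: xi)); ring.
- have := integrableZl measurableT (gE (t * de) xi * Uf f x xi) ic; exact: eq_integrable.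
- have := integrableZl measurableT (gE (t * de) xi * Wf f x xi) iS; exact: eq_integrable.
Qed.

Lemma PopE de t x : 0 < de -> 0 < t ->
  mu.-integrable setT (EFin \o (fun xi => (1 - (1 - gE (t * de) xi) ^+ N.+1) * Phi f t x xi)) /\
  Pop f de t x = \int[mu]_xi ((1 - (1 - gE (t * de) xi) ^+ N.+1) * Phi f t x xi).
Proof.
move=> d0 t0.
have ii k : mu.-integrable setT
    (EFin \o (fun xi => bcoef k * (gE (t * (sqk k * de)) xi * Phi f t x xi))).
  have td : 0 < t * (sqk k * de) by rewrite !mulr_gt0// sqk_gt0.
  by have := integrableZl measurableT (bcoef k) (integrable_gE_Phi t x td); exact: eq_integrable.
have E xi : (1 - (1 - gE (t * de) xi) ^+ N.+1) * Phi f t x xi =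
    \sum_(k < N.+1) bcoef k * (gE (t * (sqk k * de)) xi * Phi f t x xi).
  rewrite -bcoef_sum mulr_suml; apply: eq_bigr => k _.
  by rewrite gE_sqk mulrA.
split.
  by under eq_fun do rewrite E; have [] := Rintegral_sum (index_enum 'I_N.+1) ii.
under [RHS]eq_Rintegral do rewrite E.
have [_ ->] := Rintegral_sum (index_enum 'I_N.+1) ii; apply: eq_bigr => k _.
rewrite RintegralZl//; last by apply: integrable_gE_Phi; rewrite !mulr_gt0// sqk_gt0.
by rewrite FopE// mulr_gt0// sqk_gt0.
Qed.

Lemma TopE de t x : 0 < de -> 0 < t ->
  mu.-integrable setT (EFin \o (fun xi => psi1 N (kap de xi * t ^+ 2) * Phi f t x xi)) /\
  Top f de t x = \int[mu]_xi (psi1 N (kap de xi * t ^+ 2) * Phi f t x xi).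
Proof.
move=> d0 t0; have d20 : 0 < 2 * de by rewrite mulr_gt0.
have [i1 e1] := PopE x d0 t0; have [i2 e2] := PopE x d20 t0.
have E xi : psi1 N (kap de xi * t ^+ 2) * Phi f t x xi =
  (1 - (1 - gE (t * de) xi) ^+ N.+1) * Phi f t x xi -
  (1 - (1 - gE (t * (2 * de)) xi) ^+ N.+1) * Phi f t x xi.
  have -> : gE (t * (2 * de)) xi = expR (- (4 * (kap de xi * t ^+ 2))).
    by rewrite gE_kap /kap; congr (expR (- _)); ring.
  by rewrite gE_kap /psi1 -mulrBl; congr (_ * _); ring.
split; last first.
  by under eq_Rintegral do rewrite E; rewrite RintegralB// -e1 -e2.
have := integrableB measurableT i1 i2; apply: eq_integrable => // xi _.
by rewrite /= E.
Qed.

End L1.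

(** Additivity is read off on the frequency side, where every integral that has to be split is known
    to converge. *)
Lemma TopD f g de t x : 0 < de -> 0 < t -> mu.-integrable setT (EFin \o f) ->
  mu.-integrable setT (EFin \o g) ->
  Top (fun w => f w + g w) de t x = Top f de t x + Top g de t x.
Proof.
move=> d0 t0 fi gi.
have fgi : mu.-integrable setT (EFin \o (fun w => f w + g w)).
  by have := integrableD measurableT fi gi; apply: eq_integrable.
have [i1 ->] := TopE fi x d0 t0; have [i2 ->] := TopE gi x d0 t0.
have [_ ->] := TopE fgi x d0 t0.
rewrite -RintegralD//; apply: eq_Rintegral => xi _.
have c : ct (fun w => f w + g w) xi = ct f xi + ct g xi.
  rewrite /ct -RintegralD//; [|exact: integrable_cosM|exact: integrable_cosM].
  by apply: eq_Rintegral => w _; rewrite mulrDl.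
have s : st (fun w => f w + g w) xi = st f xi + st g xi.
  rewrite /st -RintegralD//; [|exact: integrable_sinM|exact: integrable_sinM].
  by apply: eq_Rintegral => w _; rewrite mulrDl.
by rewrite /Phi /Uf /Wf c s; ring.
Qed.

Lemma measurable_gavg d (T : measurableType d) f D (a : T -> V) :
  measurable_fun setT f -> measurable_fun setT a ->
  measurable_fun setT (fun p => gavg f D (a p)).
Proof.
move=> mf ma.
apply: (measurable_Rintegral2 mu (f := fun p : T * V => f p.2 * gG D (a p.1 - p.2))).
apply: measurable_funM; first by apply: (measurableT_comp mf); exact: measurable_snd.
apply: (measurableT_comp (measurable_gG D)); apply: measurable_funB_rV; last exact: measurable_snd.
by apply: (measurableT_comp ma); exact: measurable_fst.
Qed.

Section HLbound.
Variables (R0 Cs beta : R).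
Hypotheses (R00 : 0 < R0) (supp : sigma (~` cube 0 R0) = 0%E) (Cs0 : 0 <= Cs).
Hypothesis dim : forall y r, 0 < r -> (sigma (cube y r) <= (Cs * r `^ beta)%:E)%E.
Hypothesis beta_n : 0 <= beta <= n%:R.

Lemma Pop_HLmax : exists2 K : R, 0 <= K & forall f de t x,
  measurable_fun setT f -> (forall x, 0 <= f x) -> 0 < de -> de <= 1 -> 0 < t ->
  (`|Pop f de t x|%:E <= (K * de `^ (beta - n%:R))%:E * HLmax f x)%E.
Proof.
(* The scales occurring in [Pop] are up to sqrt(N+1) times larger than de <= 1. Since beta <= n,
   these factors do not worsen the power of de. *)
have [K K0 KP] := kernel_HLmax R00 supp Cs0 dim beta_n (Num.sqrt N.+1%:R).
exists ((\sum_(k < N.+1) `|bcoef k|) * K) => [|f de t x mf f0 d0 d1 t0].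
  by rewrite mulr_ge0// sumr_ge0.
have H0 := HLmax_ge0 x f0.
have h k : (`|Fop f (sqk k * de) t x|%:E <= (K * de `^ (beta - n%:R))%:E * HLmax f x)%E.
  have s0 := sqk_gt0 k; have sd : 0 < sqk k * de by rewrite mulr_gt0.
  have sd1 : sqk k * de <= Num.sqrt N.+1%:R.
    by rewrite (le_trans _ (sqk_le k))// ler_piMr// ltW.
  apply: (@le_trans _ _ ((K * (sqk k * de) `^ (beta - n%:R))%:E * HLmax f x)%E).
    apply: le_trans (KP f _ t x mf f0 sd sd1 t0).
    apply: (le_trans (le_abse_Rintegral _ _)); apply: le_nnintegral => y; first by rewrite lee_fin.
    apply: (le_trans (le_abse_Rintegral _ _)); apply: le_nnintegral => w; first by rewrite lee_fin.
    by rewrite lee_fin ger0_norm// mulr_ge0// gG_ge0// mulr_gt0.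
  apply: lee_wpmul2r => //; rewrite lee_fin ler_wpM2l// powRM ?(ltW d0) ?(ltW s0)//.
  rewrite -[leRHS]mul1r ler_wpM2r ?powR_ge0//.
  rewrite -[leRHS](powRr0 (sqk k)) ler_powR ?sqk_ge1//.
  by case/andP: beta_n => _; rewrite subr_le0.
apply: (@le_trans _ _ (\sum_(k < N.+1) (`|bcoef k| * `|Fop f (sqk k * de) t x|)%:E)%E).
  rewrite sumEFin lee_fin; apply: (le_trans (ler_norm_sum _ _ _)).
  by apply: ler_sum => k _; rewrite normrM.
apply: (@le_trans _ _ (\sum_(k < N.+1) ((`|bcoef k| * (K * de `^ (beta - n%:R)))%:E * HLmax f x))%E).
  apply: lee_sum => k _; rewrite (EFinM `|bcoef k| `|_|) (EFinM `|bcoef k|) -muleA.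
  by rewrite lee_wpmul2l ?lee_fin//; exact: h.
rewrite -ge0_sume_distrl; last first.
  by move=> k _; rewrite lee_fin !mulr_ge0 ?powR_ge0.
by apply: lee_wpmul2r => //; rewrite sumEFin lee_fin -mulr_suml mulrA.
Qed.

Lemma Top_HLmax : exists2 K : R, 0 <= K & forall f de t x,
  measurable_fun setT f -> (forall x, 0 <= f x) -> 0 < de -> de <= 2^-1 -> 0 < t ->
  (`|Top f de t x|%:E <= (K * de `^ (beta - n%:R))%:E * HLmax f x)%E.
Proof.
have [K K0 KP] := Pop_HLmax; exists (K + K) => [|f de t x mf f0 d0 d1 t0].
  exact: addr_ge0.
have H0 := HLmax_ge0 x f0.
have d20 : 0 < 2 * de by rewrite mulr_gt0.
have d21 : 2 * de <= 1 by rewrite mulrC -ler_pdivlMr// mul1r.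
have d11 : de <= 1 by rewrite (le_trans d1)// invf_le1// ler1n.
apply: (@le_trans _ _ (`|Pop f de t x|%:E + `|Pop f (2 * de) t x|%:E)%E).
  by rewrite -EFinD lee_fin ler_normB.
rewrite [(K + K) * _]mulrDl EFinD ge0_muleDl ?lee_fin ?mulr_ge0 ?powR_ge0//.
apply: leeD; first exact: KP.
apply: (le_trans (KP f _ t x mf f0 d20 d21 t0)).
apply: lee_wpmul2r => //; rewrite lee_fin ler_wpM2l// powRM ?(ltW d0)//.
rewrite -[leRHS]mul1r ler_wpM2r ?powR_ge0//.
rewrite -[leRHS](powRr0 2) ler_powR ?ler1n//.
by case/andP: beta_n => _; rewrite subr_le0.
Qed.

End HLbound.

Definition avg f t x : R := \int[sigma]_y f (x - t *: y).

Section approximation.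
Variables (f : V -> R) (B : R).
Hypotheses (cf : continuous f) (fB : forall x, `|f x| <= B).

Let mf : measurable_fun setT f. Proof. exact: continuous_measurable_rV. Qed.

Let B0 : 0 <= B. Proof. exact: le_trans (fB 0). Qed.

(** Half of the exponent forms a normalized kernel at scale sqrt 2 D; the other half is small away
    from 0. *)
Lemma gG_split D z : 0 < D -> gG D z =
  Num.sqrt 2 ^+ n * gG (Num.sqrt 2 * D) z * expR (- (pi / (2 * D ^+ 2) * dotv z z)).
Proof.
move=> D0; have s0 : 0 < Num.sqrt 2 :> R by rewrite sqrtr_gt0.
rewrite /gG !wtE mulrA -exprMn -[in RHS]mulrA -expRD.
have -> : Num.sqrt 2 * (Num.sqrt 2 * D)^-1 = D^-1 by field; rewrite !gt_eqF.
congr (_ * expR _); rewrite exprMn sqr_sqrtr//.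
by move: (@pi R) => P; field; rewrite gt_eqF.
Qed.

Lemma norm_gavg_le D z : 0 < D -> `|gavg f D z| <= B.
Proof.
move=> D0; rewrite -lee_fin; apply: (le_trans (le_abse_Rintegral _ _)).
rewrite -[leRHS]mule1 -(integral_gGB z D0) -ge0_integralZl_EFin//.
- apply: le_nnintegral => w; first by rewrite lee_fin.
  by rewrite -EFinM lee_fin normrM (ger0_norm (gG_ge0 _ D0)) ler_wpM2r// gG_ge0.
- by move=> w _; rewrite lee_fin gG_ge0.
- by have := measurable_int _ (integrable_gGB z D0).
Qed.

(** Continuity gives e on a cube around z. Outside it, [gG_split] and exp(-a) <= 1/a with a = pi r^2
    / (2 D^2) give the factor D^2, and boundedness of f does the rest. *)
Lemma gavg_sub_le z e : 0 < e -> exists2 C : R, 0 <= C & forall D, 0 < D ->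
  `|gavg f D z - f z| <= e + C * D ^+ 2.
Proof.
move=> e0; have /cvgrPdist_lt/(_ e e0)/nbhs_ballP[r /= r0 rf] := @cf z.
have rf' w : cube z r w -> `|f w - f z| < e.
  move=> zw; rewrite distrC; apply: rf; split => // i j; rewrite (ord1 i); exact: zw.
pose s2 : R := Num.sqrt 2.
have s0 : 0 < s2 by rewrite sqrtr_gt0.
exists (2 * B * s2 ^+ n * (2 / (pi * r ^+ 2))) => [|D D0].
  apply: mulr_ge0; first by rewrite mulr_ge0 ?exprn_ge0 ?mulr_ge0// ltW.
  by rewrite divr_ge0// mulr_ge0 ?pi_ge0 ?sqr_ge0.
set C := 2 * B * _ * _; have sD0 : 0 < s2 * D by rewrite mulr_gt0.
have G0 w : 0 <= gG D (z - w) by exact: gG_ge0.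
have G20 w : 0 <= gG (s2 * D) (z - w) by exact: gG_ge0.
have C0 : 0 <= C.
  apply: mulr_ge0; first by rewrite mulr_ge0 ?exprn_ge0 ?mulr_ge0// ltW.
  by rewrite divr_ge0// mulr_ge0 ?pi_ge0 ?sqr_ge0.
have p w : `|(f w - f z) * gG D (z - w)| <=
    e * gG D (z - w) + C * D ^+ 2 * gG (s2 * D) (z - w).
  rewrite normrM (ger0_norm (G0 w)).
  have [zw|zw] := pselect (cube z r w).
    apply: (@le_trans _ _ (e * gG D (z - w))); first by rewrite ler_wpM2r// ltW// rf'.
    by rewrite lerDl mulr_ge0// mulr_ge0// sqr_ge0.
  apply: (@le_trans _ _ (C * D ^+ 2 * gG (s2 * D) (z - w))); last by rewrite lerDr mulr_ge0// ltW.
  have [l rl] : exists l, r <= `|(z - w) ord0 l|.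
    apply/existsP; apply: contrapT => /negP; rewrite negb_exists => /forallP h.
    by apply: zw; apply/cubeP => l; have := h l; rewrite -ltNge !mxE.
  have rd : r ^+ 2 <= dotv (z - w) (z - w).
    apply: (@le_trans _ _ ((z - w) ord0 l ^+ 2)).
      by rewrite -[leRHS]real_normK ?num_real// lerXn2r ?nnegrE// ltW.
    rewrite /dotv (bigD1 l)//= -expr2 lerDl sumr_ge0// => k _.
    by rewrite -expr2 sqr_ge0.
  rewrite (gG_split _ D0) -/s2.
  have pr : 0 < pi / (2 * D ^+ 2) * r ^+ 2.
    by rewrite mulr_gt0 ?exprn_gt0// divr_gt0 ?pi_gt0// mulr_gt0// exprn_gt0.
  have E : expR (- (pi / (2 * D ^+ 2) * dotv (z - w) (z - w))) <= 2 / (pi * r ^+ 2) * D ^+ 2.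
    apply: (@le_trans _ _ (expR (- (pi / (2 * D ^+ 2) * r ^+ 2)))).
      by rewrite ler_expR lerN2 ler_wpM2l// divr_ge0 ?pi_ge0// mulr_ge0// sqr_ge0.
    rewrite expRN; apply: (@le_trans _ _ ((pi / (2 * D ^+ 2) * r ^+ 2)^-1)).
      rewrite lef_pV2 ?posrE ?expR_gt0//; apply: le_trans (expR_ge1Dx _).
      by rewrite lerDr.
    rewrite le_eqVlt; apply/orP; left; apply/eqP.
    by have := @pi_gt0 R; move: (@pi R) => P P0; field; rewrite !gt_eqF.
  have fw : `|f w - f z| <= 2 * B.
    by apply: (le_trans (ler_normB _ _)); rewrite mulr2n mulrDl mul1r lerD.
  apply: (@le_trans _ _ (2 * B * (s2 ^+ n * gG (s2 * D) (z - w) * (2 / (pi * r ^+ 2) * D ^+ 2)))).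
    have sg0 : 0 <= s2 ^+ n * gG (s2 * D) (z - w).
      by apply: mulr_ge0 => //; rewrite exprn_ge0// ltW.
    by apply: ler_pM => //; [apply: mulr_ge0 => //; exact: expR_ge0|exact: ler_wpM2l].
  by rewrite /C le_eqVlt; apply/orP; left; apply/eqP; ring.
have igG := integrable_gGB z D0.
have ifG : mu.-integrable setT (EFin \o (fun w => f w * gG D (z - w))).
  have := integrable_bounded_mul igG mf fB; apply: eq_integrable => // w _ /=.
  by rewrite mulrC.
have -> : gavg f D z - f z = \int[mu]_w ((f w - f z) * gG D (z - w)).
  transitivity (gavg f D z - \int[mu]_w (f z * gG D (z - w))).
    by congr (_ - _); rewrite RintegralZl// /Rintegral integral_gGB// mulr1.
  rewrite /gavg -RintegralB//; last first.
    by have := integrableZl measurableT (f z) igG; exact: eq_integrable.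
  by apply: eq_Rintegral => w _; rewrite mulrBl.
have mG D' : 0 < D' -> measurable_fun setT (fun w => (gG D' (z - w))%:E).
  by move=> D'0; have := measurable_int _ (integrable_gGB z D'0).
rewrite -lee_fin; apply: (le_trans (le_abse_Rintegral _ _)).
apply: (@le_trans _ _ (\int[mu]_w (e%:E * (gG D (z - w))%:E +
    (C * D ^+ 2)%:E * (gG (s2 * D) (z - w))%:E))%E).
  by apply: le_nnintegral => w; rewrite lee_fin.
have Zl c D' : 0 <= c -> 0 < D' -> (\int[mu]_w (c%:E * (gG D' (z - w))%:E) = c%:E)%E.
  move=> c0 D'0; rewrite ge0_integralZl_EFin ?integral_gGB ?mule1//; last exact: mG.
  by move=> w _; rewrite lee_fin gG_ge0.
have CD0 : 0 <= C * D ^+ 2 by rewrite mulr_ge0// sqr_ge0.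
rewrite ge0_integralD//.
- by rewrite !Zl// ltW.
- by move=> w _; rewrite mule_ge0 ?lee_fin// ltW.
- by apply: emeasurable_funM; [exact: measurable_cst|exact: mG].
- by move=> w _; rewrite mule_ge0 ?lee_fin.
- by apply: emeasurable_funM; [exact: measurable_cst|exact: mG].
Qed.

Lemma gavg_cvg (D : nat -> R) z : (forall k, 0 < D k) -> D k @[k --> \oo] --> (0 : R) ->
  gavg f (D k) z @[k --> \oo] --> f z.
Proof.
move=> D0 Dc; apply/cvgrPdist_le => e e0.
have e20 : 0 < e / 2 by rewrite divr_gt0.
have [C C0 CP] := gavg_sub_le z e20.
have h : (C * (D k * D k) : R) @[k --> \oo] --> (C * (0 * 0) : R).
  by apply: cvgM; [exact: cvg_cst|exact: cvgM].
have {}h : (C * (D k * D k) : R) @[k --> \oo] --> (0 : R) by move: h; rewrite mulr0 mulr0.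
move/cvgrPdist_le : h => /(_ _ e20); apply: filterS => k /= hk.
rewrite distrC (le_trans (CP _ (D0 k)))// [leRHS]splitr lerD2l expr2.
by move: hk; rewrite sub0r normrN; apply: le_trans; rewrite ler_norm.
Qed.

Lemma Fop_cvg (D : nat -> R) t x : 0 < t -> (forall k, 0 < D k) ->
  D k @[k --> \oo] --> (0 : R) -> Fop f (D k) t x @[k --> \oo] --> avg f t x.
Proof.
move=> t0 D0 Dc; have mx : measurable_fun setT (fun y : V => x - t *: y).
  apply: measurable_funB_rV; first exact: measurable_cst.
  by apply: measurable_funZ_rV; [exact: measurable_cst|exact: measurable_id].
apply: (@dominated_Rintegral _ _ _ sigma (fun k y => gavg f (t * D k) (x - t *: y))
  (fun y => f (x - t *: y)) (cst B)).
- by move=> k; exact: measurable_gavg.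
- exact: (measurableT_comp mf mx).
- move=> y; apply: gavg_cvg => [k|]; first by rewrite mulr_gt0.
  by rewrite -[X in _ --> X](mulr0 t); apply: cvgM => //; exact: cvg_cst.
- exact: finite_measure_integrable_cst.
- by move=> k y; rewrite norm_gavg_le// mulr_gt0.
Qed.

Lemma Pop_cvg t x : 0 < t -> Pop f (2^-1 ^+ k) t x @[k --> \oo] --> avg f t x.
Proof.
move=> t0; 
  have -> : avg f t x = \sum_i bcoef i * avg f t x by rewrite -mulr_suml bcoef_sum1 mul1r.
apply: cvg_big => [|i _]; first exact: add_continuous.
  apply: cvgM; first exact: cvg_cst.
apply: (@Fop_cvg (fun k => sqk i * 2^-1 ^+ k)) => //.
  by move=> k; rewrite mulr_gt0 ?sqk_gt0 ?exprn_gt0.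
rewrite -[X in _ --> X](mulr0 (sqk i)); apply: cvgM; first exact: cvg_cst.
by apply: cvg_expr; rewrite ger0_norm// invf_lt1// ltr1n.
Qed.

(** The sum of the [Top] telescopes to [Pop] at scale 2^{-J}, which converges to the average.
    Continuity and boundedness enter only here, for the whole function: its truncations are
    discontinuous, but they occur only inside [Top]. *)
Lemma avg_le t x : 0 < t -> (`|avg f t x|%:E <= `|Pop f 1 t x|%:E +
  \sum_(j <oo) `|Top f (2^-1 ^+ j.+1) t x|%:E)%E.
Proof.
move=> t0; set S := (\sum_(j <oo) _)%E.
have tele J : Pop f (2^-1 ^+ J) t x = Pop f 1 t x + \sum_(0 <= j < J) Top f (2^-1 ^+ j.+1) t x.
  elim: J => [|J IH]; first by rewrite expr0 big_geq// addr0.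
  rewrite big_nat_recr//= addrA -IH /Top.
  have -> : 2 * 2^-1 ^+ J.+1 = 2^-1 ^+ J :> R by rewrite exprS mulrA divff// mul1r.
  by rewrite addrC subrK.
have b J : (`|Pop f (2^-1 ^+ J) t x|%:E <= `|Pop f 1 t x|%:E + S)%E.
  rewrite tele; apply: (@le_trans _ _ (`|Pop f 1 t x| +
      \sum_(0 <= j < J) `|Top f (2^-1 ^+ j.+1) t x|)%:E).
    by rewrite lee_fin (le_trans (ler_normD _ _))// lerD2l ler_norm_sum.
  rewrite EFinD leeD2l// -sumEFin; apply: nneseries_lim_ge => j _ _.
  by rewrite lee_fin.
have S0 : (0 <= S)%E by apply: nneseries_ge0 => j _ _; rewrite lee_fin.
case: S S0 b => [s| |]// s0 b; last by rewrite addey ?leey.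
rewrite -EFinD lee_fin.
have h : `|Pop f (2^-1 ^+ k) t x| @[k --> \oo] --> `|avg f t x|.
  by apply: cvg_norm; exact: Pop_cvg.
rewrite -(cvg_lim _ h)//; apply: limr_le; first by apply/cvg_ex; eexists; exact: h.
by apply: nearW => k; rewrite -lee_fin EFinD; exact: b.
Qed.

End approximation.

End operators.

(** * The one-dimensional Sobolev inequality and bounds for the cutoff *)

Section calculus2.
Context {R : realType}.
Local Notation leb := (@lebesgue_measure R).

(** By the fundamental theorem h(s)^2 <= h(r)^2 + int 2 |h h'|; averaging over r in [1, 2], an
    interval of length 1, removes r. Then 2 |h h'| <= la h^2 + la^{-1} h'^2. *)
Lemma sup_sqr_le (h h' : R -> R) (la s : R) : 0 < la -> 1 <= s <= 2 ->
  (forall r : R, 1 <= r <= 2 -> is_derive r 1 h (h' r)) ->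
  (forall r : R, 1 <= r <= 2 -> {for r, continuous h'}) ->
  measurable_fun setT h -> measurable_fun setT h' ->
  (((h s) ^+ 2)%:E <= \int[leb]_(r in `[1%R, 2%R]) ((1 + la) * h r ^+ 2 + la^-1 * h' r ^+ 2)%:E)%E.
Proof.
move=> la0 s12 dh ch' mh mh'.
have ch r : 1 <= r <= 2 -> {for r, continuous h}.
  move=> /dh[d _]; exact/differentiable_continuous/derivable1_diffP.
pose J := (\int[leb]_(r in `[1%R, 2%R]) `|2 * h r * h' r|%:E)%E.
have J0 : (0 <= J)%E by apply: integral_ge0 => r _; rewrite lee_fin.
have mJ : measurable_fun setT (fun r => 2 * h r * h' r).
  by apply: measurable_funM => //; apply: measurable_funM.
have inc a b : 1 <= a -> a < b -> b <= 2 -> (`|h b ^+ 2 - h a ^+ 2|%:E <= J)%E.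
  move=> a1 ab b2.
  have ab12 r : a <= r <= b -> 1 <= r <= 2 by lra.
  have dH r : a <= r <= b -> is_derive r 1 (fun r => h r ^+ 2) (2 * h r * h' r).
    move=> /ab12/dh d; rewrite (_ : (fun _ => _) = h ^+ 2); last first.
      by apply/funext => z; rewrite exprfctE.
    by apply: is_derive_eq; rewrite /GRing.scale/= expr1; ring.
  have cH r : a <= r <= b -> {for r, continuous (fun r => h r ^+ 2)}.
    by move=> /dH[d _]; exact/differentiable_continuous/derivable1_diffP.
  have cc r : a <= r <= b -> {for r, continuous (fun r => 2 * h r * h' r)}.
    move=> /ab12 r12; apply: cvgM; last exact: ch'.
    by apply: cvgM; [exact: cvg_cst|exact: ch].
  have := @continuous_FTC2 R (fun r => 2 * h r * h' r) (fun r => h r ^+ 2) a b ab.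
  have c1 : {within `[a, b], continuous (fun r => 2 * h r * h' r)}.
    apply: continuous_in_subspaceT => r /set_mem; rewrite /= in_itv/=; exact: cc.
  have c2 : derivable_oo_LRcontinuous (fun r => h r ^+ 2) a b.
    split.
    - move=> r; rewrite in_itv/= => /andP[ar rb].
      by have [] := dH r (introT andP (conj (ltW ar) (ltW rb))).
    - by apply: cvg_at_right_filter; apply: cH; rewrite lexx ltW.
    - by apply: cvg_at_left_filter; apply: cH; rewrite lexx ltW.
  have c3 : {in `]a, b[, (fun r => h r ^+ 2)^`()%classic =1 (fun r => 2 * h r * h' r)}.
    move=> r; rewrite in_itv/= => /andP[ar rb]; rewrite derive1E.
    by have [] := dH r (introT andP (conj (ltW ar) (ltW rb))).
  move=> /(_ c1 c2 c3) FTC.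
  rewrite (_ : `|_|%:E = `|(h b ^+ 2)%:E - (h a ^+ 2)%:E|)%E// -FTC.
  apply: (le_trans (le_abse_integral _ _ _)) => //.
    by apply/measurable_EFinP; exact: measurable_funTS.
  apply: ge0_subset_integral => //.
  - by apply/measurable_EFinP; apply: measurable_funTS; exact: measurableT_comp.
have inc2 r : 1 <= r <= 2 -> ((h s ^+ 2)%:E <= (h r ^+ 2)%:E + J)%E.
  move=> r12; case: (ltgtP r s) => [rs|sr|->]; last by rewrite leeDl.
  - apply: (@le_trans _ _ ((h r ^+ 2)%:E + `|h s ^+ 2 - h r ^+ 2|%:E)%E).
      by rewrite -EFinD lee_fin -lerBlDl ler_norm.
    by rewrite leeD2l// inc//; lra.
  - apply: (@le_trans _ _ ((h r ^+ 2)%:E + `|h r ^+ 2 - h s ^+ 2|%:E)%E).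
      by rewrite -EFinD lee_fin distrC -lerBlDl ler_norm.
    by rewrite leeD2l// inc//; lra.
have l12 : leb `[1%R, 2%R] = 1%E.
  rewrite lebesgue_measure_itv/= lte_fin ltr1n -EFinD; congr (_%:E); ring.
have cI (c : \bar R) : (0 <= c)%E -> (\int[leb]_(r in `[1%R, 2%R]) c = c)%E.
  move=> c0; rewrite integral_cst//; first by move: l12 => /= ->; rewrite mule1.
have msq (D : set (measurableTypeR R)) (k : R -> R) :
    measurable_fun setT k -> measurable_fun D (fun r => (k r ^+ 2)%:E).
  by move=> mk; apply/measurable_EFinP; apply: measurable_funTS; exact: measurable_funX.
apply: (@le_trans _ _ (\int[leb]_(r in `[1%R, 2%R]) ((h r ^+ 2)%:E + J))%E).
  rewrite -[leLHS](cI _ _); last by rewrite lee_fin sqr_ge0.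
  apply: ge0_le_integral => //.
  - by move=> r _; rewrite lee_fin sqr_ge0.
  - by apply: emeasurable_funD; [exact: msq|exact: measurable_cst].
rewrite ge0_integralD//; first last.
- exact: msq.
- by move=> r _; rewrite lee_fin sqr_ge0.
rewrite cI// /J -ge0_integralD//; first last.
- by apply/measurable_EFinP; apply: measurable_funTS; exact: measurableT_comp.
- exact: msq.
- by move=> r _; rewrite lee_fin sqr_ge0.
apply: ge0_le_integral => //.
- by move=> r _; rewrite -EFinD lee_fin addr_ge0// sqr_ge0.
- apply: emeasurable_funD; first exact: msq.
  by apply/measurable_EFinP; apply: measurable_funTS; exact: measurableT_comp.
- apply/measurable_EFinP; apply: measurable_funTS; apply: measurable_funD;
    by apply: measurable_funM => //; exact: measurable_funX.
move=> r _; rewrite -EFinD lee_fin (mulrDl 1 la) mul1r -addrA lerD2l.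
have [a b] : 0 <= Num.sqrt la /\ 0 < Num.sqrt la by rewrite sqrtr_ge0 sqrtr_gt0.
have e : la = Num.sqrt la ^+ 2 by rewrite sqr_sqrtr// ltW.
rewrite e; move: (Num.sqrt la) b (h r) (h' r) => q q0 x y.
rewrite -(real_normK (num_real x)) -(real_normK (num_real y)) !normrM (ger0_norm (ler0n _ 2)).
move: `|x| `|y| => {}x {}y.
have -> : q ^+ 2 * x ^+ 2 + (q ^+ 2)^-1 * y ^+ 2 = (q * x - q^-1 * y) ^+ 2 + 2 * x * y.
  by field; rewrite gt_eqF.
by rewrite lerDr sqr_ge0.
Qed.

Lemma exprn_le_expR (m : nat) (r : R) : 0 <= r -> r ^+ m <= m`!%:R * expR r.
Proof.
move=> r0; case: m => [|m].
  by rewrite expr0 fact0 mul1r -expR0 ler_expR.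
have f0 : 0 < m.+1`!%:R :> R by rewrite ltr0n fact_gt0.
rewrite -ler_pdivrMl// mulrC; apply: le_trans (expR_ge1Dxn m r0).
by rewrite lerDr.
Qed.

Lemma gbump_le_exp N (r : R) : 0 <= r ->
  gbump N r <= N.+1`!%:R * 2 ^+ N.+1 * expR (- (r / 2)).
Proof.
move=> r0; have h := exprn_le_expR N.+1 (divr_ge0 r0 (ler0n R 2)).
have -> : gbump N r = 2 ^+ N.+1 * (r / 2) ^+ N.+1 * expR (- r).
  by rewrite /gbump -exprMn [2 * _]mulrC divfK.
have -> : expR (- r) = expR (- (r / 2)) * expR (- (r / 2)).
  by rewrite -expRD; congr expR; field.
have e : expR (r / 2) * expR (- (r / 2)) = 1 by rewrite -expRD subrr expR0.
have XE : (r / 2) ^+ N.+1 * expR (- (r / 2)) <= N.+1`!%:R.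
  by apply: (le_trans (ler_wpM2r (expR_ge0 _) h)); rewrite -mulrA e mulr1.
move: (expR (- (r / 2))) (expR_ge0 (- (r / 2))) XE => E E0 XE.
have -> : 2 ^+ N.+1 * (r / 2) ^+ N.+1 * (E * E) = 2 ^+ N.+1 * E * ((r / 2) ^+ N.+1 * E) by ring.
have -> : N.+1`!%:R * 2 ^+ N.+1 * E = 2 ^+ N.+1 * E * N.+1`!%:R by ring.
by apply: ler_wpM2l => //; rewrite mulr_ge0// exprn_ge0.
Qed.

(* Bound for [psi1] in terms of y = de |t xi|, uniform for s in [1, 2]. *)
Definition env (N : nat) (y : R) : R := (4 * pi * y ^+ 2) ^+ N.+1 * expR (- (pi * y ^+ 2)).

Lemma gbump_le_env N (y s : R) : 1 <= s <= 2 -> gbump N (pi * (s * y) ^+ 2) <= env N y.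
Proof.
move=> /andP[s1 s2]; have p0 := @pi_ge0 R.
rewrite /gbump /env (exprMn 2 s y).
have ss : 1 <= s ^+ 2 <= 4.
  rewrite exprn_ege1//=; have -> : 4 = 2 ^+ 2 :> R by ring.
  by rewrite lerXn2r ?nnegrE// (le_trans ler01).
case/andP: ss; move: (s ^+ 2) (y ^+ 2) (sqr_ge0 y) => z w w0 z1 z4.
apply: ler_pM; rewrite ?expR_ge0 ?exprn_ge0 ?mulr_ge0//; first exact: le_trans z1.
  rewrite lerXn2r ?nnegrE ?mulr_ge0//; first exact: le_trans z1.
  by rewrite mulrCA -[leRHS]mulrA ler_wpM2r// mulr_ge0.
by rewrite ler_expR lerN2 ler_wpM2l// ler_peMl.
Qed.

(** Near 0 the order of vanishing 4 (N+1) of env^2 must beat y^{-2 al} with one power of y left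
    over, which dictates the size of N. At infinity the Gaussian beats every power. The resulting
    bound is summable over y = 2^k z. *)
Lemma env_sum_le N (al : R) : 0 <= al -> 2 * al + 1 <= (4 * N.+1)%:R ->
  exists2 C : R, 0 <= C & forall y, 0 < y ->
    env N y ^+ 2 * y `^ (- (2 * al)) * (1 + y ^+ 2) <= C * Num.min (y `^ 1) (y `^ (-1)).
Proof.
move=> al0 aN; have p0 := @pi_ge0 R; have p4 : 0 <= 4 * pi :> R by rewrite mulr_ge0.
(* For y >= 1 the powers add up to y^{4(N+1)+3}: 4(N+1) from env^2, two from 1 + y^2, and one for
   the decay y^{-1}. The even power 2 m = 4(N+1) + 4 dominates it and is absorbed by exp(-y^2). *)
pose m := (2 * N.+1 + 2)%N.
have m2 : (2 * m = 4 * N.+1 + 4)%N by rewrite /m mulnDr mulnA.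
pose F : R := m`!%:R; have F0 : 0 <= F by [].
have F1 : 1 <= F by rewrite ler1n fact_gt0.
exists (2 * ((4 * pi) ^+ N.+1) ^+ 2 * F) => [|y y0]; first by apply: mulr_ge0 => //; apply: mulr_ge0 => //; exact: sqr_ge0.
have e1 : env N y ^+ 2 = ((4 * pi) ^+ N.+1) ^+ 2 * (y ^+ (4 * N.+1) * expR (- (pi * y ^+ 2)) ^+ 2).
  have -> : y ^+ (4 * N.+1) = (y ^+ 2) ^+ N.+1 * (y ^+ 2) ^+ N.+1.
    by rewrite -exprD -exprM addnn -mul2n mulnA.
  by rewrite /env (exprMn N.+1 (4 * pi) (y ^+ 2)); ring.
rewrite e1 powRr1 ?(ltW y0)// powR_inv1 ?(ltW y0)//.
have E1 : expR (- (pi * y ^+ 2)) ^+ 2 <= 1.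
  rewrite expr_le1 ?expR_ge0// -expR0 ler_expR oppr_le0.
  by rewrite mulr_ge0// sqr_ge0.
have E0 : 0 <= expR (- (pi * y ^+ 2)) ^+ 2 by rewrite exprn_ge0// expR_ge0.
have hE : expR (- (pi * y ^+ 2)) ^+ 2 <= expR (- (y ^+ 2)).
  rewrite expr2 -expRD ler_expR; have := sqr_ge0 y; have := @pi_ge2 R.
  move: (y ^+ 2) (@pi R) => z q q2 z0.
  by have := mulr_ge0 (_ : 0 <= q - 2) z0; rewrite subr_ge0 => /(_ q2); lra.
move: (expR _ ^+ 2) E0 E1 hE => E E0 E1 hE {e1}.
have := sqr_ge0 ((4 * pi : R) ^+ N.+1).
move: (((4 * pi) ^+ N.+1) ^+ 2) => P P0.
have -> : P * (y ^+ (4 * N.+1) * E) * y `^ (- (2 * al)) * (1 + y ^+ 2) =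
    P * (y ^+ (4 * N.+1) * y `^ (- (2 * al)) * E * (1 + y ^+ 2)) by ring.
have -> : 2 * P * F * Num.min y y^-1 = P * (2 * (F * Num.min y y^-1)) by ring.
apply: ler_wpM2l => //.
have pw0 : 0 <= y `^ (- (2 * al)) by exact: powR_ge0.
have [y1|y1] := leP y 1.
  rewrite min_l; last by rewrite (le_trans y1)// invf_ge1.
  have h1 : y ^+ (4 * N.+1) * y `^ (- (2 * al)) <= y.
    rewrite -powR_mulrn ?(ltW y0)// -powRD; last by rewrite (gt_eqF y0) implybT.
    rewrite -[leRHS]powRr1 ?(ltW y0)//; apply: ger_powR; first by rewrite y0.
    lra.
  have h0 : 0 <= y ^+ (4 * N.+1) * y `^ (- (2 * al)) by rewrite mulr_ge0// exprn_ge0// ltW.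
  have y2 : y ^+ 2 <= 1 by rewrite expr_le1// ltW.
  apply: (@le_trans _ _ (y * 2)); last first.
    by rewrite mulrC; apply: ler_wpM2l => //; rewrite ler_peMl// ltW.
  apply: ler_pM => //.
  - by rewrite mulr_ge0.
  - by rewrite addr_ge0// sqr_ge0.
  - by rewrite (le_trans _ h1)// ler_piMr.
  - by lra.
have y1' := ltW y1.
rewrite min_r; last by rewrite (le_trans _ y1')// invf_le1.
have h1 : y `^ (- (2 * al)) <= 1.
  rewrite powRN invf_le1 ?powR_gt0// powR_ge1//; lra.
have h2 : 1 + y ^+ 2 <= 2 * y ^+ 2 by have := exprn_ege1 2 y1'; lra.
have h3 : y ^+ (4 * N.+1) * E * y ^+ 2 <= F * y^-1.
  rewrite ler_pdivlMr//.
  apply: (@le_trans _ _ ((y ^+ 2) ^+ m * expR (- (y ^+ 2)))); last first.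
    rewrite expRN ler_pdivrMr ?expR_gt0//; apply: exprn_le_expR; exact: sqr_ge0.
  rewrite -exprM.
  have -> : y ^+ (4 * N.+1) * E * y ^+ 2 * y = y ^+ (4 * N.+1 + 2 + 1) * E.
    by rewrite !exprD expr1; ring.
  apply: ler_pM => //; first by rewrite exprn_ge0// ltW.
  by rewrite ler_weXn2l// m2 -!addnA leq_add2l.
apply: (@le_trans _ _ (2 * (y ^+ (4 * N.+1) * E * y ^+ 2))); last by rewrite ler_wpM2l.
have Y0 : 0 <= y ^+ (4 * N.+1) * E by rewrite mulr_ge0// exprn_ge0// ltW.
apply: (@le_trans _ _ (y ^+ (4 * N.+1) * E * (1 + y ^+ 2))).
  rewrite ler_wpM2r ?addr_ge0 ?sqr_ge0// mulrAC ler_piMr//.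
rewrite [leRHS]mulrCA; exact: ler_wpM2l.
Qed.

End calculus2.

(** * Multipliers *)

Section psi_measurable.
Context {R : realType} (N : nat).

(** The derivative of [psi1]. Writing 2 psi1' / t as 2 k t psi2 removes the division by t, so that
    measurability holds for all t, including t = 0. *)
Definition psi2 (r : R) : R := N.+1%:R *
  ((1 - expR (- (4 * r))) ^+ N * (4 * expR (- (4 * r))) -
   (1 - expR (- r)) ^+ N * expR (- r)).

Lemma psi1'_div (k t : R) : 2 * psi1' N (k * t ^+ 2) / t = 2 * k * t * psi2 (k * t ^+ 2).
Proof.
have [->|t0] := eqVneq t 0; first by rewrite invr0 !(mulr0, mul0r).
have -> : psi1' N (k * t ^+ 2) = k * t ^+ 2 * psi2 (k * t ^+ 2).
  by rewrite /psi1' /psi2; ring.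
by field.
Qed.

Context d (T : measurableType d) (r : T -> R).
Hypothesis mr : measurable_fun setT r.

Let mE (c : R) : measurable_fun setT (fun x => expR (- (c * r x))).
Proof.
apply: (measurableT_comp (f := @expR R)) => //.
by apply: measurableT_comp => //; apply: measurable_funM.
Qed.

Let mE1 : measurable_fun setT (fun x => expR (- r x)).
Proof. by under eq_fun do rewrite -(mul1r (r _)); exact: mE. Qed.

Lemma measurable_psi1 : measurable_fun setT (fun x => psi1 N (r x)).
Proof.
by apply: measurable_funB; apply: measurable_funX; apply: measurable_funB => //; exact: mE.
Qed.

Lemma measurable_psi2 : measurable_fun setT (fun x => psi2 (r x)).
Proof.
apply: measurable_funM => //; apply: measurable_funB; apply: measurable_funM => //.
- by apply: measurable_funX; apply: measurable_funB => //; exact: mE.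
- by apply: measurable_funM => //; exact: mE.
- by apply: measurable_funX; apply: measurable_funB.
Qed.

End psi_measurable.

Section multiplier.
Context {R : realType} {n : nat}.
Local Notation V := 'rV[R]_n.
Local Notation mu := (lebesgue_rV n).
Variables (sigma : {finite_measure set V -> \bar R}) (N : nat) (R0 : R).
Hypotheses (R00 : 0 < R0) (supp : sigma (~` cube 0 R0) = 0%E).
Variable de : R.
Hypothesis d0 : 0 < de.
Implicit Types (x xi : V) (t : R).

(* Cosine and sine parts of the multiplier of [Top] and their derivatives in t. *)
Definition mA t xi : R := psi1 N (kap de xi * t ^+ 2) * cS sigma (t *: xi).
Definition mB t xi : R := psi1 N (kap de xi * t ^+ 2) * sS sigma (t *: xi).
Definition dA t xi : R := 2 * psi1' N (kap de xi * t ^+ 2) / t * cS sigma (t *: xi) +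
  psi1 N (kap de xi * t ^+ 2) * cS' sigma xi t.
Definition dB t xi : R := 2 * psi1' N (kap de xi * t ^+ 2) / t * sS sigma (t *: xi) +
  psi1 N (kap de xi * t ^+ 2) * sS' sigma xi t.

Lemma is_derive_mA xi t : t != 0 -> is_derive t 1 (mA ^~ xi) (dA t xi).
Proof.
move=> t0; have h1 := is_derive_psi1 N (kap de xi) t0.
have h2 := is_derive_cS supp xi t.
apply: (@is_derive_eq _ _ _ _ _ _ _ _ (is_deriveM h1 h2)).
by rewrite /GRing.scale/= /dA; ring.
Qed.

Lemma is_derive_mB xi t : t != 0 -> is_derive t 1 (mB ^~ xi) (dB t xi).
Proof.
move=> t0; have h1 := is_derive_psi1 N (kap de xi) t0.
have h2 := is_derive_sS supp xi t.
apply: (@is_derive_eq _ _ _ _ _ _ _ _ (is_deriveM h1 h2)).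
by rewrite /GRing.scale/= /dB; ring.
Qed.

Let cder (g : R -> R) t (dg : R) : is_derive t 1 g dg -> {for t, continuous g}.
Proof. by move=> [h _]; exact/differentiable_continuous/derivable1_diffP. Qed.

Let cp xi t : t != 0 -> {for t, continuous (fun t => 2 * psi1' N (kap de xi * t ^+ 2) / t)}.
Proof.
move=> t0; apply: cvgM; last by apply: cvgV.
by apply: cvgM; [exact: cvg_cst|exact: continuous_psi1'].
Qed.

Lemma continuous_dA xi t : t != 0 -> {for t, continuous (dA ^~ xi)}.
Proof.
move=> t0; apply: cvgD; apply: cvgM.
- exact: cp.
- exact: cder (is_derive_cS supp xi t).
- exact: cder (is_derive_psi1 N (kap de xi) t0).
- exact: (continuous_cS' supp).
Qed.

Lemma continuous_dB xi t : t != 0 -> {for t, continuous (dB ^~ xi)}.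
Proof.
move=> t0; apply: cvgD; apply: cvgM.
- exact: cp.
- exact: cder (is_derive_sS supp xi t).
- exact: cder (is_derive_psi1 N (kap de xi) t0).
- exact: (continuous_sS' supp).
Qed.

Section measurability.
Context d (T : measurableType d) (a : T -> V) (t : T -> R).
Hypotheses (ma : measurable_fun setT a) (mt : measurable_fun setT t).

Let mr : measurable_fun setT (fun p => kap de (a p) * t p ^+ 2).
Proof.
apply: measurable_funM; last exact: measurable_funX.
by apply: measurable_funM => //; exact: measurable_dotv.
Qed.

Let mta : measurable_fun setT (fun p => t p *: a p).
Proof. exact: measurable_funZ_rV. Qed.

Let mp : measurable_fun setT (fun p => 2 * psi1' N (kap de (a p) * t p ^+ 2) / t p).
Proof.
under eq_fun do rewrite psi1'_div.
apply: measurable_funM; last exact: measurable_psi2.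
apply: measurable_funM => //; apply: measurable_funM => //.
by apply: measurable_funM => //; exact: measurable_dotv.
Qed.

Lemma measurable_mA : measurable_fun setT (fun p => mA (t p) (a p)).
Proof. by apply: measurable_funM; [exact: measurable_psi1|exact: measurable_cS]. Qed.

Lemma measurable_mB : measurable_fun setT (fun p => mB (t p) (a p)).
Proof. by apply: measurable_funM; [exact: measurable_psi1|exact: measurable_sS]. Qed.

Lemma measurable_dA : measurable_fun setT (fun p => dA (t p) (a p)).
Proof.
apply: measurable_funD; apply: measurable_funM => //.
- exact: measurable_cS.
- exact: measurable_psi1.
- exact: measurable_cS'.
Qed.

Lemma measurable_dB : measurable_fun setT (fun p => dB (t p) (a p)).
Proof.
apply: measurable_funD; apply: measurable_funM => //.
- exact: measurable_sS.
- exact: measurable_psi1.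
- exact: measurable_sS'.
Qed.

End measurability.

(** A majorant in xi uniform for t >= u, which allows differentiation in t under the frequency
    integral. With E the Gaussian on the right, [gbump] is at most a multiple of E^2; one factor E
    is spent on the |xi| that the derivative of the transform of sigma produces. *)
Lemma multiplier_le (u : R) : 0 < u -> exists2 K : R, 0 <= K & forall t xi, u <= t ->
  [/\ `|mA t xi| <= K * gE (u * (de / 2)) xi, `|mB t xi| <= K * gE (u * (de / 2)) xi,
      `|dA t xi| <= K * gE (u * (de / 2)) xi & `|dB t xi| <= K * gE (u * (de / 2)) xi].
Proof.
move=> u0; pose C1 : R := Kpsi N * (N.+1`!%:R * 2 ^+ N.+1).
have C10 : 0 <= C1 by rewrite mulr_ge0 ?Kpsi_ge0// mulr_ge0// exprn_ge0.
have pdu0 : 0 < pi * de ^+ 2 * u ^+ 2 by rewrite mulr_gt0 ?exprn_gt0// mulr_gt0 ?pi_gt0 ?exprn_gt0.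
pose C2 : R := 1 + 4 / (pi * de ^+ 2 * u ^+ 2).
have C20 : 0 <= C2 by rewrite addr_ge0// divr_ge0// ltW.
pose m := mass sigma; have m0 : 0 <= m by exact: mass_ge0.
have L0 := Lph_ge0 (n := n) R00.
have u20 : 0 <= 2 / u by rewrite divr_ge0// ltW.
have K1 : 0 <= C1 * m by exact: mulr_ge0.
have K2 : 0 <= 2 / u * C1 * m + C1 * (Lph (n:=n) R0 * C2 * m).
  apply: addr_ge0; first by apply: mulr_ge0 => //; exact: mulr_ge0.
  by apply: mulr_ge0 => //; apply: mulr_ge0 => //; exact: mulr_ge0.
exists (C1 * m + (2 / u * C1 * m + C1 * (Lph (n:=n) R0 * C2 * m))); first exact: addr_ge0.
move=> t xi ut; have t0 : 0 < t by exact: lt_le_trans ut.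
set E := gE _ _; have E0 : 0 <= E by exact: ltW (gE_gt0 _ _).
pose z := kap de xi * u ^+ 2; have z0 : 0 <= z by rewrite mulr_ge0 ?kap_ge0 ?sqr_ge0.
have Ez : E = expR (- (z / 4)).
  by rewrite /E gE_kap /z /kap; congr (expR (- _)); field.
have E1 : E <= 1 by rewrite Ez -expR0 ler_expR oppr_le0 divr_ge0.
pose r := kap de xi * t ^+ 2.
have zr : z <= r by rewrite ler_wpM2l ?kap_ge0// lerXn2r ?nnegrE ?(ltW u0) ?(ltW t0).
have r0 : 0 <= r by exact: le_trans zr.
have gb : Kpsi N * gbump N r <= C1 * (E * E).
  rewrite /C1 -[leRHS]mulrA ler_wpM2l ?Kpsi_ge0//; apply: (le_trans (gbump_le_exp N r0)).
  apply: ler_wpM2l; first by rewrite mulr_ge0// exprn_ge0.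
  by rewrite Ez -expRD ler_expR; lra.
have p1 : `|psi1 N r| <= C1 * (E * E) by exact: le_trans (psi1_le N r0) gb.
have p2 : `|2 * psi1' N r / t| <= 2 / u * C1 * (E * E).
  rewrite normrM (ger0_norm (_ : 0 <= t^-1)) ?invr_ge0 ?(ltW t0)// normrM ger0_norm//.
  rewrite [leLHS]mulrAC -(mulrA (2 / u)); apply: ler_pM => //; first by rewrite divr_ge0// ltW.
    by rewrite ler_wpM2l// lef_pV2.
  exact: le_trans (psi1'_le N r0) gb.
have Ex : E * enorm xi <= C2.
  have hx : enorm xi <= 1 + dotv xi xi.
    by rewrite -sqr_enorm; have := sqr_ge0 (enorm xi - 1); have := enorm_ge0 xi; nra.
  apply: (le_trans (ler_wpM2l E0 hx)); rewrite mulrDr mulr1 /C2 lerD//.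
  have -> : dotv xi xi = z / 4 * (4 / (pi * de ^+ 2 * u ^+ 2)).
    rewrite /z /kap; move: pdu0 (@pi_gt0 R) d0 u0; move: (@pi R) => P h P0 de0 u0'.
    by field; rewrite !gt_eqF.
  rewrite mulrA -[leRHS]mul1r ler_wpM2r// ?divr_ge0 ?(ltW pdu0)//.
  rewrite Ez expRN mulrC ler_pdivrMr ?expR_gt0// mul1r.
  by apply: le_trans (expR_ge1Dx _); rewrite lerDr.
have EE : E * E <= E by rewrite ler_piMr.
have b1 (c : R) : `|c| <= m -> `|psi1 N r * c| <= C1 * m * E.
  move=> cm; rewrite normrM; apply: (@le_trans _ _ (C1 * E * m)).
    by apply: ler_pM => //; apply: (le_trans p1); rewrite ler_wpM2l.
  by rewrite mulrAC.
have b2 (c c' : R) : `|c| <= m -> `|c'| <= Lph (n:=n) R0 * enorm xi * m ->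
    `|2 * psi1' N r / t * c + psi1 N r * c'| <=
    (2 / u * C1 * m + C1 * (Lph (n:=n) R0 * C2 * m)) * E.
  move=> cm cm'; apply: (le_trans (ler_normD _ _)); rewrite [leRHS]mulrDl; apply: lerD.
    rewrite normrM; apply: (@le_trans _ _ (2 / u * C1 * E * m)); last by rewrite mulrAC.
    by apply: ler_pM => //; apply: (le_trans p2); rewrite ler_wpM2l// mulr_ge0.
  rewrite normrM; apply: (@le_trans _ _ (C1 * (E * E) * (Lph (n:=n) R0 * enorm xi * m))).
    exact: ler_pM.
  have -> : C1 * (E * E) * (Lph (n:=n) R0 * enorm xi * m) =
      C1 * E * Lph (n:=n) R0 * m * (E * enorm xi) by ring.
  have -> : C1 * (Lph (n:=n) R0 * C2 * m) * E = C1 * E * Lph (n:=n) R0 * m * C2 by ring.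
  by apply: ler_wpM2l => //; do 3 apply: mulr_ge0 => //.
have [hc hs] := norm_cSE sigma (t *: xi).
have w1 (X : R) : X <= C1 * m * E ->
    X <= (C1 * m + (2 / u * C1 * m + C1 * (Lph (n:=n) R0 * C2 * m))) * E.
  by move=> h; rewrite [leRHS]mulrDl (le_trans h)// lerDl; exact: mulr_ge0.
have w2 (X : R) : X <= (2 / u * C1 * m + C1 * (Lph (n:=n) R0 * C2 * m)) * E ->
    X <= (C1 * m + (2 / u * C1 * m + C1 * (Lph (n:=n) R0 * C2 * m))) * E.
  by move=> h; rewrite [leRHS]mulrDl (le_trans h)// lerDr; exact: mulr_ge0.
split.
- exact/w1/b1.
- exact/w1/b1.
- by apply/w2/b2 => //; exact: norm_cS'_le.
- by apply/w2/b2 => //; exact: norm_sS'_le.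
Qed.

End multiplier.

(** * The square function *)

Section bessel2.
Context {R : realType} {n : nat}.
Local Notation V := 'rV[R]_n.
Local Notation mu := (lebesgue_rV n).
Variable f : V -> R.
Hypothesis fi : mu.-integrable setT (EFin \o f).
Variables (a b : V -> R) (K D : R).
Hypotheses (ma : measurable_fun setT a) (mb : measurable_fun setT b).
Hypothesis D0 : 0 < D.
Hypothesis aK : forall xi, `|a xi| <= K * gE D xi.
Hypothesis bK : forall xi, `|b xi| <= K * gE D xi.

Lemma phC (x xi : V) : ph x xi = ph xi x.
Proof. by rewrite /ph /dotv; congr (_ * _); apply: eq_bigr => i _; rewrite mulrC. Qed.

Let M := normL1 f + normL1 f.
Let M0 : 0 <= M. Proof. by rewrite addr_ge0 ?normL1_ge0. Qed.

Lemma integrable_multE (c : R) : mu.-integrable setT (EFin \o (fun xi => gE D xi * c)).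
Proof. by apply: (integrable_bounded_mul (M := `|c|)) => //; exact: integrable_gE. Qed.

Lemma mult_le x xi : `|a xi * Uf f x xi + b xi * Wf f x xi| <= gE D xi * (2 * K * M).
Proof.
apply: (le_trans (norm_cSsS_le fi _ _ _ _)); rewrite -/M.
have := lerD (aK xi) (bK xi) => h; apply: (le_trans (ler_wpM2r M0 h)).
by rewrite le_eqVlt; apply/orP; left; apply/eqP; ring.
Qed.

Let mct := measurable_ct fi.
Let mst := measurable_st fi.

Lemma integrable_mult x :
  mu.-integrable setT (EFin \o (fun xi => a xi * Uf f x xi + b xi * Wf f x xi)).
Proof.
apply: (le_integrable measurableT _ _ (integrable_multE (2 * K * M))).
  apply/measurable_EFinP; apply: measurable_funD; apply: measurable_funM => //.
    by apply: measurable_Uf => //; exact: measurable_cst.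
  by apply: measurable_Wf => //; exact: measurable_cst.
by move=> xi _; rewrite /= lee_fin (le_trans (mult_le x xi))// ler_norm.
Qed.

(** p - i q is the product of the multiplier a - i b with the transform ct f - i st f. *)
Let p xi := a xi * ct f xi - b xi * st f xi.
Let q xi := a xi * st f xi + b xi * ct f xi.

Let mp : measurable_fun setT p.
Proof. by apply: measurable_funB; apply: measurable_funM. Qed.

Let mq : measurable_fun setT q.
Proof. by apply: measurable_funD; apply: measurable_funM. Qed.

Let pqi (c1 c2 : V -> R) : measurable_fun setT (fun xi => a xi * c1 xi + b xi * c2 xi) ->
  (forall xi, `|c1 xi| <= normL1 f) -> (forall xi, `|c2 xi| <= normL1 f) ->
  mu.-integrable setT (EFin \o (fun xi => a xi * c1 xi + b xi * c2 xi)).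
Proof.
move=> mc h1 h2; apply: (le_integrable measurableT _ _ (integrable_multE (K * M))).
  exact/measurable_EFinP.
move=> xi _; rewrite /= lee_fin; apply: (le_trans _ (ler_norm _)).
apply: (le_trans (ler_normD _ _)); rewrite !normrM.
apply: (le_trans (lerD (ler_pM _ _ (aK xi) (h1 xi)) (ler_pM _ _ (bK xi) (h2 xi)))) => //.
by rewrite le_eqVlt; apply/orP; left; apply/eqP; rewrite /M; ring.
Qed.

Let pi' : mu.-integrable setT (EFin \o p).
Proof.
have e : p = (fun xi => a xi * ct f xi + b xi * (- st f xi)).
  by apply/funext => xi; rewrite /p mulrN.
rewrite e; apply: pqi; first by rewrite -e.
- by move=> xi; exact: norm_ct_le.
- by move=> xi; rewrite normrN; exact: norm_st_le.
Qed.

Let qi : mu.-integrable setT (EFin \o q).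
Proof.
apply: pqi => //.
- by move=> xi; exact: norm_st_le.
- by move=> xi; exact: norm_ct_le.
Qed.

(** The phase is symmetric in x and xi, so the operator is the cosine transform of p plus the sine
    transform of q, with the frequency as integration variable. [bessel] is applied to p and to q;
    the factor 2 comes from squaring a sum of two terms. *)
Lemma bessel2 :
  (\int[mu]_x ((\int[mu]_xi (a xi * Uf f x xi + b xi * Wf f x xi)) ^+ 2)%:E <=
   \int[mu]_xi (2 * ((a xi ^+ 2 + b xi ^+ 2) * (ct f xi ^+ 2 + st f xi ^+ 2)))%:E)%E.
Proof.
have E x : \int[mu]_xi (a xi * Uf f x xi + b xi * Wf f x xi) = ct p x + st q x.
  rewrite /ct /st -RintegralD//.
  - by apply: eq_Rintegral => xi _; rewrite (phC xi x) /Uf /Wf /p /q; ring.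
  - exact: integrable_cosM.
  - exact: integrable_sinM.
under eq_integral do rewrite E.
have msq (g : V -> R) : measurable_fun setT g -> measurable_fun setT (fun x => (g x ^+ 2)%:E).
  by move=> mg; apply/measurable_EFinP; exact: measurable_funX.
have mctst (g : V -> R) : mu.-integrable setT (EFin \o g) ->
    measurable_fun setT (fun x => (ct g x ^+ 2 + st g x ^+ 2)%:E).
  move=> gi; apply/measurable_EFinP; apply: measurable_funD; apply: measurable_funX.
    exact: measurable_ct.
  exact: measurable_st.
have n0 (g : V -> R) x : (0 <= (ct g x ^+ 2 + st g x ^+ 2)%:E)%E.
  by rewrite lee_fin addr_ge0 ?sqr_ge0.
have n2 (g : V -> R) x : (0 <= 2%:E * (ct g x ^+ 2 + st g x ^+ 2)%:E)%E.
  by rewrite -EFinM lee_fin mulr_ge0// addr_ge0 ?sqr_ge0.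
apply: (@le_trans _ _ (\int[mu]_x (2%:E * (ct p x ^+ 2 + st p x ^+ 2)%:E +
    2%:E * (ct q x ^+ 2 + st q x ^+ 2)%:E))%E).
  apply: le_nnintegral => x; first by rewrite lee_fin sqr_ge0.
  rewrite -!EFinM -EFinD lee_fin.
  have := sqr_ge0 (ct p x - st q x); have := sqr_ge0 (st p x); have := sqr_ge0 (ct q x).
  by move: (ct p x) (st q x) (st p x) (ct q x) => z1 z2 z3 z4; rewrite sqrrB sqrrD; lra.
rewrite ge0_integralD//; first last.
- by apply: emeasurable_funM; [exact: measurable_cst|exact: mctst].
- by apply: emeasurable_funM; [exact: measurable_cst|exact: mctst].
rewrite !ge0_integralZl_EFin//; [|exact: mctst|exact: mctst].
apply: (@le_trans _ _ (2%:E * \int[mu]_x (p x ^+ 2)%:E + 2%:E * \int[mu]_x (q x ^+ 2)%:E)%E).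
  by apply: leeD; apply: lee_wpmul2l; rewrite ?lee_fin//; exact: bessel.
rewrite -!ge0_integralZl_EFin//; first last.
- exact: msq.
- by move=> x _; rewrite lee_fin sqr_ge0.
- exact: msq.
- by move=> x _; rewrite lee_fin sqr_ge0.
rewrite -ge0_integralD//; first last.
- by apply: emeasurable_funM; [exact: measurable_cst|exact: msq].
- by move=> x _; rewrite mule_ge0 ?lee_fin ?sqr_ge0.
- by apply: emeasurable_funM; [exact: measurable_cst|exact: msq].
- by move=> x _; rewrite mule_ge0 ?lee_fin ?sqr_ge0.
apply: le_nnintegral => x; first by rewrite adde_ge0// mule_ge0 ?lee_fin ?sqr_ge0.
by rewrite -!EFinM -EFinD lee_fin /p /q le_eqVlt; apply/orP; left; apply/eqP; ring.
Qed.

End bessel2.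

Section square_function.
Context {R : realType} {n : nat}.
Local Notation V := 'rV[R]_n.
Local Notation mu := (lebesgue_rV n).
Local Notation leb := (@lebesgue_measure R).
Variables (sigma : {finite_measure set V -> \bar R}) (N : nat) (R0 : R).
Hypotheses (R00 : 0 < R0) (supp : sigma (~` cube 0 R0) = 0%E).
Implicit Types (x xi : V) (de t s : R) (f : V -> R).

Definition Tg f de t x : R :=
  \int[mu]_xi (mA sigma N de t xi * Uf f x xi + mB sigma N de t xi * Wf f x xi).
Definition Tg' f de t x : R :=
  \int[mu]_xi (dA sigma N de t xi * Uf f x xi + dB sigma N de t xi * Wf f x xi).

(* On t = 2^k s, 1 <= s <= 2, sup g^2 <= int (1 + 1/de) g^2 + de (g')^2; summing over k
   gives a square function that dominates sup_t |Top f de t|^2. *)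
Definition sqterm f de (k : int) s x : R :=
  ((1 + de^-1) * Tg f de (dy k * s) x ^+ 2 + de * (dy k * Tg' f de (dy k * s) x) ^+ 2) *
  \1_(`[1, 2]%classic : set R) s.

Definition Sq f de x : \bar R := zsum (fun k => \int[leb]_s (sqterm f de k s x)%:E)%E.

(** The frequency-side counterpart of [sqterm]: by [bessel2], the integral of [sqterm] in x is at
    most that of [mterm] against 2 (ct^2 + st^2). *)
Definition mterm de (k : int) s xi : R :=
  ((1 + de^-1) * (mA sigma N de (dy k * s) xi ^+ 2 + mB sigma N de (dy k * s) xi ^+ 2) +
   de * ((dy k * dA sigma N de (dy k * s) xi) ^+ 2 + (dy k * dB sigma N de (dy k * s) xi) ^+ 2)) *
  \1_(`[1, 2]%classic : set R) s.

Lemma sqterm_ge0 f de k s x : 0 < de -> 0 <= sqterm f de k s x.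
Proof.
move=> d0; apply: mulr_ge0 => //; apply: addr_ge0; apply: mulr_ge0; rewrite ?sqr_ge0 ?(ltW d0)//.
by rewrite addr_ge0// invr_ge0 ltW.
Qed.

Lemma mterm_ge0 de k s xi : 0 < de -> 0 <= mterm de k s xi.
Proof.
move=> d0; apply: mulr_ge0 => //; apply: addr_ge0; apply: mulr_ge0; rewrite ?addr_ge0 ?sqr_ge0 ?(ltW d0)//.
by rewrite invr_ge0 ltW.
Qed.

Lemma integral12 (g : R -> R) :
  (\int[leb]_(s in `[1%R, 2%R]) (g s)%:E = \int[leb]_s (g s * \1_(`[1, 2]%classic : set R) s)%:E)%E.
Proof.
rewrite integral_mkcond; apply: eq_integral => s _; rewrite patchE indicE.
by case: ifPn => _; rewrite ?mulr1 ?mulr0.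
Qed.

Section fixed.
Variables (f : V -> R) (de : R).
Hypotheses (fi : mu.-integrable setT (EFin \o f)) (d0 : 0 < de).

Let multK u : 0 < u -> 0 < u * (de / 2).
Proof. by move=> u0; rewrite mulr_gt0// divr_gt0. Qed.

Lemma TopTg t x : 0 < t -> Top sigma N f de t x = Tg f de t x.
Proof.
move=> t0; have [_ ->] := TopE sigma N fi x d0 t0.
by apply: eq_Rintegral => xi _; rewrite /mA /mB /Phi; ring.
Qed.

Let half_lt t : 0 < t -> t / 2 < t < t + 1.
Proof. by move=> t0; apply/andP; split; lra. Qed.

Lemma is_derive_Tg t x : 0 < t -> is_derive t 1 (fun t => Tg f de t x) (Tg' f de t x).
Proof.
move=> t0; have u0 : 0 < t / 2 by rewrite divr_gt0.
have [K K0 KP] := multiplier_le N R00 supp d0 u0; have D0 := multK u0.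
have h (r : R) : t / 2 < r < t + 1 -> r != 0 by move=> /andP[r1 _]; rewrite gt_eqF// (lt_trans u0).
apply: (@is_derive_integral R _ _ mu _
  (fun t xi => dA sigma N de t xi * Uf f x xi + dB sigma N de t xi * Wf f x xi) _ _ _ _ (half_lt t0)).
- move=> r /andP[/ltW r1 _]; apply: (integrable_mult fi (K := K) (D := t / 2 * (de / 2))) => //.
  + by apply: (measurable_mA sigma N de (a := fun xi => xi) (t := fun=> r)).
  + by apply: (measurable_mB sigma N de (a := fun xi => xi) (t := fun=> r)).
  + by move=> xi; have [] := KP r xi r1.
  + by move=> xi; have [] := KP r xi r1.
- move=> r xi /h r0; have h1 := is_derive_mA N supp de xi r0; have h2 := is_derive_mB N supp de xi r0.
  have h3 := is_deriveD (is_deriveM h1 (is_derive_cst (Uf f x xi) r 1)) (is_deriveM h2 (is_derive_cst (Wf f x xi) r 1)).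
  apply: (@is_derive_eq _ _ _ _ _ _ _ _ h3).
  by rewrite /GRing.scale/=; ring.
- exact: (integrable_multE D0 (2 * K * (normL1 f + normL1 f))).
- move=> r xi /andP[/ltW r1 _]; have [_ _ h3 h4] := KP r xi r1.
  apply: (le_trans (norm_cSsS_le fi _ _ _ _)).
  apply: (le_trans (ler_wpM2r _ (lerD h3 h4))); first by rewrite addr_ge0 ?normL1_ge0.
  by rewrite le_eqVlt; apply/orP; left; apply/eqP; ring.
Qed.

Lemma continuous_Tg' t x : 0 < t -> {for t, continuous (fun t => Tg' f de t x)}.
Proof.
move=> t0; have u0 : 0 < t / 2 by rewrite divr_gt0.
have [K K0 KP] := multiplier_le N R00 supp d0 u0; have D0 := multK u0.
have h (r : R) : t / 2 < r < t + 1 -> r != 0 by move=> /andP[r1 _]; rewrite gt_eqF// (lt_trans u0).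
apply: (@continuous_Rintegral R _ _ mu
  (fun t xi => dA sigma N de t xi * Uf f x xi + dB sigma N de t xi * Wf f x xi)
  (fun xi => gE (t / 2 * (de / 2)) xi * (2 * K * (normL1 f + normL1 f))) _ _ _ (half_lt t0)).
- move=> r /andP[/ltW r1 _]; apply: (integrable_mult fi (K := K) (D := t / 2 * (de / 2))) => //.
  + by apply: (measurable_dA sigma N de (a := fun xi => xi) (t := fun=> r)).
  + by apply: (measurable_dB sigma N de (a := fun xi => xi) (t := fun=> r)).
  + by move=> xi; have [] := KP r xi r1.
  + by move=> xi; have [] := KP r xi r1.
- move=> r xi /h r0; have cA := @continuous_dA R n sigma N R0 supp de xi r r0.
  have cB := @continuous_dB R n sigma N R0 supp de xi r r0.
  by apply: cvgD; apply: cvgM; [exact: cA|exact: cvg_cst|exact: cB|exact: cvg_cst].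
- exact: (integrable_multE D0 (2 * K * (normL1 f + normL1 f))).
- move=> r xi /andP[/ltW r1 _]; have [_ _ h3 h4] := KP r xi r1.
  apply: (le_trans (norm_cSsS_le fi _ _ _ _)).
  apply: (le_trans (ler_wpM2r _ (lerD h3 h4))); first by rewrite addr_ge0 ?normL1_ge0.
  by rewrite le_eqVlt; apply/orP; left; apply/eqP; ring.
Qed.

Section measurability.
Context d (T : measurableType d) (a : T -> V) (t : T -> R).
Hypotheses (ma : measurable_fun setT a) (mt : measurable_fun setT t).

Let ma1 : measurable_fun setT (fun p : T * V => a p.1).
Proof. by apply: (measurableT_comp ma); exact: measurable_fst. Qed.
Let mt1 : measurable_fun setT (fun p : T * V => t p.1).
Proof. by apply: (measurableT_comp mt); exact: measurable_fst. Qed.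
Let m2 : measurable_fun setT (fun p : T * V => p.2). Proof. exact: measurable_snd. Qed.

Lemma measurable_Tg : measurable_fun setT (fun p => Tg f de (t p) (a p)).
Proof.
apply: (measurable_Rintegral2 mu (f := fun p : T * V => mA sigma N de (t p.1) p.2 *
  Uf f (a p.1) p.2 + mB sigma N de (t p.1) p.2 * Wf f (a p.1) p.2)).
apply: measurable_funD; apply: measurable_funM.
- exact: measurable_mA.
- exact: measurable_Uf.
- exact: measurable_mB.
- exact: measurable_Wf.
Qed.

Lemma measurable_Tg' : measurable_fun setT (fun p => Tg' f de (t p) (a p)).
Proof.
apply: (measurable_Rintegral2 mu (f := fun p : T * V => dA sigma N de (t p.1) p.2 *
  Uf f (a p.1) p.2 + dB sigma N de (t p.1) p.2 * Wf f (a p.1) p.2)).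
apply: measurable_funD; apply: measurable_funM.
- exact: measurable_dA.
- exact: measurable_Uf.
- exact: measurable_dB.
- exact: measurable_Wf.
Qed.

End measurability.

Lemma Top_le_Sq t x : 0 < t -> ((Top sigma N f de t x ^+ 2)%:E <= Sq f de x)%E.
Proof.
move=> t0; rewrite TopTg//; have [k /andP[kt tk]] := ex_dy t0.
have k0 := @dy_gt0 R k; rewrite dyS in tk.
have -> : t = dy k * (t / dy k) by rewrite mulrC divfK// gt_eqF.
have s12 : 1 <= t / dy k <= 2.
  by rewrite ler_pdivlMr// mul1r kt ler_pdivrMr// ltW.
apply: (@le_trans _ _ (\int[leb]_s (sqterm f de k s x)%:E)%E); last first.
  by apply: (ge_zsum k) => j; apply: integral_ge0 => s _; rewrite lee_fin sqterm_ge0.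
rewrite -integral12.
have di0 : 0 < de^-1 by rewrite invr_gt0.
have mk (c : R) : measurable_fun setT (fun s : R => dy k * s).
  by apply: measurable_funM => //; exact: measurable_id.
(* The weight 1/de balances the two terms: the piece lives at frequencies |t xi| of order 1/de,
   where a derivative in s costs a factor 1/de. *)
have := @sup_sqr_le R (fun s => Tg f de (dy k * s) x) (fun s => dy k * Tg' f de (dy k * s) x)
  de^-1 (t / dy k) di0 s12.
rewrite invrK; apply.
- move=> r /andP[r1 _]; have r0 : 0 < dy k * r by rewrite mulr_gt0// (lt_le_trans _ r1).
  have h1 := is_derive_Tg x r0.
  have h2 : is_derive r 1 (fun r => dy k * r) (dy k).
    by apply: is_derive_eq; rewrite /GRing.scale/= mulr1.
  by rewrite mulrC; exact: (@is_derive1_comp R (fun t => Tg f de t x) (fun r => dy k * r) r _ _ h1 h2).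
- move=> r /andP[r1 _]; have r0 : 0 < dy k * r by rewrite mulr_gt0// (lt_le_trans _ r1).
  apply: cvgM; first exact: cvg_cst.
  apply: (@continuous_comp _ _ _ (fun r => dy k * r) (fun t => Tg' f de t x)).
    by apply: cvgM; [exact: cvg_cst|exact: cvg_id].
  exact: continuous_Tg'.
- by apply: measurable_Tg; [exact: measurable_cst|exact: mk].
- apply: measurable_funM => //.
  by apply: measurable_Tg'; [exact: measurable_cst|exact: mk].
Qed.

Lemma integral_sqterm_le k s :
  (\int[mu]_x (sqterm f de k s x)%:E <=
   \int[mu]_xi ((2 * (ct f xi ^+ 2 + st f xi ^+ 2))%:E * (mterm de k s xi)%:E))%E.
Proof.
pose F xi : R := ct f xi ^+ 2 + st f xi ^+ 2.
have F0 xi : 0 <= F xi by rewrite addr_ge0 ?sqr_ge0.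
have mF : measurable_fun setT F.
  by apply: measurable_funD; apply: measurable_funX; [exact: measurable_ct|exact: measurable_st].
rewrite /sqterm /mterm !indicE; case: (boolP (s \in _)) => [/set_mem|_]; last first.
  rewrite (eq_integral (fun=> 0%E)); last by move=> x _; rewrite mulr0.
  rewrite integral0; apply: integral_ge0 => xi _.
  by rewrite mulr0 mule0.
rewrite /= in_itv/= => /andP[s1 _]; set t := dy k * s.
have k0 := @dy_gt0 R k; have t0 : 0 < t by rewrite mulr_gt0// (lt_le_trans _ s1).
have [K K0 KP] := multiplier_le N R00 supp d0 t0; have D0 := multK t0.
have hA : measurable_fun setT (fun xi => mA sigma N de t xi).
  by apply: (measurable_mA sigma N de (a := fun xi => xi) (t := fun=> t)).
have hB : measurable_fun setT (fun xi => mB sigma N de t xi).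
  by apply: (measurable_mB sigma N de (a := fun xi => xi) (t := fun=> t)).
have hdA : measurable_fun setT (fun xi => dA sigma N de t xi).
  by apply: (measurable_dA sigma N de (a := fun xi => xi) (t := fun=> t)).
have hdB : measurable_fun setT (fun xi => dB sigma N de t xi).
  by apply: (measurable_dB sigma N de (a := fun xi => xi) (t := fun=> t)).
have hT : measurable_fun setT (fun x => Tg f de t x).
  by apply: (measurable_Tg (a := fun x => x) (t := fun=> t)).
have hT' : measurable_fun setT (fun x => Tg' f de t x).
  by apply: (measurable_Tg' (a := fun x => x) (t := fun=> t)).
have c10 : 0 <= 1 + de^-1 by rewrite addr_ge0// invr_ge0 ltW.
have c20 : 0 <= de * dy k ^+ 2 by rewrite mulr_ge0 ?sqr_ge0// ltW.
have sqE (g : V -> R) : measurable_fun setT g -> measurable_fun setT (fun x => (g x ^+ 2)%:E).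
  by move=> mg; apply/measurable_EFinP; exact: measurable_funX.
pose G (a b : V -> R) xi : \bar R := (2 * ((a xi ^+ 2 + b xi ^+ 2) * F xi))%:E.
have G0 a b xi : (0 <= G a b xi)%E.
  by rewrite lee_fin mulr_ge0// mulr_ge0// addr_ge0 ?sqr_ge0.
have mG a b : measurable_fun setT a -> measurable_fun setT b -> measurable_fun setT (G a b).
  move=> ma mb; apply/measurable_EFinP; apply: measurable_funM => //; apply: measurable_funM => //.
  by apply: measurable_funD; exact: measurable_funX.
have zl c a b : 0 <= c -> measurable_fun setT a -> measurable_fun setT b ->
    (c%:E * \int[mu]_xi G a b xi = \int[mu]_xi (c%:E * G a b xi))%E.
  by move=> c0 ma mb; rewrite ge0_integralZl_EFin//; exact: mG.
have b1 : (\int[mu]_x (Tg f de t x ^+ 2)%:E <= \int[mu]_xi G (mA sigma N de t) (mB sigma N de t) xi)%E := @bessel2 R n f fi (mA sigma N de t) (mB sigma N de t) K _ hA hB D0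
  (fun xi => let: And4 h _ _ _ := KP t xi (lexx t) in h)
  (fun xi => let: And4 _ h _ _ := KP t xi (lexx t) in h).
have b2 : (\int[mu]_x (Tg' f de t x ^+ 2)%:E <= \int[mu]_xi G (dA sigma N de t) (dB sigma N de t) xi)%E := @bessel2 R n f fi (dA sigma N de t) (dB sigma N de t) K _ hdA hdB D0
  (fun xi => let: And4 _ _ h _ := KP t xi (lexx t) in h)
  (fun xi => let: And4 _ _ _ h := KP t xi (lexx t) in h).
apply: (@le_trans _ _ (\int[mu]_x ((1 + de^-1)%:E * (Tg f de t x ^+ 2)%:E +
    (de * dy k ^+ 2)%:E * (Tg' f de t x ^+ 2)%:E))%E).
  rewrite le_eqVlt; apply/orP; left; apply/eqP; apply: eq_integral => x _.
  by rewrite mulr1 -!EFinM -EFinD; congr (_%:E); ring.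
rewrite ge0_integralD//; first last.
- by apply: emeasurable_funM; [exact: measurable_cst|exact: sqE hT'].
- by move=> x _; rewrite mule_ge0 ?lee_fin ?sqr_ge0.
- by apply: emeasurable_funM; [exact: measurable_cst|exact: sqE hT].
- by move=> x _; rewrite mule_ge0 ?lee_fin ?sqr_ge0.
rewrite !ge0_integralZl_EFin//; first last.
- exact: sqE hT.
- by move=> x _; rewrite lee_fin sqr_ge0.
- exact: sqE hT'.
- by move=> x _; rewrite lee_fin sqr_ge0.
apply: (le_trans (leeD (lee_wpmul2l _ b1) (lee_wpmul2l _ b2))); rewrite ?lee_fin//.
rewrite !zl//.
rewrite -ge0_integralD//; first last.
- by apply: emeasurable_funM; [exact: measurable_cst|exact: mG].
- by move=> x _; apply: mule_ge0 => //; rewrite lee_fin.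
- by apply: emeasurable_funM; [exact: measurable_cst|exact: mG].
- by move=> x _; apply: mule_ge0 => //; rewrite lee_fin.
rewrite le_eqVlt; apply/orP; left; apply/eqP; apply: eq_integral => xi _.
by rewrite /G -!EFinM -EFinD mulr1; congr (_%:E); rewrite /F; ring.
Qed.

End fixed.

Lemma enormZ t xi : 0 <= t -> enorm (t *: xi) = t * enorm xi.
Proof.
move=> t0; rewrite /enorm; have -> : dotv (t *: xi) (t *: xi) = t ^+ 2 * dotv xi xi.
  by rewrite /dotv mulr_sumr; apply: eq_bigr => i _; rewrite !mxE; ring.
by rewrite sqrtrM ?sqr_ge0// sqrtr_sqr ger0_norm.
Qed.

Let mph xi : measurable_fun setT (fun y => ph y xi).
Proof. by apply: measurable_ph => //; exact: measurable_cst. Qed.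

Lemma cS'Z (tau s : R) xi : cS' sigma (tau *: xi) s = tau * cS' sigma xi (tau * s).
Proof.
rewrite /cS' -RintegralZl//.
  by apply: eq_Rintegral => y _; rewrite scalerA (mulrC s) !phZr; ring.
apply: (supp_integrable supp (M := Lph (n:=n) R0 * enorm xi)).
  apply: measurable_funM; first exact: measurableT_comp.
  by apply: measurable_sin_ph => //; exact: measurable_cst.
move=> y yc; rewrite normrM normrN (le_trans _ (norm_ph_le xi yc))//.
by rewrite ler_piMr// norm_sin_le1.
Qed.

Lemma sS'Z (tau s : R) xi : sS' sigma (tau *: xi) s = tau * sS' sigma xi (tau * s).
Proof.
rewrite /sS' -RintegralZl//.
  by apply: eq_Rintegral => y _; rewrite scalerA (mulrC s) !phZr; ring.
apply: (supp_integrable supp (M := Lph (n:=n) R0 * enorm xi)).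
  apply: measurable_funM => //.
  by apply: measurable_cos_ph => //; exact: measurable_cst.
move=> y yc; rewrite normrM (le_trans _ (norm_ph_le xi yc))//.
by rewrite ler_piMr// norm_cos_le1.
Qed.

(** |m(s xi)|^2; [Qd] is likewise the squared modulus of the derivative of m(s xi) in s. *)
Definition Qm xi s : R := cS sigma (s *: xi) ^+ 2 + sS sigma (s *: xi) ^+ 2.
Definition Qd xi s : R := cS' sigma xi s ^+ 2 + sS' sigma xi s ^+ 2.

Lemma Qm_ge0 xi s : 0 <= Qm xi s. Proof. by rewrite addr_ge0 ?sqr_ge0. Qed.
Lemma Qd_ge0 xi s : 0 <= Qd xi s. Proof. by rewrite addr_ge0 ?sqr_ge0. Qed.

Lemma measurable_Qm xi : measurable_fun setT (Qm xi).
Proof.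
have h : measurable_fun setT (fun s : R => s *: xi).
  by apply: measurable_funZ_rV; [exact: measurable_id|exact: measurable_cst].
by apply: measurable_funD; apply: measurable_funX; [exact: measurable_cS|exact: measurable_sS].
Qed.

Lemma measurable_Qd xi : measurable_fun setT (Qd xi).
Proof.
have h1 : measurable_fun setT (fun _ : R => xi) by exact: measurable_cst.
have h2 : measurable_fun setT (fun s : R => s) by exact: measurable_id.
by apply: measurable_funD; apply: measurable_funX; [exact: measurable_cS'|exact: measurable_sS'].
Qed.

(** A derivative falling on the cutoff costs no power of 1/de, so 8 de of its contribution is
    absorbed in 8/de. Together with 1 + 1/de <= 2/de this gives the coefficient 10; the other 2
    comes from (x + y)^2 <= 2 x^2 + 2 y^2. *)
Lemma mterm_le de k s xi : 0 < de -> de <= 1 ->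
  mterm de k s xi <= (Kpsi N * env N (de * dy k * enorm xi)) ^+ 2 *
    (10 * de^-1 * Qm (dy k *: xi) s + 2 * de * Qd (dy k *: xi) s) *
    \1_(`[1, 2]%classic : set R) s.
Proof.
move=> d0 d1; rewrite /mterm; have k0 := @dy_gt0 R k.
rewrite !indicE; case: (boolP (s \in _)) => [/set_mem|]; last by rewrite !mulr0.
rewrite /= in_itv/= => s12; rewrite !mulr1; have /andP[s1 s2] := s12.
have s0 : 0 < s by exact: lt_le_trans s1.
set r := kap de xi * (dy k * s) ^+ 2.
have r0 : 0 <= r by rewrite mulr_ge0 ?kap_ge0 ?sqr_ge0.
set e := Kpsi N * env N _.
have gb : Kpsi N * gbump N r <= e.
  rewrite ler_wpM2l ?Kpsi_ge0//; have := gbump_le_env N (de * dy k * enorm xi) s12.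
  congr (gbump N _ <= _); rewrite /r /kap -sqr_enorm; ring.
have p1 := le_trans (psi1_le N r0) gb; have p2 := le_trans (psi1'_le N r0) gb.
have e0 : 0 <= e by exact: le_trans p1.
have sq (z : R) : `|z| <= e -> z ^+ 2 <= e ^+ 2.
  by move=> h; rewrite -[leLHS]real_normK ?num_real// lerXn2r ?nnegrE.
have {}p1 := sq _ p1; have {p2} := sq _ p2.
rewrite /mA /mB /dA /dB -/r.
have -> : dy k * (2 * psi1' N r / (dy k * s) * cS sigma ((dy k * s) *: xi) +
    psi1 N r * cS' sigma xi (dy k * s)) =
    2 * (psi1' N r / s) * cS sigma (s *: (dy k *: xi)) + psi1 N r * cS' sigma (dy k *: xi) s.
  rewrite cS'Z scalerA (mulrC s); field; rewrite !gt_eqF//.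
have -> : dy k * (2 * psi1' N r / (dy k * s) * sS sigma ((dy k * s) *: xi) +
    psi1 N r * sS' sigma xi (dy k * s)) =
    2 * (psi1' N r / s) * sS sigma (s *: (dy k *: xi)) + psi1 N r * sS' sigma (dy k *: xi) s.
  rewrite sS'Z scalerA (mulrC s); field; rewrite !gt_eqF//.
rewrite (_ : (dy k * s) *: xi = s *: (dy k *: xi)); last by rewrite scalerA mulrC.
rewrite /Qm /Qd; set c := cS _ _; set c2 := sS _ _; set c3 := cS' _ _ _; set c4 := sS' _ _ _.
move=> p2; have {}p2 : (psi1' N r / s) ^+ 2 <= e ^+ 2.
  apply: le_trans p2; rewrite expr_div_n ler_pdivrMr ?exprn_gt0// ler_peMr ?sqr_ge0//.
  exact: exprn_ege1.
have sq2 (x y : R) : (x + y) ^+ 2 <= 2 * x ^+ 2 + 2 * y ^+ 2.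
  by have := sqr_ge0 (x - y); rewrite sqrrB sqrrD; lra.
have h1 := sq2 (2 * (psi1' N r / s) * c) (psi1 N r * c3).
have h2 := sq2 (2 * (psi1' N r / s) * c2) (psi1 N r * c4).
move: (psi1 N r) (psi1' N r / s) p1 p2 h1 h2; clear - d0 d1 => P P' p1 p2 h1 h2.
move: (e ^+ 2) p1 p2 => E p1 p2.
have {}h1 : (2 * P' * c + P * c3) ^+ 2 <= 8 * E * c ^+ 2 + 2 * E * c3 ^+ 2.
  apply: (le_trans h1); rewrite !exprMn.
  have := ler_wpM2r (sqr_ge0 c) p2; have := ler_wpM2r (sqr_ge0 c3) p1; lra.
have {}h2 : (2 * P' * c2 + P * c4) ^+ 2 <= 8 * E * c2 ^+ 2 + 2 * E * c4 ^+ 2.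
  apply: (le_trans h2); rewrite !exprMn.
  have := ler_wpM2r (sqr_ge0 c2) p2; have := ler_wpM2r (sqr_ge0 c4) p1; lra.
have di : 1 <= de^-1 by rewrite invf_ge1.
have E0 : 0 <= E by exact: le_trans (sqr_ge0 P) p1.
have h3 : (P * c) ^+ 2 + (P * c2) ^+ 2 <= E * (c ^+ 2 + c2 ^+ 2).
  by rewrite !exprMn mulrDr lerD// ler_wpM2r ?sqr_ge0.
have q0 : 0 <= c ^+ 2 + c2 ^+ 2 by rewrite addr_ge0 ?sqr_ge0.
have h4 : (1 + de^-1) * ((P * c) ^+ 2 + (P * c2) ^+ 2) <= 2 * de^-1 * (E * (c ^+ 2 + c2 ^+ 2)).
  apply: ler_pM => //; first by rewrite addr_ge0// (le_trans _ di).
    by rewrite addr_ge0 ?sqr_ge0.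
  lra.
have h5 : de * ((2 * P' * c + P * c3) ^+ 2 + (2 * P' * c2 + P * c4) ^+ 2) <=
    de * (8 * (E * (c ^+ 2 + c2 ^+ 2)) + 2 * (E * (c3 ^+ 2 + c4 ^+ 2))).
  rewrite ler_wpM2l ?(ltW d0)//; lra.
have h6 : de * (8 * (E * (c ^+ 2 + c2 ^+ 2))) <= de^-1 * (8 * (E * (c ^+ 2 + c2 ^+ 2))).
  by apply: ler_wpM2r; [rewrite mulr_ge0// mulr_ge0|exact: le_trans d1 di].
apply: (le_trans (lerD h4 h5)).
have -> : E * (10 * de^-1 * (c ^+ 2 + c2 ^+ 2) + 2 * de * (c3 ^+ 2 + c4 ^+ 2)) =
  10 * (de^-1 * (E * (c ^+ 2 + c2 ^+ 2))) + 2 * (de * (E * (c3 ^+ 2 + c4 ^+ 2))) by ring.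
by move: h6; move: (E * _) (E * _) => A B; lra.
Qed.

Section frequency.
Variables (al C0 : R).
Hypotheses (al0 : 0 <= al) (C00 : 0 <= C0) (aN : 2 * al + 1 <= (4 * N.+1)%:R).
Hypothesis hQm : forall xi,
  (\int[leb]_(s in `[1%R, 2%R]) (Qm xi s)%:E <= (C0 * (1 + enorm xi) `^ (- (2 * al)))%:E)%E.
Hypothesis hQd : forall xi, (\int[leb]_(s in `[1%R, 2%R]) (Qd xi s)%:E <=
  (C0 * enorm xi ^+ 2 * (1 + enorm xi) `^ (- (2 * al)))%:E)%E.

(** With |2^k xi| = y / de, the decay hypothesis turns 1/de into de^{2 al - 1} y^{-2 al}. In the
    derivative term, de |2^k xi|^2 = y^2 / de yields the same power of de and the factor y^2. *)
Lemma integral_mterm_le de k xi : 0 < de -> de <= 1 -> 0 < enorm xi ->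
  (\int[leb]_s (mterm de k s xi)%:E <=
   (10 * Kpsi N ^+ 2 * C0 * de `^ (2 * al - 1) *
    (env N (de * dy k * enorm xi) ^+ 2 * (de * dy k * enorm xi) `^ (- (2 * al)) *
     (1 + (de * dy k * enorm xi) ^+ 2)))%:E)%E.
Proof.
move=> d0 d1 x0; set y := de * dy k * enorm xi; set om := dy k *: xi; have k0 := @dy_gt0 R k.
have om0 : 0 < enorm om by rewrite enormZ ?(ltW k0)// mulr_gt0.
have ey : enorm om = y / de.
  by rewrite enormZ ?(ltW k0)// /y; field; rewrite gt_eqF.
have y0 : 0 < y by rewrite !mulr_gt0.
pose e := (Kpsi N * env N y) ^+ 2; have e0 : 0 <= e by exact: sqr_ge0.
have c10 : 0 <= e * (10 * de^-1) by rewrite mulr_ge0// mulr_ge0// invr_ge0 ltW.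
have c20 : 0 <= e * (2 * de) by rewrite mulr_ge0// mulr_ge0// ltW.
have mQ (g : R -> R) : measurable_fun setT g -> measurable_fun (`[1, 2]%classic : set (measurableTypeR R)) (EFin \o g).
  by move=> mg; apply/measurable_EFinP; exact: measurable_funTS.
apply: (@le_trans _ _ (\int[leb]_(s in `[1%R, 2%R])
    ((e * (10 * de^-1))%:E * (Qm om s)%:E + (e * (2 * de))%:E * (Qd om s)%:E))%E).
  rewrite (@integral12 (fun s => e * (10 * de^-1) * Qm om s + e * (2 * de) * Qd om s)).
  apply: le_nnintegral => s; first by rewrite lee_fin mterm_ge0.
  rewrite lee_fin; apply: (le_trans (mterm_le _ _ _ d0 d1)).
  by rewrite -/om -/y -/e le_eqVlt; apply/orP; left; apply/eqP; ring.
rewrite ge0_integralD//; first last.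
- by apply: emeasurable_funM; [exact: measurable_cst|exact: mQ (measurable_Qd om)].
- by move=> s _; rewrite mule_ge0 ?lee_fin ?Qd_ge0.
- by apply: emeasurable_funM; [exact: measurable_cst|exact: mQ (measurable_Qm om)].
- by move=> s _; rewrite mule_ge0 ?lee_fin ?Qm_ge0.
rewrite !ge0_integralZl_EFin//; first last.
- exact: mQ (measurable_Qm om).
- by move=> s _; rewrite lee_fin Qm_ge0.
- exact: mQ (measurable_Qd om).
- by move=> s _; rewrite lee_fin Qd_ge0.
apply: (le_trans (leeD (lee_wpmul2l _ (hQm om)) (lee_wpmul2l _ (hQd om)))); rewrite ?lee_fin//.
have pw : (1 + enorm om) `^ (- (2 * al)) <= y `^ (- (2 * al)) * de `^ (2 * al).
  apply: (@le_trans _ _ (enorm om `^ (- (2 * al)))).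
    rewrite !powRN lef_pV2 ?posrE ?powR_gt0//; last by rewrite addr_gt0.
    apply: ge0_ler_powR; rewrite ?nnegrE ?mulr_ge0 ?addr_ge0 ?(ltW om0)//.
    by rewrite lerDr.
  rewrite ey powRM ?invr_ge0 ?(ltW y0) ?(ltW d0)// ler_wpM2l ?powR_ge0//.
  by rewrite -powR_inv1 ?(ltW d0)// -powRrM mulN1r opprK.
have dd : de `^ (2 * al - 1) = de `^ (2 * al) / de.
  by rewrite powRD ?(gt_eqF d0) ?implybT// powR_inv1 ?(ltW d0).
have YX0 : 0 <= y `^ (- (2 * al)) * de `^ (2 * al) by rewrite mulr_ge0// powR_ge0.
rewrite dd /e; set W := (1 + _) `^ _ in pw *; rewrite ey.
rewrite -/y in pw; move: (env N y) (Kpsi N) (y `^ _) (de `^ _) W pw YX0 => F Kp Y X W pw YX0 {e0 c10 c20 mQ}.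
apply: (@le_trans _ _ ((Kp * F) ^+ 2 * C0 * de^-1 * (10 + 2 * y ^+ 2) * (Y * X))).
  have -> : (Kp * F) ^+ 2 * (10 * de^-1) * (C0 * W) +
      (Kp * F) ^+ 2 * (2 * de) * (C0 * (y / de) ^+ 2 * W) =
      (Kp * F) ^+ 2 * C0 * de^-1 * (10 + 2 * y ^+ 2) * W by field; rewrite gt_eqF.
  apply: ler_wpM2l => //; apply: mulr_ge0; last by rewrite addr_ge0// mulr_ge0// sqr_ge0.
  by apply: mulr_ge0; [apply: mulr_ge0 => //; exact: sqr_ge0|rewrite invr_ge0 ltW].
have -> : 10 * Kp ^+ 2 * C0 * (X / de) * (F ^+ 2 * Y * (1 + y ^+ 2)) =
  (Kp * F) ^+ 2 * C0 * de^-1 * (10 + 10 * y ^+ 2) * (Y * X) by ring.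
apply: ler_wpM2r; first exact: YX0.
apply: ler_wpM2l; last by rewrite lerD2l ler_wpM2r ?sqr_ge0// ler_nat.
by apply: mulr_ge0; [apply: mulr_ge0 => //; exact: sqr_ge0|rewrite invr_ge0 ltW].
Qed.

(** For each frequency only the dilations with 2^k de |xi| near 1 matter; the others are summed by
    [env_sum_le] and [zsum_dy_min]. At xi = 0 everything vanishes. *)
Lemma zsum_mterm_le : exists2 C : R, 0 <= C & forall de xi, 0 < de -> de <= 1 ->
  (zsum (fun k => \int[leb]_s (mterm de k s xi)%:E) <= (C * de `^ (2 * al - 1))%:E)%E.
Proof.
have [C1 C10 CP] := env_sum_le al0 aN; have [C2 C20 C2P] := @zsum_dy_min R 1 ltr01.
exists (10 * Kpsi N ^+ 2 * C0 * C1 * C2) => [|de xi d0 d1].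
  by do 3 apply: mulr_ge0 => //; apply: mulr_ge0 => //; exact: sqr_ge0.
pose B := 10 * Kpsi N ^+ 2 * C0 * de `^ (2 * al - 1).
have B0 : 0 <= B.
  by apply: mulr_ge0; [apply: mulr_ge0 => //; apply: mulr_ge0 => //; exact: sqr_ge0|exact: powR_ge0].
have BC0 : 0 <= B * C1 by exact: mulr_ge0.
have i0 k : (0 <= \int[leb]_s (mterm de k s xi)%:E)%E.
  by apply: integral_ge0 => s _; rewrite lee_fin mterm_ge0.
have main (z : R) : 0 < z -> (forall k, (\int[leb]_s (mterm de k s xi)%:E <=
      (B * C1)%:E * (Num.min ((dy k * z) `^ 1) ((dy k * z) `^ (- 1)))%:E)%E) ->
    (zsum (fun k => \int[leb]_s (mterm de k s xi)%:E) <=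
     (10 * Kpsi N ^+ 2 * C0 * C1 * C2 * de `^ (2 * al - 1))%:E)%E.
  move=> z0 h; apply: (le_trans (le_zsum i0 h)).
  rewrite zsumZl//; last by move=> k; rewrite lee_fin le_min !powR_ge0.
  apply: (le_trans (lee_wpmul2l _ (C2P z z0))); first by rewrite lee_fin.
  by rewrite -EFinM lee_fin /B le_eqVlt; apply/orP; left; apply/eqP; ring.
have [x0|x0] := eqVneq (enorm xi) 0.
  apply: (main 1 ltr01) => k; apply: (@le_trans _ _ 0%E); last first.
    by rewrite mule_ge0 ?lee_fin// le_min !powR_ge0.
  rewrite -(integral0 leb setT); apply: le_nnintegral => s; first by rewrite lee_fin mterm_ge0.
  rewrite lee_fin; apply: (le_trans (mterm_le _ _ _ d0 d1)).
  have -> : env N (de * dy k * enorm xi) = 0 by rewrite x0 /env mulr0 expr0n/= mulr0 expr0n/= mul0r.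
  by rewrite mulr0 expr0n/= !mul0r.
have x1 : 0 < enorm xi by rewrite lt_def x0 enorm_ge0.
have z0 : 0 < de * enorm xi by rewrite mulr_gt0.
apply: (main _ z0) => k; apply: (le_trans (integral_mterm_le k d0 d1 x1)).
rewrite -EFinM lee_fin -/B -[leRHS]mulrA; apply: ler_wpM2l => //.
have -> : dy k * (de * enorm xi) = de * dy k * enorm xi by ring.
by apply: CP; rewrite !mulr_gt0// dy_gt0.
Qed.

(** The L^2 endpoint: for de = 2^{-j} the power 2 al - 1 of de is the square of the decay
    2^{-j(alpha - 1/2)}. *)
Lemma integral_Sq_le : exists2 C : R, 0 <= C & forall f de,
  mu.-integrable setT (EFin \o f) -> 0 < de -> de <= 1 ->
  (\int[mu]_x Sq f de x <= (C * de `^ (2 * al - 1))%:E * \int[mu]_x (f x ^+ 2)%:E)%E.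
Proof.
have [C C0' CP] := zsum_mterm_le; exists (2 * C) => [|f de fi d0 d1]; first exact: mulr_ge0.
pose F xi : R := ct f xi ^+ 2 + st f xi ^+ 2.
have F0 xi : 0 <= F xi by rewrite addr_ge0 ?sqr_ge0.
have mF : measurable_fun setT F.
  by apply: measurable_funD; apply: measurable_funX; [exact: measurable_ct|exact: measurable_st].
have mk d (T : measurableType d) (s : T -> R) k : measurable_fun setT s ->
    measurable_fun setT (fun p => dy k * s p).
  by move=> ms; apply: measurable_funM.
have mI d (T : measurableType d) (s : T -> R) : measurable_fun setT s ->
    measurable_fun setT (fun p => \1_(`[1, 2]%classic : set R) (s p) : R).
  move=> ms; rewrite -[X in measurable_fun _ X]/((\1_(`[1, 2]%classic : set R) : R -> R) \o s).
  by apply: measurableT_comp => //; apply: measurable_indic; exact: measurable_itv.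
have msq k d (T : measurableType d) (a : T -> V) (s : T -> R) :
    measurable_fun setT a -> measurable_fun setT s ->
    measurable_fun setT (fun p => (sqterm f de k (s p) (a p))%:E).
  move=> ma ms; apply/measurable_EFinP; apply: measurable_funM; last exact: mI.
  apply: measurable_funD; apply: measurable_funM => //; apply: measurable_funX.
    by apply: measurable_Tg => //; exact: mk.
  by apply: measurable_funM => //; apply: measurable_Tg' => //; exact: mk.
have mmt k d (T : measurableType d) (a : T -> V) (s : T -> R) :
    measurable_fun setT a -> measurable_fun setT s ->
    measurable_fun setT (fun p => (mterm de k (s p) (a p))%:E).
  move=> ma ms; have ms' := mk _ _ _ k ms.
  have hA := measurable_mA sigma N de ma ms'; have hB := measurable_mB sigma N de ma ms'.
  have hdA := measurable_dA sigma N de ma ms'; have hdB := measurable_dB sigma N de ma ms'.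
  apply/measurable_EFinP; apply: measurable_funM; last exact: mI.
  apply: measurable_funD; apply: measurable_funM => //.
    by apply: measurable_funD; exact: measurable_funX.
  by apply: measurable_funD; apply: measurable_funX; exact: measurable_funM.
have sq0 k s x : (0 <= (sqterm f de k s x)%:E)%E by rewrite lee_fin sqterm_ge0.
have mt0 k s x : (0 <= (mterm de k s x)%:E)%E by rewrite lee_fin mterm_ge0.
rewrite /Sq integral_zsum; first last.
- by move=> k x; apply: integral_ge0.
- move=> k; apply: (measurable_fun_fubini_tonelli_F (fun p : V * measurableTypeR R => (sqterm f de k p.2 p.1)%:E)) => //.
  by apply: msq; [exact: measurable_fst|exact: measurable_snd].
apply: (@le_trans _ _ (zsum (fun k => \int[mu]_xi \int[leb]_s ((2 * F xi)%:E * (mterm de k s xi)%:E)))%E).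
  apply: le_zsum => [k|k].
    by apply: integral_ge0 => x _; apply: integral_ge0.
  rewrite (@fubini_tonelli _ _ _ _ _ mu leb (fun p : V * measurableTypeR R => (sqterm f de k p.2 p.1)%:E))//; first last.
    by apply: msq; [exact: measurable_fst|exact: measurable_snd].
  rewrite [leRHS](@fubini_tonelli _ _ _ _ _ mu leb (fun p : V * measurableTypeR R => (2 * F p.1)%:E * (mterm de k p.2 p.1)%:E)%E)//; first last.
  - by move=> p; rewrite mule_ge0// lee_fin mulr_ge0.
  - apply: emeasurable_funM; last by apply: mmt; [exact: measurable_fst|exact: measurable_snd].
    by apply/measurable_EFinP; apply: measurable_funM => //; apply: (measurableT_comp mF); exact: measurable_fst.
  apply: le_nnintegral => s; first exact: integral_ge0.
  exact: integral_sqterm_le.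
rewrite -integral_zsum; first last.
- by move=> k x; apply: integral_ge0 => s _; rewrite mule_ge0// lee_fin mulr_ge0.
- move=> k; apply: (measurable_fun_fubini_tonelli_F (fun p : V * measurableTypeR R => (2 * F p.1)%:E * (mterm de k p.2 p.1)%:E)%E) => //.
    apply: emeasurable_funM; last by apply: mmt; [exact: measurable_fst|exact: measurable_snd].
    by apply/measurable_EFinP; apply: measurable_funM => //; apply: (measurableT_comp mF); exact: measurable_fst.
  by move=> p; rewrite mule_ge0// lee_fin mulr_ge0.
apply: (@le_trans _ _ (\int[mu]_xi ((2 * C * de `^ (2 * al - 1))%:E * (F xi)%:E))%E).
  apply: le_nnintegral => xi.
    by apply: zsum_ge0 => k; apply: integral_ge0 => s _; rewrite mule_ge0// lee_fin mulr_ge0.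
  under [X in zsum X]funext => k.
    rewrite ge0_integralZl_EFin//; last 2 first.
    - by apply: mmt; [exact: measurable_cst|exact: measurable_id].
    - by rewrite mulr_ge0.
    over.
  rewrite zsumZl ?mulr_ge0//; last by move=> k; exact: integral_ge0.
  apply: (le_trans (lee_wpmul2l _ (CP de xi d0 d1))); first by rewrite lee_fin mulr_ge0.
  by rewrite -!EFinM lee_fin le_eqVlt; apply/orP; left; apply/eqP; ring.
rewrite ge0_integralZl_EFin//; first last.
- by rewrite mulr_ge0 ?powR_ge0// mulr_ge0.
- exact/measurable_EFinP.
- by move=> x _; rewrite lee_fin.
apply: lee_wpmul2l; first by rewrite lee_fin mulr_ge0 ?powR_ge0// mulr_ge0.
exact: bessel.
Qed.

End frequency.

End square_function.

(** * The transform of the measure *)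

Section support_and_decay.
Context {R : realType} {n : nat}.
Local Notation V := 'rV[R]_n.
Local Notation leb := (@lebesgue_measure R).
Variable sigma : {finite_measure set V -> \bar R}.
Implicit Types (x xi v z : V).

Lemma supp_cube : compactly_supported sigma ->
  exists2 R0 : R, 0 < R0 & sigma (~` cube 0 R0) = 0%E.
Proof.
move=> [K cK K0]; have [M [_ MK]] := compact_bounded cK.
pose R0 : R := `|M| + 2.
have R00 : 0 < R0 by rewrite ltr_wpDl.
have mK : measurable K.
  rewrite -(setCK K); apply: measurableC; apply: open_measurable_mx.
  by apply: closed_openC; apply: compact_closed => //; exact: norm_hausdorff.
exists R0 => //; apply/eqP; rewrite -measure_le0 -K0.
apply: le_measure; rewrite ?inE.
- by apply: measurableC; exact: measurable_cube.
- exact: measurableC.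
move=> x /= nx Kx; apply: nx.
have h : `|x| <= `|M| + 1.
  by apply: MK => //; rewrite ltr_pwDr// ler_norm.
have : ball (0 : V) R0 x.
  by rewrite -ball_normE/= sub0r normrN (le_lt_trans h)// ltrD2l ltr1n.
by move=> [_ h2] i; exact: h2.
Qed.

Lemma measurable_enorm : measurable_fun setT (fun x : V => enorm x).
Proof.
apply: (measurableT_comp (f := @Num.sqrt R)).
  by apply: continuous_measurable_fun; exact: sqrt_continuous.
by apply: measurable_dotv; exact: measurable_id.
Qed.

Lemma measurable_eball x (r : R) : measurable (eball x r).
Proof.
have h : measurable_fun setT (fun y : V => enorm (y - x)).
  rewrite -[X in measurable_fun _ X]/((fun x : V => enorm x) \o (fun y => y - x)).
  apply: measurableT_comp; first exact: measurable_enorm.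
  by apply: measurable_funB_rV; [exact: measurable_id|exact: measurable_cst].
rewrite (_ : eball x r = setT `&` (fun y : V => enorm (y - x)) @^-1` `]-oo, r[%classic).
  by apply: h => //; exact: measurable_itv.
by rewrite setTI; apply/seteqP; split => y /=; rewrite in_itv.
Qed.

(** A cube of half-side r lies in the Euclidean ball of radius 2 sqrt n r, the factor 2 making the
    inequality strict. Once this radius exceeds 1, the total mass of sigma serves as the bound, so
    all radii are covered. *)
Lemma dim_cube (beta : R) : (0 < n)%N -> 0 <= beta ->
  locally_uniformly_dimensional beta sigma -> exists2 Cs : R, 0 <= Cs &
  forall x (r : R), 0 < r -> (sigma (cube x r) <= (Cs * r `^ beta)%:E)%E.
Proof.
move=> n0 b0 [C hC]; pose q : R := 2 * Num.sqrt n%:R.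
have q0 : 0 < q by rewrite mulr_gt0// sqrtr_gt0 ltr0n.
exists ((`|C| + mass sigma) * q `^ beta) => [|x r r0].
  by rewrite mulr_ge0 ?powR_ge0// addr_ge0 ?mass_ge0.
have qr0 : 0 < q * r by rewrite mulr_gt0.
rewrite -mulrA -powRM ?(ltW q0) ?(ltW r0)//.
have [qr|qr] := leP (q * r) 1.
  apply: (@le_trans _ _ (sigma (eball x (q * r)))).
    apply: le_measure; rewrite ?inE; [exact: measurable_cube|exact: measurable_eball|].
    move=> y /cubeP h; rewrite /eball/=.
    have : enorm (y - x) <= Num.sqrt n%:R * r.
      apply: enorm_le => [|i]; first exact: ltW.
      by rewrite !mxE distrC ltW.
    by move=> /le_lt_trans; apply; rewrite /q -mulrA mulr2n mulrDl !mul1r ltrDl mulr_gt0// sqrtr_gt0 ltr0n.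
  apply: (le_trans (hC x _ qr0 qr)); rewrite lee_fin ler_wpM2r ?powR_ge0//.
  by rewrite (le_trans (ler_norm _))// lerDl mass_ge0.
apply: (@le_trans _ _ (mass sigma)%:E).
  by rewrite -massE; apply: le_measure; rewrite ?inE//; exact: measurable_cube.
rewrite lee_fin -[leLHS]mulr1; apply: ler_pM => //; first exact: mass_ge0.
  by rewrite lerDr.
by apply: powR_ge1 => //; exact: ltW.
Qed.

Lemma poweR_half_le (X : \bar R) (a : R) : (0 <= X)%E -> 0 <= a ->
  (X `^ 2^-1 <= a%:E)%E -> (X <= (a ^+ 2)%:E)%E.
Proof.
case: X => [r| |]//.
  rewrite lee_fin => r0 a0; rewrite poweR_EFin !lee_fin powR12_sqrt// => h.
  by rewrite -(sqr_sqrtr r0) lerXn2r ?nnegrE ?sqrtr_ge0.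
by move=> _ a0; rewrite poweRyr ?invr_neq0// leye_eq.
Qed.

Lemma square_decay_le (al : R) (g : V -> R) : square_decay al g ->
  exists2 C : R, 0 <= C & forall xi, (\int[leb]_(t in `[1%R, 2%R]) (g (t *: xi) ^+ 2)%:E <=
    (C * (1 + enorm xi) `^ (- (2 * al)))%:E)%E.
Proof.
move=> [C hC]; exists (C ^+ 2) => [|xi]; first exact: sqr_ge0.
have p0 : 0 < 1 + enorm xi by rewrite ltr_pwDl ?enorm_ge0.
have X0 : (0 <= \int[leb]_(t in `[1%R, 2%R]) (g (t *: xi) ^+ 2)%:E)%E.
  by apply: integral_ge0 => t _; rewrite lee_fin sqr_ge0.
have h := hC xi; have a0 : 0 <= C * (1 + enorm xi) `^ (- al).
  by rewrite -lee_fin (le_trans _ h)// poweR_ge0.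
apply: (le_trans (poweR_half_le X0 a0 h)); rewrite lee_fin exprMn.
suff -> : ((1 + enorm xi) `^ (- al)) ^+ 2 = (1 + enorm xi) `^ (- (2 * al)) by [].
by rewrite -powR_mulrn ?powR_ge0// -powRrM; congr (_ `^ _); ring.
Qed.

Lemma Re_fourier : @complex.Re R \o fourier_measure sigma = cS sigma.
Proof.
apply/funext => z /=.
by apply: eq_Rintegral => y _; rewrite cosN.
Qed.

Lemma Im_fourier : @complex.Im R \o fourier_measure sigma = fun z => - sS sigma z.
Proof.
apply/funext => z /=; rewrite /sS -mulN1r -RintegralZl//.
  by apply: eq_Rintegral => y _; rewrite sinN mulN1r.
apply: (@le_integrable _ _ _ sigma _ _ _ (EFin \o cst 1)) => //.
- by apply/measurable_EFinP; apply: measurable_sin_ph => //; exact: measurable_cst.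
- by move=> y _ /=; rewrite lee_fin normr1 norm_sin_le1.
- by apply: finite_measure_integrable_cst.
Qed.

Lemma normc_fourier xi : normc (fourier_measure sigma xi) ^+ 2 =
  cS sigma xi ^+ 2 + sS sigma xi ^+ 2.
Proof.
have eR := congr1 (fun g => g xi) Re_fourier; have eI := congr1 (fun g => g xi) Im_fourier.
move: eR eI => /=; case: (fourier_measure sigma xi) => a b /= -> ->.
by rewrite sqr_sqrtr ?addr_ge0 ?sqr_ge0// sqrrN.
Qed.

Lemma derive_line (f : V -> R) z v :
  'D_v f z = 'D_1 (fun h : R => f (h *: v + z)) (0 : R).
Proof.
rewrite /derive (_ : (fun h : R => h^-1 *: (f (h *: v + z) - f z)) =
  (fun h : R => h^-1 *: (f ((h *: (1 : R) + 0) *: v + z) - f (0 *: v + z))))//.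
apply/funext => h.
by rewrite addr0 scale0r add0r /GRing.scale/= mulr1.
Qed.

Section gradient.
Variable R0 : R.
Hypotheses (R00 : 0 < R0) (supp : sigma (~` cube 0 R0) = 0%E).

Let mph xi : measurable_fun setT (fun y => ph y xi).
Proof. by apply: measurable_ph => //; exact: measurable_cst. Qed.

Let around : - 1 < (0 : R) < 1. Proof. by rewrite ltrN10 ltr01. Qed.

Let iph xi : sigma.-integrable setT (EFin \o (fun y => `|ph y xi|)).
Proof.
apply: (supp_integrable supp (M := Lph (n:=n) R0 * enorm xi)); first exact: measurableT_comp.
by move=> y yc; rewrite normr_id; exact: norm_ph_le.
Qed.

Lemma ph_line y (h : R) v z : ph y (h *: v + z) = h * ph y v + ph y z.
Proof.
rewrite -phZr /ph -mulrDr; congr (_ * _); rewrite /dotv -big_split/=.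
by apply: eq_bigr => i _; rewrite !mxE mulrDr.
Qed.

Lemma derive_cS v z : 'D_v (cS sigma) z = \int[sigma]_y (- ph y v * sin (ph y z)).
Proof.
rewrite derive_line.
have := @is_derive_integral R _ _ sigma (fun h y => cos (ph y (h *: v + z)))
  (fun h y => - ph y v * sin (ph y (h *: v + z))) (fun y => `|ph y v|) _ _ _ around.
move=> H; have [] := H _ _ (iph v) _.
- move=> x _; apply: (supp_integrable supp (M := 1)).
    by apply: measurable_cos_ph => //; exact: measurable_cst.
  by move=> y _; exact: norm_cos_le1.
- move=> x y _; rewrite (_ : (fun h => _) = cos \o (fun h => h * ph y v + ph y z)); last first.
    by apply/funext => h; rewrite ph_line.
  by apply: is_derive_eq; rewrite /GRing.scale/= ph_line; ring.
- by move=> x y _; rewrite normrM normrN ler_piMr// norm_sin_le1.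
by move=> _ ->; apply: eq_Rintegral => y _; rewrite scale0r add0r.
Qed.

Lemma derive_NsS v z : 'D_v (fun x => - sS sigma x) z = \int[sigma]_y (- (ph y v * cos (ph y z))).
Proof.
rewrite derive_line.
have H : is_derive (0 : R) 1 (fun h => sS sigma (h *: v + z))
    (\int[sigma]_y (ph y v * cos (ph y ((0 : R) *: v + z)))).
  apply: (@is_derive_integral R _ _ sigma (fun h y => sin (ph y (h *: v + z)))
    (fun h y => ph y v * cos (ph y (h *: v + z))) (fun y => `|ph y v|) _ _ _ around).
  - move=> x _; apply: (supp_integrable supp (M := 1)).
      by apply: measurable_sin_ph => //; exact: measurable_cst.
    by move=> y _; exact: norm_sin_le1.
  - move=> x y _; rewrite (_ : (fun h => _) = sin \o (fun h => h * ph y v + ph y z)); last first.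
      by apply/funext => h; rewrite ph_line.
    by apply: is_derive_eq; rewrite /GRing.scale/= ph_line; ring.
  - exact: iph.
  - by move=> x y _; rewrite normrM ler_piMr// norm_cos_le1.
have [_ ->] := is_deriveN H.
rewrite -mulN1r -RintegralZl//.
  by apply: eq_Rintegral => y _; rewrite scale0r add0r mulN1r.
apply: (supp_integrable supp (M := Lph (n:=n) R0 * enorm v)).
  by apply: measurable_funM => //; apply: measurable_cos_ph => //; exact: measurable_cst.
move=> y yc; rewrite normrM (le_trans _ (norm_ph_le v yc))//.
by rewrite ler_piMr// norm_cos_le1.
Qed.

(** Lagrange's identity: twice the difference of the two sides is the sum of the squares (a_i b_j -
    a_j b_i)^2. *)
Lemma sum_sqr_le (I : finType) (a b : I -> R) :
  (\sum_i a i * b i) ^+ 2 <= (\sum_i a i ^+ 2) * (\sum_i b i ^+ 2).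
Proof.
have h : 0 <= \sum_i \sum_j (a i * b j - a j * b i) ^+ 2.
  by apply: sumr_ge0 => i _; apply: sumr_ge0 => j _; exact: sqr_ge0.
have e : \sum_i \sum_j (a i * b j - a j * b i) ^+ 2 =
    2 * ((\sum_i a i ^+ 2) * (\sum_i b i ^+ 2)) - 2 * (\sum_i a i * b i) ^+ 2.
  have e1 : (\sum_i a i ^+ 2) * (\sum_i b i ^+ 2) = \sum_i \sum_j a i ^+ 2 * b j ^+ 2.
    by rewrite mulr_suml; apply: eq_bigr => i _; rewrite mulr_sumr.
  have e2 : (\sum_i a i ^+ 2) * (\sum_i b i ^+ 2) = \sum_i \sum_j a j ^+ 2 * b i ^+ 2.
    by rewrite e1 exchange_big.
  have e3 : (\sum_i a i * b i) ^+ 2 = \sum_i \sum_j (a i * b i) * (a j * b j).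
    by rewrite expr2 mulr_suml; apply: eq_bigr => i _; rewrite mulr_sumr.
  have -> : 2 * ((\sum_i a i ^+ 2) * (\sum_i b i ^+ 2)) =
      \sum_i \sum_j a i ^+ 2 * b j ^+ 2 + \sum_i \sum_j a j ^+ 2 * b i ^+ 2.
    by rewrite -e1 -e2; ring.
  rewrite e3 mulr_sumr -sumrN -!big_split/=; apply: eq_bigr => i _.
  rewrite mulr_sumr -sumrN -!big_split/=; apply: eq_bigr => j _; ring.
by move: h; rewrite e; lra.
Qed.

Let dl (i : 'I_n) : V := delta_mx ord0 i.

Lemma ph_delta y xi : ph y xi = \sum_i xi ord0 i * ph y (dl i).
Proof.
rewrite /ph /dotv mulr_sumr; apply: eq_bigr => i _.
rewrite (bigD1 i)//= big1 ?addr0; last first.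
  by move=> j ji; rewrite !mxE eqxx/= (negbTE ji) mulr0.
by rewrite !mxE !eqxx mulr1; ring.
Qed.

(** The derivative along the ray is the scalar product of xi with the gradient. Cauchy-Schwarz is
    applied to the real and the imaginary part separately. *)
Lemma Qd_le xi (s : R) :
  Qd sigma xi s <= enorm xi ^+ 2 * cvnorm (gradient (fourier_measure sigma) (s *: xi)) ^+ 2.
Proof.
pose a i := \int[sigma]_y (- ph y (dl i) * sin (ph y (s *: xi))).
pose b i := \int[sigma]_y (- (ph y (dl i) * cos (ph y (s *: xi)))).
have mc z : measurable_fun setT (fun y : V => cos (ph y z)).
  by apply: measurable_cos_ph => //; exact: measurable_cst.
have ms z : measurable_fun setT (fun y : V => sin (ph y z)).
  by apply: measurable_sin_ph => //; exact: measurable_cst.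
have ia i : sigma.-integrable setT (EFin \o (fun y => - ph y (dl i) * sin (ph y (s *: xi)))).
  apply: (supp_integrable supp (M := Lph (n:=n) R0 * enorm (dl i))).
    by apply: measurable_funM => //; exact: measurableT_comp.
  move=> y yc; rewrite normrM normrN (le_trans _ (norm_ph_le (dl i) yc))//.
  by rewrite ler_piMr// norm_sin_le1.
have ib i : sigma.-integrable setT (EFin \o (fun y => - (ph y (dl i) * cos (ph y (s *: xi))))).
  apply: (supp_integrable supp (M := Lph (n:=n) R0 * enorm (dl i))).
    by apply: measurableT_comp => //; exact: measurable_funM.
  move=> y yc; rewrite normrN normrM (le_trans _ (norm_ph_le (dl i) yc))//.
  by rewrite ler_piMr// norm_cos_le1.
have Zi (g : 'I_n -> V -> R) : (forall i, sigma.-integrable setT (EFin \o g i)) ->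
    \int[sigma]_y (\sum_i xi ord0 i * g i y) = \sum_i xi ord0 i * \int[sigma]_y g i y.
  move=> gi; have [|_ ->] := @Rintegral_sum R _ _ sigma _ (index_enum 'I_n) (fun i y => xi ord0 i * g i y).
    by move=> i; have := integrableZl measurableT (xi ord0 i) (gi i); exact: eq_integrable.
  by apply: eq_bigr => i _; rewrite RintegralZl.
have eA : cS' sigma xi s = \sum_i xi ord0 i * a i.
  rewrite /cS' -Zi//; apply: eq_Rintegral => y _.
  rewrite (ph_delta y xi) -sumrN mulr_suml; apply: eq_bigr => i _; ring.
have eB : - sS' sigma xi s = \sum_i xi ord0 i * b i.
  rewrite -Zi// /sS' -mulN1r -RintegralZl//.
    apply: eq_Rintegral => y _.
    rewrite (ph_delta y xi) mulN1r mulr_suml -sumrN; apply: eq_bigr => i _; ring.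
  apply: (supp_integrable supp (M := Lph (n:=n) R0 * enorm xi)); first exact: measurable_funM.
  move=> y yc; rewrite normrM (le_trans _ (norm_ph_le xi yc))//.
  by rewrite ler_piMr// norm_cos_le1.
have cs : cvnorm (gradient (fourier_measure sigma) (s *: xi)) ^+ 2 = \sum_i a i ^+ 2 + \sum_i b i ^+ 2.
  rewrite /cvnorm sqr_sqrtr; last by apply: sumr_ge0 => i _; exact: sqr_ge0.
  rewrite -big_split/=; apply: eq_bigr => i _; rewrite mxE /= sqr_sqrtr ?addr_ge0 ?sqr_ge0//.
  congr (_ ^+ 2 + _ ^+ 2); rewrite /partial.
    by rewrite Re_fourier /a -derive_cS.
  by rewrite Im_fourier /b -derive_NsS.
rewrite /Qd -[X in _ + X]sqrrN eA eB cs sqr_enorm mulrDr.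
have -> : dotv xi xi = \sum_i xi ord0 i ^+ 2 by apply: eq_bigr => i _; rewrite expr2.
by apply: lerD; exact: sum_sqr_le.
Qed.

(** The factor |xi|^2 is extracted by dividing [Qd], whose measurability is known, instead of
    multiplying the gradient. At xi = 0 the quotient is 0 by convention, and [Qd] vanishes there. *)
Lemma Qd_integral_le (al C : R) : 0 <= C ->
  (forall xi, (\int[leb]_(t in `[1%R, 2%R])
      (cvnorm (gradient (fourier_measure sigma) (t *: xi)) ^+ 2)%:E <=
    (C * (1 + enorm xi) `^ (- (2 * al)))%:E)%E) ->
  forall xi, (\int[leb]_(s in `[1%R, 2%R]) (Qd sigma xi s)%:E <=
    (C * enorm xi ^+ 2 * (1 + enorm xi) `^ (- (2 * al)))%:E)%E.
Proof.
move=> C0 h xi.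
have Q0 s : 0 <= Qd sigma xi s by exact: Qd_ge0.
have X0 : 0 <= enorm xi ^+ 2 by exact: sqr_ge0.
apply: (@le_trans _ _ ((enorm xi ^+ 2)%:E * \int[leb]_(s in `[1%R, 2%R])
    (Qd sigma xi s / enorm xi ^+ 2)%:E)%E).
  rewrite -ge0_integralZl_EFin//; last 2 first.
  - by move=> s _; rewrite lee_fin divr_ge0.
  - apply/measurable_EFinP; apply: measurable_funTS; apply: measurable_funM => //.
    exact: measurable_Qd.
  rewrite [leLHS]integral_mkcond [leRHS]integral_mkcond.
  apply: le_nnintegral => s; rewrite !patchE; case: ifPn => _ //; first by rewrite lee_fin.
  rewrite -EFinM lee_fin; have [x0|x0] := eqVneq (enorm xi) 0; last first.
    by rewrite mulrC divfK// expf_neq0.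
  by have := Qd_le xi s; rewrite x0 expr0n/= !mul0r.
rewrite (_ : C * _ * _ = enorm xi ^+ 2 * (C * (1 + enorm xi) `^ (- (2 * al)))); last by ring.
rewrite [leRHS]EFinM; apply: lee_wpmul2l; first by rewrite lee_fin.
apply: le_trans (h xi).
rewrite [leLHS]integral_mkcond [leRHS]integral_mkcond.
apply: le_nnintegral => s; rewrite !patchE; case: ifPn => _ //.
  by rewrite lee_fin divr_ge0.
rewrite lee_fin; have [x0|x0] := eqVneq (enorm xi) 0.
  by rewrite x0 expr0n/= invr0 mulr0 sqr_ge0.
rewrite ler_pdivrMr; last by rewrite exprn_gt0// lt_def x0 enorm_ge0.
by rewrite mulrC; exact: Qd_le.
Qed.

End gradient.

End support_and_decay.

(** * Interpolation *)

Section real_helpers.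
Context {R : realType}.

Definition dj (j : nat) : R := 2^-1 ^+ j.+1.

Lemma dj_gt0 j : 0 < dj j. Proof. by rewrite exprn_gt0. Qed.

Lemma dj_le_half j : dj j <= 2^-1.
Proof.
rewrite /dj exprS ler_piMr//; apply: exprn_ile1 => //.
by rewrite invf_le1// ler1n.
Qed.

Lemma dj_le1 j : dj j <= 1.
Proof. by rewrite (le_trans (dj_le_half j))// invf_le1// ler1n. Qed.

Lemma nneseries_le (u : nat -> \bar R) (B : \bar R) : (forall j, 0 <= u j)%E ->
  (forall M, \sum_(0 <= j < M) u j <= B)%E -> (\sum_(0 <= j <oo) u j <= B)%E.
Proof.
move=> u0 uB; apply: lime_le; first by apply: is_cvg_nneseries.
by apply: nearW => M; exact: uB.
Qed.

Lemma dj_powR_sum (e : R) : 0 < e -> exists2 W : R, 1 <= W &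
  (\sum_(0 <= j <oo) (dj j `^ e)%:E <= W%:E)%E.
Proof.
move=> e0; pose r : R := 2^-1 `^ e.
have r0 : 0 < r by rewrite powR_gt0.
have r1 : r < 1.
  rewrite /r /powR gt_eqF// expR_lt1 pmulr_rlt0// ln_lt0//.
  by rewrite invr_gt0 ltr0n/= invf_lt1// ltr1n.
have rj j : dj j `^ e = r ^+ j.+1.
  have -> : dj j = 2^-1 `^ j.+1%:R by rewrite powR_mulrn// invr_ge0.
  by rewrite -powRrM mulrC powRrM powR_mulrn ?powR_ge0.
exists (1 - r)^-1; first by rewrite invf_ge1 ?subr_gt0// gerBl ltW.
apply: nneseries_le => [j|M]; first by rewrite lee_fin powR_ge0.
rewrite sumEFin lee_fin -[leRHS]mul1r ler_pdivlMr ?subr_gt0//.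
suff -> : (\sum_(0 <= j < M) dj j `^ e) * (1 - r) = r - r ^+ M.+1.
  by rewrite lerBlDr (le_trans (ltW r1))// lerDl exprn_ge0// ltW.
elim: M => [|M IH]; first by rewrite big_nil mul0r expr1 subrr.
by rewrite big_nat_recr//= mulrDl IH rj !exprS; ring.
Qed.

Lemma poweR_le_mul (F M P PM : R) (X : \bar R) : 0 <= F -> 1 <= M -> (0 <= X)%E ->
  0 < P -> P <= PM -> (F%:E <= M%:E * X)%E ->
  ((F `^ P)%:E <= (M `^ PM)%:E * X `^ P)%E.
Proof.
move=> F0 M1 X0 P0 PPM; have M0 : 0 <= M by rewrite (le_trans _ M1).
case: X X0 => [r| |]//.
  rewrite lee_fin => r0; rewrite -EFinM lee_fin => h.
  rewrite poweR_EFin -EFinM lee_fin.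
  apply: (@le_trans _ _ ((M * r) `^ P)).
    by apply: ge0_ler_powR; rewrite ?nnegrE// ?mulr_ge0//; exact: ltW.
  rewrite powRM//; apply: ler_wpM2r; first exact: powR_ge0.
  exact: ler_powR.
move=> _ _; rewrite poweRyr ?gt_eqF// gt0_muley ?leey//.
by rewrite lte_fin powR_gt0// (lt_le_trans _ M1).
Qed.

(** The power F^s on the right is absorbed by the left, leaving F^e <= M X, which is then raised to
    the power q. *)
Lemma powR_div_le_mul (F M s e q qM : R) (X : \bar R) : 0 < F -> 1 <= M -> (0 <= X)%E ->
  0 < q -> q <= qM -> e + s = 1 -> (F%:E <= (M * F `^ s)%:E * X)%E ->
  ((F `^ (e * q))%:E <= (M `^ qM)%:E * X `^ q)%E.
Proof.
move=> F0 M1 X0 q0 qqM es h; rewrite powRrM.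
apply: poweR_le_mul => //; first exact: powR_ge0.
have M0 : 0 < M by rewrite (lt_le_trans _ M1).
case: X X0 h => [r| |]//; last by move=> _ _; rewrite gt0_muley ?leey// lte_fin.
rewrite lee_fin => r0; rewrite -!EFinM !lee_fin => h.
have Fs0 : 0 < F `^ s by rewrite powR_gt0.
rewrite -(ler_pM2r Fs0) -powRD; last by rewrite (gt_eqF F0) implybT.
by rewrite es (powRr1 (ltW F0)) mulrAC.
Qed.

End real_helpers.

Section HLmax_order.
Context {R : realType} {n : nat}.
Local Notation V := 'rV[R]_n.
Local Notation mu := (lebesgue_rV n).

Lemma HLmax_scale_le (g h : V -> R) (a : R) x : 0 <= a -> measurable_fun setT h ->
  (forall y, 0 <= g y) -> (forall y, 0 <= h y) -> (forall y, g y <= a * h y) ->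
  (HLmax g x <= a%:E * HLmax h x)%E.
Proof.
move=> a0 mh g0 h0 gh; apply: ge_ereal_sup => _ [q [q0 qx] <-].
apply: (@le_trans _ _ (a%:E * qmean h q)%E); last first.
  by apply: lee_wpmul2l; [rewrite lee_fin|apply: ereal_sup_ubound; exists q].
rewrite /qmean /cube_mean muleCA; apply: lee_wpmul2l.
  by rewrite lee_fin invr_ge0 exprn_ge0// mulr_ge0// ltW.
rewrite -ge0_integralZl_EFin//; first last.
- by apply/measurable_EFinP; exact: measurable_funTS.
- by move=> y _; rewrite lee_fin.
- exact: measurable_cube.
rewrite [leLHS]integral_mkcond [leRHS]integral_mkcond.
apply: le_nnintegral => y; rewrite !patchE; case: ifPn => _ //.
  by rewrite lee_fin.
by rewrite -EFinM lee_fin.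
Qed.

End HLmax_order.

Section interpolation.
Context {R : realType} {n : nat}.
Local Notation V := 'rV[R]_n.
Local Notation mu := (lebesgue_rV n).
Local Notation leb := (@lebesgue_measure R).
Variables (sigma : {finite_measure set V -> \bar R}) (N : nat) (R0 : R).
Hypotheses (R00 : 0 < R0) (supp : sigma (~` cube 0 R0) = 0%E).
Implicit Types (f : V -> R) (x y : V).

Lemma Sq_ge0 f de x : 0 < de -> (0 <= Sq sigma N f de x)%E.
Proof.
by move=> d0; apply: zsum_ge0 => k; apply: integral_ge0 => s _; rewrite lee_fin sqterm_ge0.
Qed.

Lemma measurable_Sq f de : mu.-integrable setT (EFin \o f) -> 0 < de ->
  measurable_fun setT (Sq sigma N f de).
Proof.
move=> fi d0; apply: measurable_zsum => [k|k x]; last first.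
  by apply: integral_ge0 => s _; rewrite lee_fin sqterm_ge0.
apply: (measurable_fun_fubini_tonelli_F (fun p : V * measurableTypeR R => (sqterm sigma N f de k p.2 p.1)%:E)) => //; last first.
  by move=> p; rewrite lee_fin sqterm_ge0.
have mk : measurable_fun setT (fun p : V * measurableTypeR R => dy k * p.2).
  by apply: measurable_funM => //; exact: measurable_snd.
have mx : measurable_fun setT (fun p : V * measurableTypeR R => p.1) by exact: measurable_fst.
apply/measurable_EFinP; apply: measurable_funM; last first.
  rewrite -[X in measurable_fun _ X]/((\1_(`[1, 2]%classic : set R) : R -> R) \o snd).
  apply: measurableT_comp; first by apply: measurable_indic; exact: measurable_itv.
  exact: measurable_snd.
apply: measurable_funD; apply: measurable_funM => //; apply: measurable_funX.
  exact: measurable_Tg.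
by apply: measurable_funM => //; exact: measurable_Tg'.
Qed.

Lemma measurable_poweR_var (g : V -> \bar R) (r : V -> R) :
  measurable_fun setT g -> measurable_fun setT r -> (forall x, 0 <= g x)%E ->
  (forall x, 0 < r x) -> measurable_fun setT (fun x => g x `^ r x)%E.
Proof.
move=> mg mr g0 r0; rewrite (_ : (fun x => _) = (fun x => if +oo%E <= g x then +oo%E
    else (powf (fine \o g) r x)%:E)%E); last first.
  apply/funext => x; rewrite leye_eq poweRE (gt_eqF (r0 x)) /powf.
  case: ifPn => // _; case: ifPn => // /eqP h.
  by have := g0 x; rewrite h.
apply: measurable_fun_ifT => //.
  by apply: measurable_fun_lee => //; exact: measurable_cst.
apply/measurable_EFinP; apply: measurable_powf => //.
by apply: measurableT_comp => //; exact: measurable_fine.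
Qed.

Variables (K d th kp ep : R).
Hypotheses (K1 : 1 <= K) (d0 : 0 <= d) (th01 : 0 < th < 1) (ep0 : 0 < ep).
Hypothesis hPop : forall f t x, measurable_fun setT f -> (forall x, 0 <= f x) -> 0 < t ->
  (`|Pop sigma N f 1 t x|%:E <= K%:E * HLmax f x)%E.
Hypothesis hTop : forall f j t x, measurable_fun setT f -> (forall x, 0 <= f x) -> 0 < t ->
  (`|Top sigma N f (dj j) t x|%:E <= (K * dj j `^ (- d))%:E * HLmax f x)%E.
Variables (P q e w : V -> R) (PM qM : R).
Hypotheses (P0 : forall x, 0 < P x) (PPM : forall x, P x <= PM).
Hypotheses (q0 : forall x, 0 < q x) (qqM : forall x, q x <= qM).
Hypotheses (Peq : forall x, P x = e x * q x) (eth : forall x, e x + w x * th = 1).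
Hypothesis Pw : forall x, P x = 2 + w x * (2 * (1 - th)).
Hypotheses (me : measurable_fun setT e) (mw : measurable_fun setT w).
Variables W1 W2 : R.
Hypotheses (W11 : 1 <= W1) (W21 : 1 <= W2).
Hypothesis W1P : (\sum_(0 <= j <oo) (dj j `^ (kp * th - d))%:E <= W1%:E)%E.
Hypothesis W2P : (\sum_(0 <= j <oo) (dj j `^ ep)%:E <= W2%:E)%E.

(* The exponents satisfy 1/P = th/2 + (1 - th)/q, with e = P/q and w = P (1/2 - 1/q):
   f = f^e (f^w)^th and f^2 = f^P (f^w)^(-2(1-th)). At a point where the maximal
   function to the power w has size 2^l, f is cut at height f^w = 2^{-j kp} 2^l; the
   low part is estimated by the maximal function of f^e, the high part in L^2. *)
Definition thr (j : nat) (l : int) : R := dj j `^ kp * dy l.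

(** The height is that of f^w, not of f: where P y < 2 the exponent w y is negative and the small
    values of f are the ones kept. The estimates never use the sign of w. *)
Definition fhigh f j l y : R := f y * (thr j l < f y `^ w y)%R%:R.
Definition flow f j l y : R := f y - fhigh f j l y.

Lemma thr_gt0 j l : 0 < thr j l.
Proof. by rewrite mulr_gt0 ?powR_gt0 ?dj_gt0 ?dy_gt0. Qed.

Lemma measurable_fhigh f j l : measurable_fun setT f -> measurable_fun setT (fhigh f j l).
Proof.
move=> mf; apply: measurable_funM => //.
rewrite (_ : (fun y => _) = \1_[set y | thr j l < f y `^ w y]); last first.
  by apply/funext => y; rewrite indicE mem_setE.
by apply: measurable_indic; apply: measurable_gt; exact: measurable_powf.
Qed.

Lemma fhigh_le f j l y : 0 <= f y -> 0 <= fhigh f j l y <= f y.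
Proof. by move=> f0; rewrite /fhigh; case: ltP => _; rewrite ?mulr1 ?mulr0 ?lexx ?f0. Qed.

Lemma flow_le f j l y : 0 <= f y -> 0 <= flow f j l y <= thr j l `^ th * powf f e y.
Proof.
move=> f0; rewrite /flow /fhigh /powf; case: ltP => h; rewrite ?mulr1 ?mulr0 ?subrr ?subr0.
  by rewrite lexx mulr_ge0 ?powR_ge0.
rewrite f0/=; have [->|fy] := eqVneq (f y) 0.
  by rewrite mulr_ge0 ?powR_ge0.
have f1 : 0 < f y by rewrite lt_def fy.
have {1}-> : f y = (f y `^ w y) `^ th * f y `^ e y.
  rewrite -powRrM -powRD; last by rewrite fy implybT.
  by rewrite addrC eth powRr1.
apply: ler_wpM2r; first exact: powR_ge0.
apply: ge0_ler_powR; rewrite ?nnegrE ?powR_ge0//; first by case/andP : th01 => /ltW.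
exact/ltW/thr_gt0.
Qed.

Section pointwise.
Variables (f : V -> R) (B : R).
Hypotheses (cf : continuous f) (f0 : forall x, 0 <= f x) (fB : forall x, f x <= B).
Hypothesis fi : mu.-integrable setT (EFin \o f).

Let mf : measurable_fun setT f.
Proof. exact: continuous_measurable_rV. Qed.

Lemma integrable_fhigh j l : mu.-integrable setT (EFin \o fhigh f j l).
Proof.
apply: (le_integrable _ _ _ fi) => //.
  by apply/measurable_EFinP; exact: measurable_fhigh.
by move=> y _ /=; have /andP[h1 h2] := fhigh_le j l (f0 y); rewrite lee_fin !ger0_norm.
Qed.

Lemma integrable_flow j l : mu.-integrable setT (EFin \o flow f j l).
Proof.
have h := integrableB measurableT fi (integrable_fhigh j l).
by apply: eq_integrable h => // y _ /=; rewrite EFinB.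
Qed.

Lemma Top_split_le j l t x : 0 < t ->
  (`|Top sigma N f (dj j) t x|%:E <=
   (K * thr j l `^ th * dj j `^ (- d))%:E * HLmax (powf f e) x +
   `|Top sigma N (fhigh f j l) (dj j) t x|%:E)%E.
Proof.
move=> t0.
have -> : Top sigma N f (dj j) t x =
    Top sigma N (flow f j l) (dj j) t x + Top sigma N (fhigh f j l) (dj j) t x.
  transitivity (Top sigma N (fun y => flow f j l y + fhigh f j l y) (dj j) t x).
    have ef : f = (fun y => flow f j l y + fhigh f j l y).
      by apply/funext => y; rewrite /flow subrK.
    by rewrite [in LHS]ef.
  by apply: TopD => //; [exact: dj_gt0|exact: integrable_flow|exact: integrable_fhigh].
apply: (@le_trans _ _ (`|Top sigma N (flow f j l) (dj j) t x|%:E +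
  `|Top sigma N (fhigh f j l) (dj j) t x|%:E)%E).
  by rewrite -EFinD lee_fin ler_normD.
apply: leeD => //; apply: (le_trans (hTop j x _ _ t0)).
- by apply: measurable_funB => //; exact: measurable_fhigh.
- by move=> y; have /andP[] := flow_le j l (f0 y).
have T0 : 0 <= thr j l `^ th by exact: powR_ge0.
apply: (@le_trans _ _ ((K * dj j `^ (- d))%:E * ((thr j l `^ th)%:E * HLmax (powf f e) x))%E).
  apply: lee_wpmul2l; first by rewrite lee_fin mulr_ge0 ?powR_ge0// (le_trans _ K1).
  apply: HLmax_scale_le => //; first exact: measurable_powf.
  - by move=> y; have /andP[] := flow_le j l (f0 y).
  - by move=> y; exact: powR_ge0.
  - by move=> y; have /andP[] := flow_le j l (f0 y).
by rewrite muleA -EFinM mulrAC.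
Qed.

(** F stands for the supremum over t of the averages at x. Either some high part has a large square
    function at x, and then its single term in the last sum already bounds F^P; or all high parts
    together contribute at most F/3, and the smooth part or the low parts must supply another
    third. *)
Lemma sup_pow_le x (F : R) : 0 < F ->
  (forall b, (forall t, 0 < t -> avg sigma f t x <= b) -> F <= b) ->
  ((F `^ P x)%:E <= ((3 * K) `^ PM)%:E * HLmax f x `^ P x +
    (((3 * K * W1) `^ qM)%:E * HLmax (powf f e) x `^ q x +
    \sum_(0 <= j <oo) zsum (fun l => (4 * (3 * W2) ^+ 2 * dj j `^ (- (2 * ep)) *
       dy l `^ (2 * (1 - th)))%:E * Sq sigma N (fhigh f j l) (dj j) x)))%E.
Proof.
move=> F0 Fsup; have [th0 th1] := andP th01.
have K0 : 0 < K by rewrite (lt_le_trans _ K1).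
have K31 : 1 <= 3 * K by move: K1; lra.
have K32 : 1 <= 3 * K * W1 by rewrite (le_trans K31)// ler_peMr// (le_trans _ K31).
have W10 : 0 < W1 by rewrite (lt_le_trans _ W11).
have W20 : 0 < W2 by rewrite (lt_le_trans _ W21).
have h30 : (0 <= HLmax f x)%E by exact: HLmax_ge0.
have h40 : (0 <= HLmax (powf f e) x)%E by apply: HLmax_ge0 => y; exact: powR_ge0.
have [l /andP[lF Fl]] := ex_dy (powR_gt0 (w x) F0).
set G3 := (\sum_(0 <= j <oo) _)%E.
have C30 j k : 0 <= 4 * (3 * W2) ^+ 2 * dj j `^ (- (2 * ep)) * dy k `^ (2 * (1 - th)).
  do 2 (apply: mulr_ge0; last exact: powR_ge0).
  by apply: mulr_ge0 => //; exact: sqr_ge0.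
have z0 j k : (0 <= (4 * (3 * W2) ^+ 2 * dj j `^ (- (2 * ep)) * dy k `^ (2 * (1 - th)))%:E *
    Sq sigma N (fhigh f j k) (dj j) x)%E.
  by apply: mule_ge0; [rewrite lee_fin|apply: Sq_ge0; exact: dj_gt0].
have G30 : (0 <= G3)%E by apply: nneseries_ge0 => j _ _; exact: zsum_ge0.
have G10 : (0 <= ((3 * K) `^ PM)%:E * HLmax f x `^ P x)%E.
  by rewrite mule_ge0 ?poweR_ge0// lee_fin powR_ge0.
have G20 : (0 <= ((3 * K * W1) `^ qM)%:E * HLmax (powf f e) x `^ q x)%E.
  by rewrite mule_ge0 ?poweR_ge0// lee_fin powR_ge0.
have [[j Sj]|nS] := pselect (exists j,
    (((F * dj j `^ ep / (3 * W2)) ^+ 2)%:E < Sq sigma N (fhigh f j l) (dj j) x)%E).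
  apply: le_trans (leeDr _ G10); apply: le_trans (leeDr _ G20).
  apply: (@le_trans _ _ (zsum (fun l => (4 * (3 * W2) ^+ 2 * dj j `^ (- (2 * ep)) *
       dy l `^ (2 * (1 - th)))%:E * Sq sigma N (fhigh f j l) (dj j) x)%E)); last first.
    apply: le_trans (nneseries_lim_ge j.+1 _); last by move=> i _ _; exact: zsum_ge0.
    by rewrite big_nat_recr//= leeDr// sume_ge0// => i _; exact: zsum_ge0.
  apply: le_trans (ge_zsum l _); last by move=> k; exact: z0.
  apply: le_trans (lee_wpmul2l _ (ltW Sj)); last first.
    by rewrite lee_fin.
  rewrite -EFinM lee_fin.
  have dj2 : dj j `^ (- (2 * ep)) * (dj j `^ ep) ^+ 2 = 1.
    rewrite -powR_mulrn ?powR_ge0// -powRrM -powRD; last by rewrite (gt_eqF (dj_gt0 j)) implybT.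
    by rewrite mulrC addNr powRr0.
  have -> : 4 * (3 * W2) ^+ 2 * dj j `^ (- (2 * ep)) * dy l `^ (2 * (1 - th)) *
      (F * dj j `^ ep / (3 * W2)) ^+ 2 = 4 * dy l `^ (2 * (1 - th)) * F ^+ 2.
    rewrite -[RHS]mulr1 -[X in _ = _ * X]dj2.
    by move: (_ `^ _) (_ `^ _) (_ `^ _) => u v z; field; exact: lt0r_neq0.
  rewrite Pw powRD; last by rewrite (gt_eqF F0) implybT.
  rewrite [X in X * _ <= _](_ : _ = F ^+ 2); last by rewrite powR_mulrn// ltW.
  rewrite mulrC; apply: ler_wpM2r; first exact: sqr_ge0.
  rewrite powRrM; set et := 2 * (1 - th).
  have et0 : 0 <= et by rewrite mulr_ge0// subr_ge0 ltW.
  apply: (@le_trans _ _ ((2 * dy l) `^ et)).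
    apply: ge0_ler_powR; rewrite ?nnegrE ?powR_ge0// ?mulr_ge0 ?(ltW (dy_gt0 _))//.
    by rewrite ltW// -dyS.
  rewrite powRM ?(ltW (dy_gt0 _))//; apply: ler_wpM2r; first exact: powR_ge0.
  have -> : 4 = 2 `^ 2 :> R by rewrite powR_mulrn//; ring.
  by apply: ler_powR; rewrite ?ler1n// /et ger_pMr// gerBl ltW.
have [H|H] : (F%:E <= (3 * K)%:E * HLmax f x)%E \/
    (F%:E <= (3 * K * W1 * F `^ (w x * th))%:E * HLmax (powf f e) x)%E; last 2 first.
- apply: le_trans (leeDl _ _); last exact: adde_ge0.
  by apply: poweR_le_mul => //; exact: ltW.
- apply: le_trans (leeDr _ G10); apply: le_trans (leeDl _ G30).
  rewrite Peq; exact: powR_div_le_mul (eth x) H.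
have Fw0 : 0 < F `^ (w x * th) by rewrite powR_gt0.
case HH : (HLmax f x) h30 => [r| |]// r0; last first.
  by left; rewrite gt0_muley ?leey// lte_fin mulr_gt0.
case HH4 : (HLmax (powf f e) x) h40 => [s| |]// s0; last first.
  by right; rewrite gt0_muley ?leey// lte_fin !mulr_gt0.
rewrite -!EFinM !lee_fin; move: r0 s0; rewrite !lee_fin => r0 s0.
(* The third F/3 can be absorbed because F is a real number, hence finite. *)
suff : F <= K * r + K * W1 * F `^ (w x * th) * s + F / 3.
  case: (leP F (3 * K * r)); [by left|move=> h1 h2; right; lra].
apply: Fsup => t t0; rewrite -lee_fin.
have nB y : `|f y| <= B by rewrite ger0_norm.
apply: (@le_trans _ _ `|avg sigma f t x|%:E); first by rewrite lee_fin ler_norm.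
apply: (le_trans (avg_le sigma N cf nB x t0)); rewrite -addrA EFinD.
apply: leeD; first by rewrite EFinM -HH; exact: hPop.
have term j : (`|Top sigma N f (2^-1 ^+ j.+1) t x|%:E <=
    (K * F `^ (w x * th) * s)%:E * (dj j `^ (kp * th - d))%:E +
    (F / (3 * W2))%:E * (dj j `^ ep)%:E)%E.
  apply: (le_trans (Top_split_le j l x t0)); rewrite HH4 -!EFinM -!EFinD lee_fin.
  apply: lerD.
    have -> : thr j l `^ th = dj j `^ (kp * th) * dy l `^ th.
      by rewrite /thr powRM ?powR_ge0// ?(ltW (dy_gt0 _))// -powRrM.
    have -> : K * F `^ (w x * th) * s * dj j `^ (kp * th - d) =
        K * (dj j `^ (kp * th) * F `^ (w x * th)) * dj j `^ (- d) * s.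
      by rewrite powRD; [ring|rewrite (gt_eqF (dj_gt0 j)) implybT].
    apply: ler_wpM2r => //; apply: ler_wpM2r; first exact: powR_ge0.
    apply: ler_wpM2l; first exact: ltW.
    apply: ler_wpM2l; first exact: powR_ge0.
    rewrite powRrM; apply: ge0_ler_powR; rewrite ?nnegrE ?powR_ge0// ?(ltW (dy_gt0 _))//.
    exact: ltW.
  have h : ((Top sigma N (fhigh f j l) (dj j) t x ^+ 2)%:E <=
      ((F * dj j `^ ep / (3 * W2)) ^+ 2)%:E)%E.
    apply: (le_trans (Top_le_Sq N R00 supp (integrable_fhigh j l) (dj_gt0 j) x t0)).
    by rewrite leNgt; apply/negP => h; apply: nS; exists j.
  have -> : F / (3 * W2) * dj j `^ ep = F * dj j `^ ep / (3 * W2) by ring.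
  rewrite -(@ler_pXn2r _ 2)// ?nnegrE//; last first.
    by rewrite divr_ge0 ?mulr_ge0 ?powR_ge0 ?(ltW F0)// ltW.
  by rewrite real_normK ?num_real.
have t1 j : (0 <= (K * F `^ (w x * th) * s)%:E * (dj j `^ (kp * th - d))%:E)%E.
  by rewrite -EFinM lee_fin !mulr_ge0 ?powR_ge0// ltW.
have t2 j : (0 <= (F / (3 * W2))%:E * (dj j `^ ep)%:E)%E.
  by rewrite -EFinM lee_fin mulr_ge0 ?powR_ge0// divr_ge0 ?(ltW F0)// mulr_ge0// ltW.
apply: (@le_trans _ _ (\sum_(0 <= j <oo) ((K * F `^ (w x * th) * s)%:E * (dj j `^ (kp * th - d))%:E +
    (F / (3 * W2))%:E * (dj j `^ ep)%:E))%E).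
  by apply: lee_nneseries.
rewrite nneseriesD//.
rewrite !nneseriesZl; [|by move=> j _; rewrite lee_fin powR_ge0..].
rewrite EFinD; apply: leeD.
  apply: (le_trans (lee_wpmul2l _ W1P)); first by rewrite lee_fin !mulr_ge0 ?powR_ge0// ltW.
  by rewrite -EFinM lee_fin le_eqVlt; apply/orP; left; apply/eqP; ring.
apply: (le_trans (lee_wpmul2l _ W2P)).
  by rewrite lee_fin divr_ge0 ?(ltW F0)// mulr_ge0// ltW.
rewrite -EFinM lee_fin le_eqVlt; apply/orP; left; apply/eqP; field; exact: lt0r_neq0.
Qed.

Variables (al CP Cq C4 C5 W3 : R).
Hypotheses (C40 : 0 <= C4) (C50 : 0 <= C5).
Hypotheses (mP : measurable_fun setT P) (mq : measurable_fun setT q).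
Hypothesis hHP : (\int[mu]_x HLmax f x `^ P x <= CP%:E)%E.
Hypothesis hHq : (\int[mu]_x HLmax (powf f e) x `^ q x <= Cq%:E)%E.
Hypothesis hSq : forall g de, mu.-integrable setT (EFin \o g) -> 0 < de -> de <= 1 ->
  (\int[mu]_x Sq sigma N g de x <= (C4 * de `^ (2 * al - 1))%:E * \int[mu]_x (g x ^+ 2)%:E)%E.
Hypothesis hC5 : forall y : R, 0 <= y ->
  (zsum (fun k : int => (dy k `^ (2 * (1 - th)) * (dy k < y)%R%:R)%:E) <=
   (C5 * y `^ (2 * (1 - th)))%:E)%E.
Hypothesis W3P : (\sum_(0 <= j <oo)
  (dj j `^ (2 * al - 1 - 2 * ep - kp * (2 * (1 - th))))%:E <= W3%:E)%E.
Hypothesis f1 : (\int[mu]_x (powf f P x)%:E <= 1)%E.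

(** At fixed y only the levels 2^l < f^w 2^{(j+1) kp} occur. Their geometric sum is a multiple of
    the largest term, and f^2 (f^w)^{2(1-th)} = f^P. *)
Lemma zsum_fhigh_le j y :
  (zsum (fun l => (dy l `^ (2 * (1 - th)) * fhigh f j l y ^+ 2)%:E) <=
   (C5 * dj j `^ (- (kp * (2 * (1 - th)))) * powf f P y)%:E)%E.
Proof.
set et := 2 * (1 - th); pose U := f y `^ w y; pose z := U * dj j `^ (- kp).
have z0 : 0 <= z by rewrite mulr_ge0 ?powR_ge0.
have E l : (dy l `^ et * fhigh f j l y ^+ 2)%:E =
    ((f y ^+ 2)%:E * (dy l `^ et * (dy l < z)%R%:R)%:E)%E.
  have -> : (dy l < z) = (thr j l < f y `^ w y).
    rewrite /z powRN -/U /thr -ltr_pdivlMl ?powR_gt0 ?dj_gt0//.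
    by rewrite [in RHS]mulrC.
  by rewrite /fhigh -EFinM; case: (thr j l < _); rewrite ?mulr1 ?mulr0 ?expr0n//= ?mulr0// mulrC.
under [X in zsum X]funext => l do rewrite E.
rewrite zsumZl ?sqr_ge0//; last by move=> l; rewrite lee_fin mulr_ge0 ?powR_ge0.
apply: (le_trans (lee_wpmul2l _ (hC5 z0))); first by rewrite lee_fin sqr_ge0.
rewrite -EFinM lee_fin -/et le_eqVlt; apply/orP; left; apply/eqP.
have -> : z `^ et = U `^ et * dj j `^ (- (kp * et)).
  by rewrite /z powRM ?powR_ge0// -!powRrM mulNr.
have [f00|fy] := eqVneq (f y) 0.
  by rewrite /powf f00 expr0n/= mul0r powR0 ?mulr0// gt_eqF.
have -> : powf f P y = f y ^+ 2 * U `^ et.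
  rewrite /powf Pw powRD; last by rewrite fy implybT.
  by rewrite powRrM -/U powR_mulrn.
by ring.
Qed.

(** In the last term the powers of 2^{-j} are 2 al - 1 from the square function, -2 ep from the
    margin given to the high parts and -2 kp (1 - th) from the thresholds; their total must be
    positive for the sum over j. Measurability of F is not assumed. *)
Lemma interpolation_bound (F : V -> R) : (forall x, 0 <= F x) ->
  (forall x b, (forall t, 0 < t -> avg sigma f t x <= b) -> 0 < F x -> F x <= b) ->
  (\int[mu]_x (F x `^ P x)%:E <= ((3 * K) `^ PM * CP + (3 * K * W1) `^ qM * Cq +
     4 * (3 * W2) ^+ 2 * C4 * C5 * W3)%:E)%E.
Proof.
move=> F0 Fsup; set et := 2 * (1 - th).
pose C3 : R := 4 * (3 * W2) ^+ 2.
have C30 : 0 <= C3 by apply: mulr_ge0 => //; exact: sqr_ge0.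
pose c j l : R := C3 * dj j `^ (- (2 * ep)) * dy l `^ et.
have c0 j l : 0 <= c j l by do 2 (apply: mulr_ge0; last exact: powR_ge0).
pose T j x := zsum (fun l => (c j l)%:E * Sq sigma N (fhigh f j l) (dj j) x)%E.
have s0 j l x : (0 <= (c j l)%:E * Sq sigma N (fhigh f j l) (dj j) x)%E.
  by apply: mule_ge0; [rewrite lee_fin|apply: Sq_ge0; exact: dj_gt0].
have mS j l : measurable_fun setT (Sq sigma N (fhigh f j l) (dj j)).
  by apply: measurable_Sq; [exact: integrable_fhigh|exact: dj_gt0].
have ms j l : measurable_fun setT (fun x => (c j l)%:E * Sq sigma N (fhigh f j l) (dj j) x)%E.
  by apply: emeasurable_funM => //; exact: measurable_cst.
have T0 j x : (0 <= T j x)%E by exact: zsum_ge0.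
have mT j : measurable_fun setT (T j) by exact: measurable_zsum.
have mHP : measurable_fun setT (fun x => HLmax f x `^ P x)%E.
  by apply: measurable_poweR_var => //; [exact: measurable_HLmax|move=> x; exact: HLmax_ge0].
have mHq : measurable_fun setT (fun x => HLmax (powf f e) x `^ q x)%E.
  apply: measurable_poweR_var => //; first exact: measurable_HLmax.
  by move=> x; apply: HLmax_ge0 => y; exact: powR_ge0.
have a1 : 0 <= (3 * K) `^ PM by exact: powR_ge0.
have a2 : 0 <= (3 * K * W1) `^ qM by exact: powR_ge0.
apply: (@le_trans _ _ (\int[mu]_x (((3 * K) `^ PM)%:E * HLmax f x `^ P x +
    (((3 * K * W1) `^ qM)%:E * HLmax (powf f e) x `^ q x + \sum_(0 <= j <oo) T j x)))%E).
  apply: le_nnintegral => x; first by rewrite lee_fin powR_ge0.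
  have [Fx|Fx] := eqVneq (F x) 0; last first.
    have Fx0 : 0 < F x by rewrite lt_def Fx F0.
    by apply: sup_pow_le => // b /Fsup; exact.
  rewrite Fx powR0 ?gt_eqF//; apply: adde_ge0.
    by apply: mule_ge0; [rewrite lee_fin|exact: poweR_ge0].
  apply: adde_ge0; last by apply: nneseries_ge0 => j _ _; exact: T0.
  by apply: mule_ge0; [rewrite lee_fin|exact: poweR_ge0].
have mST : measurable_fun setT (fun x => \sum_(0 <= j <oo) T j x)%E.
  by apply: ge0_emeasurable_sum => [j x _ _|j _]; [exact: T0|exact: mT].
have p1 x : (0 <= ((3 * K) `^ PM)%:E * HLmax f x `^ P x)%E.
  by apply: mule_ge0; [rewrite lee_fin|exact: poweR_ge0].
have p2 x : (0 <= ((3 * K * W1) `^ qM)%:E * HLmax (powf f e) x `^ q x)%E.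
  by apply: mule_ge0; [rewrite lee_fin|exact: poweR_ge0].
have p3 x : (0 <= \sum_(0 <= j <oo) T j x)%E by apply: nneseries_ge0 => j _ _; exact: T0.
have m1 : measurable_fun setT (fun x => ((3 * K) `^ PM)%:E * HLmax f x `^ P x)%E.
  by apply: emeasurable_funM => //; exact: measurable_cst.
have m2 : measurable_fun setT (fun x => ((3 * K * W1) `^ qM)%:E * HLmax (powf f e) x `^ q x)%E.
  by apply: emeasurable_funM => //; exact: measurable_cst.
rewrite ge0_integralD//; [|by move=> x _; exact: adde_ge0|exact: emeasurable_funD].
rewrite ge0_integralD//.
rewrite !ge0_integralZl_EFin//; [|by move=> x _; exact: poweR_ge0..].
rewrite -addrA !EFinD; apply: leeD.
  by rewrite EFinM; apply: lee_wpmul2l; rewrite ?lee_fin.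
apply: leeD.
  by rewrite EFinM; apply: lee_wpmul2l; rewrite ?lee_fin.
rewrite integral_nneseries//.
pose A j : R := C3 * C4 * (dj j `^ (- (2 * ep)) * dj j `^ (2 * al - 1)).
have A0 j : 0 <= A j.
  by apply: mulr_ge0; [exact: mulr_ge0|rewrite mulr_ge0 ?powR_ge0].
have mh j l : measurable_fun setT (fun x => (fhigh f j l x ^+ 2)%:E).
  by apply/measurable_EFinP; apply: measurable_funX; exact: measurable_fhigh.
have mdh j l : measurable_fun setT (fun x => (dy l `^ et * fhigh f j l x ^+ 2)%:E).
  apply/measurable_EFinP; apply: measurable_funM => //.
  by apply: measurable_funX; exact: measurable_fhigh.
have dh0 j l x : (0 <= (dy l `^ et * fhigh f j l x ^+ 2)%:E)%E.
  by rewrite lee_fin; apply: mulr_ge0; [exact: powR_ge0|exact: sqr_ge0].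
have bT j : (\int[mu]_x T j x <=
    (C3 * C4 * C5)%:E * (dj j `^ (2 * al - 1 - 2 * ep - kp * et))%:E)%E.
  rewrite integral_zsum//.
  apply: (@le_trans _ _ (zsum (fun l => (A j)%:E *
      \int[mu]_x (dy l `^ et * fhigh f j l x ^+ 2)%:E)%E)).
    apply: le_zsum => l; first by apply: integral_ge0.
    rewrite ge0_integralZl_EFin//; last by move=> x _; apply: Sq_ge0; exact: dj_gt0.
    have cc : (0 <= (c j l)%:E)%E by rewrite lee_fin.
    apply: (le_trans (lee_wpmul2l cc (hSq (integrable_fhigh j l) (dj_gt0 j) (dj_le1 j)))).
    under [in leRHS]eq_integral do rewrite EFinM.
    rewrite ge0_integralZl_EFin ?powR_ge0//; last by move=> x _; rewrite lee_fin sqr_ge0.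
    rewrite !muleA -!EFinM le_eqVlt; apply/orP; left; apply/eqP; congr (_%:E * _)%E.
    by rewrite /c /A; ring.
  rewrite zsumZl//; last by move=> l; exact: integral_ge0.
  rewrite -integral_zsum//.
  apply: (@le_trans _ _ ((A j)%:E * \int[mu]_x (C5 * dj j `^ (- (kp * et)) * powf f P x)%:E)%E).
    apply: lee_wpmul2l; first by rewrite lee_fin.
    by apply: le_nnintegral => x; [exact: zsum_ge0|exact: zsum_fhigh_le].
  under eq_integral do rewrite EFinM.
  rewrite ge0_integralZl_EFin//; first last.
  - by rewrite mulr_ge0 ?powR_ge0.
  - by apply/measurable_EFinP; exact: measurable_powf.
  - by move=> x _; rewrite lee_fin powR_ge0.
  rewrite muleA -EFinM.
  have AC : 0 <= A j * (C5 * dj j `^ (- (kp * et))).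
    by apply: mulr_ge0 => //; rewrite mulr_ge0 ?powR_ge0.
  apply: (@le_trans _ _ ((A j * (C5 * dj j `^ (- (kp * et))))%:E * 1)%E).
    by apply: lee_wpmul2l; rewrite ?lee_fin.
  rewrite mule1 -EFinM lee_fin le_eqVlt; apply/orP; left; apply/eqP.
  rewrite /A !powRD ?(gt_eqF (dj_gt0 j)) ?implybT//.
  by ring.
have r0 j : (0 <= (dj j `^ (2 * al - 1 - 2 * ep - kp * et))%:E)%E by rewrite lee_fin powR_ge0.
apply: (@le_trans _ _ (\sum_(0 <= j <oo)
    ((C3 * C4 * C5)%:E * (dj j `^ (2 * al - 1 - 2 * ep - kp * et))%:E))%E).
  by apply: lee_nneseries => [j _ _|j _]; [exact: integral_ge0|exact: bT].
rewrite nneseriesZl//.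
have CC : (0 <= (C3 * C4 * C5)%:E)%E by rewrite lee_fin; apply: mulr_ge0 => //; exact: mulr_ge0.
by apply: (le_trans (lee_wpmul2l CC W3P)); rewrite -EFinM.
Qed.

End pointwise.

End interpolation.

(** * Exponents *)

Section exponents.
Context {R : realType} {n : nat}.
Local Notation V := 'rV[R]_n.
Local Notation mu := (lebesgue_rV n).
Implicit Types (p : V -> R) (x y : V).

(** Continuity makes p measurable and turns its essential bounds into pointwise ones. *)
Lemma log_local_continuous p (c1 : R) : 0 < c1 -> log_local p c1 -> continuous p.
Proof.
move=> c10 lp x; apply/(@cvgrPdist_le _ _ _ (nbhs x)) => ep ep0.
(* Below exp(-c1/ep) the logarithm in the modulus of continuity exceeds c1/ep. *)
pose m : R := Num.min (2^-1) (expR (- (c1 / ep))).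
have m0 : 0 < m by rewrite lt_min invr_gt0 ltr0n expR_gt0.
pose q : R := Num.sqrt n%:R + 1.
have q0 : 0 < q by rewrite ltr_wpDl ?sqrtr_ge0.
have mq0 : 0 < m / q by rewrite divr_gt0.
near=> y.
have bxy : ball x (m / q) y by near: y; exact: nbhsx_ballx.
have h : enorm (x - y) < m.
  apply: (@le_lt_trans _ _ (Num.sqrt n%:R * (m / q))).
    apply: enorm_le => [|i]; first exact: ltW.
    by rewrite !mxE; case: bxy => _ /(_ ord0 i) /ltW.
  by rewrite mulrCA gtr_pMr// ltr_pdivrMr// mul1r /q ltrDl.
have [xy|xy] := eqVneq (enorm (x - y)) 0.
  by move/enorm_eq0/eqP: xy; rewrite subr_eq0 => /eqP ->; rewrite subrr normr0 ltW.
have xy0 : 0 < enorm (x - y) by rewrite lt_def xy enorm_ge0.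
have [h1 h2] : enorm (x - y) < 2^-1 /\ enorm (x - y) < expR (- (c1 / ep)).
  by move: h; rewrite lt_min => /andP[].
apply: (le_trans (lp x y xy0 h1)).
have l0 : c1 / ep <= ln (expR 1 + (enorm (x - y))^-1).
  rewrite -[leLHS]expRK ler_ln ?posrE ?expR_gt0 ?ltr_wpDl ?expR_gt0 ?invr_gt0 ?expR_ge0//.
  apply: ler_wpDl; first exact: expR_ge0.
  by rewrite -[leLHS]invrK -expRN lef_pV2 ?posrE ?expR_gt0// ltW.
have c0 : 0 < c1 / ep by rewrite divr_gt0.
rewrite ler_pdivrMr ?(lt_le_trans c0)//.
by rewrite mulrC -ler_pdivrMr.
Unshelve. all: by end_near. Qed.

(** The set where the inequality fails is open; if it were nonempty it would contain a cube, which
    has positive measure. *)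
Lemma continuous_ae_le (f : V -> R) (a : R) : continuous f ->
  (\forall x \ae mu, ((f x)%:E <= a%:E)%E) -> forall x, f x <= a.
Proof.
move=> cf [A [mA A0 sA]] x; rewrite leNgt; apply/negP => fx.
have hh : nbhs (f x) [set z | a < z] by exact: lt_nbhsr.
have /nbhs_ballP[r /= r0 br] : nbhs x [set y | a < f y] by exact: (@cf x _ hh).
have cA : cube x r `<=` A.
  move=> y cy; apply: sA => /=; apply/negP; rewrite lee_fin -ltNge.
  by apply: br; split => // i j; rewrite (ord1 i); exact: cy.
have : (mu (cube x r) <= 0)%E.
  by rewrite -A0; apply: le_measure; rewrite ?inE//; exact: measurable_cube.
rewrite lebesgue_cube ?(ltW r0)// lee_fin leNgt.
by rewrite exprn_gt0// mulr_gt0.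
Qed.

Lemma exponent_bounds p (a b : R) : continuous p -> exponent_inf p = a%:E ->
  exponent_sup p = b%:E -> forall x, a <= p x <= b.
Proof.
move=> cp pa pb x; apply/andP; split; last first.
  apply: continuous_ae_le => //; have /ess_supP := lexx (exponent_sup p).
  by rewrite pb.
rewrite -lerN2; move: x; apply: continuous_ae_le.
  by move=> x; apply: (continuous_comp (f := p) (g := -%R)); [exact: (@cp x)|exact: opp_continuous].
have /ess_infP : (a%:E <= exponent_inf p)%E by rewrite pa.
by apply: filterS => x /=; rewrite !lee_fin lerN2.
Qed.

End exponents.

(** * The exponent of the pointwise endpoint *)

Section interpolation_exponents.
Context {R : realType} {n : nat}.
Local Notation V := 'rV[R]_n.
Variables (p : V -> R) (pm pM s u : R).
Hypotheses (s0 : 0 < s) (s1 : s < 2^-1) (u1 : 1 <= u).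
Hypotheses (um : u < (1 - s) * pm) (uM : s * pM < u).
Hypothesis pb : forall x, pm <= p x <= pM.

(* The solution q of u/r = s + (1 - 2 s)/q. *)
Definition Qexp (r : R) : R := (1 - 2 * s) * (r / u) / (1 - s * (r / u)).

Let u0 : 0 < u. Proof. exact: lt_le_trans u1. Qed.

Lemma Qden_gt0 r : r <= pM -> 0 < 1 - s * (pM / u) <= 1 - s * (r / u).
Proof.
move=> rM; rewrite subr_gt0 mulrA ltr_pdivrMr// mul1r uM/= lerB// mulrA.
by rewrite ler_pM2r ?invr_gt0// ler_pM2l.
Qed.

Lemma Qexp_le (r1 r2 : R) : 0 < r1 -> r1 <= r2 -> r2 <= pM -> Qexp r1 <= Qexp r2.
Proof.
move=> r10 r12 r2M; have r1M := le_trans r12 r2M.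
have /andP[d0 d1] := Qden_gt0 r1M; have /andP[_ d2] := Qden_gt0 r2M.
have h1 := lt_le_trans d0 d1; have h2 := lt_le_trans d0 d2.
have s2 : 0 < 1 - 2 * s by move: s1; lra.
have r20 := lt_le_trans r10 r12.
rewrite /Qexp; apply: ler_pM.
- by rewrite mulr_ge0 ?divr_ge0 ?(ltW s2)// ltW.
- by rewrite invr_ge0 ltW.
- by rewrite ler_pM2l// ler_pM2r ?invr_gt0.
- by rewrite lef_pV2 ?posrE// lerB// ler_pM2l// ler_pM2r ?invr_gt0.
Qed.

Lemma Qexp_gt1 (r : R) : pm <= r -> r <= pM -> 1 < Qexp r.
Proof.
move=> rm rM; have /andP[d0 d1] := Qden_gt0 rM.
rewrite /Qexp ltr_pdivlMr ?(lt_le_trans d0)// mul1r ltrBlDr -mulrDl.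
have -> : 1 - 2 * s + s = 1 - s by ring.
rewrite mulrA ltr_pdivlMr// mul1r (lt_le_trans um)// ler_pM2l// subr_gt0.
by move: s1; lra.
Qed.

(** The denominator stays above 1 - s pM / u > 0 for arguments up to pM, so [Qexp] is Lipschitz
    there and log-Hoelder continuity passes from p to q. *)
Lemma Qexp_lip : exists2 L : R, 0 <= L & forall r1 r2, r1 <= pM -> r2 <= pM ->
  `|Qexp r1 - Qexp r2| <= L * `|r1 - r2|.
Proof.
pose dl := 1 - s * (pM / u).
have /andP[dl0 _] := Qden_gt0 (lexx pM).
have s2 : 0 < 1 - 2 * s by move: s1; lra.
exists ((1 - 2 * s) / u / dl ^+ 2) => [|r1 r2 r1M r2M].
  by rewrite divr_ge0 ?sqr_ge0// divr_ge0// ltW.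
have /andP[_ d1] := Qden_gt0 r1M; have /andP[_ d2] := Qden_gt0 r2M.
have h1 := lt_le_trans dl0 d1; have h2 := lt_le_trans dl0 d2.
have -> : Qexp r1 - Qexp r2 =
    (1 - 2 * s) / u / ((1 - s * (r1 / u)) * (1 - s * (r2 / u))) * (r1 - r2).
  have e r : 1 - s * (r / u) = (u - s * r) / u by field; exact: lt0r_neq0.
  have g1 : u - s * r1 != 0 by apply: lt0r_neq0; move: h1; rewrite e pmulr_lgt0 ?invr_gt0.
  have g2 : u - s * r2 != 0 by apply: lt0r_neq0; move: h2; rewrite e pmulr_lgt0 ?invr_gt0.
  rewrite /Qexp !e; field; rewrite g1 g2 lt0r_neq0//.
rewrite normrM; apply: ler_wpM2r => //.
rewrite ger0_norm; last first.
  by apply: divr_ge0; [apply: divr_ge0; exact: ltW|apply: mulr_ge0; exact: ltW].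
apply: ler_pM => //; first by rewrite divr_ge0// ltW.
  by rewrite invr_ge0 mulr_ge0 ?(ltW h1) ?(ltW h2).
rewrite lef_pV2 ?posrE ?exprn_gt0 ?mulr_gt0// expr2.
by apply: ler_pM => //; exact: ltW.
Qed.

Lemma Qexp_log_local (c1 : R) : log_local p c1 -> exists2 c : R, 0 <= c & log_local (Qexp \o p) c.
Proof.
move=> lp; have [L L0 LP] := Qexp_lip; exists (L * `|c1|) => [|x y xy0 xy]; first exact: mulr_ge0.
have /andP[_ px] := pb x; have /andP[_ py] := pb y.
apply: (le_trans (LP _ _ px py)); rewrite -mulrA; apply: ler_wpM2l => //.
apply: (le_trans (lp x y xy0 xy)); apply: ler_wpM2r; last exact: ler_norm.
rewrite invr_ge0 ln_ge0// (le_trans expR1_ge1)// lerDl invr_ge0 enorm_ge0//.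
Qed.

Lemma Qexp_log_decay (c2 pinf : R) : log_decay p c2 pinf ->
  exists2 c : R, 0 <= c & exists qinf, log_decay (Qexp \o p) c qinf.
Proof.
move=> lp; have [L L0 LP] := Qexp_lip; exists (L * `|c2|); first exact: mulr_ge0.
(* The Lipschitz bound holds only up to pM; cutting [pinf] off there does not increase its distance
   to p x. *)
exists (Qexp (Num.min pinf pM)) => x.
have /andP[_ px] := pb x; have iM : Num.min pinf pM <= pM by rewrite ge_min lexx orbT.
apply: (le_trans (LP _ _ px iM)); rewrite -mulrA; apply: ler_wpM2l => //.
have l0 : 0 <= (ln (expR 1 + enorm x))^-1.
  by rewrite invr_ge0 ln_ge0// (le_trans expR1_ge1)// lerDl enorm_ge0.
apply: (@le_trans _ _ `|p x - pinf|).
  rewrite /Num.min; case: ltP => // h; rewrite ler0_norm ?subr_le0// ler0_norm.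
    by rewrite lerN2 lerB.
  by rewrite subr_le0 (le_trans px).
by apply: (le_trans (lp x)); apply: ler_wpM2r => //; exact: ler_norm.
Qed.

End interpolation_exponents.

Section parameters.
Context {R : realType}.

(* d / (2 (a + d)) is the value of s at which the smoothing 2^{-ja} in L^2 and
   the loss 2^{jd} of the pointwise bound balance. *)
Lemma ex_parameters (d a pm pM : R) : 0 <= d -> 0 < a -> pm <= pM ->
  2 * d + 2 * a < (d + 2 * a) * pm -> d * pM < (d + 2 * a) * pm ->
  exists s u : R, [/\ 0 < s < 2^-1, d * (1 - 2 * s) < a * (2 * s), 1 <= u,
    u < (1 - s) * pm & s * pM < u].
Proof.
move=> d0 a0 pmM h1 h2; pose S := 2 * (a + d).
have S0 : 0 < S by rewrite mulr_gt0// ltr_wpDr.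
have dm : 0 < d + 2 * a by rewrite ltr_wpDl// mulr_gt0.
have pm0 : 0 < pm.
  rewrite -(pmulr_rgt0 _ dm); apply: le_lt_trans h1.
  by rewrite addr_ge0// mulr_ge0// ltW.
have pM0 : 0 < pM by exact: lt_le_trans pmM.
pose s0 := d / S.
have s00 : 0 <= s0 by rewrite divr_ge0// ltW.
(* The three upper bounds for s mean s < 1/2, (1 - s) pm > 1 and s pM < (1 - s) pm. The hypotheses
   say that the balancing value [s0] satisfies all three, so s can be taken strictly between, and u
   between max(1, s pM) and (1 - s) pm. *)
pose b := Num.min (2^-1) (Num.min (1 - pm^-1) (pm / (pm + pM))).
have s0b : s0 < b.
  rewrite !lt_min; apply/and3P; split.
  - by rewrite /s0 ltr_pdivrMr// /S; lra.
  - rewrite ltrBrDr -ltrBrDl -(ltr_pM2r pm0) mulVf ?gt_eqF//.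
    have -> : (1 - s0) * pm = (d + 2 * a) * pm / S.
      by rewrite /s0; have -> : d + 2 * a = S - d by [rewrite /S; ring]; field; exact: lt0r_neq0.
    by rewrite ltr_pdivlMr// mul1r /S; lra.
  - rewrite /s0 ltr_pdivrMr// mulrAC ltr_pdivlMr ?addr_gt0// /S; lra.
pose s := (s0 + b) / 2.
have sb : s < b by rewrite /s; lra.
have ss0 : s0 < s by rewrite /s; lra.
move: (sb); rewrite !lt_min => /and3P[b1 b2 b3].
have c1 : 1 < (1 - s) * pm.
  by move: b2; rewrite ltrBrDr -ltrBrDl -(ltr_pM2r pm0) mulVf ?gt_eqF.
have c2 : s * pM < (1 - s) * pm.
  by move: b3; rewrite ltr_pdivlMr ?addr_gt0//; lra.
exists s, ((Num.max 1 (s * pM) + (1 - s) * pm) / 2); split.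
- by rewrite b1 (le_lt_trans s00).
- by move: ss0; rewrite /s0 ltr_pdivrMr// /S; lra.
- by have : 1 <= Num.max 1 (s * pM) by [rewrite le_max lexx]; move: c1; lra.
- have : Num.max 1 (s * pM) < (1 - s) * pm by rewrite gt_max c1 c2.
  by lra.
- by have : s * pM <= Num.max 1 (s * pM) by [rewrite le_max lexx orbT]; move: c2; lra.
Qed.

End parameters.

(** * The maximal estimate for nonnegative functions *)

Section positive.
Context {R : realType} {n : nat}.
Local Notation V := 'rV[R]_n.
Local Notation mu := (lebesgue_rV n).
Local Notation leb := (@lebesgue_measure R).
Variable sigma : {finite_measure set V -> \bar R}.
Hypotheses (hn : (0 < n)%N) (hsigma : compactly_supported sigma).
Variables (beta alpha : R).
Hypotheses (hbeta : 0 <= beta <= n%:R) (halpha : 2^-1 < alpha).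
Hypothesis hdim : locally_uniformly_dimensional beta sigma.
Hypothesis hm : square_decay alpha (fun xi => normc (fourier_measure sigma xi)).
Hypothesis hgrad : square_decay alpha
  (fun xi => cvnorm (gradient (fourier_measure sigma) xi)).
Variables (p : V -> R) (pm pM s u c1 c2 pinf : R).
Hypotheses (c10 : 0 < c1) (c20 : 0 < c2).
Hypotheses (lp : log_local p c1) (dp : log_decay p c2 pinf).
Hypothesis pb : forall x, pm <= p x <= pM.
Hypotheses (pm0 : 0 < pm) (s01 : 0 < s < 2^-1) (u1 : 1 <= u).
Hypotheses (um : u < (1 - s) * pm) (uM : s * pM < u).
Hypothesis ds : (n%:R - beta) * (1 - 2 * s) < (alpha - 2^-1) * (2 * s).

Lemma multiplier_decay : exists2 C0 : R, 0 <= C0 & forall xi : V,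
  (\int[leb]_(t in `[1%R, 2%R]) (Qm sigma xi t)%:E <=
     (C0 * (1 + enorm xi) `^ (- (2 * alpha)))%:E)%E /\
  (\int[leb]_(t in `[1%R, 2%R]) (Qd sigma xi t)%:E <=
     (C0 * enorm xi ^+ 2 * (1 + enorm xi) `^ (- (2 * alpha)))%:E)%E.
Proof.
have [R0 R00 supp] := supp_cube hsigma.
have [A1 A10 A1P] := square_decay_le hm; have [A2 A20 A2P] := square_decay_le hgrad.
exists (A1 + A2) => [|xi]; first exact: addr_ge0.
have w0 : 0 <= (1 + enorm xi) `^ (- (2 * alpha)) by exact: powR_ge0.
split.
  apply: (@le_trans _ _ (A1 * (1 + enorm xi) `^ (- (2 * alpha)))%:E); last first.
    by rewrite lee_fin; apply: ler_wpM2r => //; rewrite lerDl.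
  apply: le_trans (A1P xi); rewrite le_eqVlt; apply/orP; left; apply/eqP.
  by apply: eq_integral => t _; rewrite normc_fourier.
apply: (le_trans (Qd_integral_le supp A20 A2P xi)); rewrite lee_fin.
apply: ler_wpM2r => //; apply: ler_wpM2r; first exact: sqr_ge0.
by rewrite lerDr.
Qed.

Let u0 : 0 < u. Proof. exact: lt_le_trans u1. Qed.

(** The supremum of the averages is represented by any F that lies below all their upper bounds
    wherever it is positive. The constant depends neither on g nor on its bound B. *)
Lemma positive_maximal : exists2 C : R, 0 <= C & forall (g : V -> R) (B : R),
  continuous g -> (forall x, 0 <= g x) -> (forall x, g x <= B) ->
  mu.-integrable setT (EFin \o g) ->
  (\int[mu]_x (g x `^ (p x / u))%:E <= 1)%E ->
  forall F : V -> R, (forall x, 0 <= F x) ->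
  (forall x b, (forall t, 0 < t -> avg sigma g t x <= b) -> 0 < F x -> F x <= b) ->
  (\int[mu]_x (F x `^ (p x / u))%:E <= C%:E)%E.
Proof.
have [s0 s1] := andP s01; have [b0 bn] := andP hbeta.
have [R0 R00 supp] := supp_cube hsigma.
have [Cs Cs0 dim] := dim_cube hn b0 hdim.
have [C0 C00 C0P] := multiplier_decay.
pose N := Num.Def.archi_bound (2 * alpha + 1).
have al0 : 0 <= alpha by rewrite (le_trans _ (ltW halpha))// invr_ge0.
have hN : 2 * alpha + 1 <= (4 * N.+1)%:R.
  have al1 : 0 <= 2 * alpha + 1 by rewrite addr_ge0// mulr_ge0.
  apply: (le_trans (ltW (archi_boundP al1))).
  by rewrite ler_nat (leq_trans (leqnSn N))// leq_pmull.
have [C4 C40 C4P] := integral_Sq_le R00 supp al0 C00 hN (fun xi => (C0P xi).1) (fun xi => (C0P xi).2).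
have [K1 K10 K1P] := Pop_HLmax N R00 supp Cs0 dim hbeta.
have [K2 K20 K2P] := Top_HLmax N R00 supp Cs0 dim hbeta.
pose K := K1 + K2 + 1; have K_ge1 : 1 <= K by rewrite lerDr addr_ge0.
have hPop (f : V -> R) t x : measurable_fun setT f -> (forall x, 0 <= f x) -> 0 < t ->
    (`|Pop sigma N f 1 t x|%:E <= K%:E * HLmax f x)%E.
  move=> mf f0 t0; apply: (le_trans (K1P f 1 t x mf f0 ltr01 (lexx 1) t0)).
  apply: lee_wpmul2r; first exact: HLmax_ge0.
  by rewrite lee_fin powR1 mulr1 /K -addrA lerDl addr_ge0.
have hTop (f : V -> R) j t x : measurable_fun setT f -> (forall x, 0 <= f x) -> 0 < t ->
    (`|Top sigma N f (dj j) t x|%:E <= (K * dj j `^ (- (n%:R - beta)))%:E * HLmax f x)%E.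
  move=> mf f0 t0; apply: (le_trans (K2P f (dj j) t x mf f0 (dj_gt0 j) (dj_le_half j) t0)).
  apply: lee_wpmul2r; first exact: HLmax_ge0.
  rewrite lee_fin opprB; apply: ler_wpM2r; first exact: powR_ge0.
  by rewrite /K addrAC lerDr addr_ge0.
pose d := n%:R - beta; pose a := alpha - 2^-1; pose th := 2 * s.
have d0 : 0 <= d by rewrite subr_ge0.
have a0 : 0 < a by rewrite subr_gt0.
have th0 : 0 < th by rewrite mulr_gt0.
have th1 : 0 < 1 - th by rewrite /th; move: s1; lra.
have th01 : 0 < th < 1 by rewrite th0 -subr_gt0.
(* The low parts are summable if kp th > d, the high parts if kp (1 - th) < a. The hypothesis [ds]
   leaves a gap between d / th and a / (1 - th), and kp is its midpoint. *)
pose kp := (d / th + a / (1 - th)) / 2.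
have dkp : d / th < a / (1 - th).
  by rewrite ltr_pdivrMr// mulrAC ltr_pdivlMr.
have kp1 : 0 < kp * th - d.
  by rewrite subr_gt0 -ltr_pdivrMr// /kp; lra.
have kp2 : 0 < a - kp * (1 - th).
  by rewrite subr_gt0 -ltr_pdivlMr// /kp; lra.
(* Half of the remaining margin: the exponent of the last sum over j then equals 2 ep, which is
   positive. *)
pose ep := (a - kp * (1 - th)) / 2.
have ep0 : 0 < ep by rewrite divr_gt0.
have [W1 W11 W1P] := dj_powR_sum kp1.
have [W2 W21 W2P] := dj_powR_sum ep0.
have W3e : 0 < 2 * alpha - 1 - 2 * ep - kp * (2 * (1 - th)).
  have -> : 2 * alpha - 1 - 2 * ep - kp * (2 * (1 - th)) = 2 * ep.
    by rewrite /ep /a; field.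
  by rewrite mulr_gt0.
have [W3 _ W3P] := dj_powR_sum W3e.
have et0 : 0 < 2 * (1 - th) by rewrite mulr_gt0.
have [C5 C50 C5P] := zsum_dy_lt et0.
pose P x := p x / u.
pose q x := Qexp s u (p x).
pose e x := (1 - s * P x) / (1 - 2 * s).
pose w x := P x / 2 - e x.
have s2 : 0 < 1 - 2 * s by [].
have px0 x : 0 < p x by have /andP[h _] := pb x; exact: lt_le_trans h.
have pxM x : p x <= pM by have /andP[] := pb x.
have P0 x : 0 < P x by rewrite divr_gt0.
have den x : 0 < 1 - s * P x.
  by have /andP[h1 h2] := Qden_gt0 s0 u1 uM (pxM x); exact: lt_le_trans h2.
have Peq x : P x = e x * q x.
  by rewrite /e /q /Qexp -/(P x); field; rewrite !lt0r_neq0.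
have eth x : e x + w x * th = 1.
  by rewrite /w /e /th; field; exact: lt0r_neq0.
have Pw x : P x = 2 + w x * (2 * (1 - th)).
  by rewrite /w /e /th; field; exact: lt0r_neq0.
have pm_pM : pm <= pM by have /andP[h1 h2] := pb 0; exact: le_trans h2.
have q1 : 1 < Qexp s u pm by exact: (Qexp_gt1 s0 s1 u1 um uM).
have qb x : Qexp s u pm <= q x <= Qexp s u pM.
  have /andP[h1 h2] := pb x; apply/andP; split; apply: (Qexp_le s0 s1 u1 uM) => //.
have P1 x : pm / u <= P x <= pM / u.
  by have /andP[h1 h2] := pb x; rewrite !ler_pM2r ?invr_gt0// h1.
have P11 : 1 < pm / u.
  rewrite ltr_pdivlMr// mul1r (lt_le_trans um)// ler_piMl ?(ltW pm0)//.
  by rewrite gerBl ltW.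
have cp := log_local_continuous c10 lp.
have mp : measurable_fun setT p by exact: continuous_measurable_rV.
have mP : measurable_fun setT P by apply: measurable_funM.
have m1 : measurable_fun setT (fun x => 1 - s * P x).
  by apply: measurable_funB => //; exact: measurable_funM.
have me : measurable_fun setT e by apply: measurable_funM.
have mw : measurable_fun setT w by apply: measurable_funB => //; exact: measurable_funM.
have mq : measurable_fun setT q.
  rewrite (_ : q = fun x => (1 - 2 * s) * P x * (1 - s * P x) `^ (-1)); last first.
    by apply/funext => x; rewrite powR_inv1 ?(ltW (den x)).
  apply: measurable_funM; first exact: measurable_funM.
  exact: (measurableT_comp (measurable_powR _)).
have Pu (x y : R) : `|x / u - y / u| <= `|x - y|.
  by rewrite -mulrBl normrM ler_piMr// normfV gtr0_norm// invf_le1.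
have lP : log_local P c1.
  by move=> x y xy0 xy; apply: le_trans (lp xy0 xy); exact: Pu.
have dP : log_decay P c2 (pinf / u).
  by move=> x; apply: le_trans (dp x); exact: Pu.
have [cq1 cq10 lq] := Qexp_log_local s0 s1 u1 uM pb lp.
have [cq2 cq20 [qinf dq]] := Qexp_log_decay s0 s1 u1 uM pb dp.
have [CP CP0 CPP] := HLmax_variable hn (ltW c10) (ltW c20) lP dP P11 P1 mP.
have [Cq Cq0 CqP] := HLmax_variable hn cq10 cq20 lq dq q1 qb mq.
pose C := (3 * K) `^ (pM / u) * CP + (3 * K * W1) `^ (Qexp s u pM) * Cq +
     4 * (3 * W2) ^+ 2 * C4 * C5 * W3.
exists `|C| => // g B cg g0 gB gi g1 F F0 Fsup.
have mg : measurable_fun setT g by exact: continuous_measurable_rV.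
apply: (@le_trans _ _ C%:E); last by rewrite lee_fin ler_norm.
apply: (interpolation_bound R00 supp K_ge1 th01 hPop hTop P0 (fun x => proj2 (andP (P1 x))) _
  (fun x => proj2 (andP (qb x))) Peq eth Pw me mw W11 W21 W1P W2P cg g0 gB gi C40 C50 mP mq
  (CPP g mg g0 g1) _ C4P C5P W3P g1 F0 Fsup).
  by move=> x; rewrite (lt_trans ltr01)// (lt_le_trans q1)//; have /andP[] := qb x.
apply: CqP; [exact: measurable_powf|by move=> x; exact: powR_ge0|].
apply: le_trans g1; rewrite le_eqVlt; apply/orP; left; apply/eqP.
by apply: eq_integral => x _; rewrite /powf -powRrM -Peq.
Qed.

End positive.

(** * Schwartz functions and averages *)

Section schwartz_modulus.
Context {R : realType} {n : nat}.
Local Notation V := 'rV[R]_n.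
Local Notation mu := (lebesgue_rV n).
Implicit Types (u v h : V -> R) (x y : V).

Lemma weight_ge y : ((1 + enorm y) ^+ (2 * n))^-1 <= weight y.
Proof.
rewrite /weight prodfV lef_pV2 ?posrE; last 2 first.
- by rewrite exprn_gt0// ltr_pwDl// enorm_ge0.
- by apply: prodr_gt0 => i _; rewrite ltr_pwDl// sqr_ge0.
rewrite exprM -[X in _ ^+ X](card_ord n) -prodr_const.
apply: ler_prod => i _; rewrite addr_ge0 ?sqr_ge0//=.
have := coord_le_enorm y i; rewrite -(real_normK (num_real (y ord0 i))).
by have := normr_ge0 (y ord0 i); move: `|y ord0 i| (enorm y) => a b; nra.
Qed.

Lemma real_schwartz_le_weight u : real_schwartz u ->
  continuous u /\ exists2 C : R, 0 <= C & forall x, `|u x| <= C * weight x.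
Proof.
move=> /(_ [::])/= [du /(_ (2 * n)%N)[C hC]]; split.
  by move=> x; apply: differentiable_continuous; exact: du.
exists `|C| => // x; have w0 : 0 < (1 + enorm x) ^+ (2 * n).
  by rewrite exprn_gt0// ltr_pwDl// enorm_ge0.
apply: (@le_trans _ _ (`|C| * ((1 + enorm x) ^+ (2 * n))^-1)).
  by rewrite ler_pdivlMr// mulrC (le_trans (hC x))// ler_norm.
by apply: ler_wpM2l => //; exact: weight_ge.
Qed.

Lemma normcE (z : R[i]) : normc z = Num.sqrt (complex.Re z ^+ 2 + complex.Im z ^+ 2).
Proof. by case: z. Qed.

Lemma normc_le (z : R[i]) : normc z <= `|complex.Re z| + `|complex.Im z|.
Proof.
rewrite normcE -[leRHS]ger0_norm ?addr_ge0// -sqrtr_sqr ler_sqrt ?sqr_ge0//.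
rewrite -(real_normK (num_real (complex.Re z))) -(real_normK (num_real (complex.Im z))).
by move: (normr_ge0 (complex.Re z)) (normr_ge0 (complex.Im z)); nra.
Qed.

Lemma Re_le_normc (z : R[i]) : `|complex.Re z| <= normc z.
Proof.
rewrite normcE -[leLHS]sqrtr_sqr ler_sqrt ?addr_ge0 ?sqr_ge0//.
by rewrite lerDl sqr_ge0.
Qed.

Lemma Im_le_normc (z : R[i]) : `|complex.Im z| <= normc z.
Proof.
rewrite normcE -[leLHS]sqrtr_sqr ler_sqrt ?addr_ge0 ?sqr_ge0//.
by rewrite lerDr sqr_ge0.
Qed.

Lemma schwartz_normc (f : V -> R[i]) : schwartz f ->
  [/\ continuous (@complex.Re R \o f), continuous (@complex.Im R \o f),
    continuous (fun x => normc (f x)) &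
    exists2 C : R, 0 <= C & forall x, normc (f x) <= C * weight x].
Proof.
move=> [/real_schwartz_le_weight[c1 [C1 C10 C1P]] /real_schwartz_le_weight[c2 [C2 C20 C2P]]].
split => //.
  rewrite (_ : (fun x => _) = Num.sqrt \o ((@complex.Re R \o f) * (@complex.Re R \o f) +
      (@complex.Im R \o f) * (@complex.Im R \o f))).
    move=> x; apply: continuous_comp; last exact: sqrt_continuous.
    by apply: continuousD; apply: continuousM; solve [exact: (@c1 x)|exact: (@c2 x)].
  by apply/funext => x /=; rewrite normcE !expr2.
exists (C1 + C2) => [|x]; first exact: addr_ge0.
rewrite mulrDl; apply: (le_trans (normc_le _)); apply: lerD; [exact: C1P|exact: C2P].
Qed.

(** At positive values the power function is differentiable; near a zero of h one has h <= 1, hence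
    h^u <= h. *)
Lemma continuous_powR_comp h (u : R) : 1 <= u -> continuous h -> (forall x, 0 <= h x) ->
  continuous (fun x => h x `^ u).
Proof.
move=> u1 ch h0 x; have [hx|hx] := eqVneq (h x) 0; last first.
  have hx0 : 0 < h x by rewrite lt_def hx h0.
  have ph : {for h x, continuous (fun a : R => a `^ u)}.
    apply: differentiable_continuous; apply/derivable1_diffP.
    by have [] := is_derive1_powR u hx0.
  exact: (continuous_comp (@ch x) ph).
apply/(@cvgrPdist_lt _ _ _ (nbhs x)) => ep ep0.
have m0 : 0 < Num.min ep 1 by rewrite lt_min ep0 ltr01.
have /cvgrPdist_lt/(_ _ m0) := @ch x; apply: filterS => y.
rewrite hx sub0r normrN ger0_norm// lt_min => /andP[h1 h2].
rewrite powR0 ?gt_eqF ?(lt_le_trans ltr01)// sub0r normrN ger0_norm ?powR_ge0//.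
apply: le_lt_trans h1; have [->|hy] := eqVneq (h y) 0.
  by rewrite powR0// gt_eqF ?(lt_le_trans ltr01).
rewrite -[leRHS]powRr1//; apply: ger_powR => //.
by rewrite lt_def hy h0 ltW.
Qed.

End schwartz_modulus.

Section averages.
Context {R : realType} {n : nat}.
Local Notation V := 'rV[R]_n.
Variables (sigma : {finite_measure set V -> \bar R}) (R0 : R).
Hypothesis supp : sigma (~` cube 0 R0) = 0%E.
Implicit Types (h : V -> R) (x y : V).

Lemma measurable_translate h t x : continuous h ->
  measurable_fun setT (fun y => h (x - t *: y)).
Proof.
move=> ch; apply: (measurableT_comp (f := h)); first exact: continuous_measurable_rV.
apply: measurable_funB_rV; first exact: measurable_cst.
by apply: measurable_funZ_rV; [exact: measurable_cst|exact: measurable_id].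
Qed.

Lemma integrable_translate h (B : R) t x : continuous h -> (forall x, `|h x| <= B) ->
  sigma.-integrable setT (EFin \o (fun y => h (x - t *: y))).
Proof.
move=> ch hB; apply: (supp_integrable supp (M := B)); first exact: measurable_translate.
by move=> y _; exact: hB.
Qed.

(** Real and imaginary parts of the average are each bounded by the average of |f|, whence the
    factor 2. This reduces the operator to nonnegative functions. *)
Lemma normc_dilated_average_le (f : V -> R[i]) (B t : R) x :
  continuous (@complex.Re R \o f) -> continuous (@complex.Im R \o f) ->
  continuous (fun x => normc (f x)) -> (forall x, normc (f x) <= B) ->
  normc (dilated_average sigma t f x) <= 2 * avg sigma (fun x => normc (f x)) t x.
Proof.
move=> c1 c2 c3 fB.
have n0 y : 0 <= normc (f y) by rewrite normcE sqrtr_ge0.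
have i3 : sigma.-integrable setT (EFin \o (fun y => normc (f (x - t *: y)))).
  by apply: (integrable_translate t x c3 (B := B)) => y; rewrite ger0_norm.
have part (g : V -> R) : continuous g -> (forall y, `|g y| <= normc (f y)) ->
    `|\int[sigma]_y g (x - t *: y)| <= avg sigma (fun x => normc (f x)) t x.
  move=> cg gf; have gB y : `|g y| <= B by exact: le_trans (gf y) (fB y).
  have ig := integrable_translate t x cg gB.
  apply: (le_trans (le_normr_Rintegral measurableT ig)).
  apply: le_Rintegral => //; first by have := integrable_abse ig; exact: eq_integrable.
apply: (le_trans (normc_le _)); rewrite mulr_natl mulr2n; apply: lerD.
  by apply: (part (@complex.Re R \o f)) => // y; exact: Re_le_normc.
by apply: (part (@complex.Im R \o f)) => // y; exact: Im_le_normc.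
Qed.

Lemma avg_ge0 h t x : (forall x, 0 <= h x) -> 0 <= avg sigma h t x.
Proof. by move=> h0; apply: Rintegral_ge0 => y _; exact: h0. Qed.

Lemma avg_ub h (B : R) t x : continuous h -> (forall x, 0 <= h x) -> (forall x, h x <= B) ->
  avg sigma h t x <= B * mass sigma.
Proof.
move=> ch h0 hB; have hB' y : `|h y| <= B by rewrite ger0_norm.
have B0 : 0 <= B by rewrite (le_trans (h0 x)).
apply: le_trans (supp_Rintegral_le supp (measurable_translate t x ch) (fun y _ => hB' _) B0).
exact: ler_norm.
Qed.

Lemma avg_jensen h (B u t : R) x : continuous h -> (forall x, 0 <= h x) ->
  (forall x, h x <= B) -> 1 <= u ->
  avg sigma h t x `^ u <= (mass sigma + 1) `^ (u - 1) * avg sigma (fun y => h y `^ u) t x.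
Proof.
move=> ch h0 hB u1; have hB' y : `|h y| <= B by rewrite ger0_norm.
have u0 : 0 <= u by exact: le_trans u1.
have cu := continuous_powR_comp u1 ch h0.
have uB y : `|h y `^ u| <= B `^ u.
  rewrite ger0_norm ?powR_ge0//; apply: ge0_ler_powR => //; rewrite nnegrE//.
  by rewrite (le_trans (h0 y)).
have i1 := integrable_translate t x ch hB'; have i2 := integrable_translate t x cu uB.
have mM : (sigma setT <= (mass sigma + 1)%:E)%E by rewrite massE lee_fin lerDl.
rewrite -lee_fin EFinM -poweR_EFin /avg /Rintegral.
rewrite !fineK ?integrable_fin_num//; apply: jensen_powR => //.
- by rewrite ltr_wpDl// mass_ge0.
- exact: measurable_translate.
Qed.

End averages.

(** * The maximal operator *)

Section integral_scaling.
Import HBNNSimple.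
Context {R : realType} d (T : measurableType d) (mu : {measure set T -> \bar R}).

(* The maximal function below is not known to be measurable, hence the absence
   of measurability hypotheses. *)
Lemma integralZl_le (f : T -> \bar R) (c : R) : 0 < c -> (forall x, 0 <= f x)%E ->
  (\int[mu]_x (c%:E * f x) <= c%:E * \int[mu]_x f x)%E.
Proof.
move=> c0 f0; rewrite [leLHS]ge0_integralTE; last first.
  by move=> x; rewrite mule_ge0// lee_fin ltW.
apply: ge_ereal_sup => _ [h hf <-]; rewrite -integralT_nnsfun -lee_pdivrMl//.
rewrite -ge0_integralZl_EFin//; first last.
- by rewrite invr_ge0 ltW.
- by apply/measurable_EFinP; exact: measurable_funPT.
- by move=> x _; rewrite lee_fin.
apply: le_nnintegral => x; first by rewrite mule_ge0// lee_fin// invr_ge0 ltW.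
by rewrite lee_pdivrMl//; exact: hf.
Qed.

End integral_scaling.

Section maximal_bound.
Context {R : realType} {n : nat}.
Local Notation V := 'rV[R]_n.
Local Notation mu := (lebesgue_rV n).
Variables (sigma : {finite_measure set V -> \bar R}) (R0 : R).
Hypothesis supp : sigma (~` cube 0 R0) = 0%E.
Variables (p : V -> R) (u C : R).
Hypotheses (u1 : 1 <= u) (pu1 : forall x, 1 <= p x / u) (C0 : 0 <= C).
Hypothesis CP : forall (g : V -> R) (B : R),
  continuous g -> (forall x, 0 <= g x) -> (forall x, g x <= B) ->
  mu.-integrable setT (EFin \o g) ->
  (\int[mu]_x (g x `^ (p x / u))%:E <= 1)%E ->
  forall F : V -> R, (forall x, 0 <= F x) ->
  (forall x b, (forall t, 0 < t -> avg sigma g t x <= b) -> 0 < F x -> F x <= b) ->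
  (\int[mu]_x (F x `^ (p x / u))%:E <= C%:E)%E.

(* Powers of the averages are compared by Jensen's inequality,
   (A_t h)^u <= mass^{u-1} A_t (h^u), which trades the exponent p for p/u. *)
Definition jensen_const : R := ((mass sigma + 1) `^ (u - 1) * (C + 1)) `^ u^-1.

Let u0 : 0 < u. Proof. exact: lt_le_trans u1. Qed.
Let m0 : 0 < mass sigma + 1. Proof. by rewrite ltr_wpDl// mass_ge0. Qed.
Let C1 : 1 <= C + 1. Proof. by rewrite lerDr. Qed.
Let C10 : 0 < C + 1. Proof. exact: lt_le_trans C1. Qed.

Lemma jensen_const_gt0 : 0 < jensen_const.
Proof. by rewrite powR_gt0// mulr_gt0// powR_gt0. Qed.

(** The estimate for p/u is applied to g = (|f| / l)^u, whose modular with exponent p/u is that of f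
    / l with exponent p. Jensen's inequality converts the averages of g back to averages of |f|. *)
Lemma maximal_modular_le (f : V -> R[i]) (l : R) : schwartz f -> 0 < l ->
  (modular p (fun x => (normc (f x))%:E * l^-1%:E) <= 1)%E ->
  (modular p (fun x => maximal_multiplier sigma f x * (2 * jensen_const * l)^-1%:E) <= 1)%E.
Proof.
move=> sf l0 fl; have [cR cI ch [A A0 hA]] := schwartz_normc sf.
pose h x := normc (f x) / l.
have n0 x : 0 <= normc (f x) by rewrite normcE sqrtr_ge0.
have nA x : normc (f x) <= A by rewrite (le_trans (hA x))// ler_piMr// weight_le1.
have h0 x : 0 <= h x by rewrite divr_ge0// ltW.
pose B := A / l.
have B0 : 0 <= B by rewrite divr_ge0// ltW.
have hB x : h x <= B by rewrite ler_pM2r ?invr_gt0.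
have hc : continuous h.
  by move=> x; exact: (continuousM (@ch x) (@cst_continuous _ _ l^-1 x)).
pose g x := h x `^ u.
have gc : continuous g by exact: continuous_powR_comp.
have g0 x : 0 <= g x by exact: powR_ge0.
have gB x : g x <= B `^ u by apply: ge0_ler_powR; rewrite ?nnegrE ?(ltW u0).
have gw x : g x <= B `^ (u - 1) * B * weight x.
  have hw : h x <= B * weight x by rewrite /h mulrAC ler_pM2r ?invr_gt0.
  have [hx|hx] := eqVneq (h x) 0.
    rewrite /g hx powR0 ?gt_eqF//; apply: mulr_ge0; last exact/ltW/weight_gt0.
    by rewrite mulr_ge0 ?powR_ge0.
  have -> : g x = h x `^ (u - 1) * h x.
    by rewrite -[X in _ * X](powRr1 (h0 x)) -powRD ?subrK// hx implybT.
  rewrite -mulrA; apply: ler_pM; rewrite ?powR_ge0//.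
  by apply: ge0_ler_powR; rewrite ?nnegrE ?subr_ge0.
have wi : mu.-integrable setT (EFin \o @weight R n).
  apply/integrableP; split; first by apply/measurable_EFinP; exact: measurable_weight.
  apply: (@le_lt_trans _ _ (\int[mu]_x (weight x)%:E)%E); last exact: integral_weight_lty.
  apply: le_nnintegral => x; first exact: abse_ge0.
  by rewrite lee_fin ger0_norm// ltW// weight_gt0.
have gi : mu.-integrable setT (EFin \o g).
  apply: (le_integrable _ _ _ (integrableZl measurableT (B `^ (u - 1) * B) wi)) => //.
    by apply/measurable_EFinP; exact: continuous_measurable_rV.
  move=> x _; rewrite -EFinM !abse_EFin lee_fin (ger0_norm (g0 x)) (le_trans (gw x))//.
  exact: ler_norm.
have g1 : (\int[mu]_x (g x `^ (p x / u))%:E <= 1)%E.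
  apply: le_trans fl; rewrite le_eqVlt; apply/orP; left; apply/eqP.
  apply: eq_integral => x _; rewrite -EFinM gee0_abs ?lee_fin ?h0//.
  by rewrite poweR_EFin /g -powRrM mulrC divfK// gt_eqF.
pose S x := [set avg sigma g t x | t in [set t | 0 < t]].
(* The supremum is a real number because g is bounded and sigma is finite. *)
pose F x := sup (S x).
have Sub x : has_ubound (S x).
  by exists (B `^ u * mass sigma) => _ [t _ <-]; exact: (avg_ub supp).
have avgF t x : 0 < t -> avg sigma g t x <= F x.
  by move=> t0; apply: ub_le_sup => //; exists t.
have F0 x : 0 <= F x by apply: le_trans (avgF 1 x ltr01); exact: avg_ge0.
have FP := CP gc g0 gB gi g1 F0 _.
have {}FP : (\int[mu]_x (F x `^ (p x / u))%:E <= C%:E)%E.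
  apply: FP => x b hb _; apply: ge_sup; first by exists (avg sigma g 1 x), 1 => //=.
  by move=> _ [t t0 <-]; exact: hb.
pose Mu := (mass sigma + 1) `^ (u - 1).
have Mu0 : 0 < Mu by rewrite powR_gt0.
have z0 x : 0 <= F x / (C + 1) by rewrite divr_ge0// ltW.
have avgh t x : 0 < t -> avg sigma h t x <= jensen_const * (F x / (C + 1)) `^ u^-1.
  move=> t0; rewrite /jensen_const -powRM ?mulr_ge0 ?invr_ge0 ?(ltW Mu0) ?(ltW C10)//.
  have -> : Mu * (C + 1) * (F x / (C + 1)) = Mu * F x by field; exact: lt0r_neq0.
  have a0 : 0 <= avg sigma h t x by exact: avg_ge0.
  rewrite -[leLHS]powRr1// -(mulfV (lt0r_neq0 u0)) powRrM.
  apply: ge0_ler_powR; rewrite ?nnegrE ?powR_ge0 ?invr_ge0 ?(ltW u0)//.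
    by rewrite mulr_ge0 ?(ltW Mu0).
  apply: (le_trans (avg_jensen supp t x hc h0 hB u1)).
  by apply: ler_wpM2l; [exact: ltW|exact: avgF].
have Mf x : (0 <= maximal_multiplier sigma f x <=
    (2 * jensen_const * l * (F x / (C + 1)) `^ u^-1)%:E)%E.
  apply/andP; split.
    apply: (@le_trans _ _ (normc (dilated_average sigma 1 f x))%:E).
      by rewrite lee_fin normcE sqrtr_ge0.
    by apply: ereal_sup_ubound; exists 1 => //=.
  apply: ge_ereal_sup => _ [t t0 <-]; rewrite lee_fin.
  apply: (le_trans (normc_dilated_average_le supp t x cR cI ch nA)).
  have -> : avg sigma (fun x => normc (f x)) t x = l * avg sigma h t x.
    have hB' y : `|h y| <= B by rewrite ger0_norm.
    rewrite /avg -RintegralZl//; last exact: (integrable_translate supp t x hc hB').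
    by apply: eq_Rintegral => y _; rewrite /h mulrCA mulfV ?mulr1// gt_eqF.
  have := avgh t x t0; move: (avg _ _ _ _) (_ `^ _) => a b ab.
  rewrite -!mulrA ler_pM2l// mulrCA ler_pM2l//.
have jl : 0 < 2 * jensen_const * l by rewrite !mulr_gt0// jensen_const_gt0.
(* Dividing F by C + 1 >= 1 gains at least the factor 1/(C + 1) after raising to the power p/u >= 1.
   This brings the modular down from C to C/(C + 1) < 1. *)
apply: (@le_trans _ _ (\int[mu]_x ((C + 1)^-1%:E * (F x `^ (p x / u))%:E))%E).
  apply: le_nnintegral => x; first exact: poweR_ge0.
  have /andP[M0 M1] := Mf x.
  have px0 : 0 <= p x.
    by have := pu1 x; rewrite ler_pdivlMr// mul1r; apply: le_trans; exact: ltW.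
  apply: (@le_trans _ _ ((((F x / (C + 1)) `^ u^-1)%:E `^ p x)%E)).
    have X0 : (0 <= maximal_multiplier sigma f x * (2 * jensen_const * l)^-1%:E)%E.
      by rewrite mule_ge0// lee_fin invr_ge0 ltW.
    rewrite gee0_abs//; apply: gt0_ler_poweR => //.
    - by rewrite in_itv/= X0 leey.
    - by rewrite in_itv/= lee_fin powR_ge0 leey.
    - by rewrite lee_pdivrMr// -EFinM mulrC.
  rewrite poweR_EFin -EFinM lee_fin -powRrM (mulrC u^-1) powRM ?invr_ge0 ?(ltW C10)//.
  rewrite [leRHS]mulrC; apply: ler_wpM2l; first exact: powR_ge0.
  apply: ge1r_powR; last exact: pu1.
  by rewrite invr_gt0 C10/= invf_le1.
apply: (@le_trans _ _ ((C + 1)^-1%:E * C%:E)%E).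
  apply: (le_trans (integralZl_le _ _ _)).
  - by rewrite invr_gt0.
  - by move=> x; rewrite lee_fin powR_ge0.
  by apply: lee_wpmul2l => //; rewrite lee_fin invr_ge0 ltW.
by rewrite -EFinM lee_fin mulrC ler_pdivrMr// mul1r lerDl.
Qed.

Lemma maximal_norm_le (f : V -> R[i]) : schwartz f ->
  (variable_norm p (maximal_multiplier sigma f)
   <= (2 * jensen_const)%:E * variable_norm p (fun x => (normc (f x))%:E))%E.
Proof.
move=> sf; have j0 : 0 < 2 * jensen_const by rewrite mulr_gt0// jensen_const_gt0.
rewrite -lee_pdivrMl//; apply: le_ereal_inf_tmp => _ [l [l0 fl] <-].
rewrite lee_pdivrMl// -EFinM; apply: ereal_inf_lbound; exists (2 * jensen_const * l) => //.
split; first exact: mulr_gt0.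
exact: maximal_modular_le.
Qed.

End maximal_bound.

Theorem theorem2p3 (R : realType) (n : nat) (hn : (1 <= n)%N)
    (sigma : {finite_measure set 'rV[R]_n -> \bar R})
    (hsigma : compactly_supported sigma)
    (beta alpha : R) (hbeta : 0 <= beta <= n%:R) (halpha : 2^-1 < alpha)
    (hdim : locally_uniformly_dimensional beta sigma)
    (hm : square_decay alpha (fun xi => normc (fourier_measure sigma xi)))
    (hgrad : square_decay alpha
       (fun xi => cvnorm (gradient (fourier_measure sigma) xi)))
    (p : 'rV[R]_n -> R) (hp : log_holder p)
    (hlow : (((2 * n%:R + 2 * alpha - 2 * beta - 1)
              / (n%:R + 2 * alpha - beta - 1))%:E < exponent_inf p)%E)
    (hmid : (exponent_inf p <= exponent_sup p)%E)
    (hup : (exponent_sup p <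
            if beta == n%:R then +oo
            else ((n%:R + 2 * alpha - beta - 1) / (n%:R - beta))%:E
                 * exponent_inf p)%E) :
  exists C : R, forall f : 'rV[R]_n -> R[i], schwartz f ->
    (variable_norm p (maximal_multiplier sigma f)
     <= C%:E * variable_norm p (fun x => (normc (f x))%:E))%E.
Proof.
have [_ [c1 [c2 [pinf [c10 c20 _ lp dp]]]]] := hp.
have cp := log_local_continuous c10 lp.
have [b0 bn] := andP hbeta.
have d0 : 0 <= n%:R - beta by rewrite subr_ge0.
have a0 : 0 < alpha - 2^-1 by rewrite subr_gt0.
(* The strict upper bound forces p_+ to be finite also when beta = n, where the bound itself is
   +oo. *)
have sup_fin : (exponent_sup p < +oo)%E.
  by apply: lt_le_trans hup _; exact: leey.
case Epm : (exponent_inf p) hlow hmid hup => [pm| |] // hlow hmid hup; last first.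
  by move: hmid; rewrite leye_eq => /eqP h; move: sup_fin; rewrite h.
case EpM : (exponent_sup p) hmid hup sup_fin => [pM| |] // hmid hup _.
have pb := exponent_bounds cp Epm EpM.
move: hlow hmid; rewrite lte_fin lee_fin => hlow hmid.
have D0 : 0 < n%:R + 2 * alpha - beta - 1.
  by have -> : n%:R + 2 * alpha - beta - 1 = (n%:R - beta) + 2 * (alpha - 2^-1); [field|lra].
(* In terms of d = n - beta and a = alpha - 1/2 the hypotheses read 2d + 2a < (d + 2a) p_- and d p_+
   < (d + 2a) p_-. The second form also makes sense for d = 0. *)
have h1 : 2 * (n%:R - beta) + 2 * (alpha - 2^-1) < ((n%:R - beta) + 2 * (alpha - 2^-1)) * pm.
  by move: hlow; rewrite ltr_pdivrMr//; lra.
have pm0 : 0 < pm.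
  have dm : 0 < (n%:R - beta) + 2 * (alpha - 2^-1) by lra.
  by rewrite -(pmulr_rgt0 _ dm); apply: le_lt_trans h1; lra.
have h2 : (n%:R - beta) * pM < ((n%:R - beta) + 2 * (alpha - 2^-1)) * pm.
  move: hup; case: eqP => [->|bneq].
    by move=> _; rewrite subrr mul0r add0r mulr_gt0// mulr_gt0.
  have d1 : 0 < n%:R - beta by rewrite lt_def d0 subr_eq0 andbT; apply/eqP => e; apply: bneq.
  by rewrite -EFinM lte_fin mulrAC ltr_pdivlMr//; lra.
have [s [u [s01 ds u1 um uM]]] := ex_parameters d0 a0 hmid h1 h2.
have [C C0 CP] := positive_maximal hn hsigma hbeta halpha hdim hm hgrad c10 c20 lp dp pb pm0
  s01 u1 um uM ds.
have [R0 R00 supp] := supp_cube hsigma.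
have u0 : 0 < u by exact: lt_le_trans u1.
have pu1 x : 1 <= p x / u.
  have /andP[px _] := pb x; have [s0 _] := andP s01.
  rewrite ler_pdivlMr// mul1r (le_trans (ltW um))// (le_trans _ px)//.
  by rewrite ler_piMl ?(ltW pm0)// gerBl ltW.
exists (2 * jensen_const sigma u C) => f sf.
exact: (maximal_norm_le supp u1 pu1 C0 CP sf).
Qed.
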